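(* Assume that (A1), (A2), (A3) hold and that the Lévy process $\xi$ drifts to $-\infty$. Let $K\ge1$ be an integer such that $\{1,\dots,K\}$ is accessible by $X_n$ for every $n\ge1$. Then $$\left(\frac{X^\dagger_n(\lfloor a_n t\rfloor)}{n};\ t\ge 0\right)\ \xrightarrow[n\to\infty]{(d)}\ (Y(t);\ t\ge0)$$ in distribution in $\mathbb D(\mathbb R_+,\mathbb R)$.
   Context: Let $\mathbb N=\{1,2,\dots\}$. For every $n\ge1$ let $(p_{n,k})_{k\ge1}$ be nonnegative reals with $\sum_{k\ge1}p_{n,k}=1$, and let $(X_n(k))_{k\ge0}$ be the discrete-time Markov chain on $\mathbb N$ with $X_n(0)=n$ and $\mathbb P(X_n(k+1)=j\mid X_n(k)=i)=p_{i,j}$. Let $\Pi_n^*(dx)=\sum_{k\ge1}p_{n,k}\,\delta_{\ln k-\ln n}(dx)$. Let $(a_n)_{n\ge0}$ be positive reals, regularly varying with index $\gamma>0$, i.e. $a_{\lfloor xn\rfloor}/a_n\to x^\gamma$ for every $x>0$. Let $\Pi$ be a measure on $\mathbb R\setminus\{0\}$ with $\Pi(\{-1,1\})=0$ and $\int(1\wedge x^2)\,\Pi(dx)<\infty$. (A1): for every continuous $f$ with compact support in $[0,\infty]\setminus\{1\}$, $a_n\,\mathbb E[f(X_n(1)/n)]\to\int_{\mathbb R}f(e^x)\,\Pi(dx)$. (A2): there exist $b\in\mathbb R$, $\sigma^2\ge0$ with $a_n\int_{-1}^1x\,\Pi_n^*(dx)\to b$ and $a_n\int_{-1}^1x^2\,\Pi_n^*(dx)\to\sigma^2+\int_{-1}^1x^2\,\Pi(dx)$.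 (A3): there exists $\beta>0$ with $\limsup_{n\to\infty}a_n\int_1^\infty e^{\beta x}\,\Pi_n^*(dx)<\infty$. Let $\xi$ be the Lévy process with $\xi(0)=0$ and $\mathbb E[e^{i\lambda\xi(t)}]=e^{t\Phi(\lambda)}$, $\Phi(\lambda)=-\frac12\sigma^2\lambda^2+ib\lambda+\int(e^{i\lambda x}-1-i\lambda x\mathbb 1_{|x|\le1})\,\Pi(dx)$; $\xi$ drifts to $-\infty$ if $\xi(t)\to-\infty$ a.s. Let $I_\infty=\int_0^\infty e^{\gamma\xi(s)}ds$, $\tau(t)=\inf\{u\ge0:\int_0^ue^{\gamma\xi(s)}ds>t\}$, $Y(t)=e^{\xi(\tau(t))}$ for $t<I_\infty$ and $Y(t)=0$ for $t\ge I_\infty$. The set $\{1,\dots,K\}$ is accessible by $X_n$ if with positive probability $X_n(i)\le K$ for some $i\ge0$. Let $A^{(K)}_n=\inf\{k\ge1:X_n(k)\le K\}$ ($\inf\emptyset=\infty$) and $X^\dagger_n(k)=X_n(k\wedge A^{(K)}_n)$. $\mathbb D(\mathbb R_+,\mathbb R)$ carries the Skorokhod $J_1$ topology. *)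

(* Defs.v *)
From HB Require Import structures.
From mathcomp Require Import all_boot all_order all_algebra.
From mathcomp Require Import all_classical all_reals all_analysis.

Set Implicit Arguments.
Unset Strict Implicit.
Unset Printing Implicit Defensive.
Import Order.TTheory GRing.Theory Num.Theory.
Import numFieldNormedType.Exports.

Local Open Scope classical_set_scope.
Local Open Scope ring_scope.

Section Defs.
Variable R : realType.

Definition cadlag (f : R -> R) : Prop :=
  (forall t, 0 <= t -> f x @[x --> t^'+] --> f t) /\
  (forall t, 0 < t -> cvg (f x @[x --> t^'-])).

Definition J1_time_change (lam : R -> R) : Prop :=
  [/\ lam 0 = 0, {within [set t | 0 <= t], continuous lam},
      (forall s t, 0 <= s -> s < t -> lam s < lam t) &
      lam t @[t --> +oo] --> +oo].

(** convergence x_m -> y in the Skorokhod J1 topology of D(R_+,R)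
    (Jacod-Shiryaev, Thm VI.1.14) *)
Definition J1_cvg (x : nat -> R -> R) (y : R -> R) : Prop :=
  exists lam : nat -> R -> R,
    [/\ forall m, J1_time_change (lam m),
        (fun m => ereal_sup [set (`|lam m t - t|)%:E | t in [set t | 0 <= t]])
          @ \oo --> 0%E &
        forall N : nat,
        (fun m => ereal_sup [set (`|x m (lam m t) - y t|)%:E
                            | t in [set t | 0 <= t <= N%:R]]) @ \oo --> 0%E].

(** F : D(R_+,R) -> R is continuous for J1 (J1 is metrizable, so sequential
    continuity on D is continuity) *)
Definition J1_continuous (F : (R -> R) -> R) : Prop :=
  forall (x : nat -> R -> R) (y : R -> R),
    (forall m, cadlag (x m)) -> cadlag y -> J1_cvg x y ->
    F (x m) @[m --> \oo] --> F y.

Definition bounded_fun (F : (R -> R) -> R) : Prop :=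
  exists M : R, forall x, `|F x| <= M.

Definition cvg_dist_D {d d'} {T : measurableType d} {T' : measurableType d'}
    (P : probability T R) (Z : nat -> T -> R -> R)
    (Q : probability T' R) (Y : T' -> R -> R) : Prop :=
  forall F : (R -> R) -> R, bounded_fun F -> J1_continuous F ->
    (fun n => (\int[P]_w (F (Z n w))%:E)%E) @ \oo --> (\int[Q]_w (F (Y w))%:E)%E.

Definition markov_chain {d} {T : measurableType d} (P : probability T R)
    (p : nat -> nat -> R) (n : nat) (X : nat -> T -> nat) : Prop :=
  [/\ forall k i, measurable (X k @^-1` [set i]),
      forall k w, (0 < X k w)%N &
      forall (k : nat) (i : nat -> nat), (forall m, (0 < i m)%N) ->
        P [set w | forall m, (m <= k)%N -> X m w = i m] =
        (((i 0%N == n)%:R * \prod_(m < k) p (i m) (i m.+1)%N) : R)%:E].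

Definition hitting_time (x : nat -> nat) (K : nat) : option nat :=
  match pselect (exists k, (0 < k)%N && (x k <= K)%N) with
  | left h => Some (ex_minn h)
  | right _ => None
  end.

Definition stopped (x : nat -> nat) (K : nat) (k : nat) : nat :=
  match hitting_time x K with
  | Some A => x (minn k A)
  | None => x k
  end.

(** E[f(X_n(1)/n)] = sum_{k>=1} p_{n,k} f(k/n) *)
Definition exp_step (p : nat -> nat -> R) (n : nat) (f : R -> R) : \bar R :=
  (\sum_(1 <= k <oo) ((p n k * f (k%:R / n%:R))%:E))%E.

(** integral of g against Pi_n^* = sum_{k>=1} p_{n,k} delta_{ln k - ln n} *)
Definition Pistar_int (p : nat -> nat -> R) (n : nat) (g : R -> R) : \bar R :=
  (\sum_(1 <= k <oo) ((p n k * g (ln k%:R - ln n%:R))%:E))%E.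

(** continuous f with compact support in [0,oo] \ {1}, seen on [0,oo):
    continuous on [0,oo), with a limit at +oo, vanishing near 1 *)
Definition test_fun_A1 (f : R -> R) : Prop :=
  [/\ {within [set x | 0 <= x], continuous f}, cvg (f x @[x --> +oo]) &
      exists2 e : R, 0 < e & forall x, `|x - 1| < e -> f x = 0].

Definition reg_var (a : nat -> R) (gamma : R) : Prop :=
  (forall n, 0 < a n) /\
  forall x : R, 0 < x ->
    (fun n => a (Num.truncn (x * n%:R)) / a n) @ \oo --> x `^ gamma.

Definition levy_measure (Pi : {measure set R -> \bar R}) : Prop :=
  [/\ Pi [set 0] = 0%E, Pi [set x | x = -1 \/ x = 1] = 0%E &
      ((\int[Pi]_x (Num.min 1 (x ^+ 2))%:E)%E < +oo)%E].

Definition RePhi (sigma2 : R) (Pi : {measure set R -> \bar R}) (lam : R) : R :=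
  - (sigma2 * lam ^+ 2) / 2 + Rintegral Pi setT (fun x => cos (lam * x) - 1).

Definition ImPhi (b : R) (Pi : {measure set R -> \bar R}) (lam : R) : R :=
  b * lam +
  Rintegral Pi setT (fun x => sin (lam * x) - lam * x * (if `|x| <= 1 then 1 else 0)).

(** xi is a Lévy process with characteristics (b, sigma2, Pi), i.e.
    E[exp(i lam xi(t))] = exp(t Phi(lam)) (written in real/imag parts) *)
Definition levy_process {d} {T : measurableType d} (Q : probability T R)
    (b sigma2 : R) (Pi : {measure set R -> \bar R}) (xi : R -> T -> R) : Prop :=
  [/\ (forall t, measurable_fun setT (xi t)),
      {ae Q, forall w, xi 0 w = 0} /\ {ae Q, forall w, cadlag (xi ^~ w)},
      (forall (k : nat) (t : nat -> R) (B : nat -> set R),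
        0 <= t 0%N -> (forall j, t j <= t j.+1) -> (forall j, measurable (B j)) ->
        Q (\bigcap_(j in [set j | (j < k)%N])
              [set w | xi (t j.+1) w - xi (t j) w \in B j]) =
        (\prod_(j < k) Q [set w | (xi (t j.+1) w - xi (t j) w)%R \in B j])%E),
      (forall s t (B : set R), 0 <= s -> 0 <= t -> measurable B ->
        Q [set w | xi (t + s) w - xi s w \in B] = Q [set w | xi t w \in B]) &
      forall t lam, 0 <= t ->
        (\int[Q]_w (cos (lam * xi t w))%:E)%E =
          (expR (t * RePhi sigma2 Pi lam) * cos (t * ImPhi b Pi lam))%:E /\
        (\int[Q]_w (sin (lam * xi t w))%:E)%E =
          (expR (t * RePhi sigma2 Pi lam) * sin (t * ImPhi b Pi lam))%:E].

Definition drifts_to_minus_infty {d} {T : measurableType d}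
    (Q : probability T R) (xi : R -> T -> R) : Prop :=
  {ae Q, forall w, xi t w @[t --> +oo] --> -oo}.

Definition int_upto (gamma : R) (g : R -> R) (u : R) : \bar R :=
  (\int[lebesgue_measure]_(s in `[0%R, u]) (expR (gamma * g s))%:E)%E.

Definition I_infty (gamma : R) (g : R -> R) : \bar R :=
  (\int[lebesgue_measure]_(s in `[0%R, +oo[) (expR (gamma * g s))%:E)%E.

Definition tau (gamma : R) (g : R -> R) (t : R) : R :=
  inf [set u | 0 <= u /\ (t%:E < int_upto gamma g u)%E].

Definition lamperti (gamma : R) (g : R -> R) (t : R) : R :=
  if (t%:E < I_infty gamma g)%E then expR (g (tau gamma g t)) else 0.

End Defs.

(* Submission.v *)
(** Read on its own clock, [ln X] is cut into cells of length [h]. Over one cell the jumps of the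
 chain, rescaled by [a], act on trigonometric sums almost like the convolution semigroup of [xi],
 so that the vector of cell increments converges to independent increments of [xi]. By regular
 variation the real time spent in a cell is close to [h * exp (gamma * ln X)], hence the path of
 [X / n] is, up to a small J1 distance, a Lamperti transform of these increments. After the first
 [N] cells the path is negligible: [exp (t * xi)] has a negative drift for some small [t], since
 otherwise [xi] could not tend to [-oo], and this gives a Lyapunov function for the chain that
 controls its excursions down to [K]. A bounded [F] is approximated from below by J1-Lipschitz
 functionals, which gives the lower limit for [F] and, applied to [- F], the upper one. *)
Require Import Defs.
From HB Require Import structures.
From mathcomp Require Import all_boot all_order all_algebra.
From mathcomp Require Import all_classical all_reals all_analysis.
From mathcomp Require Import ring lra zify.
From mathcomp Require Import measurable_realfun.
Import Order.TTheory GRing.Theory Num.Theory.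
Import numFieldNormedType.Exports.
Local Open Scope classical_set_scope.
Local Open Scope ring_scope.

Set Implicit Arguments.
Unset Strict Implicit.
Unset Printing Implicit Defensive.

(** The increments of the cells determine the path up to a small J1 distance only if the chain makes
    at most one sizeable move per cell. A second move has probability of order $h^2$ in a cell,
    hence of order $h$ over a fixed clock horizon: this is why a cell carries a phase, and why $h$
    is chosen after the horizon and before $n$. The assumptions are asymptotic, and regular
    variation is uniform only on compact sets, so cells are followed only while the state stays in
    $[ne^{-B},ne^{B}]$; leaving this window counts as a failure, whose probability is small for
    large $B$. The functional $F$ enters through regularisations that small J1 perturbations change
    little; this makes them functions of the cell increments, uniformly continuous on boxes, and
    such functions are approximated there by trigonometric sums, whose limits come from $\Phi$. No
    measurability of $F(Y)$ is given: it is replaced by a measurable function equal to it almost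
    everywhere, an iterated limit of functions of finitely many increments. *)

Ltac pos := solve [done | exact: expR_ge0 | exact: expR_gt0 | exact: sqr_ge0
 | apply: mulr_ge0; pos | apply: divr_ge0; pos | apply: addr_ge0; pos | apply: exprn_ge0; pos
 | apply: mulr_gt0; pos | apply: divr_gt0; pos | apply: addr_gt0; pos | apply: ltr_wpDl; pos
 | rewrite invr_ge0; pos | rewrite invr_gt0; pos | rewrite subr_ge0; pos | rewrite subr_gt0; pos
 | rewrite ltr0n; pos | rewrite lt_min; apply/andP; split; pos | apply: ltW; pos].

Definition sums_to_one (R : realType) (p : nat -> nat -> R) := forall n, (0 < n)%N ->
 (fun N => \sum_(1 <= k < N) p n k) @ \oo --> (1 : R).

Definition step_limit (R : realType) (p : nat -> nat -> R) (a : nat -> R)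
  (Pi : {measure set R -> \bar R}) := forall f : R -> R, test_fun_A1 f ->
 (fun n => (a n)%:E * exp_step p n f)%E @ \oo -->
  (Rintegral Pi setT (fun x => f (expR x)))%:E.

(** * One-step averages and iterated expectations over histories *)

Section Averages.
Variables (R : realType) (p : nat -> nat -> R).
Hypotheses (p_ge0 : forall n k, 0 <= p n k) (p_sum1 : sums_to_one p).

Definition bdd T (g : T -> R) := exists M : R, forall x, `|g x| <= M.

(* State 0 is sent to 1, so that every row is a probability. *)
Definition row (j k : nat) : R := if j == 0%N then (k == 0%N)%:R else p j k.+1.

(** States start at 1, so [row j k] is the weight of the state [k.+1]. The average is a limit of
    real partial sums; all its laws are stated for bounded [g], where the series converges
    absolutely. *)
Definition av (j : nat) (g : nat -> R) : R := limn (series (fun k => row j k * g k.+1)).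

Lemma row_ge0 j k : 0 <= row j k.
Proof. by rewrite /row; case: ifP. Qed.

Lemma row_sum1 j : series (row j) @ \oo --> (1 : R).
Proof.
case: j => [|j].
 apply: (@cvg_near_cst _ _ (1:R)).
 exists 1%N => // -[|N] //= _.
 by rewrite /series /= big_nat_recl //= big1 ?addr0.
rewrite (_ : series _ = fun N => \sum_(1 <= k < N.+1) p j.+1 k); last first.
 by apply/funext => N; rewrite /series /= big_add1.
by have := @p_sum1 j.+1 isT; rewrite -cvg_shiftS.
Qed.

Lemma av_cvg j (g : nat -> R) : bdd g ->
 cvgn (series (fun k => row j k * g k.+1)).
Proof.
move=> [M gM]; apply: normed_cvg.
apply: (@series_le_cvg _ _ (fun k => row j k * M)).
- by move=> n /=.
- by move=> n; rewrite mulr_ge0 ?row_ge0 //; apply: le_trans (gM n).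
- by move=> n /=; rewrite normrM (ger0_norm (row_ge0 _ _)) ler_wpM2l ?row_ge0.
rewrite (_ : (fun k => _) = M *: row j); last by apply/funext => k /=; rewrite mulrC.
by apply: is_cvg_seriesZ; apply/cvg_ex; exists 1; exact: row_sum1.
Qed.

Lemma bddD T (f g : T -> R) : bdd f -> bdd g ->
 bdd (fun x => f x + g x).
Proof.
move=> [M fM] [N gN]; exists (M + N) => x.
by rewrite (le_trans (ler_normD _ _)) ?lerD.
Qed.

Lemma bddM T (f g : T -> R) : bdd f -> bdd g ->
 bdd (fun x => f x * g x).
Proof.
move=> [M fM] [N gN]; exists (M * N) => x.
by rewrite normrM ler_pM.
Qed.

Lemma bdd_cst T c : bdd (fun _ : T => c).
Proof. by exists `|c|. Qed.

Lemma bddN T (f : T -> R) : bdd f -> bdd (fun x => - f x).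
Proof. by move=> [M fM]; exists M => x; rewrite normrN. Qed.

Lemma bddB T (f g : T -> R) : bdd f -> bdd g ->
 bdd (fun x => f x - g x).
Proof. by move=> bf bg; apply: bddD => //; exact: bddN. Qed.

Lemma bddZ T c (f : T -> R) : bdd f -> bdd (fun x => c * f x).
Proof. by move=> bf; apply: bddM => //; exact: bdd_cst. Qed.

Ltac bdds := solve [assumption | exact: bdd_cst | apply: bddZ; bdds | apply: bddD; bdds
 | apply: bddB; bdds | apply: bddM; bdds].

Lemma bdd_comp T U (f : U -> R) (h : T -> U) : bdd f ->
 bdd (fun x => f (h x)).
Proof. by move=> [M fM]; exists M. Qed.

Lemma eq_av j (f g : nat -> R) : (forall k, (0 < k)%N -> f k = g k) -> av j f = av j g.
Proof.
by move=> fg; rewrite /av; congr (limn (series _)); apply/funext => k; rewrite fg.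
Qed.

Lemma avD j f g : bdd f -> bdd g ->
 av j (fun k => f k + g k) = av j f + av j g.
Proof.
move=> bf bg; rewrite /av -lim_seriesD; [|exact: av_cvg..].
by congr (limn (series _)); apply/funext => k /=; rewrite mulrDr.
Qed.

Lemma avZ j c f : bdd f -> av j (fun k => c * f k) = c * av j f.
Proof.
move=> bf; rewrite /av -[RHS](lim_seriesZ c); last exact: av_cvg.
by congr (limn (series _)); apply/funext => k /=; rewrite mulrCA.
Qed.

Lemma avN j f : bdd f -> av j (fun k => - f k) = - av j f.
Proof.
by move=> bf; rewrite -mulN1r -avZ //; apply: eq_av => k _; rewrite mulN1r.
Qed.

Lemma avB j f g : bdd f -> bdd g ->
 av j (fun k => f k - g k) = av j f - av j g.
Proof. by move=> bf bg; rewrite avD ?avN //; exact: bddN. Qed.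

Lemma av_cst j c : av j (fun=> c) = c.
Proof.
rewrite /av (_ : (fun k => _) = c *: row j); last first.
 by apply/funext => k /=; rewrite mulrC.
rewrite lim_seriesZ; last by apply/cvg_ex; exists 1; exact: row_sum1.
by rewrite (cvg_lim _ (row_sum1 j)) // [c *: _]mulr1.
Qed.

Lemma av_le j f g : bdd f -> bdd g ->
 (forall k, (0 < k)%N -> f k <= g k) -> av j f <= av j g.
Proof.
move=> bf bg fg; apply: lim_series_le; [exact: av_cvg..|].
by move=> k; rewrite ler_wpM2l ?row_ge0 ?fg.
Qed.

Lemma av_ge0 j f : bdd f -> (forall k, (0 < k)%N -> 0 <= f k) -> 0 <= av j f.
Proof.
by move=> bf f0; rewrite -(av_cst j 0); apply: av_le => //; exact: bdd_cst.
Qed.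

Lemma av_norm j f M : (forall k, `|f k| <= M) -> `|av j f| <= M.
Proof.
move=> fM; have bf : bdd f by exists M.
rewrite ler_norml -{1}(av_cst j (- M)) -{2}(av_cst j M).
by apply/andP; split; apply: av_le => //; try exact: bdd_cst;
  move=> k _; move: (fM k); rewrite ler_norml => /andP[].
Qed.

Lemma av_norm_le j f g : bdd f -> bdd g ->
 (forall k, (0 < k)%N -> `|f k| <= g k) -> `|av j f| <= av j g.
Proof.
move=> bf bg fg; rewrite ler_norml; apply/andP; split.
 rewrite -avN //; apply: av_le => //; first exact: bddN.
 by move=> k /fg; rewrite ler_norml => /andP[].
by apply: av_le => // k /fg; rewrite ler_norml => /andP[].
Qed.

(** Dominated convergence in a fixed row: all but [e / 2] of the mass sits on finitely many states,
    and on those the pointwise convergence is uniform. *)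
Lemma av_cvg0 j (f : nat -> nat -> R) : (forall m k, 0 <= f m k <= 1) ->
 (forall k, f m k @[m --> \oo] --> (0 : R)) -> av j (f m) @[m --> \oo] --> (0 : R).
Proof.
move=> f01 f0; apply/cvgrPdist_le => e e0.
have bf m : bdd (f m).
 exists 1 => k; have /andP[? ?] := f01 m k; by rewrite ger0_norm.
have [N HN] : exists N, 1 - e / 2 <= series (row j) N.
 have /cvgrPdist_le/(_ (e / 2)) := row_sum1 j.
 move=> /(_ ltac:(lra)) [N _ /(_ N (leqnn N))] /=.
 rewrite ler_norml => /andP[_ H]; exists N; lra.
have : \forall m \near \oo, forall k, (k < N)%N -> f m k.+1 <= e / 2.
 have : forall k, \forall m \near \oo, f m k.+1 <= e / 2.
  move=> k; have /cvgrPdist_le/(_ (e / 2)) := f0 k.+1.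
  move=> /(_ ltac:(lra)); apply: filterS => m.
  by rewrite sub0r normrN => /(le_trans (ler_norm _)).
 move=> H; elim: N {HN} => [|N IH]; first by near=> m.
 near=> m => k; rewrite ltnS leq_eqVlt => /orP[/eqP ->|].
  by near: m; exact: H.
 by move: k; near: m; exact: IH.
apply: filterS => m Hm.
rewrite sub0r normrN ger0_norm; last first.
 by apply: av_ge0 => // k _; have /andP[] := f01 m k.
have -> : e = e / 2 + e / 2 by lra.
pose g (k : nat) : R := e / 2 + (N < k)%:R.
have bg : bdd (fun k : nat => (N < k)%:R : R).
 by exists 1 => k; case: (_ < _)%N; rewrite ?normr1 ?normr0.
apply: (@le_trans _ _ (av j g)).
 apply: av_le => //; first by bdds.
 case=> // k _; rewrite /g; case: ltnP => kN.
  by have /andP[_ H] := f01 m k.+1; rewrite (le_trans H)// lerDr; lra.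
 by rewrite addr0 Hm.
rewrite /g avD ?av_cst ?lerD2l //; last exact: bdd_cst.
have -> : (fun k : nat => (N < k)%:R) = (fun k => 1 - (k <= N)%:R) :> (nat -> R).
 by apply/funext => k; rewrite ltnNge; case: leqP => _; rewrite /= ?subrr ?subr0.
have bg' : bdd (fun k : nat => (k <= N)%:R : R).
 by exists 1 => k; case: (_ <= _)%N; rewrite ?normr1 ?normr0.
rewrite avB ?av_cst //; last exact: bdd_cst.
suff : series (row j) N <= av j (fun k : nat => (k <= N)%:R) by lra.
have cv := @av_cvg j _ bg'; apply: (limr_ge cv).
exists N => // M /= NM.
rewrite /series /= (@big_cat_nat _ _ _ N 0%N M)//= ler_wpDr//.
 by apply: sumr_ge0 => i _; rewrite mulr_ge0 ?row_ge0.
rewrite le_eqVlt; apply/orP; left; apply/eqP.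
by rewrite !big_mkord; apply: eq_bigr => i _; rewrite ltn_ord mulr1.
Unshelve. all: end_near. Qed.

(* [s] lists the states visited, most recent first. *)
Fixpoint EN (N : nat) (V : seq nat -> R) (s : seq nat) : R :=
 if N is N'.+1 then av (head 0%N s) (fun k => EN N' V (k :: s)) else V s.

Lemma EN_norm N V M s : (forall s, `|V s| <= M) -> `|EN N V s| <= M.
Proof. by move=> VM; elim: N s => [//|N IH] s /=; apply: av_norm => k. Qed.

Lemma EN_bounded N V : bdd V -> bdd (EN N V).
Proof. by move=> [M VM]; exists M => s; exact: EN_norm. Qed.

Lemma EN_bounded1 N V s : bdd V -> bdd (fun k : nat => EN N V (k :: s)).
Proof. by move=> bV; apply: (@bdd_comp _ _ _ (cons^~ s)); exact: EN_bounded. Qed.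

Lemma eq_EN N V W s : (forall s, V s = W s) -> EN N V s = EN N W s.
Proof. by move=> /funext ->. Qed.

Lemma END N V W s : bdd V -> bdd W ->
 EN N (fun s => V s + W s) s = EN N V s + EN N W s.
Proof.
move=> bV bW; elim: N s => [//|N IH] s /=.
by rewrite -avD; [apply: eq_av => k _|exact: EN_bounded1..].
Qed.

Lemma ENZ N c V s : bdd V -> EN N (fun s => c * V s) s = c * EN N V s.
Proof.
move=> bV; elim: N s => [//|N IH] s /=.
by rewrite -avZ; [apply: eq_av => k _|exact: EN_bounded1].
Qed.

Lemma EN_cst N c s : EN N (fun=> c) s = c.
Proof.
elim: N s => [//|N IH] s /=.
by under eq_av => k _ do rewrite IH; rewrite av_cst.
Qed.

Lemma ENN N V s : bdd V -> EN N (fun s => - V s) s = - EN N V s.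
Proof.
by move=> bV; rewrite -mulN1r -ENZ //; apply: eq_EN => k; rewrite mulN1r.
Qed.

Lemma ENB N V W s : bdd V -> bdd W ->
 EN N (fun s => V s - W s) s = EN N V s - EN N W s.
Proof. by move=> bV bW; rewrite END ?ENN //; exact: bddN. Qed.

(** Restricts pointwise inequalities under [EN] to histories that can occur: the new states are
    positive and the old history, in particular the initial state, is kept. *)
Fixpoint extends (N : nat) (s s' : seq nat) : Prop :=
 if N is N'.+1 then
  exists2 k, (0 < k)%N & extends N' (k :: s) s'
 else s' = s.

Lemma EN_le_ext N V W s : bdd V -> bdd W ->
 (forall s', extends N s s' -> V s' <= W s') -> EN N V s <= EN N W s.
Proof.
move=> bV bW; elim: N s => [|N IH] s H /=; first exact: H.
apply: av_le; [exact: EN_bounded1..|move=> k k0].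
by apply: IH => s' es'; apply: H; exists k.
Qed.

Lemma EN_le N V W s : bdd V -> bdd W ->
 (forall s, V s <= W s) -> EN N V s <= EN N W s.
Proof. by move=> bV bW VW; apply: EN_le_ext. Qed.

(** [EN] unfolds at the first step of the path; this peels off the last one, which is the form in
    which the Markov property of the given chain is available. *)
Lemma EN_recr N V s : EN N.+1 V s = EN N (fun s => av (head 0%N s) (fun k => V (k :: s))) s.
Proof.
elim: N s => [//|N IH] s.
by change (av (head 0%N s) (fun k => EN N.+1 V (k :: s)) =
 av (head 0%N s) (fun k => EN N (fun s => av (head 0%N s) (fun k => V (k :: s))) (k :: s)));
 apply: eq_av => k _; rewrite IH.
Qed.

Lemma av_EFin j (g : nat -> R) : bdd g ->
 (\sum_(0 <= k <oo) (row j k * g k.+1)%:E)%E = (av j g)%:E.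
Proof.
move=> bg; rewrite /av -EFin_lim; last exact: av_cvg.
by congr (limn _); apply/funext => N /=; rewrite sumEFin.
Qed.

(** * The chain on its probability space and the recursive expectation *)

Section Link.
Context {d : measure_display} {T : measurableType d} (P : probability T R).
Variables (n : nat) (X : nat -> T -> nat).
Hypotheses (n_gt0 : (0 < n)%N) (X_mc : markov_chain P p n X).

Fixpoint hist (N : nat) (w : T) : seq nat :=
 if N is N'.+1 then X N w :: hist N' w else [:: X 0%N w].

Lemma size_hist N w : size (hist N w) = N.+1.
Proof. by elim: N => //= N ->. Qed.

Lemma nth_hist N w m : (m <= N)%N -> nth 1%N (hist N w) (N - m) = X m w.
Proof.
elim: N => [|N IH]; first by rewrite leqn0 => /eqP ->.
rewrite leq_eqVlt => /orP[/eqP ->|]; first by rewrite subnn.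
by rewrite ltnS => mN; rewrite subSn //= IH.
Qed.

Lemma hist_eqP N w s : size s = N.+1 ->
 (hist N w = s) <-> (forall m, (m <= N)%N -> X m w = nth 1%N s (N - m)).
Proof.
move=> ss; split=> [<- m mN|H]; first by rewrite nth_hist.
apply: (@eq_from_nth _ 1%N) => [|i]; rewrite size_hist ?ss // ltnS => iN.
by rewrite -{1 2}(subKn iN) nth_hist ?leq_subr // H ?leq_subr.
Qed.

Lemma measurable_X k (A : set nat) : measurable (X k @^-1` A).
Proof.
have [mX _ _] := X_mc.
rewrite (_ : _ @^-1` _ = \bigcup_(i in A) (X k @^-1` [set i])); last first.
 by apply/seteqP; split=> w /=; [move=> Aw; exists (X k w)|move=> [i Ai /= ->]].
by apply: bigcup_measurable => i _; exact: mX.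
Qed.

Lemma measurable_hist N (A : set (seq nat)) : measurable (hist N @^-1` A).
Proof.
have H1 : forall s, measurable (hist N @^-1` [set s]).
 elim: N => [|N IH] s.
  rewrite (_ : _ @^-1` _ = X 0%N @^-1` [set x | [:: x] = s]) //.
  exact: measurable_X.
 case: s => [|x s].
  by rewrite (_ : _ @^-1` _ = set0) //; apply/seteqP; split.
 rewrite (_ : _ @^-1` _ = X N.+1 @^-1` [set x] `&` hist N @^-1` [set s]).
  by apply: measurableI => //; exact: measurable_X.
 by apply/seteqP; split=> w /= [-> ->].
rewrite (_ : _ @^-1` _ = \bigcup_s (if s \in A then hist N @^-1` [set s] else set0)).
 by apply: countable_bigcupT_measurable => // s; case: ifP.
apply/seteqP; split=> w /=; first by move=> Aw; exists (hist N w) => //; rewrite mem_set.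
by move=> [s _]; case: ifP => // /set_mem As /= ->.
Qed.

(** Both sides vanish unless [s] is a list of [N.+1] positive states; in that case two consecutive
    instances of the finite-dimensional formula differ by exactly one factor [row]. *)
Lemma hist_cylinder N s k :
 P ([set w | X N.+1 w = k.+1] `&` [set w | hist N w = s]) =
 (P [set w | hist N w = s] * (row (head 0%N s) k)%:E)%E.
Proof.
have [_ X0 Xp] := X_mc.
have [/andP[/eqP ss s0]|bad] :=
  boolP ((size s == N.+1) && all (fun x => 0 < x)%N s); last first.
 have E : [set w | hist N w = s] = set0.
  apply/seteqP; split=> w //= E; move/negP: bad; apply.
  rewrite -E size_hist eqxx /=; elim: N {E} => /= [|N IH]; by rewrite X0.
 by rewrite E setI0 measure0 mul0e.
(* Past the index [N] the value [k.+1] is both the next state and a positive default, so a single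
   sequence [i] describes the two cylinders. *)
pose i m := if (m <= N)%N then nth 1%N s (N - m) else k.+1.
have i0 m : (0 < i m)%N.
 rewrite /i; case: ifP => // mN.
 by have /(all_nthP 1%N)/(_ (N - m)%N) := s0; apply; rewrite ss ltnS leq_subr.
have E1 : [set w | hist N w = s] = [set w | forall m, (m <= N)%N -> X m w = i m].
 apply/seteqP; split=> w /=; rewrite (hist_eqP _ ss) => H m mN.
  by rewrite H // /i mN.
 by rewrite H // /i mN.
have E2 : [set w | X N.+1 w = k.+1] `&` [set w | hist N w = s] =
     [set w | forall m, (m <= N.+1)%N -> X m w = i m].
 rewrite E1; apply/seteqP; split=> w /=.
  move=> [H1 H2] m; rewrite leq_eqVlt => /orP[/eqP ->|]; last exact: H2.
  by rewrite H1 /i ltnn.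
 move=> H; split; first by rewrite H // /i ltnn.
 by move=> m mN; apply: H; exact: leqW.
rewrite E2 E1 !Xp // -EFinM big_ord_recr /= mulrA; congr ((_ * _)%:E).
rewrite /i leqnn ltnn subnn; case: s ss s0 {i i0 E1 E2} => // x s _ /= /andP[x0 _].
by rewrite /row; case: x x0.
Qed.

(** Histories take countably many values, so the integral is a series over them, enumerated through
    [pickle]; an index that codes no history contributes 0. *)
Lemma integral_hist N (A : set T) (U : seq nat -> R) : measurable A ->
 (forall s, 0 <= U s) ->
 (\int[P]_w (\1_A w * U (hist N w))%:E)%E =
 (\sum_(0 <= i <oo) (if pickle_inv i is Some s then
   (U s)%:E * P (A `&` [set w | hist N w = s]) else 0))%E.
Proof.
move=> mA U0.
have mAs s : measurable (A `&` [set w | hist N w = s]).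
 by apply: measurableI => //; exact: (measurable_hist N [set s]).
pose f i w : \bar R := (if pickle_inv i is Some s then
   (U s)%:E * (\1_(A `&` [set w | hist N w = s]) w)%:E else 0)%E.
have f0 i w : (0 <= f i w)%E.
 by rewrite /f; case: (pickle_inv i) => // s; rewrite mule_ge0 // lee_fin.
have mf i : measurable_fun setT (f i).
 rewrite /f; case: (pickle_inv i) => [s|]; last exact: measurable_cst.
 by apply: measurable_funeM; apply/measurable_EFinP; exact: measurable_indic.
transitivity (\int[P]_w (\sum_(0 <= i <oo) f i w))%E.
 apply: eq_integral => w _.
 rewrite (nneseriesD1 (n := pickle (hist N w))) //= eseries0 ?adde0.
  rewrite /f pickleK_inv -EFinM !indicE in_setI mulrC.
  by rewrite [X in _ && X](_ : _ = true) ?andbT //; apply/mem_set.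
 move=> i _ ine; rewrite /f; case E : (pickle_inv i) => [s|//].
 rewrite indicE in_setI [X in _ && X](_ : _ = false) ?andbF ?mule0 //.
 apply/negbTE/negP => /set_mem /= H; move: ine; rewrite H.
 by have := @pickle_invK (seq nat) i; rewrite E /= => ->; rewrite eqxx.
rewrite integral_nneseries //; apply: eq_eseriesr => i _.
rewrite /f; case: (pickle_inv i) => [s|]; last by rewrite integral0.
rewrite ge0_integralZl //; last 2 first.
- by apply/measurable_EFinP; exact: measurable_indic.
- by rewrite lee_fin.
by rewrite integral_indic // setIT.
Qed.

Lemma measurable_hist_fun N (V : seq nat -> R) : measurable_fun setT (fun w => V (hist N w)).
Proof.
move=> _ A mA; rewrite setTI.
by rewrite (_ : _ @^-1` _ = hist N @^-1` (V @^-1` A)) //; exact: measurable_hist.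
Qed.

Lemma integral_histS N (V : seq nat -> R) : bdd V -> (forall s, 0 <= V s) ->
 (\int[P]_w (V (hist N.+1 w))%:E)%E =
 (\int[P]_w (av (head 0%N (hist N w)) (fun k => V (k :: hist N w)))%:E)%E.
Proof.
move=> bV V0.
have bV1 s : bdd (fun k : nat => V (k :: s)).
 exact: (@bdd_comp _ _ _ (cons^~ s)).
transitivity (\int[P]_w (\sum_(0 <= k <oo)
  (\1_[set w | X N.+1 w = k.+1] w * V (k.+1 :: hist N w))%:E))%E.
 apply: eq_integral => w _; have [_ X0 _] := X_mc.
 rewrite (nneseriesD1 (n := (X N.+1 w).-1)) //=; last first.
  by move=> k _; rewrite lee_fin mulr_ge0.
 rewrite eseries0 ?adde0.
  rewrite prednK // indicE [_ \in _](_ : _ = true) ?mul1r //.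
  by apply/mem_set.
 move=> k _ kX; rewrite indicE [_ \in _](_ : _ = false) ?mul0r //.
 apply/negbTE/negP => /set_mem /= H; move: kX; by rewrite H eqxx.
rewrite integral_nneseries //; last 2 first.
- move=> k; apply/measurable_EFinP; apply: measurable_funM.
  by apply: measurable_indic; exact: (measurable_X _ [set k.+1]).
 exact: (measurable_hist_fun N (fun s => V (k.+1 :: s))).
- by move=> k w _; rewrite lee_fin mulr_ge0.
transitivity (\int[P]_w (\sum_(0 <= k <oo)
  (row (head 0%N (hist N w)) k * V (k.+1 :: hist N w))%:E))%E; last first.
 by apply: eq_integral => w _; rewrite -(av_EFin (head 0%N (hist N w)) (bV1 (hist N w))).
rewrite integral_nneseries //; last 2 first.
- move=> k; apply/measurable_EFinP.
 exact: (measurable_hist_fun N (fun s => row (head 0%N s) k * V (k.+1 :: s))).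
- by move=> k w _; rewrite lee_fin mulr_ge0 ?row_ge0.
apply: eq_eseriesr => k _.
rewrite (@integral_hist N _ (fun s => V (k.+1 :: s))) //; last first.
 exact: (measurable_X _ [set k.+1]).
transitivity (\int[P]_w (\1_setT w *
  (row (head 0%N (hist N w)) k * V (k.+1 :: hist N w)))%:E)%E; last first.
 by apply: eq_integral => w _; rewrite indicT mul1r.
rewrite (@integral_hist N _ (fun s => row (head 0%N s) k * V (k.+1 :: s))) //; last first.
 by move=> s; rewrite mulr_ge0 ?row_ge0.
apply: eq_eseriesr => i _; case: (pickle_inv i) => // s.
rewrite setTI hist_cylinder [in RHS]mulrC EFinM -muleA; congr (_ * _)%E.
exact: muleC.
Qed.

Lemma integral_hist_ge0 N (V : seq nat -> R) : bdd V -> (forall s, 0 <= V s) ->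
 (\int[P]_w (V (hist N w))%:E)%E = (EN N V [:: n])%:E.
Proof.
elim: N V => [|N IH] V bV V0; last first.
 rewrite integral_histS // EN_recr -IH //.
  have [M VM] := bV; exists M => s; exact: av_norm.
 move=> s; apply: av_ge0 => //; exact: (@bdd_comp _ _ _ (cons^~ s)).
have [_ X0 Xp] := X_mc.
have P1 : P [set w | X 0%N w = n] = 1%E.
 have := Xp 0%N (fun=> n) (fun=> n_gt0); rewrite big_ord0 eqxx mulr1 => <-.
 congr (P _); apply/seteqP; split => w /=; last exact.
 by move=> H m; rewrite leqn0 => /eqP ->.
have mX : measurable [set w | X 0%N w = n] by exact: (measurable_X _ [set n]).
transitivity (\int[P]_w (V [:: n])%:E)%E; last first.
 by rewrite integral_cst //= probability_setT mule1.
apply: ge0_ae_eq_integral => //.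
- by apply/measurable_EFinP; exact: (measurable_hist_fun 0%N V).
- by move=> w _; rewrite lee_fin.
- by move=> w _; rewrite lee_fin.
exists (~` [set w | X 0%N w = n]); split; first exact: measurableC.
 by have := probability_setC P mX; rewrite P1 subee.
move=> w /= H HX; apply: H => _ /=; by rewrite HX.
Qed.

Lemma integral_hist_EN N (V : seq nat -> R) : bdd V ->
 (\int[P]_w (V (hist N w))%:E)%E = (EN N V [:: n])%:E.
Proof.
move=> bV; have [M VM] := bV.
have bVM : bdd (fun s => V s + M) by bdds.
have := integral_hist_ge0 N bVM (fun s => _ : 0 <= V s + M).
move=> /(_ (fun s => ltac:(have := VM s; rewrite ler_norml => /andP[? _]; lra))).
rewrite END ?EN_cst //; last exact: bdd_cst.
under eq_integral do rewrite EFinD.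
have iV : P.-integrable setT (EFin \o (fun w => V (hist N w))).
 apply: measurable_bounded_integrable => //.
 - by rewrite ltey_eq fin_num_measure.
 - exact: measurable_hist_fun.
 exists M; split; first exact: num_real.
 by move=> x Mx w _ /=; apply: le_trans (VM _) (ltW _).
have := @integralD_EFin _ _ _ P setT measurableT (fun w => V (hist N w)) (cst M) iV.
move=> /(_ (finite_measure_integrable_cst _ _ measurableT)) /= ->.
rewrite /= integral_cst //= probability_setT mule1 EFinD => /(congr1 (fun x => x - M%:E)%E).
by rewrite !addeK.
Qed.

End Link.

End Averages.

(** * Taylor bounds for sine, cosine and exponential; clamping *)

Section Elementary.
Variable R : realType.
Implicit Types x y t : R.

Lemma MVT0 (f df : R -> R) x : (forall t, is_derive t 1 f (df t)) -> f 0 = 0 ->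
 exists2 c, `|c| <= `|x| & f x = df c * x.
Proof.
move=> fd f0.
have cf : continuous f.
 by move=> t; apply: differentiable_continuous; apply/derivable1_diffP; have [] := fd t.
have [x0|x0] := leP 0 x.
 have [c] := @MVT_segment _ f df 0 x x0 (fun t _ => fd t) (continuous_subspaceT cf).
 rewrite in_itv /= f0 !subr0 => /andP[c0 cx] ->; exists c => //.
 by rewrite !ger0_norm.
have [c] := @MVT_segment _ f df x 0 (ltW x0) (fun t _ => fd t) (continuous_subspaceT cf).
rewrite in_itv /= f0 !sub0r => /andP[c0 cx] E; exists c.
 by rewrite (ler0_norm cx) (ltr0_norm x0) lerN2.
by apply: oppr_inj; rewrite E mulrN.
Qed.

Lemma normr_sin_le x : `|sin x| <= `|x|.
Proof.
have [c _ ->] := @MVT0 sin cos x (fun t => is_derive_sin t) (sin0 _).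
by rewrite normrM ler_piMl // cos_max.
Qed.

Lemma cos_sin2 x : 1 - cos x = 2 * sin (x / 2) ^+ 2.
Proof.
rewrite {1}(_ : x = x / 2 + x / 2); last by lra.
by rewrite cosD -!expr2 cos2sin2; lra.
Qed.

Lemma one_sub_cos_le x : 0 <= 1 - cos x <= x ^+ 2 / 2.
Proof.
rewrite cos_sin2 mulr_ge0 ?sqr_ge0 //=.
have : sin (x / 2) ^+ 2 <= (x / 2) ^+ 2.
 by rewrite -real_normK ?num_real // -[leRHS]real_normK ?num_real // lerXn2r ?nnegrE // normr_sin_le.
have -> : (x / 2) ^+ 2 = x ^+ 2 / 4 by field.
lra.
Qed.

Lemma sin_taylor x : `|sin x - x| <= `|x| ^+ 3.
Proof.
have D t : is_derive t 1 (fun u => sin u - u) (cos t - 1).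
 by apply: is_deriveB.
have [|c cx ->] := @MVT0 (fun u => sin u - u) (fun t => cos t - 1) x D.
 by rewrite sin0 subrr.
rewrite normrM exprSr ler_wpM2r // distrC.
have /andP[c0 c1] := one_sub_cos_le c.
rewrite ger0_norm // (le_trans c1) // -(real_normK (num_real c)).
have : `|c| ^+ 2 <= `|x| ^+ 2 by rewrite lerXn2r ?nnegrE.
have : 0 <= `|c| ^+ 2 by pos.
lra.
Qed.

(** Since $1-\cos x=2\sin^2(x/2)$, the left side is a difference of two squares and the bounds on
    sine apply to each factor. *)
Lemma cos_taylor x : `|cos x - 1 + x ^+ 2 / 2| <= `|x| ^+ 3 * `|x|.
Proof.
have -> : cos x - 1 + x ^+ 2 / 2 = 2 * ((x / 2) - sin (x / 2)) * (x / 2 + sin (x / 2)).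
 transitivity (x ^+ 2 / 2 - (1 - cos x)); first by ring.
 by rewrite cos_sin2; field.
have h1 := sin_taylor (x / 2); have h2 := normr_sin_le (x / 2).
have e2 : `|x / 2| = `|x| / 2 by rewrite normrM (ger0_norm (x := 2^-1)).
rewrite !normrM distrC (ger0_norm (x := 2)) //.
apply: ler_pM => //.
 move: h1; rewrite e2 !exprMn => h1.
 have : 0 <= `|x| ^+ 3 by pos.
 rewrite (_ : `|x| ^+ 3 * 2^-1 ^+ 3 = `|x| ^+ 3 / 8) in h1; last by field.
 lra.
by rewrite (le_trans (ler_normD _ _)) //; rewrite e2 in h2 *; lra.
Qed.

Lemma expR_lip x : `|expR x - 1| <= `|x| * expR `|x|.
Proof.
have D (t : R) : is_derive t 1 (fun u : R => expR u - 1) (expR t).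
 by rewrite -[X in is_derive _ _ _ X]subr0; apply: is_deriveB.
have [|c cx ->] := @MVT0 (fun u : R => expR u - 1) expR x D.
 by rewrite expR0 subrr.
rewrite normrM mulrC ler_wpM2l // ger0_norm ?expR_ge0 // ler_expR.
by rewrite (le_trans (ler_norm _)).
Qed.

Lemma expR_taylor2 x : `|expR x - 1 - x| <= `|x| ^+ 2 * expR `|x|.
Proof.
have D (t : R) : is_derive t 1 (fun u : R => expR u - 1 - u) (expR t - 1).
 by apply: is_deriveB; rewrite -[X in is_derive _ _ _ X]subr0; apply: is_deriveB.
have [|c cx ->] := @MVT0 _ _ x D.
 by rewrite expR0 !subrr.
rewrite normrM exprSr expr1 mulrAC ler_wpM2r // (le_trans (expR_lip c)) //.
by rewrite ler_pM ?expR_ge0 // ler_expR.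
Qed.

Definition clamp (y : R) : R := Num.max 0 (Num.min 1 y).

Lemma clamp01 y : 0 <= clamp y <= 1.
Proof. by rewrite /clamp le_max lexx /= ge_max ler01 ge_min lexx. Qed.

Lemma clamp_le0 y : y <= 0 -> clamp y = 0.
Proof. by move=> y0; rewrite /clamp; apply/max_idPl; rewrite ge_min y0 orbT. Qed.

Lemma clamp_ge1 y : 1 <= y -> clamp y = 1.
Proof. by move=> y1; rewrite /clamp (min_idPl y1); apply/max_idPr. Qed.

Lemma continuous_clamp : continuous clamp.
Proof.
by move=> y; apply: continuous_max; [exact: cvg_cst|apply: continuous_min; [exact: cvg_cst|exact: cvg_id]].
Qed.

Lemma continuous_clamp_comp (f : R -> R) : continuous f -> continuous (fun x => clamp (f x)).
Proof. by move=> cf x; apply: (@continuous_comp _ _ _ f clamp); [exact: cf|exact: continuous_clamp]. Qed.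

End Elementary.

(** * Dominated convergence against the Lévy measure *)

Section Integrals.
Variable R : realType.

Lemma Rintegral_cvg d (T : measurableType d) (mu : {measure set T -> \bar R})
  (f_ : nat -> T -> R) (f g : T -> R) :
 (forall n, measurable_fun setT (f_ n)) -> measurable_fun setT f ->
 mu.-integrable setT (EFin \o g) ->
 (forall n x, `|f_ n x| <= g x) ->
 {ae mu, forall x, f_ n x @[n --> \oo] --> f x} ->
 Rintegral mu setT (f_ n) @[n --> \oo] --> Rintegral mu setT f.
Proof.
move=> mf_ mf ig fg ff.
have [|||||H1 _ H2] := @dominated_convergence _ _ R mu setT measurableT
 (fun n => EFin \o f_ n) (EFin \o f) (EFin \o g).
- by move=> n; apply/measurable_EFinP.
- by apply/measurable_EFinP.
- by apply: filterS ff => x fx _; apply: cvg_EFin => //; apply: nearW.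
- exact: ig.
- by apply: aeW => x n _ /=; rewrite lee_fin.
apply: fine_cvg; rewrite /Rintegral fineK; first exact: H2.
by apply: integrable_fin_num.
Qed.

Variable Pi : {measure set R -> \bar R}.
Hypothesis Pi_levy : levy_measure Pi.

Definition min1sq (x : R) : R := Num.min 1 (x ^+ 2).

Lemma min1sq_ge0 x : 0 <= min1sq x.
Proof. by rewrite /min1sq le_min ler01 sqr_ge0. Qed.

Lemma measurable_min1sq : measurable_fun setT min1sq.
Proof.
apply: measurable_minr; first exact: measurable_cst.
exact: measurable_funX.
Qed.

Lemma integrable_min1sq C : Pi.-integrable setT (EFin \o (fun x => C * min1sq x)).
Proof.
apply: (@eq_integrable _ _ _ _ setT measurableT (fun x => C%:E * (min1sq x)%:E)%E) => //.
apply: integrableZl => //; have [_ _ H] := Pi_levy.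
apply/integrableP; split; first by apply/measurable_EFinP; exact: measurable_min1sq.
apply: le_lt_trans H; rewrite le_eqVlt; apply/orP; left; apply/eqP.
by apply: eq_integral => x _ /=; rewrite ger0_norm // min1sq_ge0.
Qed.

Lemma integrable_levy C (f : R -> R) : measurable_fun setT f ->
 (forall x, `|f x| <= C * min1sq x) -> Pi.-integrable setT (EFin \o f).
Proof.
move=> mf fC; apply: (le_integrable _ _ _ (integrable_min1sq C)) => //.
 exact/measurable_EFinP.
by move=> x _ /=; rewrite lee_fin (le_trans (fC x)) ?ler_norm.
Qed.

(** Convergence is asked only off $\{-1,1\}$, which [Pi] does not charge. This absorbs the
    discontinuities of the truncation $1_{|x|\le1}$ in (A2) and in $\Phi$. *)
Lemma Rintegral_levy_cvg C (f_ : nat -> R -> R) (f : R -> R) :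
 (forall n, measurable_fun setT (f_ n)) -> measurable_fun setT f ->
 (forall n x, `|f_ n x| <= C * min1sq x) ->
 (forall x, x != 1 -> x != -1 -> f_ n x @[n --> \oo] --> f x) ->
 Rintegral Pi setT (f_ n) @[n --> \oo] --> Rintegral Pi setT f.
Proof.
move=> mf_ mf fC ff; apply: (Rintegral_cvg mf_ mf (integrable_min1sq C) fC).
have [_ H _] := Pi_levy.
exists [set x | x = -1 \/ x = 1]; split => //.
 rewrite (_ : [set _ | _] = [set -1] `|` [set 1]); last by apply/seteqP; split=> x.
 exact: measurableU.
move=> x /= nx; have [->|x1] := eqVneq x 1; first by right.
by have [->|x2] := eqVneq x (-1); [left|exfalso; apply: nx; exact: ff].
Qed.

End Integrals.

(** * A smooth bounded function measuring displacement *)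

Section PhiElementary.
Variable R : realType.

(** A smooth substitute for the indicator of $|x|\ge r$: it is 0 at the origin, at least $1/2$ from
    distance [r] on, and has small derivatives for large [r], so that one step of the chain raises
    its mean very little. *)
Definition phi (r x : R) : R := x ^+ 2 / (r ^+ 2 + x ^+ 2).

Lemma phi_den_gt0 (r x : R) : 0 < r -> 0 < r ^+ 2 + x ^+ 2.
Proof. by move=> r0; rewrite ltr_wpDr ?sqr_ge0 ?exprn_gt0. Qed.

Lemma phi01 (r x : R) : 0 < r -> 0 <= phi r x <= 1.
Proof.
move=> r0; have d0 := phi_den_gt0 x r0.
rewrite /phi; apply/andP; split; first by pos.
by rewrite ler_pdivrMr // mul1r lerDr sqr_ge0.
Qed.

Lemma phi0 (r : R) : phi r 0 = 0.
Proof. by rewrite /phi expr0n mul0r. Qed.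

Lemma phi_ge_half (r x : R) : 0 < r -> r <= `|x| -> 2^-1 <= phi r x.
Proof.
move=> r0 rx; have d0 := phi_den_gt0 x r0.
rewrite /phi ler_pdivlMr //.
have : r ^+ 2 <= x ^+ 2.
 by rewrite -(real_normK (num_real x)) lerXn2r // nnegrE ltW.
lra.
Qed.

(** The remainder of the first-order expansion is $y^2$ times an explicit fraction, whose numerator
    is controlled from above by $(x+(x+y))^2\ge0$. *)
Lemma phi_sub_le (r x y : R) : 0 < r ->
 phi r (x + y) - phi r x - 2 * x * r ^+ 2 / (r ^+ 2 + x ^+ 2) ^+ 2 * y <= y ^+ 2 / r ^+ 2.
Proof.
move=> r0; have dx := phi_den_gt0 x r0; have dz := phi_den_gt0 (x + y) r0.
have -> : phi r (x + y) - phi r x - 2 * x * r ^+ 2 / (r ^+ 2 + x ^+ 2) ^+ 2 * y =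
 y ^+ 2 * (r ^+ 2 * (r ^+ 2 - x ^+ 2 - 2 * x * (x + y)) /
  ((r ^+ 2 + x ^+ 2) ^+ 2 * (r ^+ 2 + (x + y) ^+ 2))).
 by rewrite /phi; field; rewrite !gt_eqF.
rewrite ler_wpM2l ?sqr_ge0 //.
rewrite ler_pdivrMr ?mulr_gt0 ?exprn_gt0 //.
have r2 : 0 < r ^+ 2 by pos.
rewrite ler_pdivlMl // mulrA.
have h1 : r ^+ 2 - x ^+ 2 - 2 * x * (x + y) <= r ^+ 2 + (x + y) ^+ 2.
 have := sqr_ge0 (x + (x + y)); rewrite sqrrD mulr_natl; lra.
apply: (@le_trans _ _ (r ^+ 2 * r ^+ 2 * (r ^+ 2 + (x + y) ^+ 2))).
 by rewrite ler_wpM2l // mulr_ge0 // ltW.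
rewrite ler_wpM2r ?(ltW dz) // -expr2 lerXn2r ?nnegrE ?(ltW r2) ?(ltW dx) //.
by rewrite lerDl sqr_ge0.
Qed.

Lemma phi_slope (r x : R) : 0 < r ->
 `|2 * x * r ^+ 2 / (r ^+ 2 + x ^+ 2) ^+ 2| <= r^-1.
Proof.
move=> r0; have dx := phi_den_gt0 x r0.
rewrite normrM normfV (gtr0_norm (x := _ ^+ 2)) ?exprn_gt0 //.
rewrite ler_pdivrMr ?exprn_gt0 // normrM (gtr0_norm (x := r ^+ 2)) ?exprn_gt0 //.
rewrite normrM (gtr0_norm (x := 2)) // ler_pdivlMl //.
have h : 2 * `|x| * r <= r ^+ 2 + x ^+ 2.
 have := sqr_ge0 (r - `|x|); rewrite sqrrB real_normK ?num_real // mulr_natl; lra.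
rewrite [leLHS](_ : _ = (2 * `|x| * r) * r ^+ 2); last by ring.
rewrite expr2 ler_pM //; first by pos.
 by pos.
by rewrite lerDl sqr_ge0.
Qed.

Lemma phi_lip (r x y : R) : 0 < r -> phi r (x + y) - phi r x <= `|y| / r.
Proof.
move=> r0; have dx := phi_den_gt0 x r0; have dz := phi_den_gt0 (x + y) r0.
have -> : phi r (x + y) - phi r x = y * (r ^+ 2 * ((x + y) + x) /
  ((r ^+ 2 + x ^+ 2) * (r ^+ 2 + (x + y) ^+ 2))).
 by rewrite /phi; field; rewrite !gt_eqF.
apply: (le_trans (ler_norm _)); rewrite normrM ler_wpM2l //.
rewrite normrM normfV (gtr0_norm (x := (r ^+ 2 + x ^+ 2) * _)) ?mulr_gt0 //.
rewrite ler_pdivrMr ?mulr_gt0 // normrM (gtr0_norm (x := r ^+ 2)) ?exprn_gt0 //.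
rewrite ler_pdivlMl //.
have hx : 2 * `|x| * r <= r ^+ 2 + x ^+ 2.
 have := sqr_ge0 (r - `|x|); rewrite sqrrB real_normK ?num_real // mulr_natl; lra.
have hz : 2 * `|x + y| * r <= r ^+ 2 + (x + y) ^+ 2.
 have := sqr_ge0 (r - `|x + y|); rewrite sqrrB real_normK ?num_real // mulr_natl; lra.
have r2 : 0 < r ^+ 2 by pos.
have nD := ler_normD (x + y) x.
apply: (@le_trans _ _ (r * (r ^+ 2 * (`|x + y| + `|x|)))).
 by rewrite !ler_wpM2l // ltW.
have h1 : r ^+ 2 * (2 * `|x| * r) <= (r ^+ 2 + (x + y) ^+ 2) * (r ^+ 2 + x ^+ 2).
 by apply: ler_pM; [exact: sqr_ge0|rewrite !mulr_ge0 // ltW|rewrite lerDl sqr_ge0|exact: hx].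
have h2 : r ^+ 2 * (2 * `|x + y| * r) <= (r ^+ 2 + x ^+ 2) * (r ^+ 2 + (x + y) ^+ 2).
 by apply: ler_pM; [exact: sqr_ge0|rewrite !mulr_ge0 // ltW|rewrite lerDl sqr_ge0|exact: hz].
have -> : r * (r ^+ 2 * (`|x + y| + `|x|)) =
 (r ^+ 2 * (2 * `|x| * r) + r ^+ 2 * (2 * `|x + y| * r)) / 2 by field.
rewrite ler_pdivrMr //; move: h1; rewrite mulrC; lra.
Qed.

End PhiElementary.

(** * Limits of rescaled one-step averages, from (A1) and (A2) *)

Section SmallJumps.
Variables (R : realType) (p : nat -> nat -> R).
Hypotheses (p_ge0 : forall n k, 0 <= p n k) (p_sum1 : sums_to_one p).
Variables (a : nat -> R) (Pi : {measure set R -> \bar R}) (b sigma2 : R).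
Hypotheses (a_gt0 : forall n, 0 < a n) (Pi_levy : levy_measure Pi) (A1 : step_limit p a Pi).

(** For [j >= 1] and bounded [g], the integral of [g] against $\Pi_j^*$, as a real number. *)
Definition jump (j : nat) (g : R -> R) : R := av p j (fun k => g (ln k%:R - ln j%:R)).

Definition jump_cvg (g : R -> R) (l : R) := a j * jump j g @[j --> \oo] --> l.

Lemma bdd_jump j (g : R -> R) : bdd g ->
 bdd (fun k : nat => g (ln k%:R - ln j%:R)).
Proof. exact: (@bdd_comp _ _ _ g (fun k : nat => ln k%:R - ln j%:R)). Qed.

Lemma series1_av j g : (0 < j)%N -> bdd g ->
 (\sum_(1 <= k <oo) (p j k * g k)%:E)%E = (av p j g)%:E.
Proof.
move=> j0 bg; apply: cvg_lim => //.
rewrite -cvg_shiftS /=.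
rewrite (_ : (fun n : nat => (\sum_(1 <= k < n.+1) (p j k * g k)%:E)%E) =
 EFin \o series (fun k => row p j k * g k.+1)).
 apply: cvg_EFin; first exact: nearW.
 exact: (av_cvg p_ge0 p_sum1 bg).
apply/funext => N /=; rewrite sumEFin /series /= big_add1 /=; congr (_%:E).
by apply: eq_bigr => i _; rewrite /row; case: j j0.
Qed.

Lemma jump_cvg_ereal (u : nat -> \bar R) g l : bdd g ->
 (forall j, (0 < j)%N -> u j = (jump j g)%:E) ->
 ((a j)%:E * u j)%E @[j --> \oo] --> l%:E -> jump_cvg g l.
Proof.
move=> bg ug H; have /fine_cvgP[_] := H.
apply: cvg_trans; apply: near_eq_cvg; near=> j => /=.
by rewrite ug -?EFinM //; near: j; exists 1%N.
Unshelve. all: end_near. Qed.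

Lemma jump_cvg_Pistar g l : bdd g ->
 (fun n => (a n)%:E * Pistar_int p n g)%E @ \oo --> l%:E -> jump_cvg g l.
Proof.
move=> bg; apply: jump_cvg_ereal => // j j0.
by rewrite /Pistar_int series1_av //; exact: bdd_jump.
Qed.

(** A test function of (A1) in logarithmic coordinates: vanishing near 0 becomes vanishing near 1,
    and constancy near both infinities gives continuity at 0 and a limit at $+\infty$. *)
Lemma jump_cvg_A1 (f : R -> R) (e r c1 c2 : R) : bdd f -> continuous f ->
 0 < e -> 0 < r -> (forall x, `|x| < e -> f x = 0) ->
 (forall x, x <= - r -> f x = c1) -> (forall x, r <= x -> f x = c2) ->
 jump_cvg f (Rintegral Pi setT f).
Proof.
move=> bf cf e0 r0 fe fr1 fr2.
(* Below [expR (- r)] the constant [c1] is imposed, because the value of [ln] at 0 has no meaning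
   here; this is what makes [F] continuous at 0. *)
pose F (x : R) := if x < expR (- r) then c1 else f (ln x).
have FE x : 0 < x -> F x = f (ln x).
 move=> x0; rewrite /F; case: ifP => // xr; rewrite fr1 //.
 by rewrite -(expRK (- r)) ler_ln ?posrE ?expR_gt0 // ltW.
have -> : Rintegral Pi setT f = Rintegral Pi setT (fun x => F (expR x)).
 by apply: eq_Rintegral => x _; rewrite FE ?expR_gt0 ?expRK.
have tF : test_fun_A1 F.
 split.
 - apply: continuous_in_subspaceT => x; rewrite inE /= le_eqVlt => /orP[/eqP <-|x0].
   have F0 : F 0 = c1 by rewrite /F expR_gt0.
   rewrite /continuous_at F0; apply: cvg_near_cst.
   have : \forall y \near (0 : R), y < expR (- r).
    by apply: lt_nbhsl; rewrite expR_gt0.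
   by apply: filterS => y yr; rewrite /F yr.
  have H : {for x, continuous (f \o @ln R)}.
   by apply: continuous_comp; [exact: continuous_ln|exact: cf].
  rewrite /prop_for /continuous_at (FE x x0).
  apply: cvg_trans H; apply: near_eq_cvg.
  have : \forall y \near x, 0 < y by exact: lt_nbhsr.
  by apply: filterS => y y0; rewrite FE.
 - apply/cvg_ex; exists c2; apply: cvg_near_cst.
  exists (expR r); split; first exact: num_real.
  move=> y ry; have y0 : 0 < y by apply: lt_trans ry; exact: expR_gt0.
  by rewrite FE // fr2 // -(expRK r) ler_ln ?posrE ?expR_gt0 // ltW.
 - have := @continuous_ln R 1 ltr01; rewrite /prop_for /continuous_at ln1.
  move=> /cvgrPdist_lt/(_ e e0); rewrite -nbhs_ballE => -[d /= d0 H].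
  exists (Num.min d (2^-1)); first by rewrite lt_min d0 invr_gt0 ltr0n.
  move=> x; rewrite lt_min => /andP[xd x2].
  have x0 : 0 < x by move: x2; rewrite ltr_norml; lra.
  rewrite FE // fe //; have := H x; rewrite /ball /= sub0r normrN.
  by apply; rewrite /ball_ /= distrC.
have bF : bdd F.
 have [M fM] := bf; exists (Num.max M `|c1|) => x.
 by rewrite /F; case: ifP => _; rewrite le_max ?fM ?lexx ?orbT.
apply: jump_cvg_ereal (A1 tF) => // j j0.
rewrite /exp_step (series1_av (g := fun k => F (k%:R / j%:R))) //; last first.
 exact: (@bdd_comp _ _ _ F (fun k : nat => k%:R / j%:R)).
congr (_%:E); apply: eq_av => k k0.
by rewrite FE ?divr_gt0 ?ltr0n // ln_div ?posrE ?ltr0n.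
Qed.

Lemma jumpD j f g : bdd f -> bdd g ->
 jump j (fun x => f x + g x) = jump j f + jump j g.
Proof. by move=> bf bg; rewrite /jump avD //; exact: bdd_jump. Qed.

Lemma jumpZ j c f : bdd f -> jump j (fun x => c * f x) = c * jump j f.
Proof. by move=> bf; rewrite /jump avZ //; exact: bdd_jump. Qed.

Lemma jumpB j f g : bdd f -> bdd g ->
 jump j (fun x => f x - g x) = jump j f - jump j g.
Proof. by move=> bf bg; rewrite /jump avB //; exact: bdd_jump. Qed.

Lemma jump_cst j c : jump j (fun=> c) = c.
Proof. by rewrite /jump av_cst. Qed.

Lemma jump_le j f g : bdd f -> bdd g -> (forall x, f x <= g x) ->
 jump j f <= jump j g.
Proof. by move=> bf bg fg; apply: av_le => //; exact: bdd_jump. Qed.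

Lemma jump_ge0 j f : bdd f -> (forall x, 0 <= f x) -> 0 <= jump j f.
Proof. by move=> bf f0; apply: av_ge0 => //; exact: bdd_jump. Qed.

Lemma jump_norm_le j f g : bdd f -> bdd g -> (forall x, `|f x| <= g x) ->
 `|jump j f| <= jump j g.
Proof. by move=> bf bg fg; apply: av_norm_le => //; exact: bdd_jump. Qed.

Lemma jump_cvgD f g l m : bdd f -> bdd g ->
 jump_cvg f l -> jump_cvg g m -> jump_cvg (fun x => f x + g x) (l + m).
Proof.
move=> bf bg fl gm; rewrite /jump_cvg.
under eq_fun do rewrite jumpD // mulrDr; exact: cvgD.
Qed.

Lemma jump_cvgZ c f l : bdd f ->
 jump_cvg f l -> jump_cvg (fun x => c * f x) (c * l).
Proof.
move=> bf fl; rewrite /jump_cvg.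
under eq_fun do rewrite jumpZ // mulrCA; by apply: cvgMr.
Qed.

(** The error [H] need not be uniformly small: it suffices that its own rescaled averages have a
    small limit. *)
Lemma jump_cvg_approx g l : bdd g ->
 (forall e : R, 0 < e -> exists g' l' H h, [/\ bdd g', bdd H &
  [/\ jump_cvg g' l', jump_cvg H h, (forall x, `|g x - g' x| <= H x),
   `|l - l'| <= e & h <= e]]) ->
 jump_cvg g l.
Proof.
move=> bg HH; apply/cvgrPdist_le => e e0.
have [|g' [l' [H [h [bg' bH [gl' Hh gH ll' he]]]]]] := HH (e / 4); first by lra.
have e40 : 0 < e / 4 by lra.
have /cvgrPdist_le/(_ _ e40) N1 := gl'; have /cvgrPdist_le/(_ _ e40) N2 := Hh.
near=> j.
have h1 : `|l' - a j * jump j g'| <= e / 4 by near: j.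
have h2 : `|h - a j * jump j H| <= e / 4 by near: j.
have h3 : `|a j * jump j g - a j * jump j g'| <= a j * jump j H.
 rewrite -mulrBr -jumpB // normrM gtr0_norm // ler_pM2l //.
 by apply: jump_norm_le => //; exact: bddB.
move: h1 h2 h3 ll'; rewrite !ler_norml => /andP[? ?] /andP[? ?] /andP[? ?] /andP[? ?].
by apply/andP; split; lra.
Unshelve. all: end_near. Qed.

Definition sq1 (x : R) : R := x ^+ 2 * (if `|x| <= 1 then 1 else 0).

Section SquareLimit.
Variable v : R.
Hypothesis sq1_cvg : jump_cvg sq1 v.

Lemma sq1_bounded x : 0 <= sq1 x <= 1.
Proof.
rewrite /sq1; case: ifP => x1; rewrite ?mulr0 ?mulr1 ?lexx ?ler01 // sqr_ge0 /=.
by rewrite -real_normK ?num_real // exprn_ile1.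
Qed.

Lemma bdd_sq1 : bdd sq1.
Proof. by exists 1 => x; have /andP[? ?] := sq1_bounded x; rewrite ger0_norm. Qed.

(* [cut_r] vanishes near 0, near 1 and -1 and near infinity, and increases to 1 elsewhere. *)
Definition bump (r : nat) (x : R) := clamp (2 - r%:R * `|(`|x| - 1)|).
Definition tail (r : nat) (x : R) := clamp (`|x| - r%:R).
Definition cut (r : nat) (x : R) :=
 clamp (r%:R * `|x| - 1) * (1 - bump r x) * (1 - tail r x).

Lemma continuous_norm_R : continuous (fun x : R => `|x|).
Proof. exact: norm_continuous. Qed.

Lemma continuous_bump r : continuous (bump r).
Proof.
apply: continuous_clamp_comp => x; apply: cvgB; first exact: cvg_cst.
apply: cvgMr; apply: cvg_norm; apply: cvgB; last exact: cvg_cst.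
exact: continuous_norm_R.
Qed.

Lemma continuous_tail r : continuous (tail r).
Proof.
by apply: continuous_clamp_comp => x; apply: cvgB; [exact: continuous_norm_R|exact: cvg_cst].
Qed.

Lemma continuous_cut r : continuous (cut r).
Proof.
move=> x; apply: cvgM; first apply: cvgM.
- apply: (@continuous_clamp_comp _ (fun x => r%:R * `|x| - 1)) => y.
 by apply: cvgB; [apply: cvgMr; exact: continuous_norm_R|exact: cvg_cst].
- by apply: cvgB; [exact: cvg_cst|exact: continuous_bump].
- by apply: cvgB; [exact: cvg_cst|exact: continuous_tail].
Qed.

Lemma bdd_clamp (f : R -> R) : bdd (fun x => clamp (f x)).
Proof. by exists 1 => x; have /andP[? ?] := clamp01 (f x); rewrite ger0_norm. Qed.

Lemma min1sq_ge x (k : nat) : (0 < k)%N -> (k%:R^-1 : R) <= `|x| -> (k%:R^-1 : R) ^+ 2 <= min1sq x.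
Proof.
move=> k0 kx; rewrite /min1sq le_min; apply/andP; split.
 rewrite exprn_ile1 // ?invr_ge0 // invf_le1 ?ler1n ?ltr0n //.
by rewrite -(real_normK (num_real x)) lerXn2r ?nnegrE ?invr_ge0.
Qed.

Lemma bump_le r x : (4 <= r)%N -> 0 <= bump r x <= 4 * min1sq x.
Proof.
move=> r4; have /andP[h0 h1] := clamp01 (2 - r%:R * `|(`|x| - 1)|).
rewrite /bump h0 /=.
have [x2|x2] := leP (2%:R^-1) `|x|.
 have := @min1sq_ge x 2%N isT x2; lra.
rewrite clamp_le0; first by rewrite mulr_ge0 // min1sq_ge0.
rewrite ler0_norm; last by lra.
have : 4 <= r%:R :> R by rewrite ler_nat.
nra.
Qed.

Lemma tail_le r x : (1 <= r)%N -> 0 <= tail r x <= min1sq x.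
Proof.
move=> r1; have /andP[h0 h1] := clamp01 (`|x| - r%:R).
rewrite /tail h0 /=; have [x2|x2] := leP (1%:R^-1) `|x|.
 have := @min1sq_ge x 1%N isT x2; rewrite invr1 expr1n; lra.
rewrite clamp_le0 ?min1sq_ge0 //; rewrite invr1 in x2.
have : 1 <= r%:R :> R by rewrite ler1n.
lra.
Qed.

Lemma bump_cvg_int r : (4 <= r)%N -> jump_cvg (bump r) (Rintegral Pi setT (bump r)).
Proof.
move=> r4; have r4' : 4 <= r%:R :> R by rewrite ler_nat.
apply: (@jump_cvg_A1 _ (2^-1) 2 0 0) => //.
- exact: bdd_clamp.
- exact: continuous_bump.
- move=> x x2; apply: clamp_le0; rewrite ler0_norm; last by lra.
 have : 0 <= `|x| by []; nra.
- move=> x x2; apply: clamp_le0; rewrite (ler0_norm (x := x)); last by lra.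
 rewrite ger0_norm; nra.
- move=> x x2; apply: clamp_le0; rewrite (ger0_norm (x := x)); last by lra.
 rewrite ger0_norm; nra.
Qed.

Lemma tail_cvg_int r : (1 <= r)%N -> jump_cvg (tail r) (Rintegral Pi setT (tail r)).
Proof.
move=> r1; have r1' : 1 <= r%:R :> R by rewrite ler1n.
apply: (@jump_cvg_A1 _ 1 (r%:R + 1) 1 1) => //.
- exact: bdd_clamp.
- exact: continuous_tail.
- by move=> x x2; apply: clamp_le0; lra.
- by move=> x x2; apply: clamp_ge1; rewrite ler0_norm; lra.
- by move=> x x2; apply: clamp_ge1; rewrite ger0_norm; lra.
Qed.

Lemma near_natge (x : R) : \forall r \near \oo, x <= r%:R.
Proof.
have [N xN] : exists N : nat, x <= N%:R.
 by exists (Num.truncn x).+1; exact/ltW/truncnS_gt.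
by exists N => // r /= Nr; rewrite (le_trans xN) ?ler_nat.
Qed.

Lemma tail_int0 : Rintegral Pi setT (tail r) @[r --> \oo] --> (0 : R).
Proof.
rewrite -(cvg_shiftn 1); have E0 : Rintegral Pi setT (cst 0) = 0 by rewrite /Rintegral integral0.
suff : Rintegral Pi setT (tail (r + 1)) @[r --> \oo] --> Rintegral Pi setT (cst 0).
 by rewrite E0.
apply: (@Rintegral_levy_cvg _ _ Pi_levy 1 (fun r => tail (r + 1)) (cst 0)).
- by move=> r; apply: continuous_measurable_fun; exact: continuous_tail.
- exact: measurable_cst.
- move=> r x; have /andP[h0 h1] := @tail_le (r + 1)%N x ltac:(lia).
 by rewrite ger0_norm // mul1r.
move=> x _ _; apply: cvg_near_cst; have := near_natge `|x|.
by apply: filterS => r xr; apply: clamp_le0; rewrite subr_le0 (le_trans xr) ?ler_nat ?leq_addr.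
Qed.

Lemma bump_int0 : Rintegral Pi setT (bump r) @[r --> \oo] --> (0 : R).
Proof.
rewrite -(cvg_shiftn 4); have E0 : Rintegral Pi setT (cst 0) = 0 by rewrite /Rintegral integral0.
suff : Rintegral Pi setT (bump (r + 4)) @[r --> \oo] --> Rintegral Pi setT (cst 0).
 by rewrite E0.
apply: (@Rintegral_levy_cvg _ _ Pi_levy 4 (fun r => bump (r + 4)) (cst 0)).
- by move=> r; apply: continuous_measurable_fun; exact: continuous_bump.
- exact: measurable_cst.
- move=> r x; have /andP[h0 h1] := @bump_le (r + 4)%N x ltac:(lia).
 by rewrite ger0_norm.
move=> x x1 x2; apply: cvg_near_cst.
have y0 : 0 < `|(`|x| - 1)|.
 rewrite normr_gt0 subr_eq0; apply/negP => /eqP xx.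
 move: x1 x2; have [|] := lerP 0 x => H; move: xx.
  by rewrite ger0_norm // => ->; rewrite eqxx.
 by rewrite ltr0_norm // => /(congr1 -%R); rewrite opprK => ->; rewrite eqxx.
have := near_natge (2 / `|(`|x| - 1)|).
apply: filterS => r xr; apply: clamp_le0; rewrite subr_le0.
move: xr; rewrite ler_pdivrMr // => H; apply: le_trans H _.
by rewrite ler_wpM2r // ler_nat leq_addr.
Qed.

Lemma cut01 r x : 0 <= cut r x <= 1.
Proof.
have /andP[? ?] := clamp01 (r%:R * `|x| - 1).
have /andP[? ?] := clamp01 (2 - r%:R * `|(`|x| - 1)|).
have /andP[? ?] := clamp01 (`|x| - r%:R).
by rewrite /cut /bump /tail !mulr_ge0 ?subr_ge0 //= !mulr_ile1 ?mulr_ge0 ?subr_ge0 //; lra.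
Qed.

Lemma bump_norm1 (r : nat) x y : (0 < r)%N -> `|x| = 1 -> `|y - x| <= (r%:R^-1 : R) ->
 bump r y = 1.
Proof.
move=> r0 x1 yx; apply: clamp_ge1.
have H : `|(`|y| - 1)| <= r%:R^-1.
 by have := ler_dist_dist y x; rewrite x1 => /le_trans; apply.
have rr : 0 < r%:R :> R by pos.
have : r%:R * `|(`|y| - 1)| <= r%:R / r%:R :> R by rewrite ler_pM2l.
rewrite divff ?gt_eqF //; lra.
Qed.

Lemma norm_neq1 (x : R) : x != 1 -> x != -1 -> 0 < `|(`|x| - 1)|.
Proof.
move=> x1 x2; rewrite normr_gt0 subr_eq0; apply/negP => /eqP xx.
move: x1 x2; have [|] := lerP 0 x => H; move: xx.
 by rewrite ger0_norm // => ->; rewrite eqxx.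
by rewrite ltr0_norm // => /(congr1 -%R); rewrite opprK => ->; rewrite eqxx.
Qed.

Lemma cut_near1 (x : R) : x != 0 -> x != 1 -> x != -1 -> \forall r \near \oo, cut (r + 1) x = 1.
Proof.
move=> x0 x1 x2.
have x0' : 0 < `|x| by rewrite normr_gt0.
have y0 := norm_neq1 x1 x2.
have n1 := near_natge `|x|; have n2 := near_natge (2 / `|x|).
have n3 := near_natge (2 / `|(`|x| - 1)|).
near=> r.
have h1 : `|x| <= r%:R by near: r.
have h2 : 2 / `|x| <= r%:R by near: r.
have h3 : 2 / `|(`|x| - 1)| <= r%:R by near: r.
rewrite /cut /bump /tail natrD clamp_ge1; last first.
 by move: h2; rewrite ler_pdivrMr // mulrDl mul1r; move: x0'; lra.
rewrite [in X in 1 - X]clamp_le0; last first.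
 by move: h3; rewrite ler_pdivrMr // mulrDl mul1r; move: y0; lra.
by rewrite clamp_le0 ?subr0 ?mulr1 //; move: h1; lra.
Unshelve. all: end_near. Qed.

(** A union bound over the three places that [cut] removes: near 0, near $\pm1$ and near
    infinity. *)
Lemma one_sub_cut_le r x :
 1 - cut r x <= (1 - clamp (r%:R * `|x| - 1)) + (bump r x + tail r x).
Proof.
have /andP[q0 q1] := clamp01 (r%:R * `|x| - 1).
have /andP[y0 y1] := clamp01 (2 - r%:R * `|(`|x| - 1)|).
have /andP[z0 z1] := clamp01 (`|x| - r%:R).
rewrite /cut; rewrite -/(bump r x) in y0 y1 *; rewrite -/(tail r x) in z0 z1 *.
move: (clamp _) (bump r x) (tail r x) q0 q1 y0 y1 z0 z1 => q y z q0 q1 y0 y1 z0 z1.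
have h1 : 0 <= (1 - q) * y by pos.
have h2 : q * (1 - y) <= 1 by rewrite mulr_ile1 //; lra.
have h3 : 0 <= (1 - q * (1 - y)) * z by pos.
move: h1 h3; rewrite !(mulrBr, mulrBl, mulr1, mul1r) => h1 h3; lra.
Qed.

Section Workhorse.
Variables (g : R -> R) (C : R).
Hypotheses (mg : measurable_fun setT g) (g3 : forall x, `|x| <= 1 -> `|g x| <= C * `|x| ^+ 3)
 (gC : forall x, `|g x| <= C) (cg : forall x, x != 1 -> x != -1 -> {for x, continuous g}).

Let C0 : 0 <= C. Proof. exact: le_trans (gC 0). Qed.

Lemma continuous_mul_cut r : (0 < r)%N -> continuous (fun x => g x * cut r x).
Proof.
move=> r0 x; have [x1|x1] := eqVneq `|x| 1.
 have bx : forall y, `|y - x| <= r%:R^-1 -> g y * cut r y = 0.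
  move=> y yx; have E := bump_norm1 r0 x1 yx.
  by rewrite /cut E subrr mulr0 mul0r mulr0.
 rewrite /continuous_at bx ?subrr ?normr0 ?invr_ge0 //; apply: cvg_near_cst.
 have : \forall y \near x, `|x - y| < r%:R^-1.
  by have /cvgrPdist_lt := @cvg_id _ (nbhs x); apply; rewrite invr_gt0 ltr0n.
 by apply: filterS => y xy; apply: bx; rewrite distrC ltW.
apply: cvgM; last exact: continuous_cut.
by apply: cg; apply: contraNneq x1 => ->; rewrite ?normrN normr1.
Qed.

Lemma norm_le_min1sq x : `|g x| <= C * min1sq x.
Proof.
rewrite /min1sq minEle; case: ifP => [_|/negbT]; first by rewrite mulr1.
rewrite -ltNge -(real_normK (num_real x)) expr_lt1 // => /ltW x1.
by rewrite (le_trans (g3 x1)) // ler_wpM2l // exprSr ler_piMr // exprn_ge0.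
Qed.

Lemma mul_cut_le r x : `|g x * cut r x| <= `|g x|.
Proof. by have /andP[? ?] := cut01 r x; rewrite normrM ler_piMr // ger0_norm. Qed.

Lemma mul_cut_int_cvg :
 Rintegral Pi setT (fun x => g x * cut r x) @[r --> \oo] --> Rintegral Pi setT g.
Proof.
rewrite -(cvg_shiftn 1).
apply: (@Rintegral_levy_cvg _ _ Pi_levy C (fun r x => g x * cut (r + 1) x) g) => //.
- move=> r; apply: continuous_measurable_fun; apply: continuous_mul_cut; by rewrite addn1.
- by move=> r x; rewrite (le_trans (mul_cut_le _ _)) ?norm_le_min1sq.
move=> x x1 x2; have [->|x0] := eqVneq x 0.
 apply: cvg_near_cst; apply: nearW => r.
 have := @g3 0; rewrite normr0 expr0n mulr0 => /(_ ler01).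
 by rewrite normr_le0 => /eqP ->; rewrite mul0r.
apply: cvg_near_cst; have := cut_near1 x0 x1 x2.
by apply: filterS => r ->; rewrite mulr1.
Qed.

Lemma mul_cut_approx r x : (2 <= r)%N ->
 `|g x - g x * cut r x| <= C * (2 / r%:R * sq1 x + (bump r x + tail r x)).
Proof.
move=> r2; have r2' : 2 <= r%:R :> R by rewrite ler_nat.
have r0 : 0 < r%:R :> R by lra.
rewrite -{1}(mulr1 (g x)) -mulrBr normrM.
have /andP[c0 c1] := cut01 r x; rewrite (ger0_norm (x := 1 - _)); last by lra.
have /andP[s0 s1] := sq1_bounded x.
have /andP[b0 b1] := clamp01 (2 - r%:R * `|(`|x| - 1)|).
have /andP[t0 t1] := clamp01 (`|x| - r%:R).
have /andP[q0 q1] := clamp01 (r%:R * `|x| - 1).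
apply: (@le_trans _ _ (`|g x| * ((1 - clamp (r%:R * `|x| - 1)) + (bump r x + tail r x)))).
 by rewrite ler_wpM2l // one_sub_cut_le.
rewrite mulrDr [leRHS]mulrDr; apply: lerD; last first.
 by rewrite ler_wpM2r // addr_ge0.
have [xr|xr] := lerP 2 (r%:R * `|x|).
 rewrite clamp_ge1; last by move: xr; lra.
 by rewrite subrr mulr0 mulr_ge0 // mulr_ge0 // divr_ge0.
have x1 : `|x| <= 1.
 rewrite -(ler_pM2l r0) mulr1; move: xr r2'; lra.
apply: (@le_trans _ _ `|g x|); first by rewrite ler_piMr //; lra.
apply: (le_trans (g3 x1)); rewrite ler_wpM2l // /sq1 x1 mulr1 -(real_normK (num_real x)).
rewrite exprSr mulrC ler_wpM2r ?exprn_ge0 //.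
by rewrite ler_pdivlMr // mulrC ltW.
Qed.

(** Extends (A1) to functions that are $O(|x|^3)$ at 0 and may jump at $\pm1$. Multiplication by
    [cut r] gives a test function. Near 0 the loss is at most $2/r$ times the second moment, which
    converges; near $\pm1$ and infinity it is controlled by (A1) for [bump] and [tail], whose
    [Pi]-integrals tend to 0 with growing [r]. *)
Lemma jump_cvg_int : jump_cvg g (Rintegral Pi setT g).
Proof.
apply: jump_cvg_approx; first by exists C.
move=> e e0.
pose e' := e / (3 * (C + 1)).
have C1 : 0 < C + 1 by move: C0; lra.
have e'0 : 0 < e' by pos.
have e'E : C * (3 * e') <= e.
 have : (C + 1) * e' = e / 3 by rewrite /e'; field; rewrite gt_eqF.
 rewrite mulrDl mul1r; move: e'0; lra.
have n1 := near_natge (2 * (`|v| + 1) / e').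
have /cvgrPdist_le/(_ _ e0) n2 := mul_cut_int_cvg.
have /cvgrPdist_le/(_ _ e'0) n3 := tail_int0.
have /cvgrPdist_le/(_ _ e'0) n4 := bump_int0.
near \oo => r.
have h1 : 2 * (`|v| + 1) / e' <= r%:R by near: r.
have h2 : `|Rintegral Pi setT g - Rintegral Pi setT (fun x => g x * cut r x)| <= e by near: r.
have h3 : `|0 - Rintegral Pi setT (tail r)| <= e' by near: r.
have h4 : `|0 - Rintegral Pi setT (bump r)| <= e' by near: r.
have h5 : (4 <= r)%N by near: r.
have r0 : 0 < r%:R :> R by rewrite ltr0n; apply: leq_trans h5.
exists (fun x => g x * cut r x), (Rintegral Pi setT (fun x => g x * cut r x)).
exists (fun x => C * (2 / r%:R * sq1 x + (bump r x + tail r x))).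
exists (C * (2 / r%:R * v + (Rintegral Pi setT (bump r) + Rintegral Pi setT (tail r)))).
have bgc : bdd (fun x => g x * cut r x).
 by exists C => x; rewrite (le_trans (mul_cut_le _ _)).
have bb : bdd (bump r) by exact: bdd_clamp.
have bt : bdd (tail r) by exact: bdd_clamp.
have bs := bdd_sq1.
have bsZ : bdd (fun x => 2 / r%:R * sq1 x).
 by apply: bddM => //; exact: bdd_cst.
have bbt := bddD bb bt.
have bH := bddD bsZ bbt.
split => //; first by apply: bddM => //; exact: bdd_cst.
split => //.
- apply: (@jump_cvg_A1 _ r%:R^-1 (r%:R + 1) 0 0) => //.
 + by apply: continuous_mul_cut; exact: leq_trans h5.
 + by pos.
 + move=> x xr; rewrite /cut clamp_le0 ?mul0r ?mulr0 // subr_le0.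
  by rewrite -(ler_pM2l (x := r%:R^-1)) ?invr_gt0 // mulKf ?gt_eqF // mulr1 ltW.
 + move=> x xr; rewrite /cut /tail [in X in _ * (1 - X)]clamp_ge1 ?subrr ?mulr0 //.
  by rewrite ler0_norm; lra.
 + move=> x xr; rewrite /cut /tail [in X in _ * (1 - X)]clamp_ge1 ?subrr ?mulr0 //.
  by rewrite ger0_norm; lra.
- apply: jump_cvgZ => //; apply: jump_cvgD => //; first exact: jump_cvgZ.
 by apply: jump_cvgD => //; [exact: bump_cvg_int|apply: tail_cvg_int; exact: leq_trans h5].
- by move=> x; apply: mul_cut_approx; exact: leq_trans h5.
- move: h3 h4; rewrite !sub0r !normrN => h3 h4.
 have hv : 2 / r%:R * v <= e'.
  have : 2 * (`|v| + 1) <= r%:R * e' by move: h1; rewrite ler_pdivrMr.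
  have := ler_norm v; rewrite mulrAC ler_pdivrMr // mulrC; lra.
 have := ler_norm (Rintegral Pi setT (tail r)) => ht.
 have := ler_norm (Rintegral Pi setT (bump r)) => hb.
 apply: le_trans e'E; rewrite ler_wpM2l //; move: hv ht hb h3 h4; lra.
Unshelve. all: end_near. Qed.

End Workhorse.

End SquareLimit.

Definition ind1 (x : R) : R := if `|x| <= 1 then 1 else 0.
Definition id1 (x : R) : R := x * (if `|x| <= 1 then 1 else 0).

Hypothesis A2b : jump_cvg id1 b.
Local Notation v := (sigma2 + Rintegral Pi [set x | `|x| <= 1] (fun x => x ^+ 2)).
Hypothesis A2v : jump_cvg sq1 v.

Lemma continuous_ind1 (x : R) : x != 1 -> x != -1 -> {for x, continuous ind1}.
Proof.
move=> x1 x2; have := norm_neq1 x1 x2; rewrite normr_gt0 subr_eq0 => xx.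
rewrite /prop_for /continuous_at; apply: cvg_near_cst.
move: xx; rewrite neq_lt => /orP[xx|xx].
 have : \forall y \near x, `|y| < 1.
  exact: (@cvgr_lt _ _ (nbhs x) _ (fun y => `|y|) `|x| (@continuous_norm_R x)).
 by apply: filterS => y y1; rewrite /ind1 !ltW.
have : \forall y \near x, 1 < `|y|.
 exact: (@cvgr_gt _ _ (nbhs x) _ (fun y => `|y|) `|x| (@continuous_norm_R x)).
by apply: filterS => y y1; rewrite /ind1 !leNgt y1 xx.
Qed.

Lemma measurable_ind1 : measurable_fun setT ind1.
Proof.
apply: measurable_fun_ifT => //; apply: measurable_fun_ler => //.
Qed.

Lemma measurable_id1 : measurable_fun setT id1.
Proof. by apply: measurable_funM => //; exact: measurable_ind1. Qed.

Lemma measurable_sq1 : measurable_fun setT sq1.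
Proof.
by apply: measurable_funM; [exact: measurable_funX|exact: measurable_ind1].
Qed.

Lemma continuous_id1 (x : R) : x != 1 -> x != -1 -> {for x, continuous id1}.
Proof. by move=> x1 x2; apply: continuousM; [exact: cvg_id|exact: continuous_ind1]. Qed.

Lemma continuous_sq1 (x : R) : x != 1 -> x != -1 -> {for x, continuous sq1}.
Proof.
move=> x1 x2; apply: continuousM; [exact: exprn_continuous|exact: continuous_ind1].
Qed.

Lemma id1_bounded x : `|id1 x| <= 1.
Proof. by rewrite /id1; case: ifP => x1; rewrite ?mulr1 ?mulr0 ?normr0. Qed.

Lemma bdd_id1 : bdd id1.
Proof. by exists 1; exact: id1_bounded. Qed.

Lemma sq1_int : Rintegral Pi setT sq1 = Rintegral Pi [set x | `|x| <= 1] (fun x => x ^+ 2).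
Proof.
rewrite [RHS]Rintegral_mkcond; apply: eq_Rintegral => x _.
rewrite /patch /sq1; case: ifP => H.
 by rewrite mem_set // mulr1.
by rewrite memNset ?mulr0 //= H.
Qed.

Lemma sq1_le_min1sq x : `|sq1 x| <= 1 * min1sq x.
Proof.
have /andP[h0 h1] := sq1_bounded x; rewrite ger0_norm // mul1r /min1sq le_min h1 /= /sq1.
by case: ifP; rewrite ?mulr1 ?mulr0 ?sqr_ge0.
Qed.

Lemma integrable_sq1 : Pi.-integrable setT (EFin \o sq1).
Proof. exact: (integrable_levy Pi_levy measurable_sq1 sq1_le_min1sq). Qed.

Lemma continuous_cosM (t : R) : continuous (fun x : R => cos (t * x)).
Proof.
move=> x; apply: (@continuous_comp _ _ _ (fun x => t * x) cos); last exact: continuous_cos.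
by apply: cvgMr; exact: cvg_id.
Qed.

Lemma continuous_sinM (t : R) : continuous (fun x : R => sin (t * x)).
Proof.
move=> x; apply: (@continuous_comp _ _ _ (fun x => t * x) sin); last exact: continuous_sin.
by apply: cvgMr; exact: cvg_id.
Qed.

Lemma bdd_cosB (t : R) : bdd (fun x : R => cos (t * x) - 1).
Proof.
apply: bddB; last exact: bdd_cst.
by exists 1 => x; exact: cos_max.
Qed.

Lemma bdd_sinM (t : R) : bdd (fun x : R => sin (t * x)).
Proof. by exists 1 => x; exact: sin_max. Qed.

Lemma cosB_le_min1sq (t x : R) : `|cos (t * x) - 1| <= (t ^+ 2 / 2 + 2) * min1sq x.
Proof.
rewrite distrC; have /andP[c0 c1] := one_sub_cos_le (t * x); rewrite ger0_norm //.
have t2 : 0 <= t ^+ 2 by pos.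
rewrite /min1sq minEle; case: ifP => h; last first.
 apply: (le_trans c1); rewrite exprMn mulrDl mulrAC; nra.
have := cos_geN1 (t * x); rewrite mulr1; lra.
Qed.

(** Subtracting the two Taylor terms truncated to $[-1,1]$ leaves a function of third order at 0, to
    which [jump_cvg_int] applies; the two terms converge by (A2). *)
Lemma jump_cvg_taylor (f : R -> R) (C c1 c2 : R) : continuous f -> (forall x, `|f x| <= C) ->
 (forall x, `|x| <= 1 -> `|f x - c1 * x - c2 * x ^+ 2| <= C * `|x| ^+ 3) ->
 jump_cvg f (Rintegral Pi setT (fun x => f x - c1 * id1 x - c2 * sq1 x) + (c1 * b + c2 * v)).
Proof.
move=> cf fC f3; set g := fun x : R => _.
have bf : bdd f by exists C.
have bi : bdd (fun x => c1 * id1 x) by apply: bddM; [exact: bdd_cst|exact: bdd_id1].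
have bs : bdd (fun x => c2 * sq1 x) by apply: bddM; [exact: bdd_cst|exact: bdd_sq1].
have bg : bdd g by apply: bddB => //; exact: bddB.
have H : jump_cvg g (Rintegral Pi setT g).
 apply: (@jump_cvg_int _ A2v g (C + (`|c1| + `|c2|))).
 - apply: measurable_funB; last by apply: measurable_funM => //; exact: measurable_sq1.
  by apply: measurable_funB; [exact: continuous_measurable_fun|apply: measurable_funM => //; exact: measurable_id1].
 - move=> x x1; rewrite /g /id1 /sq1 x1 !mulr1; apply: (le_trans (f3 x x1)).
  by rewrite ler_wpM2r ?exprn_ge0 // lerDl addr_ge0.
 - move=> x; have /andP[s0 s1] := sq1_bounded x; have i1 := id1_bounded x.
  rewrite /g -addrA -opprD; apply: (le_trans (ler_normB _ _)); apply: lerD => //.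
  apply: (le_trans (ler_normD _ _)); rewrite (normrM c1) (normrM c2) (ger0_norm s0).
  by apply: lerD; rewrite ler_piMr.
 - move=> x x1 x2; apply: cvgB; last by apply: cvgMr; exact: continuous_sq1.
  by apply: cvgB; [exact: cf|apply: cvgMr; exact: continuous_id1].
have -> : f = (fun x => g x + (c1 * id1 x + c2 * sq1 x)) by apply/funext => x; rewrite /g; ring.
apply: jump_cvgD => //; first exact: bddD.
by apply: jump_cvgD => //; apply: jump_cvgZ => //; [exact: bdd_id1|exact: bdd_sq1].
Qed.

(** With the sine version below, this says $a_j(E[e^{itJ}]-1)\to\Phi(t)$ for the jump $J$ of the
    logarithm from [j]. The [Pi]-part of the second moment cancels against the integral of the
    quadratic Taylor term and only $-\sigma^2t^2/2$ remains. *)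
Lemma jump_cvg_cos (t : R) : jump_cvg (fun x => cos (t * x) - 1) (RePhi sigma2 Pi t).
Proof.
have cc : continuous (fun x : R => cos (t * x) - 1).
 by move=> x; apply: cvgB; [exact: continuous_cosM|exact: cvg_cst].
have t4 : 0 <= `|t| ^+ 4 by pos.
have -> : RePhi sigma2 Pi t = Rintegral Pi setT (fun x => cos (t * x) - 1 - 0 * id1 x - - (t ^+ 2 / 2) * sq1 x) +
  (0 * b + - (t ^+ 2 / 2) * v).
 rewrite (_ : (fun x => _ - _) = fun x => (cos (t * x) - 1) + t ^+ 2 / 2 * sq1 x); last first.
  by apply/funext => x; ring.
 rewrite RintegralD //; last 2 first.
 - exact: (integrable_levy Pi_levy (continuous_measurable_fun cc) (cosB_le_min1sq t)).
 - apply: (@eq_integrable _ _ _ _ setT measurableT (fun x => (t ^+ 2 / 2)%:E * (sq1 x)%:E)%E) => //.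
  by apply: integrableZl => //; exact: integrable_sq1.
 rewrite RintegralZl //; last exact: integrable_sq1.
 by rewrite sq1_int /RePhi; field.
apply: (jump_cvg_taylor (C := `|t| ^+ 4 + 2)) => // [x|x x1].
 by have := cos_max (t * x); rewrite !ler_norml => /andP[? ?]; apply/andP; split; lra.
rewrite [X in `|X|](_ : _ = cos (t * x) - 1 + (t * x) ^+ 2 / 2); last by rewrite exprMn; ring.
apply: (le_trans (cos_taylor _)); rewrite normrM exprMn.
rewrite [leLHS](_ : _ = `|t| ^+ 4 * `|x| ^+ 3 * `|x|); last by ring.
apply: (@le_trans _ _ (`|t| ^+ 4 * `|x| ^+ 3)); last by rewrite ler_wpM2r ?exprn_ge0 // lerDl.
by rewrite ler_piMr // mulr_ge0 // exprn_ge0.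
Qed.

Lemma jump_cvg_sin (t : R) : jump_cvg (fun x => sin (t * x)) (ImPhi b Pi t).
Proof.
have -> : ImPhi b Pi t = Rintegral Pi setT (fun x => sin (t * x) - t * id1 x - 0 * sq1 x) + (t * b + 0 * v).
 rewrite /ImPhi mul0r addr0 addrC mulrC; congr (_ + _).
 by apply: eq_Rintegral => x _; rewrite /id1; ring.
apply: (jump_cvg_taylor (C := `|t| ^+ 3 + 1)) => [|x|x x1]; first exact: continuous_sinM.
 by apply: (le_trans (sin_max _)); rewrite lerDr.
rewrite mul0r subr0; apply: (le_trans (sin_taylor _)).
by rewrite normrM exprMn ler_wpM2r ?exprn_ge0 // lerDl.
Qed.

Definition expB (t D x : R) := expR (t * Num.min x D) - 1.

Lemma bdd_expB (t D : R) : 0 <= t -> bdd (expB t D).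
Proof.
move=> t0; exists (expR (t * D) + 1) => x.
apply: (le_trans (ler_normB _ _)); rewrite normr1 lerD2r ger0_norm ?expR_ge0 //.
by rewrite ler_expR ler_wpM2l // ge_min lexx orbT.
Qed.

(** Dominates the increments of [phi r] over jumps with $|x|>1$, which are at most $\min(1,|x|/r)$.
    The clamped factor makes it vanish near 0, as (A1) requires. *)
Definition zeta (r x : R) : R := clamp (2 * `|x| - 1) * Num.min 1 (`|x| / r).

Lemma continuous_zeta r : continuous (zeta r).
Proof.
move=> x; apply: cvgM.
 apply: (@continuous_clamp_comp _ (fun x => 2 * `|x| - 1)) => y.
 by apply: cvgB; [apply: cvgMr; exact: continuous_norm_R|exact: cvg_cst].
have := @continuous_min R R (cst 1) (fun y : R => `|y| / r) x; apply; first exact: cvg_cst.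
by apply: cvgMl; exact: continuous_norm_R.
Qed.

Lemma zeta01 r x : 0 < r -> 0 <= zeta r x <= 1.
Proof.
move=> r0; have /andP[q0 q1] := clamp01 (2 * `|x| - 1).
have m0 : 0 <= Num.min 1 (`|x| / r) by rewrite le_min ler01 divr_ge0 // ltW.
by rewrite /zeta mulr_ge0 // mulr_ile1 // ge_min lexx.
Qed.

Lemma bdd_zeta r : 0 < r -> bdd (zeta r).
Proof. by move=> r0; exists 1 => x; have /andP[? ?] := zeta01 x r0; rewrite ger0_norm. Qed.

Lemma zeta_cvg_int r : 0 < r -> jump_cvg (zeta r) (Rintegral Pi setT (zeta r)).
Proof.
move=> r0.
have h x : r + 1 <= `|x| -> zeta r x = 1.
 move=> rx; rewrite /zeta clamp_ge1; last by lra.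
 by rewrite mul1r min_l // ler_pdivlMr // mul1r; lra.
apply: (@jump_cvg_A1 (zeta r) (2^-1) (r + 1) 1 1) => //.
- exact: bdd_zeta.
- exact: continuous_zeta.
- by pos.
- by move=> x x2; rewrite /zeta clamp_le0 ?mul0r //; lra.
- by move=> x x2; apply: h; rewrite ler0_norm; lra.
- by move=> x x2; apply: h; rewrite ger0_norm; lra.
Qed.

Lemma zeta_int0 : Rintegral Pi setT (zeta r.+1%:R) @[r --> \oo] --> (0 : R).
Proof.
have E0 : Rintegral Pi setT (cst 0) = 0 by rewrite /Rintegral integral0.
suff : Rintegral Pi setT (zeta r.+1%:R) @[r --> \oo] --> Rintegral Pi setT (cst 0).
 by rewrite E0.
apply: (@Rintegral_levy_cvg _ _ Pi_levy 4 (fun r => zeta r.+1%:R) (cst 0)).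
- by move=> r; apply: continuous_measurable_fun; exact: continuous_zeta.
- exact: measurable_cst.
- move=> r x; have /andP[h0 h1] := @zeta01 r.+1%:R x ltac:(by rewrite ltr0n).
 rewrite ger0_norm //; have [x2|x2] := leP (2%:R^-1) `|x|.
  by have := @min1sq_ge x 2%N isT x2; lra.
 rewrite /zeta clamp_le0 ?mul0r; last by lra.
 by rewrite mulr_ge0 // min1sq_ge0.
move=> x _ _; apply/cvgrPdist_le => e e0.
have := near_natge (`|x| / e); apply: filterS => r xr.
rewrite /= sub0r normrN ger0_norm; last first.
 by have /andP[h0 h1] := @zeta01 r.+1%:R x ltac:(by rewrite ltr0n).
have /andP[q0 q1] := clamp01 (2 * `|x| - 1).
apply: (@le_trans _ _ (Num.min 1 (`|x| / r.+1%:R))).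
 by rewrite /zeta ler_piMl // le_min ler01 divr_ge0.
rewrite ge_min; apply/orP; right; rewrite ler_pdivrMr ?ltr0n //.
move: xr; rewrite ler_pdivrMr // mulrC => xr; apply: (le_trans xr).
by rewrite (ler_wpM2l (ltW e0)) // ler_nat.
Qed.

Lemma phi_step_le (r x y : R) : 0 < r ->
 phi r (x + y) <= phi r x + 2 * x * r ^+ 2 / (r ^+ 2 + x ^+ 2) ^+ 2 * id1 y
  + r ^- 2 * sq1 y + zeta r y.
Proof.
move=> r0; rewrite /id1 /sq1; case: ifP => [y1|/negbT]; rewrite ?mulr1 ?mulr0 ?addr0.
 have := phi_sub_le x y r0; have /andP[z0 _] := zeta01 y r0; rewrite mulrC; lra.
rewrite -ltNge => y1; rewrite /zeta clamp_ge1; last by lra.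
rewrite mul1r -lerBlDl le_min phi_lip // andbT.
by have /andP[? ?] := phi01 x r0; have /andP[? ?] := phi01 (x + y) r0; lra.
Qed.

(** Bounds the drift of [phi r] per unit of clock time: the first moment times the slope, the second
    moment times the curvature, and the large jumps. It tends to 0 as [r] grows, and this makes
    exits from wide windows rare. *)
Definition phi_rate (r : R) : R :=
 (`|b| + 1) / r + (`|v| + 1) / r ^+ 2 + (Rintegral Pi setT (zeta r) + r^-1).

Lemma phi_drift (r : R) : 0 < r -> \forall j \near \oo, forall x,
 jump j (fun y => phi r (x + y)) <= phi r x + phi_rate r / a j.
Proof.
move=> r0; have r2 : 0 < r ^+ 2 by pos.
have /cvgrPdist_le/(_ 1 ltr01) n1 := A2b; have /cvgrPdist_le/(_ 1 ltr01) n2 := A2v.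
have ri : 0 < r^-1 by pos.
have /cvgrPdist_le/(_ _ ri) n3 := zeta_cvg_int r0.
near=> j => x.
have h1 : `|b - a j * jump j id1| <= 1 by near: j.
have h2 : `|v - a j * jump j sq1| <= 1 by near: j.
have h3 : `|Rintegral Pi setT (zeta r) - a j * jump j (zeta r)| <= r^-1 by near: j.
pose c := 2 * x * r ^+ 2 / (r ^+ 2 + x ^+ 2) ^+ 2.
have bs := bdd_sq1; have bi := bdd_id1; have bz := bdd_zeta r0.
have bsZ : bdd (fun y => r ^- 2 * sq1 y).
 by apply: bddM => //; exact: bdd_cst.
have biZ : bdd (fun y => c * id1 y).
 by apply: bddM => //; exact: bdd_cst.
have bp : bdd (fun y => phi r (x + y)).
 by exists 1 => y; have /andP[? ?] := phi01 (x + y) r0; rewrite ger0_norm.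
have bc : bdd (fun _ : R => phi r x) by exact: bdd_cst.
have b1 := bddD bc biZ; have b2 := bddD b1 bsZ; have b3 := bddD b2 bz.
apply: (le_trans (jump_le j bp b3 (fun y => phi_step_le x y r0))).
rewrite (jumpD j b2 bz) (jumpD j b1 bsZ) (jumpD j bc biZ).
rewrite (jumpZ j c bi) (jumpZ j _ bs) jump_cst -!addrA lerD2l.
rewrite ler_pdivlMr // mulrC !mulrDr /phi_rate -addrA; apply: lerD; last apply: lerD.
- rewrite mulrCA; apply: (le_trans (ler_norm _)); rewrite normrM mulrC.
 apply: ler_pM => //; last exact: phi_slope.
 move: h1 (ler_norm b) (ler_norm (- b)); rewrite normrN !ler_norml => /andP[? ?] ? ?.
 by apply/andP; split; lra.
- rewrite mulrCA mulrC ler_pM2r ?invr_gt0 //.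
 by move: h2 (ler_norm v); rewrite !ler_norml => /andP[? ?] ?; lra.
- by move: h3; rewrite !ler_norml => /andP[? ?]; lra.
Unshelve. all: end_near. Qed.

Lemma phi_rate_cvg0 : phi_rate r.+1%:R @[r --> \oo] --> (0 : R).
Proof.
have h : (r.+1%:R^-1 : R) @[r --> \oo] --> (0 : R) by exact: cvg_harmonic.
rewrite /phi_rate -[X in _ --> X](_ : (`|b| + 1) * 0 + (`|v| + 1) * (0 * 0) + (0 + 0) = 0);
 last by ring.
apply: cvgD; last by apply: cvgD => //; exact: zeta_int0.
apply: cvgD; apply: cvgMr => //.
rewrite (_ : (fun x : nat => _) = (fun x : nat => x.+1%:R^-1 * x.+1%:R^-1)).
 exact: cvgM.
by apply/funext => x; rewrite expr2 invfM.
Qed.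

Lemma phi_rate_ge0 r : 0 < r -> 0 <= phi_rate r.
Proof.
move=> r0; rewrite /phi_rate !addr_ge0 ?divr_ge0 ?addr_ge0 ?sqr_ge0 ?invr_ge0 ?(ltW r0) //.
by apply: Rintegral_ge0 => x _; have /andP[] := zeta01 x r0.
Qed.

End SmallJumps.

(** * Uniform convergence for regularly varying sequences *)

Section RegularVariation.
Variables (R : realType) (a : nat -> R) (gamma : R).
Hypotheses (gamma_gt0 : 0 < gamma) (a_rv : reg_var a gamma).

Let a_gt0 n : 0 < a n. Proof. by have [] := a_rv. Qed.

Let g (n : nat) : R := ln (a n) - gamma * ln n%:R.

Lemma truncn_div_cvg (x : R) : 0 < x ->
 (Num.truncn (x * n%:R))%:R / n%:R @[n --> \oo] --> x.
Proof.
move=> x0; apply/cvgrPdist_le => e e0.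
have n2 := near_natge (e^-1).
near=> n; have n0 : 0 < n%:R :> R by rewrite ltr0n; near: n.
have xn : 0 <= x * n%:R by pos.
have h1 : (Num.truncn (x * n%:R))%:R <= x * n%:R by rewrite truncn_le.
have h2 : x * n%:R < (Num.truncn (x * n%:R)).+1%:R by rewrite truncnS_gt.
rewrite ger0_norm; last by rewrite subr_ge0 ler_pdivrMr.
have ne : 1 <= e * n%:R.
 by rewrite -ler_pdivrMl // mulr1; near: n.
rewrite lerBlDr -(ler_pM2r n0) mulrDl divfK ?gt_eqF //.
move: h2; rewrite -natr1; lra.
Unshelve. all: end_near. Qed.

Lemma g_cvg (x : R) : 0 < x -> g (Num.truncn (x * n%:R)) - g n @[n --> \oo] --> (0 : R).
Proof.
move=> x0; have [_ /(_ x x0) ax] := a_rv.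
have h1 : ln (a (Num.truncn (x * n%:R)) / a n) @[n --> \oo] --> gamma * ln x.
 rewrite -ln_powR; apply: (@cvg_comp _ _ _ _ (@ln R)) ax _.
 by apply: continuous_ln; rewrite powR_gt0.
have h2 : ln ((Num.truncn (x * n%:R))%:R / n%:R) @[n --> \oo] --> ln x.
 apply: (@cvg_comp _ _ _ _ (@ln R)) (truncn_div_cvg x0) _.
 exact: continuous_ln.
have : ln (a (Num.truncn (x * n%:R)) / a n) - gamma * ln ((Num.truncn (x * n%:R))%:R / n%:R)
  @[n --> \oo] --> gamma * ln x - gamma * ln x.
 by apply: cvgB => //; apply: cvgMr.
rewrite subrr.
apply: cvg_trans; apply: near_eq_cvg.
have n1 := near_natge (x^-1); have n2 : \forall n \near \oo, (0 < n)%N by exists 1%N.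
near=> n; have n0 : 0 < n%:R :> R by rewrite ltr0n; near: n.
have xn : 1 <= x * n%:R by rewrite -ler_pdivrMl // mulr1; near: n.
have t0 : 0 < (Num.truncn (x * n%:R))%:R :> R by rewrite ltr0n truncn_gt0.
rewrite /= !ln_div ?posrE // /g; ring.
Unshelve. all: end_near. Qed.

Lemma truncn_interval (k M : nat) (z : R) : (0 < M)%N -> k%:R <= z * M%:R < k.+1%:R ->
 Num.truncn (z * M%:R) = k.
Proof. by move=> M0 H; apply/truncn_def. Qed.

(** By contradiction, with Baire's theorem. Along a bad sequence of pairs [(N l, M l)], whose ratio
    [M l / N l] tends to some [r], the bound between [z * M l] and [M l] holds for each fixed [z]
    from some [l] on; on a suitable open set [V] this index is uniform. The bounds at the scales
    [N l] and [M l] are then compared at a common integer, which contradicts the choice of the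
    pairs. *)
Lemma log_uct (c C e : R) : 0 < c -> 0 < e ->
 \forall n \near \oo, forall m, c * n%:R <= m%:R <= C * n%:R -> `|g m - g n| <= e.
Proof.
move=> c0 e0; apply: contrapT => bad.
have {bad}bad : forall l : nat, exists nm : nat * nat,
  [/\ (l < nm.1)%N, c * nm.1%:R <= nm.2%:R <= C * nm.1%:R & e < `|g nm.2 - g nm.1| ].
 move=> l; apply: contrapT => H; apply: bad; exists l.+1 => // n /= ln m mn.
 rewrite leNgt; apply/negP => em; apply: H; exists (n, m); split => //.
have [nm nmP] := choice bad.
pose rho l : R := (nm l).2%:R / (nm l).1%:R.
have nm1_gt0 l : 0 < (nm l).1%:R :> R.
 by have [H _ _] := nmP l; rewrite ltr0n; apply: leq_ltn_trans H.
have rhoP l : c <= rho l <= C.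
 by have [_ /andP[h1 h2] _] := nmP l; rewrite /rho ler_pdivlMr // ler_pdivrMr // h1.
have [|f finc /cvg_ex[r rhor]] := @bolzano_weierstrass R rho.
 exists (`|C|); split; first exact: num_real.
 move=> x Cx l _ /=; have /andP[h1 h2] := rhoP l.
 rewrite ger0_norm; last by rewrite (le_trans _ h1) ?ltW.
 by rewrite (le_trans h2) // (le_trans (ler_norm _)) // ltW.
have f_ge l : (l <= f l)%N.
 elim: l => // l IH; apply: (leq_ltn_trans IH).
 by have := finc l.+1 l; rewrite !leEnat => H; rewrite ltnNge H -ltnNge.
pose N l := (nm (f l)).1; pose M l := (nm (f l)).2.
have N_gt l : (l < N l)%N.
 by have [H _ _] := nmP (f l); apply: leq_ltn_trans H; exact: f_ge.
have N0 l : 0 < (N l)%:R :> R by exact: nm1_gt0.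
have cM l : c * (N l)%:R <= (M l)%:R by have [_ /andP[]] := nmP (f l).
have M0 l : 0 < (M l)%:R :> R.
 by apply: lt_le_trans (cM l); rewrite mulr_gt0.
have NM l : e < `|g (M l) - g (N l)| by have [] := nmP (f l).
have r_ge : c <= r.
 apply: (@cvgr_to_ge _ _ _ _ _ _ _ rhor); apply: nearW => l /=.
 by have /andP[] := rhoP (f l).
have r0 : 0 < r by apply: lt_le_trans r_ge.
have N_oo : N l @[l --> \oo] --> \oo.
 by move=> A [n0 _ nA]; exists n0 => // l /= nl; apply: nA => /=; apply: leq_trans nl (ltnW (N_gt l)).
have M_oo : M l @[l --> \oo] --> \oo.
 move=> A [n0 _ nA]; have [k _ kP] := near_natge (n0%:R / c).
 exists k => // l kl; apply: nA => /=; rewrite -(ler_nat R).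
 apply: le_trans (cM l); rewrite mulrC -ler_pdivrMr //; apply: kP => /=.
 exact: leq_trans kl (ltnW (N_gt l)).
have gN (z : R) : 0 < z -> \forall l \near \oo, `|g (Num.truncn (z * (N l)%:R)) - g (N l)| < e / 2.
 move=> z0; have e20 : 0 < e / 2 by lra.
 have /cvgrPdist_lt/(_ _ e20) := cvg_comp _ _ N_oo (g_cvg z0).
 by apply: filterS => l; rewrite sub0r normrN.
have gM (z : R) : 0 < z -> \forall l \near \oo, `|g (Num.truncn (z * (M l)%:R)) - g (M l)| < e / 2.
 move=> z0; have e20 : 0 < e / 2 by lra.
 have /cvgrPdist_lt/(_ _ e20) := cvg_comp _ _ M_oo (g_cvg z0).
 by apply: filterS => l; rewrite sub0r normrN.
(* The points [z] at which the bound at scale [M l] fails for some [l >= L]. The endpoints [k / M l]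
   are left out so that the set is open; adding the half-line below 1 forces the open set found
   later into [z >= 1]. *)
pose F L : set R := [set z | z < 1] `|` \bigcup_(lk in [set lk : nat * nat |
  (L <= lk.1)%N /\ e / 2 <= `|g lk.2 - g (M lk.1)| ])
  [set z | lk.2%:R / (M lk.1)%:R < z < lk.2.+1%:R / (M lk.1)%:R].
have openF L : open (F L).
 apply: openU; first exact: open_lt.
 apply: bigcup_open => -[l k] _ /=.
 rewrite (_ : [set z | _] = [set z | k%:R / (M l)%:R < z] `&` [set z | z < k.+1%:R / (M l)%:R]).
  by apply: openI; [exact: open_gt|exact: open_lt].
 by apply/seteqP; split=> z /= => [/andP[]|[-> ->]].
have [L FL] : exists L, ~ dense (F L).
 apply: contrapT => /forallNP nd.
 have dF : dense (\bigcap_i F i).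
  apply: (@Baire R R^o) => i; split; first exact: openF.
  exact: contrapT (nd i).
 have [||z [/= z1 zF]] := dF [set z | 1 < z].
 - by exists 2 => /=; lra.
 - exact: open_gt.
 have z0 : 0 < z by lra.
 have [l0 _ l0P] := gM z z0.
 have [zlt|[[l k] [/= Ll ek] zk]] := zF l0 I; first by move: zlt => /=; lra.
 have := l0P l Ll => /=; rewrite (_ : Num.truncn _ = k) ?ltNge ?ek //.
 move: zk => /=; rewrite ltr_pdivrMr // ltr_pdivlMr // => /andP[h1 h2].
 by apply: truncn_interval; rewrite -?(ltr0n R) // (ltW h1) h2.
have [V [[z0 Oz0] [openO OF]]] : exists V : set R, V !=set0 /\ (open V /\ V `&` F L = set0).
 move: FL => /existsNP[V /not_implyP[V0 /not_implyP[oV nV]]].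
 by exists V; split => //; split => //; apply: contrapT => /eqP/set0P.
have notF z : V z -> ~ F L z.
 by move=> Oz Fz; have : (V `&` F L) z by []; rewrite OF.
have z01 : 1 <= z0 by rewrite leNgt; apply/negP => h; apply: (notF z0 Oz0); left.
(* A bad point of [V] could be a left endpoint, which [F L] omits; but then the points just to its
   right are bad as well and still belong to [V]. *)
have gMO l z : (L <= l)%N -> 0 < z -> V z ->
  `|g (Num.truncn (z * (M l)%:R)) - g (M l)| < e / 2.
 move=> Ll zgt0 Oz; rewrite ltNge; apply/negP => ek.
 have zM : 0 <= z * (M l)%:R by pos.
 set k := Num.truncn _ in ek.
 have h1 : k%:R <= z * (M l)%:R by rewrite truncn_le.
 have h2 : z * (M l)%:R < k.+1%:R by rewrite truncnS_gt.
 have n1 : \forall y \near z^'+, V y.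
  apply: cvg_within; exact: open_nbhs_nbhs.
 have n2 : \forall y \near z^'+, z < y by exact: nbhs_right_gt.
 have n3 : \forall y \near z^'+, y < k.+1%:R / (M l)%:R.
  by apply: nbhs_right_lt; rewrite ltr_pdivlMr.
 near z^'+ => y.
 apply: (notF y); first by near: y.
 right; exists (l, k) => //=; apply/andP; split; last by near: y.
 by rewrite ltr_pdivrMr //; apply: (le_lt_trans h1); rewrite ltr_pM2r //; near: y.
have rz0 : 0 < r * z0 by rewrite mulr_gt0 //; lra.
(* The point $rz_0N_l/M_l$ tends to $z_0$, hence enters [V]; multiplied by [M l] it is $rz_0N_l$,
   the very point used at the scale [N l]. *)
have cvgz : r * z0 * ((rho \o f) l)^-1 @[l --> \oo] --> z0.
 have : r * z0 * ((rho \o f) l)^-1 @[l --> \oo] --> r * z0 * r^-1.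
  by apply: cvgMr; apply: cvgV => //; rewrite gt_eqF.
 by rewrite mulrAC mulfV ?gt_eqF // mul1r.
have n1 : \forall l \near \oo, V (r * z0 * ((rho \o f) l)^-1).
 by apply: cvgz; exact: open_nbhs_nbhs.
have n2 := gN _ rz0.
have n3 : \forall l \near \oo, (L <= l)%N by exists L.
near \oo => l.
have rl : 0 < rho (f l) by exact: (divr_gt0 (M0 l) (N0 l)).
have h1 : `|g (Num.truncn (r * z0 * (N l)%:R)) - g (N l)| < e / 2 by near: l.
have h2 : `|g (Num.truncn (r * z0 * (rho (f l))^-1 * (M l)%:R)) - g (M l)| < e / 2.
 apply: gMO; [by near: l|by pos|by near: l].
have E : r * z0 * (rho (f l))^-1 * (M l)%:R = r * z0 * (N l)%:R.
 rewrite /rho -/(M l) -/(N l) invf_div -mulrA; congr (_ * _).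
 by rewrite divfK ?gt_eqF.
have := NM l; rewrite E in h2.
move: h1 h2; rewrite !ltr_norml => /andP[? ?] /andP[? ?].
apply/negP; rewrite -leNgt ler_norml; apply/andP; split; lra.
Unshelve. all: end_near. Qed.

Lemma uct (B e : R) : 0 < e -> \forall n \near \oo, forall m, (0 < m)%N ->
 - B <= ln m%:R - ln n%:R <= B ->
 `|a m / a n - expR (gamma * (ln m%:R - ln n%:R))| <= e.
Proof.
move=> e0; pose K := expR (gamma * B) * expR 1.
have K0 : 0 < K by pos.
pose d := Num.min 1 (e / K).
have d0 : 0 < d by pos.
have n1 := @log_uct (expR (- B)) (expR B) d (expR_gt0 _) d0.
near=> n => m m0 /andP[h1 h2].
have n0 : (0 < n)%N by near: n.
have gd' : forall m, expR (- B) * n%:R <= m%:R <= expR B * n%:R -> `|g m - g n| <= d by near: n.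
have nR : 0 < n%:R :> R by pos.
have mR : 0 < m%:R :> R by pos.
have mn : m%:R = expR (ln m%:R - ln n%:R) * n%:R :> R.
 by rewrite expRB !lnK ?posrE // divfK // gt_eqF.
have gd : `|g m - g n| <= d.
 apply: gd'; by rewrite mn !ler_pM2r // !ler_expR h1 h2.
have -> : a m / a n = expR (gamma * (ln m%:R - ln n%:R)) * expR (g m - g n).
 rewrite -expRD -[a m]lnK ?posrE // -{1}[a n]lnK ?posrE // -expRB; congr expR.
 by rewrite /g; ring.
rewrite -{2}[expR (gamma * _)]mulr1 -mulrBr normrM gtr0_norm ?expR_gt0 //.
have d1 : d <= 1 by rewrite ge_min lexx.
have de : d <= e / K by rewrite ge_min lexx orbT.
apply: (@le_trans _ _ (expR (gamma * B) * (d * expR 1))).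
 apply: ler_pM; rewrite ?expR_ge0 ?normr_ge0 // ?ler_expR ?ler_pM2l //.
 apply: (le_trans (expR_lip _)); apply: ler_pM; rewrite ?normr_ge0 ?expR_ge0 //.
 by rewrite ler_expR (le_trans gd).
have -> : expR (gamma * B) * (d * expR 1) = d * K by rewrite /K; ring.
by rewrite -ler_pdivlMr.
Unshelve. all: end_near. Qed.

(* [ln (a m) - gamma / 2 * ln m] stays above its values near [N], by halving [m]. *)
Lemma a_cvgy (A : R) : \forall n \near \oo, A <= a n.
Proof.
pose d := gamma / 2 * ln 2; have l2 : 0 < ln 2 :> R by rewrite ln_gt0 // ltr1n.
have d0 : 0 < d by pos.
have n1 : \forall n \near \oo, (0 < n)%N by exists 1%N.
have [N _ H] := filterI (@log_uct 1 3 d ltr01 d0) n1.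
have key m : (N <= m)%N -> g N - d + gamma / 2 * ln m%:R <= ln (a m).
 elim/ltn_ind: m => m IH Nm; have [_ m0] := H m Nm.
 have gE k : ln (a k) = g k + gamma * ln k%:R by rewrite /g subrK.
 have [mN|mN] := ltnP m (2 * N)%N.
  have [/(_ m) HN _] := H N (leqnn N).
  have {HN} : `|g m - g N| <= d.
   by apply: HN; rewrite mul1r ler_nat Nm -natrM ler_nat (leq_trans (ltnW mN)) // leq_mul.
  have : 0 <= gamma / 2 * ln m%:R by rewrite mulr_ge0 ?divr_ge0 ?(ltW gamma_gt0) // ln_ge0 // ler1n.
  rewrite gE ler_norml (_ : gamma * ln m%:R = gamma / 2 * ln m%:R + gamma / 2 * ln m%:R); last by field.
  by move: (g m) (g N) (_ * ln _) => x y z *; lra.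
 have Nh : (N <= m./2)%N by lia.
 have [/(_ m) Hh h0] := H m./2 Nh; have hm : (m./2 < m)%N by lia.
 have {Hh} : `|g m - g m./2| <= d.
  by apply: Hh; rewrite mul1r -natrM !ler_nat; apply/andP; split; lia.
 have : d <= gamma / 2 * (ln m%:R - ln m./2%:R).
  rewrite ler_wpM2l ?divr_ge0 ?(ltW gamma_gt0) // lerBrDr -lnM ?posrE ?ltr0n //.
  by rewrite ler_ln ?posrE -?natrM ?ltr0n ?ler_nat ?muln_gt0 //; lia.
 have := IH m./2 hm Nh; rewrite !gE ler_norml.
 rewrite (_ : gamma * ln m%:R = gamma / 2 * ln m%:R + gamma / 2 * ln m%:R); last by field.
 rewrite (_ : gamma * ln m./2%:R = gamma / 2 * ln m./2%:R + gamma / 2 * ln m./2%:R); last by field.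
 rewrite mulrBr; move: (g m) (g N) (g m./2) (_ * ln m%:R) (_ * ln m./2%:R) => x y z u w *; lra.
have nN : \forall n \near \oo, (N <= n)%N by exists N.
have nA := near_natge (expR ((ln (`|A| + 1) - (g N - d)) / (gamma / 2))).
apply: filterS3 n1 nN nA => n n0 Nn.
rewrite -[X in _ <= X -> _]lnK ?posrE ?ltr0n // ler_expR ler_pdivrMr ?divr_gt0 // => An.
apply: (@le_trans _ _ (`|A| + 1)); first by have := ler_norm A; lra.
rewrite -ler_ln ?posrE //; apply: le_trans (key n Nn).
by move: An; rewrite mulrC; move: (gamma / 2 * _) => *; lra.
Qed.

End RegularVariation.

(** * Cutting a history into cells *)

Section MachineDef.
Variable R : realType.

(* The chain is read cell by cell: a cell is a stretch of clock time of length [h], a step from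
  [x] lasting [1 / a x]. Inside a cell, phase 0 means that the log-position has stayed
  within [eps] of its value [sy] at the start of the cell, phase 1 that it has left that
  neighbourhood once and stayed within [eps] of the landing value [sr] since, and phase 2
  that it has moved a second time; the cell ends in phase 2 or with a new increment in [sd]. *)
Record mstate := MState {
 sx : nat; sj : nat; sS : R; sy : R; sph : nat; sr : R; sd : seq R }.

Variables (a : nat -> R) (n : nat) (h : R) (N : nat) (eps lo hi : R).

Definition lg (x : nat) : R := ln x%:R - ln n%:R.

Definition in_range (x : nat) : bool := [&& (0 < x)%N, lo <= lg x & lg x <= hi].

Definition alive (st : mstate) : bool :=
 [&& (sj st < N)%N, (sph st < 2)%N & in_range (sx st)].

(** The state reached by the closing step of a cell starts the next cell, so in phase 0 this step
    may be arbitrarily large; in phase 1 it still has to stay near the landing value. *)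
Definition step (st : mstate) (x : nat) : mstate :=
 let S := sS st + (a (sx st))^-1 in
 if h <= S then
  if (sph st == 1%N) && (eps < `|lg x - sr st|)
  then MState x (sj st) S (sy st) 2 (sr st) (sd st)
  else MState x (sj st).+1 0 (lg x) 0 (lg x) (rcons (sd st) (lg x - sy st))
 else if sph st == 0%N then
  if `|lg x - sy st| <= eps then MState x (sj st) S (sy st) 0 (sr st) (sd st)
  else MState x (sj st) S (sy st) 1 (lg x) (sd st)
 else if `|lg x - sr st| <= eps then MState x (sj st) S (sy st) 1 (sr st) (sd st)
  else MState x (sj st) S (sy st) 2 (sr st) (sd st).

(** The machine freezes for good once it has completed its cells, reached phase 2 or left the
    window. Every potential below is therefore constant from then on. *)
Definition upd (st : mstate) (x : nat) : mstate := if alive st then step st x else st.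

Definition mstart (x : nat) : mstate := MState x 0 0 (lg x) 0 (lg x) [::].

Fixpoint run (s : seq nat) : mstate :=
 if s is x :: s' then (if s' is [::] then mstart x else upd (run s') x) else mstart 0.

Lemma run_cons x s : s != [::] -> run (x :: s) = upd (run s) x.
Proof. by case: s. Qed.

End MachineDef.

Lemma normr_prod_le (R : realType) (M : R) (F : nat -> R) (u v : nat) : 0 <= M ->
 (forall i, (u <= i < v)%N -> `|F i| <= M) -> `|\prod_(u <= i < v) F i| <= M ^+ (v - u).
Proof.
move=> M0 FM; rewrite normr_prod -prodr_const_nat.
rewrite !big_nat; apply: ler_prod => i ui; rewrite normr_ge0 /=; exact: FM.
Qed.

(** * Supermartingales along the cells *)

Section Machine.
Variables (R : realType) (p : nat -> nat -> R).
Hypotheses (p_ge0 : forall n k, 0 <= p n k) (p_sum1 : sums_to_one p).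
Variables (a : nat -> R) (n : nat) (h : R) (N : nat) (eps lo hi cmax : R).
Hypotheses (a_gt0 : forall n, 0 < a n) (n_gt0 : (0 < n)%N) (h_gt0 : 0 < h).
Local Notation lg := (lg R n).
Local Notation in_range := (in_range n lo hi).
Local Notation alive := (alive n N lo hi).
Local Notation step := (step a n h eps).
Local Notation upd := (upd a n h N eps lo hi).
Local Notation run := (run a n h N eps lo hi).
Local Notation jump := (jump p).
Local Notation EN := (EN p).
Local Notation mstate := (mstate R).
Implicit Types st : mstate.

Hypotheses (c_le : forall x, in_range x -> (a x)^-1 <= cmax) (cmax_le : cmax <= h)
 (cmax_gt0 : 0 < cmax).

(** A completed cell is charged its maximal length [h + cmax] rather than its actual one. The clock
    then grows by at least the length of every live step and never exceeds [N%:R * (h + cmax)]. *)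
Definition mclock (st : mstate) : R := (sj st)%:R * (h + cmax) + sS st.

Definition mwf (st : mstate) : Prop :=
 [/\ 0 <= sS st, (sph st <= 1)%N -> sS st < h, (sj st <= N)%N,
   (sj st = N)%N -> sS st = 0 /\ sph st = 0%N &
   sS st <= h + cmax /\ size (sd st) = sj st].

Lemma alive_range st : alive st -> in_range (sx st).
Proof. by case/and3P. Qed.

Lemma mwf_step st x : alive st -> mwf st -> mwf (step st x).
Proof.
move=> al [S0 Sh jN jN0 [Sm sz]]; have /and3P[j1 ph1 rg] := al.
have cm := c_le rg; have Slt := Sh ph1.
have jne : (sj st = N)%N -> False by move=> E; rewrite E ltnn in j1.
have h1 : 0 <= sS st + (a (sx st))^-1 by pos.
have h2 : sS st + (a (sx st))^-1 <= h + cmax by rewrite lerD // ltW.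
have h3 : 0 <= h + cmax by pos.
rewrite /step; case: (leP h (sS st + _)) => hS.
 case: ifP => _; first by split => //= /jne.
 by split => //=; rewrite size_rcons sz.
by do ! case: ifP => _; split => //=; move=> /jne.
Qed.

Lemma mwf_run s : (0 < N)%N -> mwf (run s).
Proof.
move=> N0; have w x : mwf (mstart R n x).
 by split => //=; split => //; rewrite addr_ge0 // ltW.
elim: s => [|x [|y s] IH]; [exact: w|exact: w|].
by rewrite run_cons // /upd; case: ifP => // al; exact: mwf_step.
Qed.

Lemma mclock_step st x : alive st -> mwf st -> mclock st + (a (sx st))^-1 <= mclock (step st x).
Proof.
move=> al [S0 Sh _ _ _]; have /and3P[j1 ph1 rg] := al.
have cm := c_le rg; have Slt := Sh ph1.
rewrite /mclock /step; case: (leP h (sS st + _)) => hS; last by do ! case: ifP => _; rewrite /= -addrA.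
case: ifP => _ /=; rewrite ?addrA // addr0 -natr1 mulrDl mul1r -!addrA lerD2l.
by rewrite lerD // ltW.
Qed.

Lemma mclock_le s : (0 < N)%N -> mclock (run s) <= N%:R * (h + cmax).
Proof.
move=> N0; have [S0 Sh jN jN0 [Sm _]] := mwf_run s N0.
have hc : 0 <= h + cmax by pos.
move: jN; rewrite leq_eqVlt => /orP[/eqP E|jN].
 by have [S1 _] := jN0 E; rewrite /mclock S1 addr0 E.
rewrite /mclock; apply: (@le_trans _ _ ((sj (run s)).+1%:R * (h + cmax))).
 by rewrite -natr1 mulrDl mul1r lerD2l.
by rewrite ler_wpM2r // ler_nat.
Qed.

Lemma mclock_ge0 s : (0 < N)%N -> 0 <= mclock (run s).
Proof.
move=> N0; have [S0 _ _ _ _] := mwf_run s N0.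
by rewrite /mclock addr_ge0 // mulr_ge0 // addr_ge0 // ltW.
Qed.

Definition hpos (s : seq nat) := (s != [::]) && all (ltn 0) s.

Lemma supermartingale_in k V s : bdd V -> hpos s ->
 (forall s, hpos s -> av p (head 0%N s) (fun k => V (k :: s)) <= V s) -> EN k V s <= V s.
Proof.
move=> bV hs SV; elim: k s hs => [//|k IH] s hs /=.
apply: le_trans (SV s hs); apply: av_le => //; first exact: EN_bounded1.
 exact: (@bdd_comp _ _ _ V (cons^~ s)).
by move=> x x0; apply: IH; move: hs; rewrite /hpos /= x0 => /andP[].
Qed.

Lemma alive_sx s : alive (run s) -> sx (run s) = head 0%N s.
Proof.
elim: s => [//|x [//|y s] IH]; rewrite run_cons // /upd.
case: ifP => [al _|nal]; last by rewrite nal.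
by rewrite /= /step; do ! case: ifP.
Qed.

(** The drift inequality has to be checked at live, well-formed states only, the machine being
    frozen elsewhere. *)
Lemma machine_supermartingale k (v : mstate -> R) : (0 < N)%N ->
 bdd (fun s => v (run s)) ->
 (forall st, alive st -> mwf st ->
   av p (sx st) (fun x => v (step st x)) <= v st) ->
 EN k (fun s => v (run s)) [:: n] <= v (mstart R n n).
Proof.
move=> N0 bv H; rewrite -[leRHS]/(v (run [:: n])).
apply: (@supermartingale_in k (fun s => v (run s)) [:: n]) => //.
 by rewrite /hpos /= n_gt0.
move=> s /andP[s0 _].
under eq_av => x _ do rewrite run_cons // /upd.
case: (boolP (alive (run s))) => al; last by rewrite av_cst.
by rewrite -alive_sx //; apply: H => //; exact: mwf_run.
Qed.

Lemma lg_jump x y u : lg x - u = (lg y - u) + (ln x%:R - ln y%:R) :> R.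
Proof. by rewrite /lg; ring. Qed.

Lemma bdd_phi (r : R) : 0 < r -> bdd (phi r).
Proof. by move=> r0; exists 1 => y; have /andP[? ?] := phi01 y r0; rewrite ger0_norm. Qed.

Lemma bdd_av_phi (r u : R) : 0 < r -> bdd (fun x : nat => phi r (lg x - u)).
Proof. by move=> r0; apply: (@bdd_comp _ _ _ (phi r) (fun x => lg x - u)); exact: bdd_phi. Qed.

Lemma av_phi (r C : R) : 0 < r ->
 (forall x, in_range x -> forall u, jump x (fun y => phi r (u + y)) <= phi r u + C / a x) ->
 forall st u A B (w : nat -> R), alive st -> 0 <= A -> bdd w ->
 (forall x, (0 < x)%N -> w x <= A * phi r (lg x - u) + B) ->
 av p (sx st) w <= A * (phi r (lg (sx st) - u) + C / a (sx st)) + B.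
Proof.
move=> r0 H st u A B w al A0 bw wle.
have bph := bdd_av_phi u r0.
have bA : bdd (fun x : nat => A * phi r (lg x - u)).
 by apply: bddM => //; exact: bdd_cst.
have bAB : bdd (fun x : nat => A * phi r (lg x - u) + B).
 by apply: bddD => //; exact: bdd_cst.
apply: (le_trans (av_le p_ge0 p_sum1 (sx st) bw bAB wle)).
rewrite avD //; last exact: bdd_cst.
rewrite avZ // av_cst // lerD2r ler_wpM2l //.
have := H _ (alive_range al) (lg (sx st) - u); apply: le_trans.
rewrite /Submission.jump; apply: av_le => //.
 by apply: (@bdd_comp _ _ _ (phi r)); exact: bdd_phi.
by move=> x _; rewrite (lg_jump x (sx st)).
Qed.

(** * Two moves in one cell *)

Section Bad.
Variable C : R.
Hypotheses (eps_gt0 : 0 < eps) (C_ge0 : 0 <= C).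
Hypothesis phi_eps : forall x, in_range x -> forall u,
 jump x (fun y => phi eps (u + y)) <= phi eps u + C / a x.

Let q0 := 2 * C * (h + cmax).

(** A potential dominating the probability of ever reaching phase 2. In phase 1 it bounds the chance
    of a further move in the time left of the cell; in phase 0 it is the same bound for a first
    move, times the bound [q0] for the second; each later cell adds [q0 ^+ 2]. The factor 2 in front
    of [phi] makes the potential at least 1 once a distance [eps] is exceeded. *)
Definition vbad st : R :=
 if sph st == 2%N then 1 else if (sj st < N)%N then
  (if sph st == 0%N then q0 * (2 * phi eps (lg (sx st) - sy st) + 2 * C * (h + cmax - sS st))
   else 2 * phi eps (lg (sx st) - sr st) + 2 * C * (h + cmax - sS st))
  + (N.-1 - sj st)%:R * q0 ^+ 2
 else 0.

Let q0_ge0 : 0 <= q0.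
Proof. by rewrite /q0 !mulr_ge0 // addr_ge0 // ltW. Qed.

Lemma vbad_bounded : (0 < N)%N -> exists M, forall st, mwf st -> `|vbad st| <= M.
Proof.
move=> N0; exists (1 + (q0 + 1) * (2 + 2 * C * (h + cmax)) + N%:R * q0 ^+ 2).
move=> st [S0 Sh jN jN0 [Sm _]].
have q2 : 0 <= q0 ^+ 2 by pos.
have Nq : 0 <= N%:R * q0 ^+ 2 by pos.
have big : 0 <= (q0 + 1) * (2 + 2 * C * (h + cmax)) by pos.
have rest : 0 <= (N.-1 - sj st)%:R * q0 ^+ 2 <= N%:R * q0 ^+ 2.
 by rewrite mulr_ge0 //= ler_wpM2r // ler_nat (leq_trans (leq_subr _ _)) // leq_pred.
have /andP[rest0 rest1] := rest.
have f u : 0 <= 2 * phi eps u + 2 * C * (h + cmax - sS st) <= 2 + 2 * C * (h + cmax).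
 have /andP[p0 p1] := phi01 u eps_gt0.
 apply/andP; split.
  apply: addr_ge0; first exact: mulr_ge0.
  by apply: mulr_ge0; [exact: mulr_ge0|rewrite subr_ge0].
 rewrite lerD //; first by lra.
 by rewrite ler_wpM2l ?mulr_ge0 // lerBlDr lerDl.
rewrite /vbad; case: ifP => _; first by rewrite normr1 -addrA lerDl addr_ge0.
case: ifP => _; last by rewrite normr0 !addr_ge0.
case: ifP => _.
 have /andP[f0 f1] := f (lg (sx st) - sy st).
 rewrite ger0_norm; last by pos; exact: mulr_ge0.
 apply: lerD => //.
 apply: (@le_trans _ _ ((q0 + 1) * (2 + 2 * C * (h + cmax)))); last by rewrite lerDr.
 by rewrite ler_pM // lerDl.
have /andP[f0 f1] := f (lg (sx st) - sr st).
rewrite ger0_norm; last exact: addr_ge0.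
apply: lerD => //.
apply: (@le_trans _ _ ((q0 + 1) * (2 + 2 * C * (h + cmax)))); last by rewrite lerDr.
by apply: (le_trans f1); rewrite ler_peMl ?addr_ge0 // lerDr.
Qed.

Lemma vbad_step st : alive st -> mwf st -> av p (sx st) (fun x => vbad (step st x)) <= vbad st.
Proof.
move=> al wf; have [S0 Sh jN jN0 [Sm _]] := wf; have /and3P[j1 ph1 rg] := al.
have N0 : (0 < N)%N by apply: leq_ltn_trans j1.
have bw : bdd (fun x => vbad (step st x)).
 by have [M vM] := vbad_bounded N0; exists M => x; apply: vM; exact: mwf_step.
have Slt := Sh ph1; have cm := c_le rg; set c := (a (sx st))^-1 in cm *.
have c0 : 0 < c by pos.
have rho0 : 0 <= 2 * C * (h + cmax - (sS st + c)).
 by rewrite mulr_ge0 ?mulr_ge0 // subr_ge0 lerD // ltW.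
have big_phi u : eps < `|u| -> 1 <= 2 * phi eps u.
 by move=> hu; have := phi_ge_half eps_gt0 (ltW hu); lra.
have phi_pos u : 0 <= 2 * phi eps u.
 by pos; have /andP[] := phi01 u eps_gt0.
have rest0 : 0 <= (N.-1 - sj st)%:R * q0 ^+ 2 :> R by pos.
have fresh x y r : vbad (MState x (sj st).+1 0 y 0 r (rcons (sd st) (y - sy st))) =
  (if (sj st < N.-1)%N then q0 * (2 * phi eps (lg x - y) + q0) else 0)
  + (N.-1 - (sj st).+1)%:R * q0 ^+ 2.
 rewrite /vbad /= -[X in (_ < X)%N](prednK N0) ltnS subr0.
 case: ifP => // jlt; rewrite add0r (_ : _ - _ = 0)%N ?mul0r //.
 by apply/eqP; rewrite subn_eq0 leqW // leqNgt jlt.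
have freshE x : vbad (MState x (sj st).+1 0 (lg x) 0 (lg x) (rcons (sd st) (lg x - sy st))) =
  (N.-1 - sj st)%:R * q0 ^+ 2.
 rewrite fresh subrr phi0 mulr0 add0r -expr2; case: ifP => jlt.
  rewrite -[X in X + _]mul1r -mulrDl nat1r; congr (_%:R * _).
  by rewrite subnSK.
 rewrite add0r; congr (_%:R * _).
 have /eqP -> : (N.-1 - sj st == 0)%N by rewrite subn_eq0 leqNgt jlt.
 by apply/eqP; rewrite subn_eq0 leqW // leqNgt jlt.
have [hS|hS] := leP h (sS st + c).
 have [ph|ph] := eqVneq (sph st) 1%N.
  apply: (@le_trans _ _ (2 * (phi eps (lg (sx st) - sr st) + C / a (sx st)) +
    (2 * C * (h + cmax - (sS st + c)) + (N.-1 - sj st)%:R * q0 ^+ 2))).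
   apply: (av_phi eps_gt0 phi_eps) => // x _.
   rewrite /step -/c hS ph /=; case: ifP => hu.
    rewrite {1}/vbad /= -[X in X <= _]addr0 lerD ?big_phi // addr_ge0 //.
   by rewrite freshE addrA lerDr addr_ge0.
  rewrite /vbad ph /= j1 -/c addrA lerD2r; lra.
 have ph0 : sph st = 0%N by move: ph ph1; case: (sph st) => [|[|]].
 under eq_av => x _ do rewrite /step -/c hS (negbTE ph) /= freshE.
 rewrite av_cst // /vbad ph0 /= j1 lerDr mulr_ge0 // addr_ge0 // mulr_ge0 ?mulr_ge0 //.
 by pos.
have hS' : (h <= sS st + c) = false by rewrite leNgt hS.
have [ph|ph] := eqVneq (sph st) 0%N.
 apply: (@le_trans _ _ ((2 * q0) * (phi eps (lg (sx st) - sy st) + C / a (sx st)) +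
   (q0 * (2 * C * (h + cmax - (sS st + c))) + (N.-1 - sj st)%:R * q0 ^+ 2))).
  apply: (av_phi eps_gt0 phi_eps) => //; first by pos.
  move=> x _; rewrite /step -/c hS' /= ph /=; case: (leP _ eps) => hu.
   by rewrite /vbad /= j1 addrA lerD2r; lra.
  rewrite /vbad /= j1 subrr phi0 mulr0 add0r addrA lerD2r.
  apply: (@le_trans _ _ (q0 * (2 * phi eps (lg x - sy st)))).
   apply: (@le_trans _ _ (q0 * 1)); last by rewrite ler_wpM2l // big_phi.
   rewrite mulr1 /q0 ler_wpM2l ?mulr_ge0 // lerBlDr lerDl addr_ge0 // ltW //.
  by rewrite mulrA (mulrC q0 2) lerDl mulr_ge0.
 rewrite /vbad ph /= j1 -/c addrA lerD2r.
 have -> : 2 * q0 * (phi eps (lg (sx st) - sy st) + C * c) + q0 * (2 * C * (h + cmax - (sS st + c))) =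
  q0 * (2 * phi eps (lg (sx st) - sy st) + 2 * C * (h + cmax - sS st)) by ring.
 exact: lexx.
apply: (@le_trans _ _ (2 * (phi eps (lg (sx st) - sr st) + C / a (sx st)) +
  (2 * C * (h + cmax - (sS st + c)) + (N.-1 - sj st)%:R * q0 ^+ 2))).
 apply: (av_phi eps_gt0 phi_eps) => // x _.
 rewrite /step -/c hS' /= (negbTE ph); case: (leP _ eps) => hu.
  by rewrite /vbad /= j1 addrA lerD2r.
 rewrite {1}/vbad /= -[X in X <= _]addr0 lerD ?big_phi // addr_ge0 //.
have ph' : sph st = 1%N by move: ph ph1; case: (sph st) => [|[|]].
rewrite /vbad ph' /= j1 -/c addrA lerD2r; lra.
Qed.

(** The bound is the initial value of [vbad]. It is of order [N%:R * h ^+ 2] when [cmax <= h], hence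
    small for a fine mesh and a fixed horizon [N%:R * h]. *)
Lemma bad_bound k : (0 < N)%N ->
 EN k (fun s => (sph (run s) == 2%N)%:R) [:: n] <= N%:R * (2 * C * (h + cmax)) ^+ 2.
Proof.
move=> N0; have bvb : bdd (fun s => vbad (run s)).
 by have [M vM] := vbad_bounded N0; exists M => s; apply: vM; exact: mwf_run.
apply: (@le_trans _ _ (EN k (fun s => vbad (run s)) [:: n])).
 apply: EN_le => //.
  by exists 1 => s; case: (_ == _); rewrite ?normr1 ?normr0.
 move=> s; have [S0 Sh jN jN0 [Sm _]] := mwf_run s N0.
 rewrite /vbad; case: ifP => // ph; case: ifP => // _; rewrite (_ : false%:R = 0 :> R) //.
 apply: addr_ge0; last by pos.
 case: ifP => _; last by pos.
 by pos.
apply: (le_trans (machine_supermartingale k N0 bvb (@vbad_step))).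
rewrite /vbad /= N0 subrr phi0 mulr0 add0r subr0 subn0 -/q0 -expr2.
rewrite -[X in X + _]mul1r -mulrDl ler_wpM2r ?sqr_ge0 //.
by rewrite nat1r (prednK N0).
Qed.

End Bad.

(** * Leaving the window *)

Section Exit.
Variables (B C : R).
Hypotheses (B_gt0 : 0 < B) (C_ge0 : 0 <= C).
Hypothesis phi_B : forall x, in_range x -> forall u,
 jump x (fun y => phi B (u + y)) <= phi B u + C / a x.

(** [phi B] of the position minus [C] times the clock is a supermartingale that starts at 0, since
    [lg n = 0], and the clock is bounded. *)
Lemma exit_bound k : (0 < N)%N ->
 EN k (fun s => phi B (lg (sx (run s)))) [:: n] <= C * (N%:R * (h + cmax)).
Proof.
move=> N0; pose v st := phi B (lg (sx st)) - C * mclock st.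
have bp : bdd (fun s => phi B (lg (sx (run s)))).
 by apply: (@bdd_comp _ _ _ (phi B)); exact: bdd_phi.
have bm : bdd (fun s => C * mclock (run s)).
 exists (C * (N%:R * (h + cmax))) => s.
 by rewrite ger0_norm ?mulr_ge0 ?mclock_ge0 // ler_wpM2l // mclock_le.
have := @machine_supermartingale k v N0 (bddB bp bm).
have v0 : v (mstart R n n) = 0 by rewrite /v /mclock /= /lg subrr phi0 mul0r addr0 mulr0 subr0.
rewrite v0 ENB // => H.
have {}H : EN k (fun s => phi B (lg (sx (run s)))) [:: n] <= EN k (fun s => C * mclock (run s)) [:: n].
 rewrite -subr_le0; apply: H => st al wf.
 pose B0 := - (C * (mclock st + (a (sx st))^-1)).
 apply: (@le_trans _ _ (1 * (phi B (lg (sx st) - 0) + C / a (sx st)) + B0)).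
  apply: (av_phi B_gt0 phi_B) => //.
   exists (1 + C * (N%:R * (h + cmax) + (h + cmax))) => x.
   have /andP[p0 p1] := phi01 (lg (sx (step st x))) B_gt0.
   have [S0 _ jN _ [Sm _]] := mwf_step x al wf.
   have hc : 0 <= h + cmax by pos.
   have m0 : 0 <= mclock (step st x) by rewrite /mclock addr_ge0 // mulr_ge0.
   have m1 : mclock (step st x) <= N%:R * (h + cmax) + (h + cmax).
    by rewrite /mclock lerD // ler_wpM2r // ler_nat.
   rewrite /v; apply: (le_trans (ler_normB _ _)); rewrite ger0_norm // lerD //.
   by rewrite ger0_norm ?mulr_ge0 // ler_wpM2l.
  move=> x _; have := mclock_step x al wf => mc.
  have sxE : sx (step st x) = x by rewrite /step; do ! case: ifP.
  by rewrite /v sxE subr0 mul1r lerD2l /B0 lerN2 ler_wpM2l.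
 by rewrite mul1r subr0 /v /B0 mulrDr; lra.
apply: (le_trans H); rewrite -(EN_cst p_sum1 k (C * (N%:R * (h + cmax))) [:: n]).
apply: EN_le => //; first exact: bdd_cst.
by move=> s; rewrite ler_wpM2l // mclock_le.
Qed.

End Exit.

(** Each live step costs at least [cmin] of a clock that never exceeds [N%:R * (h + cmax)], so a
    long history cannot be live. *)
Lemma stopped_by (cmin : R) s : (0 < N)%N -> 0 < cmin ->
 (forall x, in_range x -> cmin <= (a x)^-1) -> hpos s ->
 N%:R * (h + cmax) < (size s).-1%:R * cmin -> ~~ alive (run s).
Proof.
move=> N0 c0 cm hs; apply: contraTN => al; rewrite -leNgt.
apply: le_trans (mclock_le s N0).
elim: s al {hs} => [|x [|y s] IH]; [by rewrite mul0r mclock_ge0|by rewrite mul0r mclock_ge0|].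
rewrite run_cons // /upd; case: ifP => [al _|->//].
have := mclock_step x al (mwf_run (y :: s) N0); apply: le_trans.
rewrite [(size _).-1]/= -natr1 mulrDl mul1r lerD //; first exact: IH.
exact: (cm _ (alive_range al)).
Qed.

(** * Almost-martingales built from products over the cells *)

Section Martingale.
Hypothesis N_gt0 : (0 < N)%N.
Variables (G : nat -> R -> R -> R) (delta M K : R).
Hypotheses (delta_ge0 : 0 <= delta) (K_ge0 : 0 <= K) (M_ge1 : 1 <= M).
Hypothesis G_step : forall x, in_range x -> forall i, (i < N)%N -> forall rho, - h <= rho <= h ->
 forall u, `|av p x (fun y => G i (rho - (a x)^-1) (u + (ln y%:R - ln x%:R))) - G i rho u|
  <= delta / a x.
Hypothesis G_le : forall i rho d, (i < N)%N -> - h <= rho <= h -> `|G i rho d| <= M.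
Hypothesis G_lip : forall i rho d, (i < N)%N -> - cmax <= rho <= 0 ->
 `|G i rho d - G i 0 d| <= K * cmax.

Let M_ge0 : 0 <= M. Proof. exact: le_trans M_ge1. Qed.
Let h_rg0 : - h <= 0 <= h. Proof. by rewrite oppr_le0 !ltW. Qed.
Let h_rgh : - h <= h <= h. Proof. by rewrite lexx andbT; move: h_gt0; lra. Qed.

Definition done_prod st := \prod_(0 <= i < sj st) G i 0 (nth 0 (sd st) i).
Definition fut_prod st := \prod_((sj st).+1 <= i < N) G i h 0.

(** [G i rho d] plays the role of the conditional mean of the factor [i] when the cell has increment
    [d] so far and clock time [rho] left. Completed cells contribute their value at time 0, the
    current cell its conditional mean, the later cells their mean from a fresh start. *)
Definition vmart st : R :=
 if (sj st < N)%N then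
  done_prod st * fut_prod st * G (sj st) (h - sS st) (lg (sx st) - sy st)
 else done_prod st.

Lemma done_prod_le st : (sj st <= N)%N -> `|done_prod st| <= M ^+ sj st.
Proof.
move=> jN; rewrite -[X in M ^+ X]subn0; apply: normr_prod_le => // i /andP[_ ij].
by apply: G_le => //; exact: leq_trans jN.
Qed.

Lemma fut_prod_le st : `|fut_prod st| <= M ^+ (N - (sj st).+1).
Proof. by apply: normr_prod_le => // i /andP[_ iN]; exact: G_le. Qed.

Lemma done_fut_le st : (sj st < N)%N -> `|done_prod st * fut_prod st| <= M ^+ N.
Proof.
move=> jN; rewrite normrM.
apply: (@le_trans _ _ (M ^+ sj st * M ^+ (N - (sj st).+1))).
 by apply: ler_pM => //; [exact: done_prod_le (ltnW jN)|exact: fut_prod_le].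
by rewrite -exprD ler_weXn2l // -[leqRHS](subnKC jN) leq_add2r leqnSn.
Qed.

Lemma mwf_rho st : mwf st -> - h <= h - sS st <= h.
Proof.
move=> [S0 _ _ _ [Sm _]]; apply/andP; split; last by rewrite lerBlDr lerDl.
by move: Sm cmax_le; lra.
Qed.

Lemma vmart_le st : mwf st -> `|vmart st| <= M ^+ N.
Proof.
move=> wf; have [S0 Sh jN jN0 [Sm _]] := wf; rewrite /vmart; case: ifP => jlt; last first.
 by apply: (le_trans (done_prod_le jN)); rewrite ler_weXn2l.
rewrite normrM (normrM (done_prod st)).
apply: (@le_trans _ _ (M ^+ sj st * M ^+ (N - (sj st).+1) * M)).
 apply: ler_pM => //; last exact: G_le (mwf_rho wf).
 by apply: ler_pM => //; [exact: done_prod_le|exact: fut_prod_le].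
by rewrite -exprD -exprSr ler_weXn2l // -addSn subnKC.
Qed.

(** Compensates the defects of [vmart]: [delta] per unit of clock for the error of each step, and
    [K * cmax] per cell because a cell closes with a remaining time in [[- cmax, 0]] instead of
    exactly 0. *)
Definition vcomp st : R := M ^+ N * (delta * mclock st + K * cmax * (sj st)%:R).

Lemma vmart_step_target (s : R) st x : `|s| = 1 -> alive st -> mwf st ->
 s * vmart (step st x) - vcomp (step st x) <=
 s * (done_prod st * fut_prod st) *
  G (sj st) (h - sS st - (a (sx st))^-1) (lg x - sy st)
 - (M ^+ N * (delta * (mclock st + (a (sx st))^-1) + K * cmax * (sj st)%:R)).
Proof.
move=> s1 al wf; have [S0 Sh jN jN0 [Sm sz]] := wf; have /and3P[j1 ph1 rg] := al.
have MN0 : 0 <= M ^+ N by pos.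
have mc := mclock_step x al wf.
have Slt := Sh ph1; have cm := c_le rg.
have c0 : 0 < (a (sx st))^-1 by pos.
set c := (a (sx st))^-1 in mc cm c0 *.
have same st' : sj st' = sj st -> sS st' = sS st + c -> sd st' = sd st -> sy st' = sy st ->
  sx st' = x -> vmart st' = done_prod st * fut_prod st * G (sj st) (h - sS st - c) (lg x - sy st).
 by move=> E1 E2 E3 E4 E5; rewrite /vmart /done_prod /fut_prod E1 E2 E3 E4 E5 j1 opprD addrA.
have [[E1 E2]|[E1 hS]] : (sj (step st x) = sj st /\
  vmart (step st x) = done_prod st * fut_prod st * G (sj st) (h - sS st - c) (lg x - sy st)) \/
  (step st x = MState x (sj st).+1 0 (lg x) 0 (lg x) (rcons (sd st) (lg x - sy st))
  /\ h <= sS st + c).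
 rewrite /step -/c; case: (leP h (sS st + c)) => hS.
  by case: ifP => _; [left; split=> //; exact: same|right].
 by left; do ! case: ifP => _; split => //; exact: same.
 by rewrite E2 mulrA lerD2l /vcomp lerN2 E1 ler_wpM2l // lerD2r ler_wpM2l.
have Ev : vmart (step st x) = done_prod st * fut_prod st * G (sj st) 0 (lg x - sy st).
 rewrite E1 /vmart /=; have Ed : done_prod (MState x (sj st).+1 0 (lg x) 0 (lg x) (rcons (sd st) (lg x - sy st)))
   = done_prod st * G (sj st) 0 (lg x - sy st).
  rewrite /done_prod /= big_nat_recr //= nth_rcons sz ltnn eqxx; congr (_ * _).
  rewrite !big_nat; apply: eq_bigr => i /andP[_ ij]; by rewrite nth_rcons sz ij.
 rewrite Ed; case: ifP => jlt.
  by rewrite subr0 subrr /fut_prod /= [in RHS]big_ltn //; ring.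
 rewrite /fut_prod big_geq ?mulr1 // leqNgt; exact/negbT.
rewrite Ev E1 /vcomp /= -natr1.
set D := done_prod st * fut_prod st.
have DM : `|D| <= M ^+ N by exact: done_fut_le.
have rg0 : - cmax <= h - sS st - c <= 0.
 by apply/andP; split; move: hS Slt cm; lra.
have GL := G_lip (lg x - sy st) j1 rg0.
have mc' : mclock st + c <= mclock (MState x (sj st).+1 0 (lg x) 0 (lg x) (rcons (sd st) (lg x - sy st))).
 by rewrite -E1.
set m1 := mclock (MState _ _ _ _ _ _ _) in mc' *.
set g0 := G (sj st) 0 _ in GL *; set g1 := G (sj st) _ _ in GL *.
have key : s * D * (g0 - g1) <= M ^+ N * (K * cmax).
 apply: (le_trans (ler_norm _)); rewrite normrM normrM s1 mul1r.
 by apply: ler_pM => //; rewrite distrC.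
have k2 : M ^+ N * (delta * (mclock st + c)) <= M ^+ N * (delta * m1).
 by rewrite !ler_wpM2l.
rewrite !mulrDr !mulrA in key k2 *.
move: key k2; rewrite !mulrN mulr1 => key k2; lra.
Qed.

(** The sign [s] treats both one-sided bounds at once: [vmart - vcomp] and [- vmart - vcomp] both
    have nonpositive drift. *)
Lemma vmart_step (s : R) st : `|s| = 1 -> alive st -> mwf st ->
 av p (sx st) (fun x => s * vmart (step st x) - vcomp (step st x)) <= s * vmart st - vcomp st.
Proof.
move=> s1 al wf; have [S0 Sh jN jN0 [Sm sz]] := wf; have /and3P[j1 ph1 rg] := al.
have MN0 : 0 <= M ^+ N by pos.
set D := done_prod st * fut_prod st.
have DM : `|D| <= M ^+ N by exact: done_fut_le.
set c := (a (sx st))^-1; have c0 : 0 < c by pos.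
pose Gx x := G (sj st) (h - sS st - c) (lg x - sy st).
have Slt := Sh ph1; have cm := c_le rg.
have rg1 : - h <= h - sS st - c <= h.
 apply/andP; split; last by move: S0 c0; lra.
 by move: Slt cm cmax_le h_gt0; rewrite -/c; lra.
have bG : bdd Gx by exists M => x; exact: G_le.
have bDG : bdd (fun x => s * D * Gx x).
 by apply: bddM => //; exact: bdd_cst.
have hc : 0 <= h + cmax by pos.
have bv : bdd (fun x => s * vmart (step st x) - vcomp (step st x)).
 exists (M ^+ N + M ^+ N * (delta * (N%:R * (h + cmax) + (h + cmax)) + K * cmax * N%:R)) => x.
 have wf' := mwf_step x al wf.
 have [S0' Sh' jN' _ [Sm' _]] := wf'.
 have m0 : 0 <= mclock (step st x) by rewrite /mclock addr_ge0 // mulr_ge0.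
 have m1 : mclock (step st x) <= N%:R * (h + cmax) + (h + cmax).
  by rewrite /mclock lerD // ler_wpM2r // ler_nat.
 have Kc : 0 <= K * cmax by pos.
 apply: (le_trans (ler_normB _ _)); apply: lerD.
  by rewrite normrM s1 mul1r vmart_le.
 rewrite /vcomp ger0_norm; last by pos.
 by rewrite ler_wpM2l // lerD // ler_wpM2l // ler_nat.
pose B0 := - (M ^+ N * (delta * (mclock st + c) + K * cmax * (sj st)%:R)).
have bDGB : bdd (fun x => s * D * Gx x + B0).
 by apply: bddD => //; exact: bdd_cst.
apply: (@le_trans _ _ (av p (sx st) (fun x => s * D * Gx x + B0))).
 by apply: av_le => // x _; exact: vmart_step_target.
rewrite avD //; last exact: bdd_cst.
rewrite avZ // av_cst // /B0.
have GS := G_step rg j1 (mwf_rho wf) (lg (sx st) - sy st).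
have -> : av p (sx st) Gx = av p (sx st) (fun y : nat =>
  G (sj st) (h - sS st - c) (lg (sx st) - sy st + (ln y%:R - ln (sx st)%:R))).
 by apply: eq_av => x _; rewrite /Gx (lg_jump x (sx st)).
set A := av _ _ _ in GS *; set g := G (sj st) (h - sS st) _ in GS *.
rewrite -/c in GS.
have -> : vmart st = D * g by rewrite /vmart j1.
have key : s * D * (A - g) <= M ^+ N * (delta * c).
 apply: (le_trans (ler_norm _)); rewrite normrM normrM s1 mul1r.
 by apply: ler_pM.
rewrite /vcomp; move: key; rewrite !mulrDr !mulrN !mulrA => key; lra.
Qed.

Lemma vmart_EN k : `|EN k (fun s => vmart (run s)) [:: n] - \prod_(0 <= i < N) G i h 0|
 <= M ^+ N * (delta * (N%:R * (h + cmax)) + K * cmax * N%:R).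
Proof.
have MN0 : 0 <= M ^+ N by pos.
have Kc : 0 <= K * cmax by pos.
set E := M ^+ N * _.
have wfr s : mwf (run s) by exact: mwf_run.
have bvm : bdd (fun s => vmart (run s)) by exists (M ^+ N) => s; exact: vmart_le.
have vc s : 0 <= vcomp (run s) <= E.
 have [_ _ jN _ _] := wfr s.
 have m0 : 0 <= mclock (run s) by exact: mclock_ge0.
 have m1 : mclock (run s) <= N%:R * (h + cmax) by exact: mclock_le.
 rewrite /vcomp; apply/andP; split.
  by pos; apply: addr_ge0; apply: mulr_ge0.
 by rewrite ler_wpM2l // lerD // ler_wpM2l // ler_nat.
have bvc : bdd (fun s => vcomp (run s)).
 by exists E => s; have /andP[? ?] := vc s; rewrite ger0_norm.
have init : vmart (mstart R n n) = \prod_(0 <= i < N) G i h 0.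
 rewrite /vmart /= N_gt0 /done_prod /fut_prod /= big_geq // mul1r subr0 subrr.
 by rewrite [RHS]big_ltn // mulrC.
have init' : vcomp (mstart R n n) = 0.
 by rewrite /vcomp /mclock /= mul0r addr0 !mulr0 addr0 mulr0.
have main (s : R) : `|s| = 1 ->
  s * EN k (fun s => vmart (run s)) [:: n] - E <= s * \prod_(0 <= i < N) G i h 0.
 move=> s1; have bs : bdd (fun t => s * vmart (run t)).
  by apply: bddM => //; exact: bdd_cst.
 have := @machine_supermartingale k (fun st => s * vmart st - vcomp st) N_gt0 (bddB bs bvc)
  (fun st al wf => vmart_step s1 al wf).
 rewrite init init' subr0 ENB // ENZ //; apply: le_trans; rewrite lerD2l lerN2.
 rewrite -(EN_cst p_sum1 k E [:: n]); apply: EN_le => //; first exact: bdd_cst.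
 by move=> t; have /andP[] := vc t.
have h1 := main 1 (normr1 _); have h2 := main (-1) (etrans (normrN1 _) erefl).
by rewrite ler_norml; apply/andP; split; lra.
Qed.

Definition succ (st : mstate) : bool := sj st == N.
Definition trig_done st : R := \prod_(0 <= i < N) G i 0 (nth 0 (sd st) i).

Lemma bdd_bool T (P : T -> bool) : bdd (fun x => (P x)%:R : R).
Proof. by exists 1 => x; case: (P x); rewrite ?normr1 ?normr0. Qed.

Lemma trig_done_le st : `|trig_done st| <= M ^+ N.
Proof.
rewrite /trig_done -[X in M ^+ X]subn0; apply: normr_prod_le => // i /andP[_ iN].
exact: G_le.
Qed.

Lemma fdd_bound k : `|EN k (fun s => (succ (run s))%:R * trig_done (run s)) [:: n]
  - \prod_(0 <= i < N) G i h 0|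
 <= M ^+ N * (delta * (N%:R * (h + cmax)) + K * cmax * N%:R)
   + M ^+ N * EN k (fun s => (~~ succ (run s))%:R) [:: n].
Proof.
have wfr s : mwf (run s) by exact: mwf_run.
have bvm : bdd (fun s => vmart (run s)) by exists (M ^+ N) => s; exact: vmart_le.
have bf : bdd (fun s => (~~ succ (run s))%:R : R) by exact: bdd_bool.
have bfM : bdd (fun s => M ^+ N * (~~ succ (run s))%:R).
 by apply: bddM => //; exact: bdd_cst.
have bt : bdd (fun s => (succ (run s))%:R * trig_done (run s)).
 apply: bddM; first exact: bdd_bool.
 by exists (M ^+ N) => s; exact: trig_done_le.
have H s : `|(succ (run s))%:R * trig_done (run s) - vmart (run s)| <= M ^+ N * (~~ succ (run s))%:R.
 rewrite /succ; case: eqP => E /=; rewrite ?mul1r ?mul0r ?mulr0 ?mulr1.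
  by rewrite /vmart E ltnn /done_prod E subrr normr0.
 by rewrite sub0r normrN vmart_le.
have VE := vmart_EN k.
have D1 : EN k (fun s => (succ (run s))%:R * trig_done (run s)) [:: n] - EN k (fun s => vmart (run s)) [:: n]
  <= M ^+ N * EN k (fun s => (~~ succ (run s))%:R) [:: n].
 rewrite -ENZ // -ENB //; apply: EN_le => //; first exact: bddB.
 by move=> s; apply: le_trans (H s); exact: ler_norm.
have D2 : - (M ^+ N * EN k (fun s => (~~ succ (run s))%:R) [:: n]) <=
  EN k (fun s => (succ (run s))%:R * trig_done (run s)) [:: n] - EN k (fun s => vmart (run s)) [:: n].
 rewrite -ENZ // -ENB // -ENN //; apply: EN_le => //; [exact: bddN|exact: bddB|].
 by move=> s; have := H s; rewrite ler_norml => /andP[].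
move: VE; rewrite !ler_norml => /andP[V1 V2]; apply/andP; split; lra.
Qed.

End Martingale.

End Machine.

(** * One step against the convolution semigroup *)

Section TrigStep.
Variable R : realType.

(** Compares the real parts of $e^{i\alpha}(1+X+iY)$ and $e^{i\alpha}e^{c(A+iB)}$ when $X+iY$ is
    close to $c(A+iB)$; here $c=1/a_x$ and $A+iB=\Phi(t)$ in the application. The error is
    [2 * e * c] plus a term of order [c ^+ 2]. *)
Lemma trig_step_error (A B c e X Y : R) : 0 < c <= 1 ->
 `|X - c * A| <= e * c -> `|Y - c * B| <= e * c -> forall al : R,
 `|(cos al * (1 + X) - sin al * Y) - expR (c * A) * cos (al + c * B)| <=
 (2 * e + c * (A ^+ 2 * expR `|A| + expR `|A| * B ^+ 2 + `|B| ^+ 3 + `|B| * `|A| * expR `|A|)) * c.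
Proof.
move=> /andP[c0 c1] hX hY al.
have cA : expR `|c * A| <= expR `|A|.
 by rewrite ler_expR normrM (gtr0_norm c0) ler_piMl.
have e0 : expR (c * A) <= expR `|A| by apply: le_trans cA; rewrite ler_expR ler_norm.
have hE : `|1 + c * A - expR (c * A)| <= c * (A ^+ 2 * expR `|A|) * c.
 have -> : 1 + c * A - expR (c * A) = - (expR (c * A) - 1 - c * A) by ring.
 rewrite normrN; apply: (le_trans (expR_taylor2 _)).
 rewrite normrM exprMn (gtr0_norm c0) real_normK ?num_real //.
 rewrite [leRHS](_ : _ = c ^+ 2 * A ^+ 2 * expR `|A|); last by ring.
 apply: ler_wpM2l; first by pos; exact: sqr_ge0.
 by rewrite ler_expR ler_piMl.
have hC : `|expR (c * A) * (1 - cos (c * B))| <= c * (expR `|A| * B ^+ 2) * c.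
 have /andP[q0 q1] := one_sub_cos_le (c * B).
 rewrite ger0_norm; last by pos.
 rewrite [leRHS](_ : _ = expR `|A| * (c * B) ^+ 2); last by ring.
 by apply: ler_pM => //; rewrite ?expR_ge0 //; have := sqr_ge0 (c * B); lra.
have hS : `|c * B - sin (c * B)| <= c * (`|B| ^+ 3) * c.
 rewrite distrC; apply: (le_trans (sin_taylor _)).
 rewrite normrM (gtr0_norm c0) exprMn [leRHS](_ : _ = c ^+ 2 * `|B| ^+ 3); last by ring.
 by rewrite ler_wpM2r ?exprn_ge0 // ler_wiXn2l // ltW.
have hR : `|sin (c * B) * (1 - expR (c * A))| <= c * (`|B| * `|A| * expR `|A|) * c.
 rewrite normrM [leRHS](_ : _ = (c * `|B|) * ((c * `|A|) * expR `|A|)); last by ring.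
 apply: ler_pM => //.
  by apply: (le_trans (normr_sin_le _)); rewrite normrM (gtr0_norm c0).
 rewrite distrC; apply: (le_trans (expR_lip _)); rewrite [X in X * _]normrM (gtr0_norm c0).
 by rewrite ler_wpM2l // mulr_ge0 // ltW.
have ca := cos_max al; have sa := sin_max al.
rewrite cosD (_ : _ - _ = cos al * ((X - c * A) + (1 + c * A - expR (c * A)) +
  expR (c * A) * (1 - cos (c * B))) + (- sin al) * ((Y - c * B) + (c * B - sin (c * B)) +
  sin (c * B) * (1 - expR (c * A)))); last by ring.
apply: (le_trans (ler_normD _ _)); rewrite !normrM normrN.
have k1 : `|(X - c * A) + (1 + c * A - expR (c * A)) + expR (c * A) * (1 - cos (c * B))| <=
  e * c + c * (A ^+ 2 * expR `|A|) * c + c * (expR `|A| * B ^+ 2) * c.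
 by apply: (le_trans (ler_normD _ _)); apply: lerD => //;
  apply: (le_trans (ler_normD _ _)); apply: lerD.
have k2 : `|(Y - c * B) + (c * B - sin (c * B)) + sin (c * B) * (1 - expR (c * A))| <=
  e * c + c * (`|B| ^+ 3) * c + c * (`|B| * `|A| * expR `|A|) * c.
 by apply: (le_trans (ler_normD _ _)); apply: lerD => //;
  apply: (le_trans (ler_normD _ _)); apply: lerD.
have k3 := ler_piMl (normr_ge0 (X - c * A + (1 + c * A - expR (c * A)) + expR (c * A) * (1 - cos (c * B)))) ca.
have k4 := ler_piMl (normr_ge0 (Y - c * B + (c * B - sin (c * B)) + sin (c * B) * (1 - expR (c * A)))) sa.
apply: (le_trans (lerD (le_trans k3 k1) (le_trans k4 k2))).
by rewrite le_eqVlt; apply/orP; left; apply/eqP; ring.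
Qed.

End TrigStep.

(** * Comparison of two machines *)

Section Compare.
Variable R : realType.
Variables (a : nat -> R) (n : nat) (h : R) (N : nat).

Definition good (lo hi : R) (st : mstate R) : bool :=
 (sj st == N) && in_range n lo hi (sx st).

Definition same_core (st st' : mstate R) :=
 [/\ sx st' = sx st, sj st' = sj st, sS st' = sS st, sy st' = sy st & sd st' = sd st].

(** Two positions in the window of half-width [B] differ by at most [2 * B <= eps'], so as long as
    the first machine is live the second never leaves phase 0. On good runs both have the same cells
    and increments, which makes the limit law of the increments independent of [eps] and of the
    window. *)
Lemma run_compare (eps B eps' B' : R) s : B <= B' -> 2 * B <= eps' ->
 let st := run a n h N eps (- B) B s in let st' := run a n h N eps' (- B') B' s in
 (alive n N (- B) B st -> [/\ same_core st st', sph st' = 0%N & - B <= sy st <= B]) /\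
 (good (- B) B st -> same_core st st' /\ good (- B') B' st').
Proof.
move=> BB' Be.
have rgi x : in_range n (- B) B x -> in_range n (- B') B' x.
 by move=> /and3P[x0 x1 x2]; apply/and3P; split=> //;
  [apply: le_trans x1; rewrite lerN2|apply: le_trans BB'].
have ini x : let st := mstart R n x in
 (alive n N (- B) B st -> [/\ same_core st st, sph st = 0%N & - B <= sy st <= B]) /\
 (good (- B) B st -> same_core st st /\ good (- B') B' st).
 split=> /=; first by move=> /and3P[_ _ /and3P[_ -> ->]].
 by move=> /andP[g1 g2]; split=> //; rewrite /good g1 rgi.
elim: s => [|x [|y s] IH]; [exact: ini|exact: ini|].
move: IH; rewrite !(run_cons _ _ _ _ _ _ _ x (s := y :: s)) //.
set st := run _ _ _ _ _ _ _ (y :: s); set st' := run _ _ _ _ _ _ _ (y :: s).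
move=> /= [IHa IHg]; rewrite /upd.
case: (boolP (alive n N (- B) B st)) => al; last first.
 split; first by move=> al'; rewrite al' in al.
 move=> g; have [c g'] := IHg g.
 by rewrite {1 2}/alive; have /andP[/eqP -> _] := g'; rewrite ltnn.
have [[cx cj cS cy cd] ph /andP[y1 y2]] := IHa al.
have /and3P[j1 ph1 rg] := al.
have al' : alive n N (- B') B' st'.
 by rewrite /alive cj j1 ph cx rgi.
have clo z : in_range n (- B) B z -> `|lg R n z - sy st| <= eps'.
 move=> /and3P[_ z1 z2]; apply: le_trans Be; rewrite ler_norml; apply/andP; split; lra.
have jN : (sj st == N) = false by apply/negbTE; rewrite neq_ltn j1.
rewrite al'.
rewrite /step cx cS ph; case: (leP h (sS st + (a (sx st))^-1)) => hS /=.
 case: ifP => c1 /=; first by rewrite /alive /good /= jN andbF.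
 split=> [/and3P[_ _ /= rx]|/andP[/= g1 g2]].
  by rewrite cj cd cy; split => //; have /and3P[_ -> ->] := rx.
 by rewrite cj cd cy; split => //; rewrite /good /= g1 rgi.
suff H st2 : [/\ sx st2 = x, sj st2 = sj st, sS st2 = sS st + (a (sx st))^-1, sy st2 = sy st & sd st2 = sd st] ->
 (alive n N (- B) B st2 -> [/\ same_core st2 (if `|lg R n x - sy st'| <= eps'
   then MState x (sj st') (sS st + (a (sx st))^-1) (sy st') 0 (sr st') (sd st')
   else MState x (sj st') (sS st + (a (sx st))^-1) (sy st') 1 (lg R n x) (sd st')),
   sph (if `|lg R n x - sy st'| <= eps'
   then MState x (sj st') (sS st + (a (sx st))^-1) (sy st') 0 (sr st') (sd st')
   else MState x (sj st') (sS st + (a (sx st))^-1) (sy st') 1 (lg R n x) (sd st')) = 0%N & - B <= sy st2 <= B]) /\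
 (good (- B) B st2 -> same_core st2 (if `|lg R n x - sy st'| <= eps'
   then MState x (sj st') (sS st + (a (sx st))^-1) (sy st') 0 (sr st') (sd st')
   else MState x (sj st') (sS st + (a (sx st))^-1) (sy st') 1 (lg R n x) (sd st')) /\
  good (- B') B' (if `|lg R n x - sy st'| <= eps'
   then MState x (sj st') (sS st + (a (sx st))^-1) (sy st') 0 (sr st') (sd st')
   else MState x (sj st') (sS st + (a (sx st))^-1) (sy st') 1 (lg R n x) (sd st'))).
 by case: (sph st == 0%N) => /=;
  [case: (`|lg R n x - sy st| <= eps)|case: (`|lg R n x - sr st| <= eps)]; apply: H.
move=> [e1 e2 e3 e4 e5]; split; last by rewrite /good e2 jN.
move=> /and3P[_ _]; rewrite e1 => rx; rewrite cy clo // e4 y1 y2; split => //.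
by split; rewrite /= ?e1 ?e2 ?e3 ?e4 ?e5.
Qed.

End Compare.

Section TrigComb.
Variables (R : realType) (Pi : {measure set R -> \bar R}) (b sigma2 : R).
(* A triple [(c, t, w)] stands for the function [c * cos (t * d + w)] and [trigv r] for the
  action on it of the convolution semigroup of the Levy process at time [r]. *)
Local Notation trig := (seq (R * R * R)).
Definition trig1 (r : R) (q : R * R * R) (d : R) : R :=
 q.1.1 * (expR (r * RePhi sigma2 Pi q.1.2) *
  cos (q.1.2 * d + q.2 + r * ImPhi b Pi q.1.2)).
Definition trigv (l : trig) (r d : R) : R := \sum_(q <- l) trig1 r q d.

Definition trig_prod (N : nat) (ls : nat -> trig) (v : seq R) : R :=
 \prod_(0 <= i < N) trigv (ls i) 0 (nth 0 v i).

Definition trig_comb (N : nat) (cs : seq (R * (nat -> trig))) (v : seq R) : R :=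
 \sum_(c <- cs) c.1 * trig_prod N c.2 v.

End TrigComb.

(** * Bernstein polynomials *)

Section Bernstein.
Variable R : realType.

Definition bern (m r : nat) (u : R) : R := (u ^+ r * (1 - u) ^+ (m - r)) *+ 'C(m, r).

Lemma bern_ge0 m r u : 0 <= u <= 1 -> 0 <= bern m r u.
Proof. by move=> /andP[u0 u1]; rewrite mulrn_wge0 // mulr_ge0 // exprn_ge0 // subr_ge0. Qed.

Lemma bern_sum m u : \sum_(r < m.+1) bern m r u = 1.
Proof.
have := exprDn (1 - u) u m; rewrite subrK expr1n => ->.
by apply: eq_bigr => r _; rewrite /bern mulrC.
Qed.

(** Pascal's rule, or conditioning a binomial variable on one of its [m.+1] trials. The moments
    below follow from it by induction. *)
Lemma bernS m u (f : nat -> R) : \sum_(r < m.+2) bern m.+1 r u * f r =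
 (1 - u) * (\sum_(r < m.+1) bern m r u * f r) + u * (\sum_(r < m.+1) bern m r u * f r.+1).
Proof.
have bS r : bern m.+1 r.+1 u = (1 - u) * bern m r.+1 u + u * bern m r u.
 rewrite /bern binS mulrnDr subSS; congr (_ + _); last by rewrite mulrnAr exprS mulrA.
 rewrite mulrnAr; have [rm|mr] := ltnP r m; last by rewrite bin_small ?mulr0n.
 by rewrite mulrCA -exprS subnSK.
rewrite big_ord_recl /=; under eq_bigr => i _ do rewrite bS mulrDl -!mulrA.
rewrite big_split /= -!mulr_sumr addrA; congr (_ + _).
rewrite big_ord_recr /= [X in _ + (1 - u) * (_ + X)](_ : _ = 0); last first.
 by rewrite /bern bin_small // mulr0n mul0r.
rewrite addr0 [in RHS]big_ord_recl mulrDr; congr (_ + _).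
by rewrite /bern !bin0 !subn0 exprS !expr0 !mul1r mulr1n mulrA.
Qed.

Lemma bern_mean m u : \sum_(r < m.+1) bern m r u * r%:R = m%:R * u.
Proof.
elim: m => [|m IH]; first by rewrite big_ord1 mulr0 mul0r.
rewrite (bernS m u (fun r => r%:R)) IH.
under [X in _ + u * X]eq_bigr => r _ do rewrite -natr1 mulrDr mulr1.
by rewrite big_split /= IH bern_sum -natr1; ring.
Qed.

Lemma bern_second m u : \sum_(r < m.+1) bern m r u * r%:R ^+ 2 =
 m%:R * u * (1 - u) + (m%:R * u) ^+ 2.
Proof.
elim: m => [|m IH]; first by rewrite big_ord1 !mul0r expr0n mulr0 addr0.
rewrite (bernS m u (fun r => r%:R ^+ 2)) IH.
under [X in _ + u * X]eq_bigr => r _.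
 rewrite -natr1 (_ : _ * _ = bern m r u * r%:R ^+ 2 + 2 * (bern m r u * r%:R) + bern m r u);
  last by ring.
 over.
rewrite !big_split /= -mulr_sumr IH bern_mean bern_sum -natr1; ring.
Qed.

Lemma bern_var m u : (0 < m)%N -> 0 <= u <= 1 ->
 \sum_(r < m.+1) bern m r u * (r%:R / m%:R - u) ^+ 2 <= m%:R^-1.
Proof.
move=> m0 /andP[u0 u1]; have m0' : m%:R != 0 :> R by rewrite pnatr_eq0 -lt0n.
have -> : \sum_(r < m.+1) bern m r u * (r%:R / m%:R - u) ^+ 2 =
  m%:R ^- 2 * (\sum_(r < m.+1) bern m r u * r%:R ^+ 2) +
  (- 2 * u / m%:R) * (\sum_(r < m.+1) bern m r u * r%:R) + u ^+ 2 * \sum_(r < m.+1) bern m r u.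
 rewrite !mulr_sumr -!big_split; apply: eq_bigr => r _ /=.
 by field.
rewrite bern_second bern_mean bern_sum [leLHS](_ : _ = u * (1 - u) / m%:R); last by field.
rewrite ler_piMl ?invr_ge0 //; apply: mulr_ile1 => //; rewrite ?subr_ge0 //.
by rewrite lerBlDr lerDl.
Qed.

End Bernstein.

(** * Approximation by products of trigonometric sums *)

Section TrigApprox.
Variables (R : realType) (Pi : {measure set R -> \bar R}) (b sigma2 : R).
Local Notation trigv := (trigv Pi b sigma2).
Local Notation trig_comb := (trig_comb Pi b sigma2).

Lemma trigv0 l d : trigv l 0 d = \sum_(q <- l) q.1.1 * cos (q.1.2 * d + q.2).
Proof. by apply: eq_bigr => q _; rewrite /trig1 !mul0r expR0 mul1r addr0. Qed.

Definition istrig (f : R -> R) := exists l, forall d, f d = trigv l 0 d.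

Lemma istrig_cst c : istrig (fun=> c).
Proof. by exists [:: (c, 0, 0)] => d; rewrite trigv0 big_seq1 /= mul0r addr0 cos0 mulr1. Qed.

Lemma istrigD f g : istrig f -> istrig g -> istrig (fun d => f d + g d).
Proof.
by move=> [l fl] [l' gl]; exists (l ++ l') => d; rewrite fl gl !trigv0 big_cat.
Qed.

Lemma istrig_cosM c t w g : istrig g -> istrig (fun d => c * cos (t * d + w) * g d).
Proof.
move=> [l gl]; exists ([seq (c * q.1.1 / 2, t + q.1.2, w + q.2) | q <- l] ++
 [seq (c * q.1.1 / 2, t - q.1.2, w - q.2) | q <- l]) => d.
rewrite gl !trigv0 big_cat !big_map /= -big_split mulr_sumr /=; apply: eq_bigr => q _.
have -> : (t + q.1.2) * d + (w + q.2) = (t * d + w) + (q.1.2 * d + q.2) by ring.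
have -> : (t - q.1.2) * d + (w - q.2) = (t * d + w) - (q.1.2 * d + q.2) by ring.
by move: (t * d + w) (q.1.2 * d + q.2) => x y; rewrite (cosD x y) (cosB x y); field.
Qed.

Lemma istrigM f g : istrig f -> istrig g -> istrig (fun d => f d * g d).
Proof.
move=> [l]; elim: l f => [|q l IH] f fl ig.
 have -> : (fun d => f d * g d) = fun=> 0; last exact: istrig_cst.
 by apply/funext => d; rewrite fl trigv0 big_nil mul0r.
have -> : (fun d => f d * g d) = fun d => q.1.1 * cos (q.1.2 * d + q.2) * g d + trigv l 0 d * g d.
 by apply/funext => d; rewrite fl !trigv0 big_cons mulrDl.
by apply: istrigD; [exact: istrig_cosM|exact: IH].
Qed.

Lemma istrigX f k : istrig f -> istrig (fun d => f d ^+ k).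
Proof.
move=> fi; elim: k => [|k IH]; first exact: (istrig_cst 1).
rewrite (_ : (fun d => _) = fun d => f d * f d ^+ k); last by apply/funext => d; rewrite exprS.
exact: istrigM.
Qed.

(** A trigonometric map of the line into [[0, 1]] that is injective on [[- B, B]]. Bernstein
    polynomials in this variable are again trigonometric sums, and they are bounded on the whole
    line. *)
Definition usin (B d : R) : R := (1 + sin (d / B)) / 2.

Lemma istrig_bern B m r : istrig (fun d => bern m r (usin B d)).
Proof.
have iu : istrig (usin B).
 exists [:: (2^-1, 0, 0); (2^-1, B^-1, - (pi / 2))] => d.
 rewrite trigv0 big_cons big_seq1 /= mul0r addr0 cos0 cosB cos_pihalf sin_pihalf mulr0 add0r mulr1.
 by rewrite /usin (mulrC d); field.
have iv : istrig (fun d => 1 - usin B d).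
 have -> : (fun d => 1 - usin B d) = fun d => 1 + (-1) * usin B d.
  by apply/funext => d; ring.
 by apply: istrigD; [exact: istrig_cst|apply: istrigM => //; exact: istrig_cst].
have -> : (fun d => bern m r (usin B d)) =
  fun d => 'C(m, r)%:R * (usin B d ^+ r * (1 - usin B d) ^+ (m - r)).
 by apply/funext => d; rewrite /bern mulr_natl.
apply: istrigM; first exact: istrig_cst.
by apply: istrigM; exact: istrigX.
Qed.

Lemma usin01 B d : 0 <= usin B d <= 1.
Proof.
have := sin_max (d / B); rewrite /usin ler_norml => /andP[s1 s2]; apply/andP; split; lra.
Qed.

Lemma sin_expand (x y : R) : `|x| <= 1 -> `|y| <= 1 -> cos 1 * `|x - y| <= `|sin x - sin y|.
Proof.
wlog xy : x y / y <= x => [H|].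
 move=> x1 y1; case: (leP y x) => [/H|/ltW /H]; first exact.
 by move=> Hyx; rewrite (distrC x) (distrC (sin x)); exact: Hyx.
rewrite !ler_norml => /andP[x1 x2] /andP[y1 y2].
have [c] : exists2 c, c \in `[y, x] & sin x - sin y = cos c * (x - y).
 apply: (@MVT_segment R sin cos y x xy).
 by apply: continuous_subspaceT => z; exact: continuous_sin.
rewrite in_itv /= => /andP[c1 c2] ->; rewrite normrM ler_wpM2r //.
have := cos1_gt0 R => c0; apply: le_trans (ler_norm _).
have p1 : 1 <= pi :> R by rewrite (le_trans _ (pi_ge2 R)) // ler1n.
have mono (u : R) : 0 <= u <= 1 -> cos 1 <= cos u.
 by move=> /andP[u0 u1]; rewrite leNgt ltr_cos -?leNgt // in_itv /=; apply/andP; split; lra.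
have [c_ge0|c_lt0] := leP 0 c; first by apply: mono; apply/andP; split; lra.
by rewrite -[cos c]cosN; apply: mono; apply/andP; split; lra.
Qed.

(** The node of the level [v] is its preimage under [usin] after clamping to the range of [usin] on
    [[- B, B]]. Clamping only brings [v] closer to every attained value, and the inverse of sine is
    Lipschitz on the clamped range. *)
Lemma node (B : R) : 0 < B -> exists2 k, 0 < k & forall v : R, exists y, `|y| <= B /\
 forall d, `|d| <= B -> `|y - d| <= k * `|v - usin B d|.
Proof.
move=> B0; have c0 := cos1_gt0 R; have s0 : 0 <= sin 1 :> R.
 by apply: sin_ge0_pi; rewrite ler01 /= (le_trans _ (pi_ge2 R)) // ler1n.
exists (2 * B / cos 1); first by pos.
move=> v; pose z := Num.max (- sin 1) (Num.min (sin 1) (2 * v - 1)).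
have [y] : exists2 y : R, y \in `[(-1 : R), 1] & sin y = z.
 apply: IVT; first by lra.
  by apply: continuous_subspaceT => w; exact: continuous_sin.
 rewrite sinN (min_idPl _) ?(max_idPr _); try lra.
 by rewrite /z le_max lexx /= ge_max; apply/andP; split; [lra|rewrite ge_min lexx].
rewrite in_itv /= => /andP[y1 y2] sy; have ny : `|y| <= 1 by rewrite ler_norml y1 y2.
exists (B * y); split; first by rewrite normrM gtr0_norm // ler_piMr // ltW.
move=> d dB; have nd : `|d / B| <= 1.
 by rewrite normrM normfV (gtr0_norm B0) ler_pdivrMr // mul1r.
have -> : B * y - d = B * (y - d / B) by field; rewrite gt_eqF.
rewrite normrM (gtr0_norm B0) -!mulrA (mulrC 2) -mulrA ler_wpM2l ?(ltW B0) //.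
rewrite -mulrA ler_pdivlMl //; apply: (le_trans (sin_expand ny nd)).
have sd : `|sin (d / B)| <= sin 1.
 have mono u w : -1 <= u -> u <= w -> w <= 1 -> sin u <= sin w :> R.
  move=> u1 uw w1; have := pi_ge2 R => p2.
  by rewrite leNgt ltr_sin -?leNgt // in_itv /=; apply/andP; split; lra.
 move: nd; rewrite !ler_norml => /andP[n1 n2]; rewrite -sinN.
 by apply/andP; split; apply: mono; lra.
have -> : `|v - usin B d| * 2 = `|(2 * v - 1) - sin (d / B)|.
 by rewrite -[X in _ * X]ger0_norm // -normrM /usin; congr (`|_|); field.
rewrite sy /z; move: sd; rewrite ler_norml => /andP[q1 q2]; move: s0 q1 q2.
move: (sin 1) (sin (d / B)) (2 * v - 1) => S D V S0 q1 q2.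
rewrite /Num.max /Num.min; case: (ltP S V) => h1; case: ltP => h2; rewrite ler_norml;
 apply/andP; split; move: (ler_norm (V - D)) (ler_norm (- (V - D))); rewrite normrN; lra.
Qed.

Definition unif_box (g : seq R -> R) (N : nat) := forall B e : R, 0 < B -> 0 < e ->
 exists2 dl, 0 < dl & forall s t, size s = N -> size t = N ->
  (forall i, (i < N)%N -> `|nth 0 s i| <= B) -> (forall i, (i < N)%N -> `|nth 0 t i| <= B) ->
  (forall i, (i < N)%N -> `|nth 0 s i - nth 0 t i| <= dl) -> `|g s - g t| <= e.

(** Tensor-product Bernstein approximation in the variables [usin]. The weights [W v r] are
    nonnegative with sum 1 for every [v], so the bound [C] holds everywhere and not only on the box.
    On the box either all coordinates of the nodes are within [dl] of [v], or the difference, at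
    most [2 * C], is paid for by Chebyshev's inequality. *)
Lemma trig_approx N (g : seq R -> R) (C B e : R) : (forall s, `|g s| <= C) ->
 unif_box g N.+1 -> 0 < B -> 0 < e ->
 exists cs, (forall v, `|trig_comb N.+1 cs v| <= C) /\
  (forall v, size v = N.+1 -> (forall i, (i < N.+1)%N -> `|nth 0 v i| <= B) ->
   `|trig_comb N.+1 cs v - g v| <= e).
Proof.
move=> gC ug B0 e0; have C0 : 0 <= C by apply: le_trans (gC [::]).
have [k k0 H] := node B0.
have [nd ndP] := choice H.
have ndB v : `|nd v| <= B by have [] := ndP v.
have ndk v : forall d, `|d| <= B -> `|nd v - d| <= k * `|v - usin B d| by have [] := ndP v.
have e2 : 0 < e / 2 by pos.
have [dl dl0 gdl] := ug B _ B0 e2.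
have co0 : 0 <= 2 * C * k ^+ 2 / dl ^+ 2.
 exact: divr_ge0 (mulr_ge0 (mulr_ge0 (ler0n R 2) C0) (sqr_ge0 k)) (sqr_ge0 dl).
pose A := 2 * C * k ^+ 2 / dl ^+ 2 * N.+1%:R.
have [m [m0 mA]] : exists m : nat, (0 < m)%N /\ A * m%:R^-1 <= e / 2.
 have [m0 _ Hm] := near_natge (A / (e / 2)); exists m0.+1; split => //.
 by rewrite ler_pdivrMr ?ltr0n // mulrC -ler_pdivrMr //; exact: (Hm m0.+1 (leqnSn _)).
have [L HL] := choice (fun r : 'I_m.+1 => istrig_bern B m r).
pose I := {ffun 'I_N.+1 -> 'I_m.+1}.
pose nodes (r : I) : seq R := [seq nd ((r i)%:R / m%:R) | i <- enum 'I_N.+1].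
pose W (v : seq R) (r : I) : R := \prod_(i < N.+1) bern m (r i) (usin B (nth 0 v i)).
exists [seq (g (nodes r), fun i : nat => L (r (inord i))) | r <- enum I].
have combE v : trig_comb N.+1 [seq (g (nodes r), fun i : nat => L (r (inord i))) | r <- enum I] v =
  \sum_(r : I) g (nodes r) * W v r.
 rewrite /Submission.trig_comb big_map big_enum /=; apply: eq_bigr => r _; congr (_ * _).
 rewrite /trig_prod big_mkord; apply: eq_bigr => i _.
 by rewrite -HL inord_val.
have W0 v r : 0 <= W v r by apply: prodr_ge0 => i _; exact/bern_ge0/usin01.
have W1 v : \sum_(r : I) W v r = 1.
 rewrite /W -(bigA_distr_bigA (fun (i : 'I_N.+1) (r : 'I_m.+1) => bern m r (usin B (nth 0 v i)))).
 by apply: big1 => i _; exact: bern_sum.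
split=> [v|v sv vB]; rewrite combE.
 apply: (le_trans (ler_norm_sum _ _ _)); apply: (@le_trans _ _ (\sum_(r : I) C * W v r)).
  by apply: ler_sum => r _; rewrite normrM (ger0_norm (W0 v r)) ler_wpM2r.
 by rewrite -mulr_sumr W1 mulr1.
have -> : \sum_(r : I) g (nodes r) * W v r - g v = \sum_(r : I) (g (nodes r) - g v) * W v r.
 rewrite -[X in _ - X]mulr1 -(W1 v) mulr_sumr -sumrB.
 by apply: eq_bigr => r _; rewrite mulrBl.
apply: (le_trans (ler_norm_sum _ _ _)).
pose ph (r : I) (i : 'I_N.+1) : R := ((r i)%:R / m%:R - usin B (nth 0 v i)) ^+ 2.
have szn r : size (nodes r) = N.+1 by rewrite size_map -cardE card_ord.
have nthn r (i : 'I_N.+1) : nth 0 (nodes r) i = nd ((r i)%:R / m%:R).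
 by rewrite (nth_map i) ?nth_ord_enum // size_enum_ord.
have key r : `|g (nodes r) - g v| <= e / 2 + 2 * C * k ^+ 2 / dl ^+ 2 * \sum_(i < N.+1) ph r i.
 have S0 : 0 <= \sum_(i < N.+1) ph r i by apply: sumr_ge0 => i _; exact: sqr_ge0.
 have [Hi|/existsNP[i0 Hi]] := pselect (forall i : 'I_N.+1, `|nd ((r i)%:R / m%:R) - nth 0 v i| <= dl).
  apply: (@le_trans _ _ (e / 2)); last by rewrite lerDl; exact: mulr_ge0.
  apply: (gdl (nodes r) v (szn r) sv _ vB _).
   by move=> i iN; rewrite (nthn r (Ordinal iN)) ndB.
  by move=> i iN; rewrite (nthn r (Ordinal iN)); exact: (Hi (Ordinal iN)).
 have {}Hi : dl < `|nd ((r i0)%:R / m%:R) - nth 0 v i0| by rewrite ltNge; apply/negP.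
 have ph0 : dl ^+ 2 <= k ^+ 2 * ph r i0.
  rewrite /ph -exprMn -(real_normK (num_real (k * _))) lerXn2r ?nnegrE ?(ltW dl0) //.
  rewrite normrM (gtr0_norm k0); apply: (le_trans (ltW Hi)); exact: ndk (vB _ _).
 apply: (@le_trans _ _ (2 * C)).
  by apply: (le_trans (ler_normB _ _)); rewrite mulr_natl mulr2n lerD.
 apply: (@le_trans _ _ (2 * C * k ^+ 2 / dl ^+ 2 * ph r i0)).
  rewrite [leRHS](_ : _ = 2 * C * ((k ^+ 2 * ph r i0) / dl ^+ 2)); last by ring.
  by rewrite ler_peMr ?mulr_ge0 // ler_pdivlMr ?exprn_gt0 // mul1r.
 apply: (@le_trans _ _ (2 * C * k ^+ 2 / dl ^+ 2 * \sum_(i < N.+1) ph r i)).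
  rewrite ler_wpM2l // (bigD1 i0) //= lerDl; apply: sumr_ge0 => i _; exact: sqr_ge0.
 by rewrite lerDr ltW.
apply: (@le_trans _ _ (\sum_(r : I) (e / 2 * W v r +
  2 * C * k ^+ 2 / dl ^+ 2 * \sum_(i < N.+1) (ph r i * W v r)))).
 apply: ler_sum => r _; rewrite normrM (ger0_norm (W0 v r)).
 by apply: (le_trans (ler_wpM2r (W0 v r) (key r))); rewrite mulrDl -mulr_suml mulrA.
rewrite big_split /= -!mulr_sumr W1 mulr1 [leRHS]splitr lerD2l exchange_big /=.
apply: le_trans mA; rewrite /A -[leRHS]mulrA; apply: ler_wpM2l => //.
rewrite mulr_natl -[X in _ *+ X]card_ord -sumr_const; apply: ler_sum => i _.
have -> : \sum_(r : I) ph r i * W v r = \sum_(r : I) \prod_(j < N.+1)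
  (bern m (r j) (usin B (nth 0 v j)) *
   (if j == i then ((r j)%:R / m%:R - usin B (nth 0 v j)) ^+ 2 else 1)).
 apply: eq_bigr => r _; rewrite big_split /= -big_mkcond /= big_pred1_eq mulrC //.
rewrite -(bigA_distr_bigA (fun (j : 'I_N.+1) (r : 'I_m.+1) => bern m r (usin B (nth 0 v j)) *
   (if j == i then (r%:R / m%:R - usin B (nth 0 v j)) ^+ 2 else 1))).
rewrite (bigD1 i) //= eqxx [X in _ * X]big1 ?mulr1.
 by apply: bern_var => //; exact: usin01.
move=> j ji; rewrite (negbTE ji); under eq_bigr do rewrite mulr1; exact: bern_sum.
Qed.

End TrigApprox.

(** * Expectations of bounded functions and products under independence *)

Section BoundedExpectation.
Context {R : realType} {d : measure_display} {T : measurableType d} (Q : probability T R).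
Implicit Types f g : T -> R.
Local Notation Ex f := (Rintegral Q setT f).

Definition bm f := measurable_fun setT f /\ bdd f.

Lemma measurable_pre (V : T -> R) (B : set R) : measurable_fun setT V -> measurable B ->
 measurable (V @^-1` B).
Proof. by move=> mV mB; rewrite -[X in measurable X]setTI; exact: mV. Qed.

Lemma bm_integrable f : bm f -> Q.-integrable setT (EFin \o f).
Proof.
move=> [mf [M fM]]; apply: measurable_bounded_integrable => //.
 by rewrite (le_lt_trans (probability_le1 Q measurableT)) // ltry.
by exists M; split; [exact: num_real|move=> x Mx y _; exact: le_trans (fM y) (ltW Mx)].
Qed.

Lemma bm_cst c : bm (fun=> c).
Proof. by split; [exact: measurable_cst|exact: bdd_cst]. Qed.

Lemma bmD f g : bm f -> bm g -> bm (fun w => f w + g w).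
Proof. by move=> [? ?] [? ?]; split; [exact: measurable_funD|exact: bddD]. Qed.

Lemma bmM f g : bm f -> bm g -> bm (fun w => f w * g w).
Proof. by move=> [? ?] [? ?]; split; [exact: measurable_funM|exact: bddM]. Qed.

Lemma bmZ c f : bm f -> bm (fun w => c * f w).
Proof. by move=> bf; apply: bmM => //; exact: bm_cst. Qed.

Lemma bmB f g : bm f -> bm g -> bm (fun w => f w - g w).
Proof. by move=> [? ?] [? ?]; split; [exact: measurable_funB|exact: bddB]. Qed.

Lemma bm_prod (F : nat -> T -> R) u v : (forall i, (u <= i < v)%N -> bm (F i)) ->
 bm (fun w => \prod_(u <= i < v) F i w).
Proof.
move=> bF; have [uv|/ltnW vu] := leqP u v; last first.
 rewrite (_ : (fun w => _) = fun=> 1); first exact: bm_cst.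
 by apply/funext => w; rewrite big_geq.
move: bF; rewrite -(subnKC uv); elim: (v - u)%N => [|k IH] bF.
 rewrite (_ : (fun w => _) = fun=> 1); first exact: bm_cst.
 by apply/funext => w; rewrite big_geq // addn0.
rewrite (_ : (fun w => _) = fun w => \prod_(u <= i < u + k) F i w * F (u + k)%N w); last first.
 by apply/funext => w; rewrite addnS big_nat_recr //= leq_addr.
apply: bmM; last by apply: bF; rewrite leq_addr addnS ltnS leqnn.
by apply: IH => i /andP[i1 i2]; apply: bF; rewrite i1 addnS ltnS ltnW.
Qed.

Lemma bm_indic (A : set T) : measurable A -> bm (\1_A : T -> R).
Proof.
move=> mA; split; first exact: measurable_indic.
by exists 1 => w; rewrite indicE; case: (_ \in _); rewrite ?normr1 ?normr0.
Qed.

Lemma Ex_cst c : Ex (fun=> c) = c.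
Proof. by rewrite Rintegral_cst //= probability_setT /= mulr1. Qed.

Lemma ExD f g : bm f -> bm g -> Ex (fun w => f w + g w) = Ex f + Ex g.
Proof. by move=> bf bg; rewrite RintegralD //; exact: bm_integrable. Qed.

Lemma ExZ c f : bm f -> Ex (fun w => c * f w) = c * Ex f.
Proof. by move=> bf; rewrite RintegralZl //; exact: bm_integrable. Qed.

Lemma ExB f g : bm f -> bm g -> Ex (fun w => f w - g w) = Ex f - Ex g.
Proof. by move=> bf bg; rewrite RintegralB //; exact: bm_integrable. Qed.

Lemma Ex_le f g : bm f -> bm g -> (forall w, f w <= g w) -> Ex f <= Ex g.
Proof. by move=> bf bg fg; apply: le_Rintegral => //; exact: bm_integrable. Qed.

Lemma Ex_indic (A : set T) : measurable A -> Ex (\1_A : T -> R) = fine (Q A).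
Proof. by move=> mA; rewrite /Rintegral integral_indic // setIT. Qed.

Lemma bm_sum I (r : seq I) (F : I -> T -> R) : (forall i, bm (F i)) ->
 bm (fun w => \sum_(i <- r) F i w).
Proof.
move=> bF; elim: r => [|i r IH].
 by rewrite (_ : (fun w => _) = fun=> 0); [exact: bm_cst|apply/funext => w; rewrite big_nil].
rewrite (_ : (fun w => _) = fun w => F i w + \sum_(i <- r) F i w); first exact: bmD.
by apply/funext => w; rewrite big_cons.
Qed.

Lemma Ex_sum I (r : seq I) (F : I -> T -> R) : (forall i, bm (F i)) ->
 Ex (fun w => \sum_(i <- r) F i w) = \sum_(i <- r) Ex (F i).
Proof.
move=> bF; elim: r => [|i r IH].
 by rewrite big_nil (_ : (fun w => _) = fun=> 0) ?Ex_cst //; apply/funext => w; rewrite big_nil.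
rewrite big_cons -IH -ExD //; last exact: bm_sum.
by congr Rintegral; apply/funext => w; rewrite big_cons.
Qed.

Lemma Ex_disc1 L (k : T -> nat) (c : nat -> R) : (forall w, (k w < L)%N) ->
 (forall q, measurable [set w | k w = q]) ->
 Ex (fun w => c (k w)) = \sum_(q < L) c q * fine (Q [set w | k w = q]).
Proof.
move=> kL mk; rewrite (_ : (fun w => c (k w)) = fun w => \sum_(q < L) c q * \1_[set w | k w = q] w).
 rewrite Ex_sum => [|q]; last by apply: bmZ; exact: bm_indic.
 by apply: eq_bigr => q _; rewrite ExZ ?Ex_indic //; exact: bm_indic.
apply/funext => w; rewrite (bigD1 (Ordinal (kL w))) //= indicE mem_set //= mulr1.
rewrite big1 ?addr0 // => q qk; rewrite indicE memNset ?mulr0 //= => E.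
by move/eqP: qk; apply; apply: val_inj; rewrite /= E.
Qed.

(** With finitely many values the product of the factors is a finite sum of indicators of cylinders,
    one for each pattern [r] of values, and independence applies to each of them. *)
Lemma Ex_disc N L (Y : nat -> T -> R) (Z : T -> R) (k : nat -> R -> nat) (c : nat -> nat -> R) :
 (forall i x, (i < N)%N -> (k i x < L)%N) ->
 (forall i q, measurable (k i @^-1` [set q])) ->
 (forall i, measurable_fun setT (Y i)) -> measurable_fun setT Z ->
 (forall B : nat -> set R, (forall j, measurable (B j)) ->
  Q (\bigcap_(j in [set j | (j < N)%N]) [set w | Y j w \in B j]) =
  (\prod_(j < N) Q [set w | Z w \in B j])%E) ->
 Ex (fun w => \prod_(0 <= i < N) c i (k i (Y i w))) = \prod_(0 <= i < N) Ex (fun w => c i (k i (Z w))).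
Proof.
move=> kL mk mY mZ ind.
have mp (V : T -> R) B : measurable_fun setT V -> measurable B -> measurable [set w | V w \in B].
 by move=> mV mB; rewrite (_ : [set w | _] = V @^-1` B); [rewrite -[X in measurable X]setTI; exact: mV|
  apply/seteqP; split => w /=; rewrite in_setE].
pose I := {ffun 'I_N -> 'I_L}.
pose B (r : I) (j : nat) := if insub j is Some i then k j @^-1` [set nat_of_ord (r i)] else setT.
have mB r j : measurable (B r j) by rewrite /B; case: insubP => // *.
pose A (r : I) := \bigcap_(j in [set j | (j < N)%N]) [set w | Y j w \in B r j].
have mA r : measurable (A r).
 by apply: bigcap_measurableType => j _; exact: mp.
have Aw r w : (w \in A r) = [forall i : 'I_N, k i (Y i w) == r i].
 apply/idP/forallP => [|H].
  rewrite in_setE => H i; have := H i (ltn_ord i); rewrite /= in_setE /B.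
  by case: insubP => [j _ /ord_inj ->|/negP[]//] /= ->.
 rewrite in_setE => j /= jN; rewrite in_setE /B; case: insubP => // i _ Ej /=.
 by rewrite -Ej; apply/eqP; have := H i.
rewrite (_ : (fun w => _) = fun w => \sum_(r : I) ((\prod_(i < N) c i (r i)) * \1_(A r) w)); last first.
 apply/funext => w; pose r0 : I := [ffun i : 'I_N => Ordinal (kL i (Y i w) (ltn_ord i))].
 rewrite (bigD1 r0) //= indicE Aw (_ : [forall _, _]); last by apply/forallP => i; rewrite ffunE.
 rewrite mulr1 [X in _ = _ + X]big1 ?addr0 => [|r rr0].
  by rewrite big_mkord; apply: eq_bigr => i _; rewrite ffunE.
 rewrite indicE Aw (_ : [forall _, _] = false) ?mulr0 //; apply/negbTE; apply: contra rr0.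
 move=> /forallP H; apply/eqP/ffunP => i; rewrite ffunE; apply: val_inj => /=.
 by rewrite (eqP (H i)).
rewrite Ex_sum => [|r]; last by apply: bmZ; exact: bm_indic.
transitivity (\sum_(r : I) \prod_(i < N) (c i (r i) * fine (Q [set w | k i (Z w) = r i]))).
 apply: eq_bigr => r _; rewrite ExZ ?Ex_indic //; last exact: bm_indic.
 rewrite big_split /=; congr (_ * _); rewrite /A ind //.
 have -> : (\prod_(j < N) Q [set w | Z w \in B r j])%E =
   (\prod_(j < N) fine (Q [set w | k j (Z w) = r j]))%:E.
  rewrite (big_morph EFin EFinM erefl); apply: eq_bigr => j _.
  have -> : [set w | Z w \in B r j] = [set w | k j (Z w) = r j].
   apply/seteqP; split => w /=; rewrite in_setE /B; case: insubP => [i _ /ord_inj ->|/negP[]] //.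
  by rewrite fineK // fin_num_measure //; exact: (measurable_pre mZ (mk j (r j))).
 by [].
rewrite big_mkord -(bigA_distr_bigA (fun (i : 'I_N) (q : 'I_L) => c i q * fine (Q [set w | k i (Z w) = q]))).
apply: eq_bigr => i _; rewrite (@Ex_disc1 L (fun w => k i (Z w))) //.
 by move=> w; exact: kL.
by move=> q; rewrite (_ : [set w | _] = [set w | Z w \in k i @^-1` [set q]]); [exact: mp|
 apply/seteqP; split => w /=; rewrite in_setE].
Qed.

Lemma cvg_prod_nat N (f : nat -> nat -> R) (l : nat -> R) :
 (forall i, (i < N)%N -> f i m @[m --> \oo] --> l i) ->
 \prod_(0 <= i < N) f i m @[m --> \oo] --> \prod_(0 <= i < N) l i.
Proof.
elim: N => [|N IH] fl; first by rewrite big_geq //; under eq_fun do rewrite big_geq //; exact: cvg_cst.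
rewrite big_nat_recr //=; under eq_fun do rewrite big_nat_recr //=.
by apply: cvgM; [apply: IH => i iN; apply: fl; exact: ltnW|exact: fl].
Qed.

(** Independence and equality of laws are available for events only. Rounding every [F i] to
    multiples of [m.+1%:R^-1] reduces the formula to finitely many values, and dominated convergence
    removes the rounding. *)
Lemma Ex_prod N (Y : nat -> T -> R) (Z : T -> R) (F : nat -> R -> R) (M : R) :
 (forall i x, (i < N)%N -> `|F i x| <= M) ->
 (forall i, measurable_fun setT (F i)) ->
 (forall i, measurable_fun setT (Y i)) -> measurable_fun setT Z ->
 (forall B : nat -> set R, (forall j, measurable (B j)) ->
  Q (\bigcap_(j in [set j | (j < N)%N]) [set w | Y j w \in B j]) =
  (\prod_(j < N) Q [set w | Z w \in B j])%E) ->
 Ex (fun w => \prod_(0 <= i < N) F i (Y i w)) = \prod_(0 <= i < N) Ex (fun w => F i (Z w)).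
Proof.
move=> FM mF mY mZ ind.
have [->|N0] := posnP N.
 by rewrite big_geq //; under eq_Rintegral do rewrite big_geq //; exact: Ex_cst.
have M0 : 0 <= M by apply: le_trans (FM 0%N 0 N0).
(* Adding [M] makes the values nonnegative before truncation to an integer; the maximum with 0
   matters only for [i >= N], where [F i] carries no bound. *)
pose g m i x := Num.max 0 (m.+1%:R * (F i x + M)).
pose k m i x := Num.truncn (g m i x).
pose c m (q : nat) : R := q%:R / m.+1%:R - M.
have g0 m i x : 0 <= g m i x by rewrite le_max lexx.
have gE m i x : (i < N)%N -> g m i x = m.+1%:R * (F i x + M).
 move=> iN; rewrite /g (max_idPr _) // mulr_ge0 // -lerBlDr sub0r.
 by have := FM i x iN; rewrite ler_norml => /andP[].
have cF m i x : (i < N)%N -> F i x - m.+1%:R^-1 <= c m (k m i x) <= F i x.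
 move=> iN; have /andP[t1 t2] := truncn_itv (g0 m i x).
 have m1 : 0 < m.+1%:R :> R by pos.
 have -> : F i x = g m i x / m.+1%:R - M by rewrite gE //; field; rewrite addrC natr1 gt_eqF.
 have -> : g m i x / m.+1%:R - M - m.+1%:R^-1 = (g m i x - 1) / m.+1%:R - M by ring.
 by rewrite /c !lerD2r !ler_pM2r ?invr_gt0 // t1 andbT lerBlDr natr1 ltW.
have mk m i q : measurable (k m i @^-1` [set q]).
 rewrite (_ : _ @^-1` _ = g m i @^-1` `[q%:R, q.+1%:R[%classic); last first.
  apply/seteqP; split => x /=; rewrite in_itv /=; first by move=> <-; exact: truncn_itv.
  exact: truncn_def.
 have mg : measurable_fun setT (g m i).
  apply: measurable_maxr; first exact: measurable_cst.
  by apply: measurable_funM; [exact: measurable_cst|apply: measurable_funD => //; exact: measurable_cst].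
 by rewrite -[X in measurable X]setTI; exact: mg.
pose L m := (Num.truncn (m.+1%:R * (M + M))).+1.
have kL m i x : (i < N)%N -> (k m i x < L m)%N.
 move=> iN; rewrite ltnS /k; apply: le_truncn; rewrite gE // ler_wpM2l // lerD2r.
 by have := FM i x iN; rewrite ler_norml => /andP[].
have bc (V : T -> R) m i : (i < N)%N -> measurable_fun setT V -> bm (fun w => c m (k m i (V w))).
 move=> iN mV; have mA q : measurable [set w | k m i (V w) = q].
  exact: (measurable_pre mV (mk m i q)).
 rewrite (_ : (fun w => _) = fun w => \sum_(q < L m) c m q * \1_[set w | k m i (V w) = q] w).
  by apply: bm_sum => q; apply: bmZ; exact: bm_indic.
 apply/funext => w; rewrite (bigD1 (Ordinal (kL m i (V w) iN))) //= indicE mem_set //= mulr1.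
 rewrite big1 ?addr0 // => q qk; rewrite indicE memNset ?mulr0 //= => E.
 by move/eqP: qk; apply; apply: val_inj; rewrite /= E.
have cM m i x : (i < N)%N -> `|c m (k m i x)| <= M + 1.
 move=> iN; have /andP[c1 c2] := cF m i x iN.
 have := FM i x iN; rewrite !ler_norml => /andP[f1 f2].
 have : m.+1%:R^-1 <= 1 :> R by rewrite invf_le1 ?ler1n ?ltr0n.
 by move: c1 c2; move: (c m _) (m.+1%:R^-1) => u v c1 c2 v1; apply/andP; split; lra.
have cc i x : (i < N)%N -> c m (k m i x) @[m --> \oo] --> F i x.
 move=> iN; apply: (@squeeze_cvgr _ _ _ _ (fun m => F i x - m.+1%:R^-1) (fun=> F i x)).
 - by near=> m; exact: cF.
 - rewrite -[X in _ --> X]subr0; apply: cvgB; first exact: cvg_cst.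
  exact: cvg_harmonic.
 - exact: cvg_cst.
have H1 : Ex (fun w => \prod_(0 <= i < N) c m (k m i (Y i w))) @[m --> \oo] -->
  Ex (fun w => \prod_(0 <= i < N) F i (Y i w)).
 apply: (@Rintegral_cvg _ _ _ Q _ _ (fun=> (M + 1) ^+ N)).
 - move=> m; suff [] : bm (fun w => \prod_(0 <= i < N) c m (k m i (Y i w))) by [].
  by apply: bm_prod => i /andP[_ iN]; exact: bc.
 - suff [] : bm (fun w => \prod_(0 <= i < N) F i (Y i w)) by [].
  apply: bm_prod => i /andP[_ iN]; split; first exact: measurableT_comp.
  by exists M => w; exact: FM.
 - exact: (bm_integrable (bm_cst _)).
 - move=> m w; rewrite -[X in (M + 1) ^+ X]subn0; apply: normr_prod_le; first by pos.
  by move=> i /andP[_ iN]; exact: cM.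
 - by apply: aeW => w; apply: cvg_prod_nat => i iN; exact: cc.
have H2 : \prod_(0 <= i < N) Ex (fun w => c m (k m i (Z w))) @[m --> \oo] -->
  \prod_(0 <= i < N) Ex (fun w => F i (Z w)).
 apply: cvg_prod_nat => i iN; apply: (@Rintegral_cvg _ _ _ Q _ _ (fun=> M + 1)).
 - by move=> m; have [] := bc Z m i iN mZ.
 - exact: measurableT_comp.
 - exact: (bm_integrable (bm_cst _)).
 - by move=> m w; exact: cM.
 - by apply: aeW => w; exact: cc.
have E m : Ex (fun w => \prod_(0 <= i < N) c m (k m i (Y i w))) =
  \prod_(0 <= i < N) Ex (fun w => c m (k m i (Z w))).
 by apply: (@Ex_disc N (L m) Y Z (k m) (fun=> c m)) => // i x; exact: kL.
rewrite (funext E) in H1; exact: (cvg_unique _ H1 H2).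
Unshelve. all: by end_near.
Qed.

End BoundedExpectation.

Lemma bdd_family (R : realType) (F : nat -> R -> R) N : (forall i, bdd (F i)) ->
 exists M, forall i x, (i < N)%N -> `|F i x| <= M.
Proof.
move=> bF; elim: N => [|N [M IH]]; first by exists 0.
have [M' FM'] := bF N; exists (Num.max M M') => i x; rewrite ltnS leq_eqVlt le_max.
by move=> /orP[/eqP ->|iN]; [rewrite FM' orbT|rewrite IH].
Qed.

(** * Functions of the increments of the Lévy process *)

Section LevyFdd.
Context {R : realType} {d : measure_display} {T : measurableType d} (Q : probability T R).
Variables (Pi : {measure set R -> \bar R}) (b sigma2 : R) (xi : R -> T -> R).
Hypothesis xi_levy : levy_process Q b sigma2 Pi xi.
Local Notation Ex f := (Rintegral Q setT f).
Local Notation trigv := (trigv Pi b sigma2).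
Local Notation trig_comb := (trig_comb Pi b sigma2).
Local Notation trig_prod := (trig_prod Pi b sigma2).

Lemma measurable_xi t : measurable_fun setT (xi t).
Proof. by case: xi_levy. Qed.

Lemma continuous_trigv l : continuous (trigv l 0).
Proof.
rewrite (_ : trigv l 0 = fun d => \sum_(q <- l) q.1.1 * cos (q.1.2 * d + q.2)); last first.
 by apply/funext => x; exact: trigv0.
elim: l => [|q l IH].
 by rewrite (_ : (fun x => _) = fun=> 0); [exact: cst_continuous|apply/funext => x; rewrite big_nil].
rewrite (_ : (fun x => _) = fun x => q.1.1 * cos (q.1.2 * x + q.2) +
  \sum_(q <- l) q.1.1 * cos (q.1.2 * x + q.2)); last by apply/funext => x; rewrite big_cons.
move=> x; apply: cvgD; last exact: IH.
apply: cvgMr; apply: (@continuous_comp _ _ _ (fun x => q.1.2 * x + q.2) cos); last exact: continuous_cos.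
by apply: cvgD; [apply: cvgMr; exact: cvg_id|exact: cvg_cst].
Qed.

Lemma bdd_trigv l : bdd (trigv l 0).
Proof.
exists (\sum_(q <- l) `|q.1.1|) => x; rewrite trigv0.
apply: (le_trans (ler_norm_sum _ _ _)); apply: ler_sum => q _.
by rewrite normrM ler_piMr // cos_max.
Qed.

(** The characteristic function at time [h], after expanding each cosine of a sum: [trigv l h 0] is
    the semigroup applied to the function [trigv l 0]. *)
Lemma Ex_trigv l h : 0 <= h -> Ex (fun w => trigv l 0 (xi h w)) = trigv l h 0.
Proof.
move=> h0; have [_ _ _ _ /(_ h _ h0) H] := xi_levy.
have bc t : bm (fun w => cos (t * xi h w)).
 split; last by exists 1 => w; exact: cos_max.
 apply: (@measurableT_comp _ _ _ _ _ _ (fun z => cos (t * z))); last exact: measurable_xi.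
 by apply: continuous_measurable_fun; exact: continuous_cosM.
have bs t : bm (fun w => sin (t * xi h w)).
 split; last by exists 1 => w; exact: sin_max.
 apply: (@measurableT_comp _ _ _ _ _ _ (fun z => sin (t * z))); last exact: measurable_xi.
 by apply: continuous_measurable_fun; exact: continuous_sinM.
pose f (q : R * R * R) w := q.1.1 * cos q.2 * cos (q.1.2 * xi h w) +
  (- (q.1.1 * sin q.2)) * sin (q.1.2 * xi h w).
rewrite (_ : (fun w => _) = fun w => \sum_(q <- l) f q w); last first.
 by apply/funext => w; rewrite trigv0; apply: eq_bigr => q _; rewrite /f cosD; ring.
rewrite Ex_sum => [|q]; last by apply: bmD; exact: bmZ.
apply: eq_bigr => q _; rewrite /f ExD ?ExZ //; [|exact: bmZ..].
have [Hc Hs] := H q.1.2; rewrite {1 2}/Rintegral Hc Hs /=.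
by rewrite /trig1 mulr0 add0r cosD; ring.
Qed.

Definition eta N (h : R) (w : T) : seq R := mkseq (fun i => xi (i.+1%:R * h) w - xi (i%:R * h) w) N.

Lemma nth_eta N h w i : (i < N)%N -> nth 0 (eta N h w) i = xi (i.+1%:R * h) w - xi (i%:R * h) w.
Proof. by move=> iN; rewrite nth_mkseq. Qed.

Lemma measurable_incr s t : measurable_fun setT (fun w => xi s w - xi t w).
Proof. by apply: measurable_funB; exact: measurable_xi. Qed.

Lemma bm_trig_prod N h ls : bm (fun w => trig_prod N ls (eta N h w)).
Proof.
rewrite (_ : (fun w => _) = fun w => \prod_(0 <= i < N)
  trigv (ls i) 0 (xi (i.+1%:R * h) w - xi (i%:R * h) w)); last first.
 by apply/funext => w; rewrite /Submission.trig_prod !big_nat; apply: eq_bigr => i /andP[_ iN]; rewrite nth_eta.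
apply: bm_prod => i _; split; last exact: bdd_comp (bdd_trigv _).
apply: (@measurableT_comp _ _ _ _ _ _ (trigv (ls i) 0)); last exact: measurable_incr.
by apply: continuous_measurable_fun; exact: continuous_trigv.
Qed.

Lemma Ex_trig_prod N h ls : 0 <= h ->
 Ex (fun w => trig_prod N ls (eta N h w)) = \prod_(0 <= i < N) trigv (ls i) h 0.
Proof.
move=> h0; rewrite (_ : (fun w => _) = fun w => \prod_(0 <= i < N)
  trigv (ls i) 0 (xi (i.+1%:R * h) w - xi (i%:R * h) w)); last first.
 by apply/funext => w; rewrite /Submission.trig_prod !big_nat; apply: eq_bigr => i /andP[_ iN]; rewrite nth_eta.
have [M HM] := bdd_family N (fun i => bdd_trigv (ls i)).
rewrite (@Ex_prod _ _ _ Q N (fun i w => xi (i.+1%:R * h) w - xi (i%:R * h) w) (xi h)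
  (fun i => trigv (ls i) 0) M HM) //.
- by apply: eq_bigr => i _; rewrite Ex_trigv.
- by move=> i; apply: continuous_measurable_fun; exact: continuous_trigv.
- by move=> i; exact: measurable_incr.
- exact: measurable_xi.
move=> B mB; have [_ _ ind stat _] := xi_levy.
rewrite (ind N (fun i => i%:R * h) B) //; [|by rewrite mul0r|by move=> j; rewrite ler_wpM2r // ler_nat].
apply: eq_bigr => j _; rewrite -(stat (j%:R * h) h (B j)) ?mulr_ge0 //.
by congr (Q _); apply/seteqP; split => w /=; rewrite -nat1r mulrDl mul1r.
Qed.

Lemma bm_trig_comb N h cs : bm (fun w => trig_comb N cs (eta N h w)).
Proof. by apply: bm_sum => c; apply: bmZ; exact: bm_trig_prod. Qed.

Lemma Ex_trig_comb N h cs : 0 <= h -> Ex (fun w => trig_comb N cs (eta N h w)) =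
 \sum_(c <- cs) c.1 * \prod_(0 <= i < N) trigv (c.2 i) h 0.
Proof.
move=> h0; rewrite Ex_sum => [|c]; last by apply: bmZ; exact: bm_trig_prod.
by apply: eq_bigr => c _; rewrite ExZ ?Ex_trig_prod //; exact: bm_trig_prod.
Qed.

(** The approximants are accurate on boxes that grow with [m] and bounded by [C] outside, so
    dominated convergence carries expectations over from trigonometric sums to [g]. Measurability of
    [g] along the increments comes out as well, as that of a pointwise limit. *)
Lemma fdd_approx N h (g : seq R -> R) (C : R) : (forall s, `|g s| <= C) ->
 unif_box g N.+1 -> exists cs : nat -> seq (R * (nat -> seq (R * R * R))),
  [/\ forall m v, `|trig_comb N.+1 (cs m) v| <= C,
   forall m v, size v = N.+1 -> (forall i, (i < N.+1)%N -> `|nth 0 v i| <= m.+1%:R) ->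
    `|trig_comb N.+1 (cs m) v - g v| <= m.+1%:R^-1,
   measurable_fun setT (fun w => g (eta N.+1 h w)) &
   Ex (fun w => trig_comb N.+1 (cs m) (eta N.+1 h w)) @[m --> \oo] -->
    Ex (fun w => g (eta N.+1 h w))].
Proof.
move=> gC ug.
have /choice[cs Hcs] : forall m : nat, exists cs, (forall v, `|trig_comb N.+1 cs v| <= C) /\
  (forall v, size v = N.+1 -> (forall i, (i < N.+1)%N -> `|nth 0 v i| <= m.+1%:R) ->
   `|trig_comb N.+1 cs v - g v| <= m.+1%:R^-1).
 by move=> m; apply: trig_approx => //; rewrite ?invr_gt0 ltr0n.
have csC m v : `|trig_comb N.+1 (cs m) v| <= C by have [] := Hcs m.
have cvg w : trig_comb N.+1 (cs m) (eta N.+1 h w) @[m --> \oo] --> g (eta N.+1 h w).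
 apply/cvgrPdist_le => e e0.
 have [M HM] : exists M, forall i, (i < N.+1)%N -> `|nth 0 (eta N.+1 h w) i| <= M.
  exists (\sum_(i < N.+1) `|nth 0 (eta N.+1 h w) i|) => i iN.
  by rewrite (bigD1 (Ordinal iN)) //= lerDl; apply: sumr_ge0.
 near=> m; rewrite distrC; have [_ H] := Hcs m; apply: (le_trans (H _ _ _)).
 - by rewrite size_mkseq.
 - move=> i iN; apply: (le_trans (HM i iN)); apply: (@le_trans _ _ m%:R); last by rewrite ler_nat.
  by near: m; exact: near_natge.
 rewrite -[leRHS]invrK lef_pV2 ?posrE ?invr_gt0 ?ltr0n //.
 apply: (@le_trans _ _ m%:R); last by rewrite ler_nat.
 by near: m; exact: near_natge.
have mg : measurable_fun setT (fun w => g (eta N.+1 h w)).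
 apply: (@measurable_fun_cvg _ _ _ _ (fun m w => trig_comb N.+1 (cs m) (eta N.+1 h w))).
  by move=> m; have [] := bm_trig_comb N.+1 h (cs m).
 by move=> w _; exact: cvg.
exists cs; split => // [m v|]; first by have [_] := Hcs m; apply.
apply: (@Rintegral_cvg _ _ _ Q _ _ (fun=> C)) => //.
- by move=> m; have [] := bm_trig_comb N.+1 h (cs m).
- exact: (bm_integrable Q (bm_cst C)).
- by apply: aeW => w; exact: cvg.
Unshelve. all: by end_near.
Qed.

End LevyFdd.

Section GoodIncrements.
Variable R : realType.
Variables (a : nat -> R) (n : nat) (h : R) (N : nat) (eps B : R).
Local Notation rn s := (run a n h N eps (- B) B s).

(** All cell endpoints of a good run lie in the window, and an increment is the difference of two of
    them. *)
Lemma good_increments s : good n N (- B) B (rn s) ->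
 size (sd (rn s)) = N /\ forall i, (i < N)%N -> `|nth 0 (sd (rn s)) i| <= 2 * B.
Proof.
have H : (alive n N (- B) B (rn s) -> - B <= sy (rn s) <= B) /\
  (alive n N (- B) B (rn s) || good n N (- B) B (rn s) ->
  (size (sd (rn s)) == sj (rn s)) && all (fun x => `|x| <= 2 * B) (sd (rn s))).
 have ini x : (alive n N (- B) B (mstart R n x) -> - B <= sy (mstart R n x) <= B) /\
  (alive n N (- B) B (mstart R n x) || good n N (- B) B (mstart R n x) ->
   (size (sd (mstart R n x)) == sj (mstart R n x)) && all (fun x => `|x| <= 2 * B) (sd (mstart R n x))).
  by split=> //= /and3P[_ _ /and3P[_ -> ->]].
 elim: s => [|x [|y s] [IH1 IH2]]; [exact: ini|exact: ini|].
 rewrite run_cons //; set st := rn (y :: s) in IH1 IH2 *; rewrite /upd.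
 case: (boolP (alive n N (- B) B st)) => al; last by rewrite (negbTE al) in IH2 *; split=> // /IH2.
 have /andP[/eqP sz sall] := IH2 (introT orP (or_introl al)).
 have /andP[y1 y2] := IH1 al.
 rewrite /step; case: ifP => _.
  case: ifP => _; first by split=> /=; [move=> _; rewrite y1 y2|move=> _; rewrite sz eqxx].
  split=> /=; first by move=> /and3P[_ _ /and3P[_ -> ->]].
  move=> H; have /and3P[_ x1 x2] : in_range n (- B) B x.
   by move: H => /orP[/and3P[]|/andP[]].
  rewrite size_rcons sz eqxx /= all_rcons sall andbT.
  by rewrite ler_norml; apply/andP; split; lra.
 by do ! case: ifP => _; split=> /=; (try by move=> _; rewrite y1 y2); move=> _; rewrite sz eqxx.
move=> g; have [_] := H; rewrite g orbT => /(_ isT)/andP[/eqP sz /all_nthP al].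
have /andP[/eqP jN _] := g; rewrite sz jN; split=> // i iN.
by apply: al; rewrite sz jN.
Qed.

End GoodIncrements.

(** * Quantitative closeness in the J1 topology *)

Section J1close.
Variable R : realType.
Implicit Types (x y z lam mu : R -> R) (e : R).

(** The bound is on the whole half-line, which is affordable because all paths to be compared end up
    near 0. The time change acts on [x] only, and the relation is used as a directed one: where both
    directions matter both are proved. *)
Definition J1close e x y := exists lam, J1_time_change lam /\
 forall t, 0 <= t -> `|lam t - t| <= e /\ `|x (lam t) - y t| <= e.

Lemma J1_time_change_ge0 lam t : J1_time_change lam -> 0 <= t -> 0 <= lam t.
Proof.
move=> [l0 _ lm _]; rewrite le_eqVlt => /orP[/eqP <-|t0]; first by rewrite l0.
by rewrite -l0; apply/ltW/lm.
Qed.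

Lemma J1_time_change_continuous lam : lam 0 = 0 -> continuous lam ->
 (exists2 c, 0 < c & forall s t, s <= t -> c * (t - s) <= lam t - lam s) ->
 J1_time_change lam.
Proof.
move=> l0 lc [c c0 lm]; split => //.
- exact: continuous_subspaceT.
- move=> s t _ st; rewrite -subr_gt0; apply: lt_le_trans (lm s t (ltW st)).
 by pos.
apply/cvgryPge => A; near=> t.
have t0 : 0 <= t by near: t; exact: nbhs_pinfty_ge.
have := lm 0 t t0; rewrite l0 !subr0; apply: le_trans.
by rewrite -ler_pdivrMl //; near: t; exact: nbhs_pinfty_ge.
Unshelve. all: by end_near.
Qed.

Lemma J1_time_change_id : J1_time_change (@id R).
Proof.
apply: J1_time_change_continuous; [by []|by move=> t; exact: cvg_id|].
by exists 1 => [|s t _]; [exact: ltr01|rewrite mul1r].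
Qed.

Lemma J1_time_change_comp lam mu : J1_time_change lam -> J1_time_change mu ->
 J1_time_change (lam \o mu).
Proof.
move=> Jl Jm; have [l0 lc lm ly] := Jl; have [m0 mc mm my] := Jm.
split.
- by rewrite /= m0.
- apply/subspace_continuousP => t /= t0.
 move/subspace_continuousP : mc => /(_ t t0) mc.
 move/subspace_continuousP : lc => /(_ (mu t) (J1_time_change_ge0 Jm t0)) lc.
 apply: (@cvg_comp _ _ _ mu lam _ (within [set s | 0 <= s] (nbhs (mu t)))) => //.
 move=> A; rewrite /within /= => HA.
 have HH : \forall s \near t, 0 <= s -> 0 <= mu s -> A (mu s) := mc _ HA.
 change (\forall s \near t, 0 <= s -> A (mu s)).
 by apply: filterS HH => s Hs s0; apply: (Hs s0); exact: J1_time_change_ge0.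
- by move=> s t s0 st /=; apply: lm; [exact: J1_time_change_ge0|exact: mm].
- exact: (@cvg_comp _ _ _ mu lam _ _ _ my ly).
Qed.

Lemma J1close_refl x : J1close 0 x x.
Proof. by exists id; split; [exact: J1_time_change_id|move=> t _ /=; rewrite !subrr normr0]. Qed.

Lemma J1close_trans e1 e2 x y z : J1close e1 x y -> J1close e2 y z -> J1close (e1 + e2) x z.
Proof.
move=> [l [Jl Hl]] [m [Jm Hm]]; exists (l \o m); split; first exact: J1_time_change_comp.
move=> t t0 /=; have mt := J1_time_change_ge0 Jm t0.
have [h1 h2] := Hm t t0; have [h3 h4] := Hl _ mt; split.
 by rewrite (_ : _ - _ = (l (m t) - m t) + (m t - t)); [apply: (le_trans (ler_normD _ _)); apply: lerD|ring].
by rewrite (_ : _ - _ = (x (l (m t)) - y (m t)) + (y (m t) - z t));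
 [apply: (le_trans (ler_normD _ _)); apply: lerD|ring].
Qed.

Lemma J1close_cvg (x : nat -> R -> R) y (e : nat -> R) : (forall m, J1close (e m) (x m) y) ->
 e m @[m --> \oo] --> (0 : R) -> J1_cvg x y.
Proof.
move=> /choice[lam Hl] e0.
have eE : (e m)%:E @[m --> \oo] --> 0%E by apply: cvg_EFin => //; near=> m.
have sq (A : nat -> set R) (f : nat -> R -> R) : (forall m, A m 0) ->
  (forall m t, A m t -> 0 <= f m t <= e m) ->
  ereal_sup [set (f m t)%:E | t in A m] @[m --> \oo] --> 0%E.
 move=> A0 fe; apply: (@squeeze_cvge _ _ _ _ (fun=> 0%E) _ (fun m => (e m)%:E)) => //; last exact: cvg_cst.
 near=> m; apply/andP; split.
  apply: (@le_trans _ _ (f m 0)%:E); first by rewrite lee_fin; have /andP[] := fe m 0 (A0 m).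
  by apply: ereal_sup_ubound; exists 0.
 by apply: ge_ereal_sup => _ [t At <-]; rewrite lee_fin; have /andP[] := fe m t At.
exists lam; split.
- by move=> m; have [] := Hl m.
- apply: (sq (fun=> [set t | 0 <= t]) (fun m t => `|lam m t - t|)) => //= m t t0.
 by have [_ /(_ t t0)[H _]] := Hl m; rewrite normr_ge0.
move=> N; apply: (sq (fun=> [set t | 0 <= t <= N%:R]) (fun m t => `|x m (lam m t) - y t|)) => //=.
 by move=> m; rewrite lexx ler0n.
by move=> m t /andP[t0 _]; have [_ /(_ t t0)[_ H]] := Hl m; rewrite normr_ge0.
Unshelve. all: by end_near.
Qed.

(* The regularisation of [F] from below by the Lipschitz functionals [y |-> F y + k d(y, .)]. *)
Definition lipF (F : (R -> R) -> R) (C : R) (k : nat) x : R :=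
 inf ([set v | exists y e, [/\ cadlag y, 0 <= e, J1close e y x & v = F y + k%:R * e]] `|` [set C]).

Section LipF.
Variables (F : (R -> R) -> R) (C : R).
Hypothesis F_le : forall x, `|F x| <= C.
Local Notation lipF := (lipF F C).

Let lb k x : lbound ([set v | exists y e, [/\ cadlag y, 0 <= e, J1close e y x & v = F y + k%:R * e]]
  `|` [set C]) (- C).
Proof.
have := F_le x; rewrite ler_norml => /andP[C1 C2] v /= [[y [e [_ e0 _ ->]]]|->].
 have := F_le y; rewrite ler_norml => /andP[F1 _].
 by rewrite -[leLHS]addr0 lerD // mulr_ge0.
exact: le_trans C2.
Qed.

Lemma lipF_bounded k x : `|lipF k x| <= C.
Proof.
rewrite ler_norml; apply/andP; split.
 by apply: lb_le_inf; [exists C; right|exact: lb].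
by apply: ge_inf; [exists (- C); exact: lb|right].
Qed.

Lemma lipF_le k x : cadlag x -> lipF k x <= F x.
Proof.
move=> cx; apply: ge_inf; first by exists (- C); exact: lb.
by left; exists x, 0; split => //; [exact: J1close_refl|rewrite mulr0 addr0].
Qed.

Lemma lipF_lip k e x x' : 0 <= e -> J1close e x x' -> lipF k x' <= lipF k x + k%:R * e.
Proof.
move=> e0 xx'; rewrite -lerBlDr; apply: lb_le_inf; first by exists C; right.
move=> v /= [[y [e' [cy e'0 yx ->]]]|->]; rewrite lerBlDr.
 apply: ge_inf; first by exists (- C); exact: lb.
 left; exists y, (e' + e); split => //; [exact: addr_ge0|exact: J1close_trans xx'|].
 by rewrite mulrDr addrA.
have := lipF_bounded k x'; rewrite ler_norml => /andP[_ /le_trans]; apply.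
by rewrite lerDl mulr_ge0.
Qed.

(** Otherwise the competitors in the infimum give càdlàg paths [y] with [F y < F x - e / 2]. The
    penalty forces their distance to [x] below [2 * C / k.+1%:R], since [F] varies by at most
    [2 * C]; this contradicts J1 continuity. *)
Lemma lipF_cvg x : J1_continuous F -> cadlag x -> lipF k x @[k --> \oo] --> F x.
Proof.
move=> Fc cx; apply/cvgrPdist_lt => e e0; apply: contrapT => nF.
have H k : exists y, [/\ cadlag y, J1close (2 * C / k.+1%:R) y x & F y < F x - e / 2].
 apply: contrapT => nH; apply: nF; exists k.+1 => // j /= kj.
 have le := lipF_le j cx.
 rewrite ger0_norm ?subr_ge0 // ltrBlDr -ltrBlDl.
 apply: lt_le_trans (_ : F x - e / 2 <= _); first by lra.
 apply: lb_le_inf; first by exists C; right.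
 move=> v /= [[y [d [cy d0 yx ->]]]|->]; last first.
  by have := F_le x; rewrite ler_norml => /andP[_]; move: e0; lra.
 rewrite leNgt; apply/negP => lt; apply: nH; exists y; split => //; last first.
  by apply: le_lt_trans lt; rewrite lerDl mulr_ge0.
 have dC : d <= 2 * C / k.+1%:R.
  rewrite ler_pdivlMr ?ltr0n //; apply: (@le_trans _ _ (j%:R * d)).
   by rewrite mulrC ler_wpM2r // ler_nat.
  have := F_le y; have := F_le x; rewrite !ler_norml => /andP[x1 x2] /andP[y1 y2].
  by move: lt e0; move: (_ * d) => jd; lra.
 have [l [Jl Hl]] := yx; exists l; split=> // t t0; have [h1 h2] := Hl t t0.
 by split; apply: le_trans dC.
have [y Hy] := choice H.
have := Fc y x (fun m => let: And3 c _ _ := Hy m in c) cx.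
have J : J1_cvg y x.
 apply: (@J1close_cvg _ _ (fun k => 2 * C / k.+1%:R)); first by move=> m; have [] := Hy m.
 by rewrite -[X in _ --> X](mulr0 (2 * C)); apply: cvgMr; exact: cvg_harmonic.
move=> /(_ J)/cvgrPdist_lt/(_ (e / 2)); rewrite divr_gt0 // => /(_ isT)[m _ /(_ m (leqnn m))] /=.
have [_ _ lt] := Hy m.
by move=> /(le_lt_trans (ler_norm _)); move: lt; lra.
Qed.

End LipF.

Section Matched.
Variables (u v : nat -> R).
Hypotheses (u0 : u 0%N = 0) (v0 : v 0%N = 0).

(** The piecewise linear map sending each [v i] to [u i], continued with slope 1 after [v m].
    Clipping [t] at the breakpoints writes it as a sum of continuous monotone pieces. *)
Fixpoint interp (m : nat) (t : R) : R :=
 if m is k.+1 then interp k (Num.min t (v k)) +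
  (u k.+1 - u k) / (v k.+1 - v k) * (Num.min t (v k.+1) - Num.min t (v k)) +
  (t - Num.min t (v k.+1))
 else t.

Lemma continuous_interp m : continuous (interp m).
Proof.
have cm c : continuous (fun t : R => Num.min t c).
 move=> t; have /continuous_min : {for t, continuous (@id R)} by exact: cvg_id.
 by move=> /(_ (fun=> c)); apply; exact: cvg_cst.
elim: m => [|m IH] t /=; first exact: cvg_id.
apply: cvgD; last by apply: cvgB; [exact: cvg_id|exact: cm].
apply: cvgD; last by apply: cvgMr; apply: cvgB; exact: cm.
by apply: (@continuous_comp _ _ _ (fun t => Num.min t (v m)) (interp m)); [exact: cm|exact: IH].
Qed.

Lemma interp_last m t : (forall i, (i < m)%N -> v i < v i.+1) -> v m <= t ->
 interp m t = u m + (t - v m).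
Proof.
elim: m t => [|m IH] t vi vt /=; first by rewrite u0 v0 add0r subr0.
have vm := vi m (ltnSn m); have vtm : v m <= t by exact: le_trans (ltW vm) vt.
rewrite (min_idPr vt) (min_idPr vtm) IH //; last by move=> i im; apply: vi; exact: ltnW.
by field; rewrite subr_eq0 gt_eqF.
Qed.

Lemma interp_seg m i t : (forall i, (i < m)%N -> v i < v i.+1) -> (i < m)%N ->
 v i <= t <= v i.+1 -> interp m t = u i + (u i.+1 - u i) / (v i.+1 - v i) * (t - v i).
Proof.
elim: m t => [//|m IH] t vi im /andP[t1 t2] /=.
have vm := vi m (ltnSn m).
have vi' j : (j < m)%N -> v j < v j.+1 by move=> jm; apply: vi; exact: ltnW.
move: im; rewrite ltnS leq_eqVlt => /orP[/eqP E|im].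
 rewrite -E in vm vi' *; rewrite (min_idPr t1) (min_idPl t2) interp_last // subrr addr0; ring.
have mono j : (i.+1 <= j <= m)%N -> v i.+1 <= v j.
 elim: j => [|j IHj]; first by rewrite ltn0.
 rewrite leq_eqVlt => /andP[/orP[/eqP [->] //|ij] jm].
 by apply: le_trans (ltW (vi' j jm)); apply: IHj; rewrite -ltnS ij ltnW.
have tm : t <= v m by apply: le_trans t2 _; apply: mono; rewrite im leqnn.
rewrite (min_idPl tm) (min_idPl (le_trans tm (ltW vm))) IH ?t1 //; ring.
Qed.

Lemma interp_expand m : (forall i, (i < m)%N -> u i < u i.+1) -> (forall i, (i < m)%N -> v i < v i.+1) ->
 exists2 c, 0 < c & forall s t, s <= t -> c * (t - s) <= interp m t - interp m s.
Proof.
elim: m => [|m IH] ui vi /=; first by exists 1 => // s t _; rewrite mul1r.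
have [||c c0 H] := IH; [by move=> i im; apply: ui; exact: ltnW|by move=> i im; apply: vi; exact: ltnW|].
set q := _ / _; have q0 : 0 < q by rewrite divr_gt0 ?subr_gt0 ?ui ?vi.
exists (Num.min (Num.min c q) 1) => [|s t st]; first by rewrite !lt_min c0 q0 ltr01.
set c1 := Num.min _ _.
have c1c : c1 <= c by rewrite /c1 !ge_min lexx.
have c1q : c1 <= q by rewrite /c1 !ge_min lexx orbT.
have c11 : c1 <= 1 by rewrite /c1 ge_min lexx orbT.
have vm : v m < v m.+1 by exact: vi.
have a1 : 0 <= Num.min t (v m) - Num.min s (v m) by rewrite subr_ge0 le_min2 // lexx.
have a2 : 0 <= (Num.min t (v m.+1) - Num.min t (v m)) - (Num.min s (v m.+1) - Num.min s (v m)).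
 by rewrite !minEle; do ! case: ifP => //; lra.
have a3 : 0 <= (t - Num.min t (v m.+1)) - (s - Num.min s (v m.+1)).
 by rewrite !minEle; do ! case: ifP => //; lra.
have b1 := le_trans (ler_wpM2r a1 c1c) (H (Num.min s (v m)) (Num.min t (v m)) ltac:(by rewrite -subr_ge0)).
have b2 := ler_wpM2r a2 c1q; have b3 := ler_wpM2r a3 c11.
have -> : c1 * (t - s) = c1 * (Num.min t (v m) - Num.min s (v m)) +
 c1 * (Num.min t (v m.+1) - Num.min t (v m) - (Num.min s (v m.+1) - Num.min s (v m))) +
 c1 * (t - Num.min t (v m.+1) - (s - Num.min s (v m.+1))) by ring.
apply: (le_trans (lerD (lerD b1 b2) b3)).
by rewrite le_eqVlt; apply/orP; left; apply/eqP; ring.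
Qed.

End Matched.

Lemma find_seg (v : nat -> R) m t : v 0%N <= t ->
 (exists2 i, (i < m)%N & v i <= t < v i.+1) \/ v m <= t.
Proof.
move=> t0; elim: m => [|m [[i im vi]|IH]]; first by right.
 by left; exists i => //; exact: ltnW.
by have [|tm] := leP (v m.+1) t; [right|left; exists m => //; rewrite IH].
Qed.

Lemma matched_segments (m : nat) (u v : nat -> R) e x y :
 u 0%N = 0 -> v 0%N = 0 ->
 (forall i, (i < m)%N -> u i < u i.+1) -> (forall i, (i < m)%N -> v i < v i.+1) ->
 (forall i, (i <= m)%N -> `|u i - v i| <= e) ->
 (forall i, (i < m)%N -> forall t s, u i <= t < u i.+1 -> v i <= s < v i.+1 -> `|x t - y s| <= e) ->
 (forall t s, u m <= t -> v m <= s -> `|x t - y s| <= e) ->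
 J1close e x y.
Proof.
move=> u0 v0 ui vi uv xy xym; exists (interp u v m); split.
 apply: J1_time_change_continuous; last exact: interp_expand.
  have [m0|m0] := posnP m; first by rewrite m0.
  by rewrite (interp_seg u0 v0 vi m0) ?v0 ?lexx ?u0 ?subrr ?mulr0 ?addr0 // -[X in X <= _]v0 ltW // vi.
 exact: continuous_interp.
move=> t t0; have [[i im /andP[t1 t2]]|tm] := @find_seg v m t ltac:(by rewrite v0).
 have ii := vi i im; have ui' := ui i im.
 have d0 : 0 < v i.+1 - v i by rewrite subr_gt0.
 rewrite (interp_seg u0 v0 vi im) ?t1 ?(ltW t2) //.
 set w := (t - v i) / (v i.+1 - v i).
 have w0 : 0 <= w by rewrite divr_ge0 ?subr_ge0 // ltW.
 have w1 : w < 1 by rewrite ltr_pdivrMr // mul1r ltrD2r.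
 have -> : (u i.+1 - u i) / (v i.+1 - v i) * (t - v i) = w * (u i.+1 - u i) by rewrite /w; ring.
 split; last first.
  apply: (xy i im) => //; last by rewrite t1.
  rewrite lerDl mulr_ge0 ?subr_ge0 ?(ltW ui') //= -ltrBrDl.
  by rewrite gtr_pMl // subr_gt0.
 have -> : u i + w * (u i.+1 - u i) - t = (1 - w) * (u i - v i) + w * (u i.+1 - v i.+1).
  by rewrite /w; field; rewrite gt_eqF.
 apply: (le_trans (ler_normD _ _)); rewrite (normrM (1 - w)) (normrM w) (ger0_norm w0) ger0_norm ?subr_ge0 ?(ltW w1) //.
 have w1' : 0 <= 1 - w by rewrite subr_ge0 ltW.
 have := lerD (ler_wpM2l w1' (uv i (ltnW im))) (ler_wpM2l w0 (uv i.+1 im)).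
 by move=> /le_trans; apply; rewrite -mulrDl subrK mul1r.
rewrite (interp_last u0 v0 vi tm); split.
 by rewrite (_ : _ - _ = u m - v m) ?uv //; ring.
by apply: xym => //; rewrite lerDl subr_ge0.
Qed.

(** Every point has on each side a neighbourhood inside a single segment, where [f] varies by at
    most [e]; left limits then exist by the Cauchy criterion. *)
Lemma cadlag_segments (f : R -> R) :
 (forall e, 0 < e -> exists m (v c : nat -> R), [/\ v 0%N = 0, forall i, (i < m)%N -> v i < v i.+1,
   forall i, (i < m)%N -> forall t, v i <= t < v i.+1 -> `|f t - c i| <= e &
   forall t, v m <= t -> `|f t - c m| <= e]) ->
 cadlag f.
Proof.
move=> H; split=> t t0.
 apply/cvgrPdist_le => e e0; have e2 : 0 < e / 2 by rewrite divr_gt0.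
 have [m [v [c [v0 vi vc vm]]]] := H _ e2.
 have dist c0 s : `|f s - c0| <= e / 2 -> `|f t - c0| <= e / 2 -> `|f t - f s| <= e.
  move=> h1 h2; rewrite (_ : _ - _ = (f t - c0) - (f s - c0)); last by ring.
  by apply: (le_trans (ler_normB _ _)); rewrite [leRHS](splitr e); exact: lerD.
 have [[i im /andP[t1 t2]]|tm] := @find_seg v m t ltac:(by rewrite v0).
  near=> s; apply: (dist (c i)); apply: (vc i im); last by rewrite t1.
  have ts : t < s by near: s; exact: nbhs_right_gt.
  by rewrite (le_trans t1 (ltW ts)) /=; near: s; exact: nbhs_right_lt.
 near=> s; apply: (dist (c m)); apply: vm => //.
 have ts : t < s by near: s; exact: nbhs_right_gt.
 exact: le_trans tm (ltW ts).
apply/cauchy_cvgP/cauchy_exP => e e0; have e2 : 0 < e / 2 by rewrite divr_gt0.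
have [m [v [c [v0 vi vc vm]]]] := H _ e2.
have ball s c0 : `|f s - c0| <= e / 2 -> ball c0 e (f s).
 by rewrite -ball_normE /= distrC => /le_lt_trans; apply; move: e0; lra.
have [[i im /andP[t1 t2]]|tm] : (exists2 i, (i < m)%N & v i < t <= v i.+1) \/ v m < t.
 elim: m {vc vm vi} => [|m [[i im ti]|IH]]; first by right; rewrite v0.
  by left; exists i => //; exact: ltnW.
 by have [|tm] := ltP (v m.+1) t; [right|left; exists m => //; rewrite IH].
- exists (c i); suff : \forall s \near t^'-, `|f s - c i| <= e / 2 by apply: filterS => s; exact: ball.
 near=> s; apply: (vc i im).
 have st : s < t by near: s; exact: nbhs_left_lt.
 rewrite (lt_le_trans st t2) andbT; near: s; exact: nbhs_left_ge.
exists (c m); suff : \forall s \near t^'-, `|f s - c m| <= e / 2 by apply: filterS => s; exact: ball.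
near=> s; apply: vm; near: s; exact: nbhs_left_ge.
Unshelve. all: by end_near.
Qed.

End J1close.

(** * Lamperti transforms of step paths *)

Section StepPath.
Variable R : realType.
Variable gamma : R.
Hypothesis gamma_gt0 : 0 < gamma.
Implicit Types (s t : seq R) (h : R).

Definition psum s l : R := \sum_(r < l) nth 0 s r.
Definition rate s l : R := expR (gamma * psum s l).
(** The integral of $e^{\gamma\xi}$ over the first [l] cells of the step path, that is, the real
    time at which cell [l] begins. *)
Definition stime h s l : R := \sum_(r < l) h * rate s r.

(* The Lamperti transform of the path equal to [psum s j] on [[j h, (j + 1) h)], killed at [N h]. *)
Definition stp h N s (x : R) : R :=
 \sum_(j < N) if (stime h s j <= x) && (x < stime h s j.+1) then expR (psum s j) else 0.

(** Bounds the clock error caused by charging a whole cell at its initial rate although the path may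
    already have moved to its next level. *)
Definition riem h N s : R := \sum_(l < N) h * `|rate s l.+1 - rate s l|.

Lemma psumS s l : psum s l.+1 = psum s l + nth 0 s l.
Proof. by rewrite /psum big_ord_recr. Qed.

Lemma stimeS h s l : stime h s l.+1 = stime h s l + h * rate s l.
Proof. by rewrite /stime big_ord_recr. Qed.

Lemma stime0 h s : stime h s 0%N = 0.
Proof. by rewrite /stime big_ord0. Qed.

Lemma stime_ltS h s l : 0 < h -> stime h s l < stime h s l.+1.
Proof. by move=> h0; rewrite stimeS ltrDl mulr_gt0 // expR_gt0. Qed.

Lemma stime_le h s i j : 0 < h -> (i <= j)%N -> stime h s i <= stime h s j.
Proof.
move=> h0; elim: j => [|j IH]; first by rewrite leqn0 => /eqP ->.
by rewrite leq_eqVlt => /orP[/eqP ->//|ij]; apply: le_trans (IH ij) (ltW (stime_ltS s j h0)).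
Qed.

Lemma stp_seg h N s j x : 0 < h -> (j < N)%N -> stime h s j <= x < stime h s j.+1 ->
 stp h N s x = expR (psum s j).
Proof.
move=> h0 jN /andP[x1 x2]; rewrite /stp (bigD1 (Ordinal jN)) //= x1 x2 big1 ?addr0 // => i ij.
case: ifP => // /andP[y1 y2]; exfalso; move/eqP: ij; apply; apply: val_inj => /=.
case: (ltngtP i j) => // lt.
 by have := lt_le_trans y2 (le_trans (stime_le s h0 lt) x1); rewrite ltxx.
by have := lt_le_trans x2 (le_trans (stime_le s h0 lt) y1); rewrite ltxx.
Qed.

Lemma stp_last h N s x : 0 < h -> stime h s N <= x -> stp h N s x = 0.
Proof.
move=> h0 xN; rewrite /stp big1 // => i _; case: ifP => // /andP[_ x2]; exfalso.
by have := lt_le_trans x2 (le_trans (stime_le s h0 (ltn_ord i)) xN); rewrite ltxx.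
Qed.

Lemma expR_dist (x y c : R) : x <= c -> y <= c -> `|expR x - expR y| <= expR c * `|x - y|.
Proof.
wlog xy : x y / y <= x => [H|].
 move=> x1 y1; case: (leP y x) => [/H|/ltW /H]; first exact.
 by move=> Hyx; rewrite distrC (distrC x); exact: Hyx.
move=> xc _; rewrite !ger0_norm ?subr_ge0 ?ler_expR //.
have := expR_ge1Dx (y - x); rewrite expRB => H.
have h : expR x * (1 + (y - x)) <= expR y.
 by rewrite mulrC -ler_pdivlMr ?expR_gt0 // -expRN -expRB (le_trans (expR_ge1Dx _)) // expRB expRN.
apply: (@le_trans _ _ (expR x * (x - y))); first by move: h; rewrite !mulrDr !mulrN mulr1; lra.
by rewrite ler_wpM2r ?subr_ge0 // ler_expR.
Qed.

Lemma ub_cst N (c : R) : unif_box (fun=> c) N.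
Proof. by move=> B e B0 e0; exists 1 => // *; rewrite subrr normr0 ltW. Qed.

Lemma ubD N (f g : seq R -> R) : unif_box f N -> unif_box g N -> unif_box (fun s => f s + g s) N.
Proof.
move=> uf ug B e B0 e0; have e2 : 0 < e / 2 by rewrite divr_gt0.
have [d1 d10 H1] := uf B _ B0 e2; have [d2 d20 H2] := ug B _ B0 e2.
exists (Num.min d1 d2); first by rewrite lt_min d10.
move=> s t ss st sB tB st'; rewrite opprD addrACA [leRHS]splitr.
apply: (le_trans (ler_normD _ _)); apply: lerD; [apply: H1|apply: H2] => // i iN.
 by apply: le_trans (st' i iN) _; rewrite ge_min lexx.
by apply: le_trans (st' i iN) _; rewrite ge_min lexx orbT.
Qed.

Lemma ub_sum N m (f : nat -> seq R -> R) : (forall l, (l < m)%N -> unif_box (f l) N) ->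
 unif_box (fun s => \sum_(l < m) f l s) N.
Proof.
elim: m => [|m IH] uf.
 rewrite (_ : (fun s => _) = fun=> 0); first exact: ub_cst.
 by apply/funext => s; rewrite big_ord0.
rewrite (_ : (fun s => _) = fun s => \sum_(l < m) f l s + f m s).
 by apply: ubD; [apply: IH => l lm; apply: uf; exact: ltnW|exact: uf].
by apply/funext => s; rewrite big_ord_recr.
Qed.

Lemma ub_lip N (L : R) (f : R -> R) (g : seq R -> R) : 0 < L ->
 (forall x y, `|f x - f y| <= L * `|x - y|) -> unif_box g N -> unif_box (fun s => f (g s)) N.
Proof.
move=> L0 fL ug B e B0 e0; have [d d0 H] := ug B (e / L) B0 (divr_gt0 e0 L0).
exists d => // s t ss st sB tB st'; apply: (le_trans (fL _ _)).
by rewrite -ler_pdivlMl // mulrC; exact: H.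
Qed.

Lemma ubM N (f g : seq R -> R) (C : R) : 0 < C -> (forall s, `|f s| <= C) -> (forall s, `|g s| <= C) ->
 unif_box f N -> unif_box g N -> unif_box (fun s => f s * g s) N.
Proof.
move=> C0 fC gC uf ug B e B0 e0.
have e2 : 0 < e / (2 * C) by rewrite divr_gt0 // mulr_gt0.
have [d1 d10 H1] := uf B _ B0 e2; have [d2 d20 H2] := ug B _ B0 e2.
exists (Num.min d1 d2); first by rewrite lt_min d10.
move=> s t ss st sB tB st'.
have h1 : `|f s - f t| <= e / (2 * C).
 by apply: H1 => // i iN; apply: le_trans (st' i iN) _; rewrite ge_min lexx.
have h2 : `|g s - g t| <= e / (2 * C).
 by apply: H2 => // i iN; apply: le_trans (st' i iN) _; rewrite ge_min lexx orbT.
rewrite (_ : _ - _ = (f s - f t) * g s + f t * (g s - g t)); last by ring.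
apply: (le_trans (ler_normD _ _)); rewrite !normrM.
apply: (le_trans (lerD (ler_pM (normr_ge0 _) (normr_ge0 _) h1 (gC s)) (ler_pM (normr_ge0 _) (normr_ge0 _) (fC t) h2))).
by rewrite le_eqVlt; apply/orP; left; apply/eqP; field; rewrite gt_eqF.
Qed.

Lemma psum_dist N l s t (d : R) : (l <= N)%N ->
 (forall i, (i < N)%N -> `|nth 0 s i - nth 0 t i| <= d) -> `|psum s l - psum t l| <= l%:R * d.
Proof.
move=> lN H; rewrite /psum -sumrB; apply: (le_trans (ler_norm_sum _ _ _)).
rewrite mulr_natl -[X in _ *+ X]card_ord -sumr_const; apply: ler_sum => i _.
by apply: H; exact: leq_trans (ltn_ord i) lN.
Qed.

Lemma psum_le N l s (B : R) : (l <= N)%N -> 0 <= B -> (forall i, (i < N)%N -> `|nth 0 s i| <= B) ->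
 psum s l <= N%:R * B.
Proof.
move=> lN B0 H; apply: (le_trans (ler_norm _)); rewrite /psum; apply: (le_trans (ler_norm_sum _ _ _)).
apply: (@le_trans _ _ (l%:R * B)); last by rewrite ler_wpM2r // ler_nat.
rewrite mulr_natl -[X in _ *+ X]card_ord -sumr_const; apply: ler_sum => i _.
by apply: H; exact: leq_trans (ltn_ord i) lN.
Qed.

Lemma ub_expR N l (c : R) : 0 < c -> (l <= N)%N -> unif_box (fun s => expR (c * psum s l)) N.
Proof.
move=> c0 lN B e B0 e0; pose D := expR (c * (N%:R * B)) * (c * N.+1%:R).
have D0 : 0 < D by rewrite mulr_gt0 ?expR_gt0 // mulr_gt0 // ltr0n.
exists (e / D) => [|s t ss st sB tB st']; first exact: divr_gt0.
have d0 : 0 <= e / D by rewrite ltW // divr_gt0.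
apply: (@le_trans _ _ (expR (c * (N%:R * B)) * `|c * psum s l - c * psum t l|)).
 by apply: expR_dist; rewrite ler_wpM2l ?(ltW c0) //; apply: psum_le; rewrite // ltW.
rewrite -mulrBr normrM (gtr0_norm c0).
apply: (@le_trans _ _ (D * (e / D))); last by rewrite mulrC divfK // gt_eqF.
rewrite /D -!mulrA ler_wpM2l ?expR_ge0 // ler_wpM2l ?(ltW c0) //.
apply: (le_trans (psum_dist lN st')); rewrite ler_wpM2r // ler_nat.
exact: leq_trans lN (leqnSn N).
Qed.

Lemma ub_family N (g : nat -> seq R -> R) m : (forall l, (l <= m)%N -> unif_box (g l) N) ->
 forall B e : R, 0 < B -> 0 < e -> exists2 d, 0 < d & forall s t, size s = N -> size t = N ->
  (forall i, (i < N)%N -> `|nth 0 s i| <= B) -> (forall i, (i < N)%N -> `|nth 0 t i| <= B) ->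
  (forall i, (i < N)%N -> `|nth 0 s i - nth 0 t i| <= d) ->
  forall l, (l <= m)%N -> `|g l s - g l t| <= e.
Proof.
move=> ug B e B0 e0; elim: m ug => [|m IH] ug.
 have [d d0 H] := ug 0%N (leqnn _) B e B0 e0; exists d => // s t ss st sB tB st' l.
 by rewrite leqn0 => /eqP ->; exact: H.
have [d1 d10 H1] := IH (fun l lm => ug l (leq_trans lm (leqnSn m))).
have [d2 d20 H2] := ug m.+1 (leqnn _) B e B0 e0.
exists (Num.min d1 d2); first by rewrite lt_min d10.
move=> s t ss st sB tB st' l; rewrite leq_eqVlt => /orP[/eqP ->|lm].
 by apply: H2 => // i iN; apply: le_trans (st' i iN) _; rewrite ge_min lexx orbT.
by apply: H1 => // i iN; apply: le_trans (st' i iN) _; rewrite ge_min lexx.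
Qed.

Lemma ub_rate N l : (l <= N)%N -> unif_box (fun s => rate s l) N.
Proof. exact: ub_expR. Qed.

Lemma ub_stime h N l : 0 < h -> (l <= N)%N -> unif_box (fun s => stime h s l) N.
Proof.
move=> h0 lN; apply: (@ub_sum N l (fun r s => h * rate s r)) => r rl.
apply: (@ub_lip N h ( *%R h) (fun s => rate s r)) => //.
 by move=> x y; rewrite -mulrBr normrM gtr0_norm.
by apply: ub_rate; exact: leq_trans (ltnW rl) lN.
Qed.

Lemma stp_close h N s t e : 0 < h -> 0 <= e ->
 (forall l, (l <= N)%N -> `|stime h s l - stime h t l| <= e) ->
 (forall l, (l <= N)%N -> `|expR (psum s l) - expR (psum t l)| <= e) ->
 J1close e (stp h N s) (stp h N t).
Proof.
move=> h0 e0 H1 H2; apply: (@matched_segments _ N (stime h s) (stime h t)); rewrite ?stime0 //.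
- by move=> i _; exact: stime_ltS.
- by move=> i _; exact: stime_ltS.
- by move=> i iN x y xi yi; rewrite !(stp_seg h0 iN) //; apply: H2; exact: ltnW.
by move=> x y xN yN; rewrite !stp_last // subrr normr0.
Qed.

(** Close increments give step paths that are close in both directions of [J1close], and [lipF] has
    Lipschitz constant [k] for that closeness. *)
Lemma ub_lipF F C k h N : 0 < h -> (forall x, `|F x| <= C) ->
 unif_box (fun s => lipF F C k (stp h N s)) N.
Proof.
move=> h0 FC B e B0 e0; pose e1 := e / k.+1%:R.
have e10 : 0 < e1 by rewrite divr_gt0 // ltr0n.
have [d1 d10 H1] := @ub_family N (fun l s => stime h s l) N (fun l lN => ub_stime h0 lN) B e1 B0 e10.
have [d2 d20 H2] := @ub_family N (fun l s => expR (1 * psum s l)) N (fun l lN => @ub_expR N l 1 ltr01 lN) B e1 B0 e10.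
exists (Num.min d1 d2); first by rewrite lt_min d10.
move=> s t ss st sB tB st'.
have h1 i : (i < N)%N -> `|nth 0 s i - nth 0 t i| <= d1.
 by move=> iN; apply: le_trans (st' i iN) _; rewrite ge_min lexx.
have h2 i : (i < N)%N -> `|nth 0 s i - nth 0 t i| <= d2.
 by move=> iN; apply: le_trans (st' i iN) _; rewrite ge_min lexx orbT.
have q1 := H1 s t ss st sB tB h1.
have q2 l : (l <= N)%N -> `|expR (psum s l) - expR (psum t l)| <= e1.
 by move=> lN; have := H2 s t ss st sB tB h2 l lN; rewrite !mul1r.
have c1 : J1close e1 (stp h N s) (stp h N t) by apply: stp_close => //; exact: ltW.
have c2 : J1close e1 (stp h N t) (stp h N s).
 by apply: stp_close => // [|l lN|l lN]; [exact: ltW|rewrite distrC; exact: q1|rewrite distrC; exact: q2].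
have l1 := lipF_lip FC k (ltW e10) c1; have l2 := lipF_lip FC k (ltW e10) c2.
have ke : k%:R * e1 <= e.
 by rewrite /e1 mulrCA ler_piMr ?(ltW e0) // ler_pdivrMr ?ltr0n // mul1r ler_nat.
move: l1 l2 ke; move: (lipF F C k (stp h N s)) (lipF F C k (stp h N t)) (k%:R * e1) => x y w l1 l2 ke.
by rewrite ler_norml lerBlDl lerNl opprB lerBlDl; apply/andP; split;
 [apply: le_trans l1 _|apply: le_trans l2 _]; rewrite lerD2l.
Qed.

(* Equal to 1 when [riem] and the last level are at most [e1] and [e2], to 0 when one of them is
  at least twice that. *)
Definition cutoff h N (e1 e2 : R) s : R :=
 clamp (2 - riem h N s / e1) * clamp (2 - expR (psum s N) / e2).

Lemma clamp_lip (x y : R) : `|clamp x - clamp y| <= 1 * `|x - y|.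
Proof.
have := ler_norm (x - y); have := ler_norm (y - x); rewrite mul1r distrC.
by rewrite /clamp !minEle !maxEle; do ! case: ifP => //; rewrite ler_norml => *; apply/andP; split; lra.
Qed.

Lemma ub_cutoff h N e1 e2 : 0 < h -> 0 < e1 -> 0 < e2 -> unif_box (cutoff h N e1 e2) N.
Proof.
move=> h0 e10 e20.
have u1 c f : 0 < c -> unif_box f N -> unif_box (fun s => clamp (2 - f s / c)) N.
 move=> c0 uf; apply: (@ub_lip N 1 (@clamp R) (fun s => 2 - f s / c)) => //; first exact: clamp_lip.
 apply: (@ub_lip N c^-1 (fun x => 2 - x / c) f) => //; first by rewrite invr_gt0.
 move=> x y; rewrite (_ : _ - _ = - (c^-1 * (x - y))); last by ring.
 by rewrite normrN normrM ger0_norm // invr_ge0 ltW.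
have c1 x : `|clamp x| <= 1 :> R by have /andP[q0 q1] := clamp01 x; rewrite ger0_norm.
apply: (@ubM N _ _ 1) => //; apply: u1 => //.
 apply: (@ub_sum N N (fun l s => h * `|rate s l.+1 - rate s l|)) => l lN.
 apply: (@ub_lip N h (fun x => h * `|x|) (fun s => rate s l.+1 - rate s l)) => //.
  move=> x y; rewrite -mulrBr normrM gtr0_norm // ler_wpM2l ?(ltW h0) //.
  exact: ler_dist_dist.
 apply: ubD; first exact: ub_rate.
 apply: (@ub_lip N 1 (fun x => - x) (fun s => rate s l)) => //; last by apply: ub_rate; exact: ltnW.
 by move=> x y; rewrite -opprD normrN mul1r.
have := @ub_expR N N 1 ltr01 (leqnn N).
by rewrite (_ : (fun s => expR (1 * _)) = fun s => expR (psum s N)) //; apply/funext => s; rewrite mul1r.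
Qed.

End StepPath.

(** * From a good run of the machine to the path of the chain *)

Section ChainPath.
Variable R : realType.
Variables (a : nat -> R) (gamma : R) (n : nat) (h : R) (N : nat) (eps B cm e1 : R).
Hypotheses (a_gt0 : forall n, 0 < a n) (n_gt0 : (0 < n)%N) (h_gt0 : 0 < h) (N_gt0 : (0 < N)%N)
 (gamma_gt0 : 0 < gamma) (eps_ge0 : 0 <= eps) (B_ge0 : 0 <= B) (e1_ge0 : 0 <= e1) (cm_gt0 : 0 < cm).
Local Notation lg := (lg R n).
Local Notation in_range := (in_range n (- B) B).
Local Notation alive := (alive n N (- B) B).
Local Notation good := (good n N (- B) B).
Local Notation rn s := (run a n h N eps (- B) B s).
Local Notation rate := (rate gamma).
Local Notation stime := (stime gamma h).
Hypotheses (c_le : forall x, in_range x -> (a x)^-1 <= cm)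
 (a_uct : forall x, in_range x -> `|a x / a n - expR (gamma * lg x)| <= e1).

Definition idx (s : seq nat) (m : nat) : nat := nth 0%N (rev s) m.

Lemma idx_cons x s m : idx (x :: s) m = if (m < size s)%N then idx s m else if m == size s then x else 0%N.
Proof. by rewrite /idx rev_cons nth_rcons size_rev. Qed.

Lemma psum_rcons (v : seq R) d l : (l <= size v)%N -> psum (rcons v d) l = psum v l.
Proof.
move=> lv; apply: eq_bigr => i _; rewrite nth_rcons ifT //; exact: leq_trans (ltn_ord i) lv.
Qed.

Lemma rate_rcons (v : seq R) d l : (l <= size v)%N -> rate (rcons v d) l = rate v l.
Proof. by move=> lv; rewrite /rate psum_rcons. Qed.

Lemma stime_rcons (v : seq R) d l : (l <= (size v).+1)%N -> stime (rcons v d) l = stime v l.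
Proof.
move=> lv; apply: eq_bigr => i _; rewrite rate_rcons //.
by rewrite -ltnS; exact: leq_trans (ltn_ord i) lv.
Qed.

Let Cb : R := expR (gamma * B).
(** Rate error of one step: [e1] from regular variation, and the rest from a position within
    [2 * eps] of the reference level in a window bounded by [B]. *)
Let e2 : R := e1 + Cb * (gamma * (2 * eps)).
(** Bounds the real time from a departure to the end of its cell. The segments of the path change at
    the departure, while cells change at the closing step. *)
Let D : R := (h + cm) * (Cb + e1).
Let Cb_ge0 : 0 <= Cb. Proof. exact: expR_ge0. Qed.
Let e2_ge0 : 0 <= e2.
Proof. by rewrite addr_ge0 // mulr_ge0 // mulr_ge0 ?(ltW gamma_gt0) // mulr_ge0. Qed.
Let hc_ge0 : 0 <= h + cm. Proof. by rewrite addr_ge0 // ltW. Qed.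

(** Per cell: [e2] for the rate of a step, another [e2] for the gap between the landing value and
    the next level, the jump of [rate] between the two levels, and [cm * Cb] for the overshoot past
    [h]. *)
Definition clock_err (v : seq R) (l : nat) : R :=
 \sum_(r < l) ((h + cm) * (2 * e2 + `|rate v r.+1 - rate v r|) + cm * Cb).

Lemma clock_err_rcons (v : seq R) d l : (l <= size v)%N -> clock_err (rcons v d) l = clock_err v l.
Proof.
move=> lv; apply: eq_bigr => i _; rewrite !rate_rcons //.
 by apply: leq_trans lv; exact: ltnW.
exact: leq_trans (ltn_ord i) lv.
Qed.

Lemma clock_errS (v : seq R) l : clock_err v l.+1 =
 clock_err v l + ((h + cm) * (2 * e2 + `|rate v l.+1 - rate v l|) + cm * Cb).
Proof. by rewrite /clock_err big_ord_recr. Qed.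

(** After a departure the chain runs at the rate of its landing value, while the cell is still
    charged at the rate of its starting level. *)
Definition drift_err (st : mstate R) : R :=
 if sph st == 0%N then 0 else `|expR (gamma * sr st) - rate (sd st) (sj st)|.

Lemma drift_err_ge0 st : 0 <= drift_err st.
Proof. by rewrite /drift_err; case: ifP. Qed.

(* [W l] is the first index at which the path has left the neighbourhood of its value in the
  cell [l - 1]; in phase 0 the boundary [W (sj st).+1] is provisionally one past the present. *)
Record chain_inv (s : seq nat) (W : nat -> nat) : Prop := ChainInv {
 inv_W0 : W 0%N = 0%N;
 inv_Wlt : forall l, (l <= sj (rn s))%N -> (W l < W l.+1)%N;
 inv_Wle : (W (sj (rn s)).+1 <= size s)%N;
 inv_Wph : sph (rn s) = 0%N -> W (sj (rn s)).+1 = size s;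
 inv_Wph1 : sph (rn s) != 0%N -> (W (sj (rn s)).+1 < size s)%N;
 inv_val : forall l, (l <= sj (rn s))%N -> forall m, (W l <= m < W l.+1)%N ->
  in_range (idx s m) /\ `|lg (idx s m) - psum (sd (rn s)) l| <= 2 * eps;
 inv_val1 : forall m, (W (sj (rn s)).+1 <= m < size s)%N ->
  in_range (idx s m) /\ `|lg (idx s m) - sr (rn s)| <= eps;
 inv_sy : sy (rn s) = psum (sd (rn s)) (sj (rn s));
 inv_psum : forall l, (l <= sj (rn s))%N -> psum (sd (rn s)) l <= B;
 inv_sr : (sph (rn s) != 0)%N -> sr (rn s) <= B;
 inv_time : forall l, (l <= sj (rn s))%N ->
  `|(W l)%:R / a n - stime (sd (rn s)) l| <= clock_err (sd (rn s)) l + D;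
 inv_clock : `|(size s).-1%:R / a n - stime (sd (rn s)) (sj (rn s)) -
    sS (rn s) * rate (sd (rn s)) (sj (rn s))| <=
   clock_err (sd (rn s)) (sj (rn s)) + sS (rn s) * (e2 + drift_err (rn s));
 inv_back : (size s).-1%:R / a n - (W (sj (rn s)).+1)%:R / a n <= sS (rn s) * (Cb + e1) }.

Lemma in_range_n : in_range n.
Proof. by rewrite /Submission.in_range n_gt0 /Submission.lg subrr oppr_le0 B_ge0. Qed.

Lemma chain_inv0 : chain_inv [:: n] (fun l => l).
Proof.
have lg0 : lg n = 0 by rewrite /Submission.lg subrr.
have ps l : psum (@nil R) l = 0 by rewrite /psum big1 // => i _; rewrite nth_nil.
split => //=.
- move=> [|//] _ [|//] _; rewrite /idx /= in_range_n lg0 ps subr0 normr0; split=> //.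
 exact: mulr_ge0.
- by move=> [|m] //=; rewrite ltnS ltn0 andbF.
- by rewrite lg0 ps.
- by move=> l _; rewrite ps.
- move=> [|//] _; rewrite mul0r stime0 subr0 normr0 /clock_err big_ord0 add0r.
 by rewrite mulr_ge0 // addr_ge0.
- by rewrite !mul0r stime0 !subr0 normr0 /clock_err big_ord0 addr0.
by rewrite !mul0r sub0r oppr_le0 divr_ge0 // ltW.
Qed.

Lemma step_time x : in_range x -> `|(a n)^-1 - (a x)^-1 * expR (gamma * lg x)| <= (a x)^-1 * e1.
Proof.
move=> rx; have ax := a_gt0 x; have an := a_gt0 n.
rewrite (_ : _ - _ = (a x)^-1 * (a x / a n - expR (gamma * lg x))); last first.
 by rewrite [RHS]mulrBr mulKf // gt_eqF.
by rewrite normrM gtr0_norm ?invr_gt0 // ler_wpM2l ?invr_ge0 ?(ltW ax) // a_uct.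
Qed.

Lemma step_time_le x : in_range x -> (a n)^-1 <= (a x)^-1 * (Cb + e1).
Proof.
move=> rx; have := step_time rx; rewrite ler_norml => /andP[_].
rewrite lerBlDl [X in _ -> _ <= X]mulrDr => /le_trans; apply; rewrite lerD2r ler_wpM2l ?invr_ge0 ?(ltW (a_gt0 x)) //.
by rewrite ler_expR ler_wpM2l ?(ltW gamma_gt0) //; case/and3P: rx.
Qed.

Lemma expR_gamma_dist (x y : R) : x <= B -> y <= B -> `|x - y| <= 2 * eps ->
 `|expR (gamma * x) - expR (gamma * y)| <= e2 - e1.
Proof.
move=> xB yB xy; have -> : e2 - e1 = Cb * (gamma * (2 * eps)) by rewrite /e2; ring.
apply: (@le_trans _ _ (Cb * `|gamma * x - gamma * y|)).
 by apply: expR_dist; rewrite ler_wpM2l // ltW.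
by rewrite ler_wpM2l // -mulrBr normrM (gtr0_norm gamma_gt0) ler_wpM2l // ltW.
Qed.

Lemma step_drift st x y : in_range x -> y <= B -> rate (sd st) (sj st) = expR (gamma * y) ->
 (sph st == 0%N -> `|lg x - y| <= 2 * eps) ->
 (sph st != 0%N -> sr st <= B /\ `|lg x - sr st| <= eps) ->
 `|(a n)^-1 - (a x)^-1 * rate (sd st) (sj st)| <= (a x)^-1 * (e2 + drift_err st).
Proof.
move=> rx yB ry h0 h1; have xB : lg x <= B by case/and3P: rx.
have key : `|expR (gamma * lg x) - rate (sd st) (sj st)| <= (e2 - e1) + drift_err st.
 rewrite /drift_err; case: ifP => ph; first by rewrite addr0 ry; apply: expR_gamma_dist => //; exact: h0.
 have [sB xs] := h1 (negbT ph).
 rewrite (_ : _ - _ = (expR (gamma * lg x) - expR (gamma * sr st)) +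
  (expR (gamma * sr st) - rate (sd st) (sj st))); last by ring.
 apply: (le_trans (ler_normD _ _)); rewrite lerD2r; apply: expR_gamma_dist => //.
 by apply: (le_trans xs); rewrite mulr_natl mulr2n lerDl.
have ax : 0 <= (a x)^-1 by rewrite invr_ge0 ltW.
rewrite (_ : _ - _ = ((a n)^-1 - (a x)^-1 * expR (gamma * lg x)) +
  (a x)^-1 * (expR (gamma * lg x) - rate (sd st) (sj st))); last by ring.
apply: (le_trans (ler_normD _ _)); rewrite normrM (ger0_norm ax).
apply: (le_trans (lerD (step_time rx) (ler_wpM2l ax key))).
by rewrite -mulrDr ler_wpM2l //; lra.
Qed.

Lemma inv_W_le s W l : chain_inv s W -> (l <= sj (rn s))%N -> (W l.+1 <= size s)%N.
Proof.
move=> I lj; apply: leq_trans (inv_Wle I).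
have : forall k, (l <= k)%N -> (k <= sj (rn s))%N -> (W l.+1 <= W k.+1)%N.
 elim=> [|k IH]; first by rewrite leqn0 => /eqP -> _.
 rewrite leq_eqVlt => /orP[/eqP -> //|lk] kj.
 by apply: leq_trans (IH lk (ltnW kj)) _; apply/ltnW/(inv_Wlt I).
exact.
Qed.

Lemma sx_idx s : alive (rn s) -> sx (rn s) = idx s (size s).-1.
Proof.
by move=> al; rewrite alive_sx //; case: s {al} => [//|x s]; rewrite idx_cons ltnn eqxx.
Qed.

Lemma chain_inv_time s W : alive (rn s) -> chain_inv s W -> (0 < size s)%N ->
 let st := rn s in let S' := sS st + (a (sx st))^-1 in
 `|(size s)%:R / a n - stime (sd st) (sj st) - S' * rate (sd st) (sj st)| <=
   clock_err (sd st) (sj st) + S' * (e2 + drift_err st) /\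
 (size s)%:R / a n - (W (sj st).+1)%:R / a n <= S' * (Cb + e1).
Proof.
move=> al I s0 st S'; have /and3P[j1 ph1 rg] := al.
have rx := rg; rewrite sx_idx // in rx.
have sE : (size s)%:R / a n = (size s).-1%:R / a n + (a n)^-1.
 by rewrite -[in LHS](prednK s0) -natr1 mulrDl mul1r.
have sd0 : `|(a n)^-1 - (a (sx st))^-1 * rate (sd st) (sj st)| <= (a (sx st))^-1 * (e2 + drift_err st).
 apply: (@step_drift st (sx st) (psum (sd st) (sj st))) => //.
 - by apply: (inv_psum I).
 - move=> /eqP ph; rewrite sx_idx //; have [|_ //] := inv_val I (leqnn _) (m := (size s).-1).
  by rewrite [X in _ && (_ < X)%N](inv_Wph I ph) ltn_predL s0 andbT; have := inv_Wlt I (leqnn _); rewrite (inv_Wph I ph); case: (size s).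
 - move=> ph; split; first exact: (inv_sr I).
  rewrite sx_idx //; have [|_ //] := inv_val1 I (m := (size s).-1).
  by rewrite ltn_predL s0 andbT; have := inv_Wph1 I ph; case: (size s).
split.
 rewrite sE (_ : _ - _ - _ = ((size s).-1%:R / a n - stime (sd st) (sj st) -
   sS st * rate (sd st) (sj st)) + ((a n)^-1 - (a (sx st))^-1 * rate (sd st) (sj st))); last first.
  by rewrite /S'; ring.
 apply: (le_trans (ler_normD _ _)); apply: (le_trans (lerD (inv_clock I) sd0)).
 by rewrite /S' -addrA lerD2l mulrDl.
rewrite sE addrAC; apply: (le_trans (lerD (inv_back I) (step_time_le rg))).
by rewrite /S' mulrDl.
Qed.

(** When a cell closes in phase 1 the landing value is within [eps] of the new level, so the states
    seen since the departure already fit the next cell. In both phases [drift_err] is then at most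
    [e2] plus the jump of [rate], which is what [clock_err] charges for the cell. *)
Lemma chain_inv_done s W x : alive (rn s) -> chain_inv s W -> hpos s ->
 let st := rn s in
 h <= sS st + (a (sx st))^-1 -> (sph st != 0%N -> `|lg x - sr st| <= eps) -> in_range x ->
 rn (x :: s) = MState x (sj st).+1 0 (lg x) 0 (lg x) (rcons (sd st) (lg x - sy st)) ->
 chain_inv (x :: s) (fun l => if l == (sj st).+2 then (size s).+1 else W l).
Proof.
move=> al I hs st hS near rx E.
have s0 : (0 < size s)%N by move: hs; rewrite /hpos => /andP[]; case: (s).
have [S0 Sh jN jN0 [Sm sz]] := mwf_run eps a_gt0 h_gt0 c_le cm_gt0 s N_gt0.
have /and3P[j1 ph1 rg] := al; have Slt := Sh ph1; have cme := c_le rg.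
have [T1 T2] := chain_inv_time al I s0; rewrite -/st in T1 T2 S0 Sm sz Slt.
set S' := sS st + (a (sx st))^-1 in hS T1 T2.
have S'h : S' <= h + cm by rewrite lerD // ltW.
have S'0 : 0 <= S' by rewrite addr_ge0 // invr_ge0 ltW.
have xB : lg x <= B by case/and3P: rx.
have jsz : (sj st <= size (sd st))%N by rewrite sz.
pose v := rcons (sd st) (lg x - sy st).
have psv : psum v (sj st).+1 = lg x.
 rewrite psumS psum_rcons // nth_rcons sz ltnn eqxx -(inv_sy I); ring.
have rj : rate (sd st) (sj st) <= Cb.
 by rewrite ler_expR ler_wpM2l ?(ltW gamma_gt0) //; exact: (inv_psum I).
have dr : drift_err st <= e2 + `|rate v (sj st).+1 - rate v (sj st)|.
 rewrite /drift_err; case: ifP => ph; first by rewrite addr_ge0.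
 have rv : rate v (sj st) = rate (sd st) (sj st) by rewrite rate_rcons.
 rewrite rv (_ : expR _ - rate (sd st) _ = (expR (gamma * sr st) - rate v (sj st).+1) +
   (rate v (sj st).+1 - rate (sd st) (sj st))); last by ring.
 apply: (le_trans (ler_normD _ _)); rewrite lerD2r /Submission.rate psv.
 apply: (@le_trans _ _ (e2 - e1)); last by rewrite lerBlDr lerDl.
 apply: expR_gamma_dist => //; first by apply: (inv_sr I); exact: negbT.
 by rewrite distrC (le_trans (near (negbT ph))) // mulr_natl mulr2n lerDl.
have clk : `|(size s)%:R / a n - stime v (sj st).+1| <= clock_err v (sj st).+1.
 rewrite stimeS stime_rcons; last exact: leqW.
 rewrite rate_rcons // clock_errS clock_err_rcons //.
 rewrite (_ : _ - _ = ((size s)%:R / a n - stime (sd st) (sj st) - S' * rate (sd st) (sj st)) +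
   (S' - h) * rate (sd st) (sj st)); last by ring.
 apply: (le_trans (ler_normD _ _)); rewrite [X in _ + X]ger0_norm; last first.
  by rewrite mulr_ge0 ?subr_ge0 ?expR_ge0.
 have q1 : (S' - h) * rate (sd st) (sj st) <= cm * Cb.
  by apply: ler_pM; rewrite ?subr_ge0 ?expR_ge0 // lerBlDl.
 apply: (le_trans (lerD T1 q1)); rewrite -addrA lerD2l lerD2r.
 have rv : rate v (sj st) = rate (sd st) (sj st) by rewrite rate_rcons.
 rewrite rv in dr *.
 apply: (@le_trans _ _ (S' * (2 * e2 + `|rate v (sj st).+1 - rate (sd st) (sj st)|))).
  rewrite ler_wpM2l //; apply: (le_trans (lerD (lexx e2) dr)).
  by rewrite addrA mulr_natl mulr2n.
 by rewrite ler_wpM2r // addr_ge0 // mulr_ge0.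
have jne l : (l <= sj st)%N -> (l == (sj st).+2) = false.
 by move=> lj; apply/negbTE; rewrite neq_ltn ltnS (leq_trans lj).
have jne1 l : (l <= sj st)%N -> (l.+1 == (sj st).+2) = false.
 by move=> lj; apply/negbTE; rewrite neq_ltn !ltnS lj.
have jj : ((sj st).+1 == (sj st).+2) = false by exact: jne1.
have Wj := inv_Wle I.
split; rewrite ?E //=.
- exact: (inv_W0 I).
- move=> l; rewrite leq_eqVlt => /orP[/eqP ->|lj]; first by rewrite jj eqxx ltnS.
 by rewrite jne // jne1 //; exact: (inv_Wlt I).
- by rewrite eqxx.
- by rewrite eqxx.
- move=> l; rewrite leq_eqVlt => /orP[/eqP -> m|lj m].
  rewrite jj eqxx ltnS -/v psv (leq_eqVlt m) => /andP[m1 /orP[/eqP ->|m2]].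
   by rewrite idx_cons ltnn eqxx rx subrr normr0 mulr_ge0.
  rewrite idx_cons m2.
  have ph : sph st != 0%N by apply/eqP => /(inv_Wph I) W0; move: m1; rewrite W0 leqNgt m2.
  have [r1 r2] := inv_val1 I (m := m) ltac:(by rewrite m1 m2).
  split => //; rewrite (_ : _ - _ = (lg (idx s m) - sr st) - (lg x - sr st)); last by ring.
  by apply: (le_trans (ler_normB _ _)); rewrite mulr_natl mulr2n lerD // near.
 rewrite ltnS in lj; rewrite jne // jne1 // => /andP[m1 m2].
 have ms : (m < size s)%N by apply: leq_trans m2 _; exact: (inv_W_le I).
 rewrite idx_cons ms psum_rcons; last by rewrite sz.
 by apply: (inv_val I lj); rewrite m1.
- by move=> m; rewrite eqxx => /andP[m1 m2]; have := leq_trans m2 m1; rewrite ltnn.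
- move=> l; rewrite leq_eqVlt => /orP[/eqP ->|lj]; first by rewrite -/v psv.
 by rewrite psum_rcons ?sz //; exact: (inv_psum I).
- move=> l; rewrite leq_eqVlt => /orP[/eqP ->|lj].
  rewrite jj -/v (_ : _ - _ = ((size s)%:R / a n - stime v (sj st).+1) -
   ((size s)%:R / a n - (W (sj st).+1)%:R / a n)); last by ring.
  apply: (le_trans (ler_normB _ _)); apply: lerD => //.
  rewrite ger0_norm; first by apply: (le_trans T2); rewrite ler_wpM2r // addr_ge0.
  by rewrite -mulrBl divr_ge0 ?(ltW (a_gt0 n)) // subr_ge0 ler_nat.
 rewrite ltnS in lj; rewrite jne // stime_rcons ?sz ?leqW // clock_err_rcons ?sz //.
 exact: (inv_time I).
- by rewrite !mul0r subr0 addr0.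
by rewrite eqxx mul0r -mulrBl -natr1 opprD addrA subrr sub0r mulN1r oppr_le0 invr_ge0 ltW.
Qed.

(** The boundary of the next segment moves along with the present in phase 0, is fixed at the index
    of the departure, and stays there in phase 1. *)
Lemma chain_inv_stay s W x st' : alive (rn s) -> chain_inv s W -> hpos s ->
 let st := rn s in rn (x :: s) = st' ->
 [/\ sj st' = sj st, sS st' = sS st + (a (sx st))^-1, sy st' = sy st & sd st' = sd st] ->
 in_range x ->
 [\/ [/\ sph st = 0%N, sph st' = 0%N & `|lg x - sy st| <= eps],
   [/\ sph st = 0%N, sph st' = 1%N & sr st' = lg x] |
   [/\ sph st = 1%N, sph st' = 1%N, sr st' = sr st & `|lg x - sr st| <= eps]] ->
 exists W', chain_inv (x :: s) W'.
Proof.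
move=> al I hs st E [Ej ES Ey Ed] rx cases.
have s0 : (0 < size s)%N by move: hs; rewrite /hpos => /andP[]; case: (s).
have [T1 T2] := chain_inv_time al I s0; rewrite -/st in T1 T2.
have [S0 Sh jN jN0 [Sm sz]] := mwf_run eps a_gt0 h_gt0 c_le cm_gt0 s N_gt0.
rewrite -/st in S0; have xB : lg x <= B by case/and3P: rx.
have S'0 : 0 <= sS st + (a (sx st))^-1 by rewrite addr_ge0 // invr_ge0 ltW.
have Wj := inv_Wle I; rewrite -/st in Wj.
have old l m : (l <= sj st)%N -> (W l <= m < W l.+1)%N -> (m < size s)%N.
 by move=> lj /andP[_ m2]; apply: leq_trans m2 _; exact: (inv_W_le I).
have clk : drift_err st <= drift_err st' -> `|(size s)%:R / a n - stime (sd st') (sj st') -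
    sS st' * rate (sd st') (sj st')| <=
   clock_err (sd st') (sj st') + sS st' * (e2 + drift_err st').
 move=> dd; rewrite Ej ES Ed; apply: (le_trans T1); rewrite lerD2l ler_wpM2l // lerD2l //.
have jne l : (l <= sj st)%N -> (l == (sj st).+1) = false.
 by move=> lj; apply/negbTE; rewrite neq_ltn ltnS lj.
case: cases => [[p0 p0' near]|[p0 p1' sr']|[p1 p1' sr' near]].
- exists (fun l => if l == (sj st).+1 then (size s).+1 else W l).
 have W1 := inv_Wph I p0; rewrite -/st in W1.
 split; rewrite ?E ?Ej ?Ed //=.
 + exact: (inv_W0 I).
 + move=> l lj; rewrite jne // eqSS; case: eqP => [le|_]; last exact: (inv_Wlt I).
  by rewrite ltnW // ltnS -W1 le; exact: (inv_Wlt I).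
 + by rewrite eqxx.
 + by rewrite eqxx.
 + by rewrite p0'.
 + move=> l lj m; rewrite jne // eqSS; case: eqP => [le|ne] /andP[m1 m2]; last first.
   have mm : (W l <= m < W l.+1)%N by rewrite m1.
   by rewrite idx_cons (old l m lj mm); exact: (inv_val I).
  rewrite le in m1 *; rewrite idx_cons; move: m2; rewrite ltnS leq_eqVlt => /orP[/eqP ->|m2].
   rewrite ltnn eqxx; split=> //; rewrite -(inv_sy I) (le_trans near) // mulr_natl mulr2n lerDl //.
  by rewrite m2; apply: (inv_val I (leqnn _)); rewrite m1 /= W1.
 + by move=> m; rewrite eqxx => /andP[m1 m2]; have := leq_trans m2 m1; rewrite ltnn.
 + by rewrite Ey; exact: (inv_sy I).
 + exact: (inv_psum I).
 + by rewrite p0'.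
 + by move=> l lj; rewrite jne //; exact: (inv_time I).
 + by rewrite Ej Ed in clk; apply: clk; rewrite /drift_err p0 p0'.
 rewrite eqxx -mulrBl -natr1 opprD addrA subrr sub0r mulN1r.
 apply: (@le_trans _ _ 0); first by rewrite oppr_le0 invr_ge0 ltW.
 by rewrite ES mulr_ge0 // addr_ge0.
- have W1 := inv_Wph I p0; rewrite -/st in W1.
 exists W; split; rewrite ?E ?Ej ?Ed //=.
 + exact: (inv_W0 I).
 + exact: (inv_Wlt I).
 + by rewrite W1 leqW.
 + by rewrite p1'.
 + by move=> l lj m mm; rewrite idx_cons (old l m lj mm); exact: (inv_val I).
 + move=> m; rewrite W1 ltnS -eqn_leq => /eqP <-; rewrite idx_cons ltnn eqxx sr' subrr normr0.
  by split.
 + by rewrite Ey; exact: (inv_sy I).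
 + exact: (inv_psum I).
 + by rewrite sr'.
 + exact: (inv_time I).
 + rewrite Ej Ed in clk; apply: clk; rewrite {1}/drift_err p0 eqxx; exact: drift_err_ge0.
 by rewrite W1 subrr ES mulr_ge0 // addr_ge0.
have W1 := inv_Wph1 I ltac:(by rewrite -/st p1).
exists W; split; rewrite ?E ?Ej ?Ed //=.
- exact: (inv_W0 I).
- exact: (inv_Wlt I).
- exact: leqW.
- by rewrite p1'.
- by move=> l lj m mm; rewrite idx_cons (old l m lj mm); exact: (inv_val I).
- move=> m /andP[m1]; rewrite ltnS leq_eqVlt => /orP[/eqP ->|m2]; rewrite idx_cons.
  by rewrite ltnn eqxx sr'; split.
 by rewrite m2 sr'; apply: (inv_val1 I); rewrite m1.
- by rewrite Ey; exact: (inv_sy I).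
- exact: (inv_psum I).
- by rewrite sr' => _; apply: (inv_sr I); rewrite -/st p1.
- exact: (inv_time I).
- by rewrite Ej Ed in clk; apply: clk; rewrite /drift_err p1 p1' sr' Ed Ej.
by rewrite ES.
Qed.

Variables (K : nat) (eta z : R).

(** Singles out the step at which the last cell closes: the machine was live just before and is good
    now. *)
Definition reach (s : seq nat) : bool :=
 if s is x :: s' then alive (rn s') && good (rn s) else false.

Definition post_of (x : nat) : nat :=
 if (x <= K)%N then 3 else if eta * n%:R < x%:R then 2 else 1.

(* [post s] is 0 as long as the machine has not completed its cells at a state below [z n];
  afterwards it records whether the path entered [1, K] before exceeding [eta n] (3),
  exceeded [eta n] first (2), or did neither so far (1). *)
Fixpoint post (s : seq nat) : nat :=
 if s is x :: s' then
  if post s' == 0%N then (if reach (x :: s') && (x%:R <= z * n%:R) then post_of x else 0%N)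
  else if post s' == 1%N then post_of x else post s'
 else 0%N.

Lemma reach_cons x s : reach (x :: s) = alive (rn s) && good (rn (x :: s)).
Proof. by []. Qed.

Lemma post_cons x s : post (x :: s) = if post s == 0%N
 then (if reach (x :: s) && (x%:R <= z * n%:R) then post_of x else 0%N)
 else if post s == 1%N then post_of x else post s.
Proof. by []. Qed.

Lemma expR_lg x : (0 < x)%N -> expR (lg x) = x%:R / n%:R.
Proof.
by move=> x0; rewrite /Submission.lg expRD expRN !lnK // posrE ltr0n.
Qed.

Lemma rn_cons x s : s != [::] -> rn (x :: s) = if alive (rn s) then step a n h eps (rn s) x else rn s.
Proof. exact: run_cons. Qed.

Lemma good_not_alive st : good st -> alive st = false.
Proof. by move=> /andP[/eqP E _]; rewrite /Submission.alive E ltnn. Qed.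

Lemma chain_inv_run s : hpos s -> last 0%N s = n -> alive (rn s) || reach s ->
 exists W, chain_inv s W.
Proof.
elim: s => [//|x s IH] hs ls ar.
have [s0|s0] := eqVneq s [::].
 by move: ls; rewrite s0 /= => ->; exists (fun l => l); exact: chain_inv0.
have hs' : hpos s by move: hs; rewrite /hpos s0 /= => /andP[].
have ls' : last 0%N s = n by case: (s) s0 ls.
have al : alive (rn s).
 apply: contraT => nal; move: ar; rewrite reach_cons (negbTE nal) orbF.
 by rewrite rn_cons // (negbTE nal) => al; rewrite al in nal.
have [W I] := IH hs' ls' ltac:(by rewrite al).
have rsx := rn_cons x s0; rewrite al in rsx.
have g : alive (rn (x :: s)) || good (rn (x :: s)) by move: ar; rewrite reach_cons al.
have /and3P[j1 ph1 rg] := al.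
have jN : (sj (rn s) == N) = false by apply/negbTE; rewrite neq_ltn j1.
have rx : in_range x.
 have sxx : sx (rn (x :: s)) = x by rewrite rsx /step; do ! case: ifP.
 by rewrite -sxx; case/orP: g => [/and3P[]|/andP[]].
have stay := @chain_inv_stay s W x (rn (x :: s)) al I hs' erefl.
move: stay g; rewrite rsx /step; case: (leP h _) => hS.
 case: ifP => c1; first by rewrite /Submission.alive /Submission.good /= jN andbF.
 move=> _ _; eexists; apply: (chain_inv_done al I hs') => //.
  move=> ph; rewrite leNgt; apply: contraFN c1 => ->; rewrite andbT.
  by move: ph ph1; case: (sph (rn s)) => [|[|]].
 by rewrite rsx /step hS c1.
case: eqP => ph; last first.
 have ph' : sph (rn s) = 1%N by move: ph ph1; case: (sph (rn s)) => [|[|]].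
 case: (leP _ eps) => c1; last by rewrite /Submission.alive /Submission.good /= jN andbF.
 by move=> stay _; apply: stay => //; apply: Or33.
case: (leP _ eps) => c1 stay _; apply: stay => //; first exact: Or31.
exact: Or32.
Qed.

Lemma good_sy s : good (rn s) -> sy (rn s) = lg (sx (rn s)).
Proof.
elim: s => [|x s IH] gd; first by [].
have [s0|s0] := eqVneq s [::]; first by rewrite s0.
move: gd; rewrite rn_cons //; case: ifP => [al|_]; last exact: IH.
have /and3P[j1 _ _] := al.
have jN : (sj (rn s) == N) = false by apply/negbTE; rewrite neq_ltn j1.
by rewrite /step; do ! case: ifP => //= _; rewrite /Submission.good /= jN.
Qed.

Lemma good_psum s : hpos s -> last 0%N s = n -> reach s ->
 psum (sd (rn s)) N = lg (sx (rn s)).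
Proof.
move=> hs ls re; have gd : good (rn s) by case: (s) re => // x s' /andP[].
have [W I] := chain_inv_run hs ls ltac:(by rewrite re orbT).
by rewrite -good_sy // (inv_sy I); case/andP: gd => /eqP ->.
Qed.

Lemma post_of_neq0 x : post_of x != 0%N.
Proof. by rewrite /post_of; do ! case: ifP. Qed.

Lemma post_good s : hpos s -> last 0%N s = n -> good (rn s) ->
 expR (psum (sd (rn s)) N) <= z -> post s != 0%N.
Proof.
elim: s => [//|x s IH] hs ls gd ez.
have [s0|s0] := eqVneq s [::].
 by move: gd; rewrite s0 /Submission.good /= => /andP[/eqP N0]; move: N_gt0; rewrite -N0.
have hs' : hpos s by move: hs; rewrite /hpos s0 /= => /andP[].
have ls' : last 0%N s = n by case: (s) s0 ls.
rewrite post_cons; case: (eqVneq (post s) 0%N) => [ps0|ps0]; last first.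
 by case: ifP => // _; exact: post_of_neq0.
have [al|nal] := boolP (alive (rn s)); last first.
 move: gd ez; rewrite rn_cons // (negbTE nal) => gd ez.
 by have := IH hs' ls' gd ez; rewrite ps0.
have re : reach (x :: s) by rewrite reach_cons al gd.
have sxx : sx (rn (x :: s)) = x by rewrite rn_cons // al /step; do ! case: ifP.
have x0 : (0 < x)%N by move: hs; rewrite /hpos /= => /andP[].
rewrite re; move: ez; rewrite good_psum // sxx expR_lg // ler_pdivrMr ?ltr0n // => -> /=.
exact: post_of_neq0.
Qed.

(** Cuts the history at the end [s0] of the last cell, where the invariant holds and the state is at
    most [z * n%:R], and translates the value of [post] into what the path does afterwards. *)
Lemma post_split s : hpos s -> last 0%N s = n -> post s != 0%N ->
 exists W s0, [/\ chain_inv s0 W, rn s = rn s0, good (rn s0), (idx s0 (size s0).-1)%:R <= z * n%:R &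
  [/\ (0 < size s0 <= size s)%N, forall m, (m < size s0)%N -> idx s m = idx s0 m,
   post s = 1%N -> forall m, ((size s0).-1 <= m < size s)%N -> (idx s m)%:R <= eta * n%:R &
   post s = 3%N -> exists A, [/\ ((size s0).-1 <= A < size s)%N, (idx s A <= K)%N &
    forall m, ((size s0).-1 <= m < A)%N -> (idx s m)%:R <= eta * n%:R]]].
Proof.
have po x : post_of x != 0%N by rewrite /post_of; do ! case: ifP.
have p1 x : post_of x = 1%N -> x%:R <= eta * n%:R.
 by rewrite /post_of; case: ifP => // _; case: ifP => // /negbT; rewrite -leNgt.
have p3 x : post_of x = 3%N -> (x <= K)%N by rewrite /post_of; case: ifP => // _; case: ifP.
elim: s => [//|x s IH] hs ls ps.
have [s0|s0] := eqVneq s [::].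
 by move: ps; rewrite s0 /= [Submission.alive _ _ _ _ _]/Submission.alive /= andbF.
have hs' : hpos s by move: hs; rewrite /hpos s0 /= => /andP[].
have ls' : last 0%N s = n by case: (s) s0 ls.
rewrite post_cons in ps *; move: ps; case: (eqVneq (post s) 0%N) => [ps0|ps0].
 case: ifP => // /andP[re xz] _.
 have [W I] := chain_inv_run hs ls ltac:(by rewrite re orbT).
 have /andP[al gd] := re.
 exists W, (x :: s); split => //; first by rewrite idx_cons ltnn eqxx.
 split; [by rewrite leqnn|by []| |].
 - move=> /p1 xe m /=; rewrite ltnS -eqn_leq => /eqP <-.
  by rewrite idx_cons ltnn eqxx.
 - move=> /p3 xK; exists (size s); rewrite idx_cons ltnn eqxx; split => //=.
   by rewrite ltnS leqnn.
  by move=> m /andP[m1 m2]; have := leq_ltn_trans m1 m2; rewrite ltnn.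
have [W [s1 [I re gd iz [/andP[sz1 sz] ix H1 H3]]]] := IH hs' ls' ps0.
have rex : rn (x :: s) = rn s1 by rewrite rn_cons // re good_not_alive.
move=> _; exists W, s1; split => //; split.
- by rewrite sz1 /= leqW.
- by move=> m ms; rewrite idx_cons (leq_trans ms) // ix.
- case: eqP => [ps1|ps1]; last by move/ps1.
 move=> /p1 xe m /andP[m1]; rewrite /= ltnS leq_eqVlt idx_cons => /orP[/eqP ->|m2].
  by rewrite ltnn eqxx.
 by rewrite m2 H1 // m1.
case: eqP => [ps1 /p3 xK|_ ps3].
 exists (size s); rewrite idx_cons ltnn eqxx; split => //=.
  by rewrite ltnS leqnn andbT (leq_trans (leq_pred _)).
 by move=> m /andP[m1 m2]; rewrite idx_cons m2 H1 // m1.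
have [A [/andP[A1 A2] AK AH]] := H3 ps3.
exists A; rewrite idx_cons A2; split => //; first by rewrite A1 /= leqW.
by move=> m /andP[m1 m2]; rewrite idx_cons (ltn_trans m2) // AH // m1.
Qed.

Lemma stoppedP (x : nat -> nat) m :
 (stopped x K m = x m /\ forall l, (0 < l < m)%N -> (K < x l)%N) \/
 exists A, [/\ (0 < A <= m)%N, (x A <= K)%N & stopped x K m = x A].
Proof.
rewrite /stopped /hitting_time; case: pselect => [hit|nhit]; last first.
 left; split => // l /andP[l0 _]; rewrite ltnNge; apply/negP => xl.
 by apply: nhit; exists l; rewrite l0.
case: ex_minnP => A /andP[A0 AK] Am; have [Al|mA] := leqP A m.
 by right; exists A; rewrite A0.
left; split => // l /andP[l0 lm]; rewrite ltnNge; apply/negP => xl.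
by have := Am l; rewrite l0 xl leqNgt (ltn_trans lm mA) => /(_ isT).
Qed.

(** The stopped, rescaled path read off a finite history, which is continued by its last state;
    functionals of the path thus become functions of a list. *)
Definition cpath (s : seq nat) (t : R) : R :=
 (stopped (fun m => idx s (minn m (size s).-1)) K (Num.truncn (a n * t)))%:R / n%:R.

Lemma clock_err_riem v l : clock_err v l =
 l%:R * ((h + cm) * (2 * e2) + cm * Cb) + (h + cm) / h * riem gamma h l v.
Proof.
elim: l => [|l IH]; first by rewrite /clock_err /riem !big_ord0 mulr0 mul0r addr0.
rewrite clock_errS IH /riem big_ord_recr /= -natr1 -/e2 -/Cb.
by field; rewrite gt_eqF.
Qed.

Lemma clock_err_mono v l l' : (l <= l')%N -> clock_err v l <= clock_err v l'.
Proof.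
elim: l' => [|l' IH]; first by rewrite leqn0 => /eqP ->.
rewrite leq_eqVlt => /orP[/eqP -> //|ll]; apply: (le_trans (IH ll)).
rewrite clock_errS lerDl addr_ge0 // mulr_ge0 ?(ltW cm_gt0) // addr_ge0 // mulr_ge0 //.
Qed.

Lemma in_cell (W : nat -> nat) j m : W 0%N = 0%N -> (m < W j)%N ->
 exists2 l, (l < j)%N & (W l <= m < W l.+1)%N.
Proof.
move=> W0; elim: j => [|j IH]; first by rewrite W0.
move=> mj; have [mW|mW] := ltnP m (W j); last by exists j; rewrite ?mW ?mj.
by have [l lj ml] := IH mW; exists l => //; exact: ltnW.
Qed.

(** The steps from [W i] to [W i.+1] are matched with cell [i] of the step path. After the last cell
    both paths are below [dl]: in its last segment the chain is within a factor [expR (4 * eps)] of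
    a state at most [z * n%:R], then it stays below [eta * n%:R] until it is possibly absorbed at a
    state at most [K]. *)
Lemma chain_close s (dl : R) : hpos s -> last 0%N s = n -> (post s == 1%N) || (post s == 3%N) ->
 (forall x, in_range x -> (K < x)%N) ->
 clock_err (sd (rn s)) N + D <= dl -> expR B * (2 * eps) <= dl -> z * expR (4 * eps) <= dl ->
 eta <= dl -> K%:R <= dl * n%:R ->
 J1close dl (cpath s) (stp gamma h N (sd (rn s))).
Proof.
move=> hs ls ps inK cN eB zd ed Kd.
have n0 : 0 < n%:R :> R by rewrite ltr0n.
have [|W [s0 [I re gd iz [/andP[sz1 sz] ix H1 H3]]]] := post_split hs ls.
 by case/orP: ps => /eqP ->.
have /andP[/eqP jN rg] := gd; rewrite re in cN *.
have [W0 Wlt Wle _ _ Wval Wval1 _ _ _ Wt _ _] := I.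
rewrite jN in Wlt Wle Wval Wval1 Wt.
set v := sd (rn s0) in cN Wval Wt *.
have [_ _ _ /(_ jN)[_ ph0] _] := mwf_run eps a_gt0 h_gt0 c_le cm_gt0 s0 N_gt0.
have WN : W N.+1 = size s0 by rewrite -jN; exact: (inv_Wph I).
have WNs : (W N < size s0)%N by rewrite -WN; exact: Wlt.
have Wmono l l' : (l <= l')%N -> (l' <= N.+1)%N -> (W l <= W l')%N.
 elim: l' => [|l' IH]; first by rewrite leqn0 => /eqP ->.
 rewrite leq_eqVlt => /orP[/eqP -> //|ll] lN.
 by apply: leq_trans (IH ll (ltnW lN)) _; apply/ltnW/Wlt.
have inr m : (m < W N)%N -> (K < idx s m)%N.
 move=> mN; have ms : (m < size s0)%N by exact: ltn_trans WNs.
 have [l lN ml] := in_cell W0 mN.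
 by rewrite ix //; apply: inK; have [] := Wval l (ltnW lN) m ml.
have mmin m : (m < size s0)%N -> minn m (size s).-1 = m.
 by move=> ms; apply/minn_idPl; rewrite -ltnS prednK ?(leq_trans ms) // (leq_trans sz1).
have dl0 : 0 <= dl by apply: le_trans eB; rewrite mulr_ge0 ?expR_ge0 // mulr_ge0.
have le_dl m : m%:R <= dl * n%:R -> m%:R / n%:R <= dl by rewrite ler_pdivrMr.
apply: (matched_segments (u := fun i => (W i)%:R / a n) (v := stime v) (m := N)).
- by rewrite W0 mul0r.
- exact: stime0.
- by move=> i iN; rewrite ltr_pM2r ?invr_gt0 // ltr_nat Wlt // ltnW.
- by move=> i iN; exact: stime_ltS.
- move=> i iN; apply: (le_trans (Wt i iN)); apply: le_trans cN.
 by rewrite lerD2r clock_err_mono.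
- move=> i iN t x /andP[t1 t2] xs; rewrite (stp_seg _ iN xs) //.
 rewrite ler_pdivrMr // in t1; rewrite ltr_pdivlMr // in t2.
 have t0 : 0 <= a n * t by rewrite mulrC (le_trans _ t1).
 rewrite /cpath; set m := Num.truncn _.
 have m1 : (W i <= m < W i.+1)%N.
  by rewrite /m truncn_ge_nat // truncn_lt_nat // ![a n * t]mulrC t1 t2.
 have ms : (m < W N)%N.
  by case/andP: m1 => _ m2; apply: leq_trans m2 _; apply: Wmono => //; exact: ltnW.
 have -> : stopped (fun m => idx s (minn m (size s).-1)) K m = idx s0 m.
  have [[-> _]|[A [/andP[A0 Am] AK _]]] := stoppedP (fun m => idx s (minn m (size s).-1)) m.
   by rewrite mmin ?ix // (ltn_trans ms).
  have As : (A < W N)%N by exact: leq_ltn_trans ms.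
  by move: AK; rewrite mmin ?(ltn_trans As) // leqNgt inr.
 have [r1 r2] := Wval i (ltnW iN) m m1.
 have x0 : (0 < idx s0 m)%N by case/and3P: r1.
 rewrite -expR_lg //; apply: le_trans eB.
 apply: (le_trans (expR_dist _ (c := B) _)).
 - by case/and3P: r1.
 - by rewrite /v; apply: (inv_psum I); rewrite jN ltnW.
 by rewrite ler_wpM2l ?expR_ge0.
move=> t x t1 x1; rewrite (stp_last _ x1) // subr0.
rewrite ler_pdivrMr // in t1.
have t0 : 0 <= a n * t by rewrite mulrC (le_trans _ t1).
rewrite /cpath; set m := Num.truncn _.
have m1 : (W N <= m)%N by rewrite /m truncn_ge_nat // mulrC.
rewrite ger0_norm ?divr_ge0 //; apply: le_dl.
have n00 : 0 <= n%:R :> R by exact: ler0n.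
have etad : eta * n%:R <= dl * n%:R by rewrite ler_wpM2r.
have [[-> mh]|[A [_ AK ->]]] := stoppedP (fun m => idx s (minn m (size s).-1)) m; last first.
 by apply: le_trans Kd; rewrite ler_nat.
set m' := minn m _; have m's : (m' < size s)%N.
 by rewrite /m' (leq_ltn_trans (geq_minr _ _)) // ltn_predL (leq_trans sz1).
have [ms|ms] := ltnP m' (size s0); last first.
 have m'1 : ((size s0).-1 <= m')%N by rewrite (leq_trans (leq_pred _)).
 case/orP: ps => /eqP ps; first by apply: le_trans etad; apply: H1 => //; rewrite m'1.
 have [A [/andP[A1 A2] AK AH]] := H3 ps.
 have [m'A|Am'] := ltnP m' A; first by apply: le_trans etad; apply: AH; rewrite m'1.
 move: Am'; rewrite leq_eqVlt => /orP[/eqP <-|Am']; first by apply: le_trans Kd; rewrite ler_nat.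
 have := mh A; rewrite (leq_trans Am' (geq_minl _ _)) (_ : (0 < A)%N); last first.
  apply: leq_trans A1; have := WNs; case: (size s0) => // q; rewrite ltnS; apply: leq_trans.
  by rewrite -W0; apply: (@leq_trans (W 1%N)); [exact: Wlt|exact: Wmono].
 have -> : minn A (size s).-1 = A.
  by apply/minn_idPl; rewrite -ltnS prednK // (leq_trans sz1).
 move=> /(_ isT).
 by rewrite ltnNge AK.
have m'1 : (W N <= m' < W N.+1)%N.
 rewrite WN ms andbT /m' leq_min m1 /= -ltnS prednK ?(leq_trans sz1) //.
 exact: leq_trans WNs sz.
have [r1 r2] := Wval N (leqnn _) m' m'1.
have zl : (W N <= (size s0).-1 < W N.+1)%N.
 by rewrite WN ltn_predL sz1 andbT; have := WNs; case: (size s0).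
have [q1 q2] := Wval N (leqnn _) _ zl.
have x1' : (0 < idx s0 (size s0).-1)%N by case/and3P: q1.
have x0 : (0 < idx s0 m')%N by case/and3P: r1.
rewrite ix // -ler_pdivrMr // -expR_lg //.
move: iz; rewrite -ler_pdivrMr // -expR_lg // => iz.
apply: le_trans zd; apply: le_trans (ler_wpM2r (expR_ge0 _) iz).
rewrite -expRD ler_expR.
move: r2 q2; rewrite !ler_norml => /andP[_ r2] /andP[q2 _].
by move: r2 q2; move: (lg _) (lg _) (psum v N) => A1 A2 A3 *; lra.
Qed.

End ChainPath.

(** * Lamperti transform of a càdlàg path and its discretisation *)

Section CadlagPath.
Variables (R : realType) (gamma : R) (g : R -> R).
Hypotheses (gamma_gt0 : 0 < gamma) (g_cadlag : cadlag g) (g_lim : g t @[t --> +oo] --> -oo).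

(* [0, x] has a finite partition into intervals on which [g] oscillates by at most [e]. *)
Inductive cells (e : R) : R -> Prop :=
| cells0 : cells e 0
| cellsS x y : cells e x -> x < y ->
  (forall s t, x <= s < y -> x <= t < y -> `|g s - g t| <= e) -> cells e y.

(** A supremum argument: the left limit shows that the supremum is attained, right continuity that
    one can go beyond it. *)
Lemma cells_exist (e M : R) : 0 < e -> 0 <= M -> cells e M.
Proof.
move=> e0 M0; have e2 : 0 < e / 2 by rewrite divr_gt0.
pose S : set R := [set x | 0 <= x <= M /\ cells e x].
have S0 : S 0 by split; [rewrite lexx M0|exact: cells0].
have hS : has_sup S by split; [exists 0|exists M => x [/andP[_ ?]]].
set c := sup S.
have c0 : 0 <= c by apply: sup_upper_bound.
have cM : c <= M by apply: ge_sup; [exists 0|move=> x [/andP[_ ?]]].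
have osc (l s t : R) : `|g s - l| <= e / 2 -> `|g t - l| <= e / 2 -> `|g s - g t| <= e.
 move=> h1 h2; rewrite (_ : _ - _ = (g s - l) - (g t - l)); last by ring.
 by apply: (le_trans (ler_normB _ _)); rewrite [leRHS](splitr e); exact: lerD.
have cS : cells e c.
 have [->|c_neq0] := eqVneq c 0; first exact: cells0.
 have cgt0 : 0 < c by rewrite lt_neqAle eq_sym c_neq0.
 have [_ /(_ c cgt0)/cvg_ex[l Hl]] := g_cadlag.
 have /cvgrPdist_le/(_ _ e2) [d /= d0 Hd] := Hl.
 have [x Sx xc] := sup_adherent d0 hS.
 have xc' : x <= c by exact: sup_upper_bound.
 move: xc'; rewrite le_eqVlt => /orP[/eqP <-|xc']; first by case: Sx.
 have Hd' s : x <= s < c -> `|g s - l| <= e / 2.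
  move=> /andP[s1 s2]; rewrite distrC; apply: Hd => //=.
  by rewrite ger0_norm ?subr_ge0 ?(ltW s2) //; move: xc s1; rewrite -/c; lra.
 apply: (cellsS (proj2 Sx) xc') => s t hs ht.
 by apply: (osc l); exact: Hd'.
suff -> : M = c by [].
apply/eqP; rewrite eq_le cM andbT leNgt; apply/negP => ltM.
have [/(_ c c0) + _] := g_cadlag => /cvgrPdist_le/(_ _ e2) [d /= d0 Hd].
pose y := Num.min M (c + d / 2).
have cy : c < y by rewrite /y lt_min ltM ltrDl divr_gt0.
have yd : y <= c + d / 2 by rewrite /y ge_min lexx orbT.
have Hd' s : c <= s < y -> `|g s - g c| <= e / 2.
 move=> /andP[]; rewrite le_eqVlt => /orP[/eqP <- _|s1 s2].
  by rewrite subrr normr0 ltW.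
 rewrite distrC; apply: Hd => //=; rewrite ler0_norm ?subr_le0 ?(ltW s1) //.
 by move: yd s2 d0; lra.
have Sy : S y.
 split; first by rewrite (le_trans c0 (ltW cy)) /= /y ge_min lexx.
 by apply: (cellsS cS cy) => s t hs ht; apply: (osc (g c)); exact: Hd'.
by have := sup_upper_bound hS Sy; rewrite leNgt cy.
Qed.

Lemma cells_partition (e M : R) : cells e M -> exists r (v : nat -> R), [/\ v 0%N = 0, v r = M,
 forall i, (i < r)%N -> v i < v i.+1 &
 forall i, (i < r)%N -> forall s t, v i <= s < v i.+1 -> v i <= t < v i.+1 -> `|g s - g t| <= e].
Proof.
elim=> [|x y _ [r [v [v0 vr vi vg]]] xy xyg]; first by exists 0%N, (fun=> 0).
exists r.+1, (fun i => if (i <= r)%N then v i else y); split.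
- by rewrite /= v0.
- by rewrite ltnn.
- move=> i ir; have ir' : (i <= r)%N by []; rewrite ir'.
 case: (ltnP i r) => [/vi //|ri]; have -> : i = r by apply/eqP; rewrite eqn_leq ir' ri.
 by rewrite vr.
move=> i ir; have ir' : (i <= r)%N by []; rewrite ir'.
case: (ltnP i r) => [/vg //|ri].
have -> : i = r by apply/eqP; rewrite eqn_leq ir' ri.
by rewrite vr.
Qed.

Lemma g_bounded (M : R) : 0 <= M -> exists B, forall t, 0 <= t < M -> `|g t| <= B.
Proof.
move=> M0; have := cells_exist ltr01 M0; elim=> [|x y _ [B HB] xy xyg].
 by exists 0 => t /andP[t0 t1]; have := le_lt_trans t0 t1; rewrite ltxx.
exists (Num.max B (`|g x| + 1)) => t /andP[t0 ty]; rewrite le_max.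
have [tx|xt] := ltP t x; first by rewrite HB // t0.
have h := xyg t x ltac:(by rewrite xt) ltac:(by rewrite lexx).
apply/orP; right; rewrite -lerBlDl; apply: le_trans h.
by apply: le_trans (lerB_dist _ _); rewrite lerD2l.
Qed.

Lemma g_ub : exists C, forall t, 0 <= t -> g t <= C.
Proof.
have /cvgrNyPle/(_ 0) [M0 [_ HM]] := g_lim.
pose M := Num.max 0 M0 + 1; have M00 : 0 <= M by rewrite addr_ge0 // le_max lexx.
have [B HB] := g_bounded M00.
exists (Num.max B 0) => t t0; rewrite le_max; have [tM|Mt] := ltP t M.
 by rewrite (le_trans (ler_norm _)) // HB // t0.
rewrite HM ?orbT //; apply: lt_le_trans Mt; rewrite /M ltr_pwDr //.
by rewrite le_max lexx orbT.
Qed.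

Let f (t : R) : R := expR (gamma * g t).
Let f_ge0 t : 0 <= f t. Proof. exact: expR_ge0. Qed.

(** By right continuity [f t] is the limit of the values of [f] at the next grid point of mesh
    [n.+1%:R^-1], taken strictly to the right of [t]. *)
Lemma measurable_f : measurable_fun (`[0, +oo[%classic : set R) f.
Proof.
pose tn (n : nat) (t : R) := Num.truncn (n.+1%:R * Num.max 0 t).
pose F n t := f ((tn n t).+1%:R / n.+1%:R).
apply: (@measurable_fun_cvg _ _ _ _ F).
 move=> n; apply: measurable_funTS.
 have mt q : measurable (tn n @^-1` [set q]).
  have mh : measurable_fun setT (fun t : R => n.+1%:R * Num.max 0 t).
   by apply: measurable_funM; [exact: measurable_cst|apply: measurable_maxr; [exact: measurable_cst|exact: measurable_id]].
  rewrite (_ : _ @^-1` _ = (fun t : R => n.+1%:R * Num.max 0 t) @^-1` `[q%:R, q.+1%:R[%classic).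
   by rewrite -[X in measurable X]setTI; exact: mh.
  apply/seteqP; split => x /=; rewrite in_itv /=; last exact: truncn_def.
  by move=> <-; apply: truncn_itv; rewrite mulr_ge0 // le_max lexx.
 move=> _ B mB; rewrite setTI.
 rewrite (_ : _ @^-1` _ = \bigcup_(q in [set q : nat | B (f (q.+1%:R / n.+1%:R))]) (tn n @^-1` [set q])).
  by apply: bigcup_measurable => q _; exact: mt.
 apply/seteqP; split => x /=; first by move=> Bx; exists (tn n x).
 by move=> [q Bq /= E]; rewrite /F E.
move=> t /=; rewrite in_itv /= andbT => t0.
have [/(_ t t0) gr _] := g_cadlag.
have tE n : tn n t = Num.truncn (n.+1%:R * t) by rewrite /tn (max_idPr t0).
have lt n : t < (tn n t).+1%:R / n.+1%:R.
 rewrite ltr_pdivlMr ?ltr0n // mulrC tE.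
 by have /andP[] := truncn_itv (mulr_ge0 (ler0n R n.+1) t0).
have le n : (tn n t).+1%:R / n.+1%:R <= t + n.+1%:R^-1.
 have /andP[h _] := truncn_itv (mulr_ge0 (ler0n R n.+1) t0).
 by rewrite tE -natr1 mulrDl mul1r lerD2r ler_pdivrMr ?ltr0n // [leRHS]mulrC.
have c1 : (tn n t).+1%:R / n.+1%:R @[n --> \oo] --> t.
 apply: (@squeeze_cvgr _ _ _ _ (fun=> t) (fun n => t + n.+1%:R^-1)).
 - by near=> n; rewrite le andbT ltW.
 - exact: cvg_cst.
 - by rewrite -[X in _ --> X]addr0; apply: cvgD; [exact: cvg_cst|exact: cvg_harmonic].
have c2 : g ((tn n t).+1%:R / n.+1%:R) @[n --> \oo] --> g t.
 apply/cvgrPdist_le => e e0; have /cvgrPdist_le/(_ e e0) [d /= d0 Hd] := gr.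
 have /cvgrPdist_lt/(_ d d0) c3 := c1.
 by near=> n; apply: Hd => //=; near: n.
apply: (@continuous_cvg _ _ _ _ _ _ (fun x => expR (gamma * x))) => //.
by apply: (@continuous_comp _ _ _ ( *%R gamma) expR); [apply: cvgMr; exact: cvg_id|exact: continuous_expR].
Unshelve. all: by end_near.
Qed.

Local Notation mu := (@lebesgue_measure R).
Local Notation A := (int_upto gamma g).

Lemma mf_sub (D : set R) : measurable D -> D `<=` `[0, +oo[%classic ->
 measurable_fun D (fun s => (f s)%:E).
Proof.
move=> mD DD; apply/measurable_EFinP; apply: (measurable_funS _ DD measurable_f) => //.
Qed.

Let sub (u v : R) : 0 <= u -> (`[u, v[%classic : set R) `<=` `[0, +oo[%classic.
Proof. by move=> u0 s /=; rewrite !in_itv /= andbT => /andP[us _]; exact: le_trans us. Qed.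

Lemma int_uptoD u v : 0 <= u -> u <= v -> A v = (A u + \int[mu]_(s in `[u, v[%classic) (f s)%:E)%E.
Proof.
move=> u0 uv; have v0 := le_trans u0 uv.
have E w : 0 <= w -> A w = (\int[mu]_(s in `[0%R, w[%classic) (f s)%:E)%E.
 move=> w0; rewrite /int_upto -integral_itv_bndo_bndc //.
 by apply: mf_sub => //; exact: sub.
rewrite !E // -ge0_integral_setU //.
- congr (integral _ _ _); apply/seteqP; split => s /=; rewrite !in_itv /=.
  move=> /andP[s0 sv]; have [su|us] := ltP s u; first by left; rewrite s0.
  by right; rewrite sv.
 by move=> [/andP[s0 su]|/andP[us sv]]; [rewrite s0 (lt_le_trans su)|rewrite (le_trans u0 us) sv].
- apply: mf_sub; first exact: measurableU.
 by rewrite subUset; split; apply: sub.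
- by move=> s _; rewrite lee_fin.
- rewrite disj_set2E; apply/eqP/seteqP; split => s //= []; rewrite !in_itv /=.
 by move=> /andP[_ su] /andP[us _]; have := lt_le_trans su us; rewrite ltxx.
Qed.

Lemma int_cell (c1 c2 u v : R) : 0 <= c1 -> 0 <= u -> u <= v ->
 (forall s, u <= s < v -> c1 <= f s <= c2) ->
 ((c1 * (v - u))%:E <= \int[mu]_(s in `[u, v[%classic) (f s)%:E <= (c2 * (v - u))%:E)%E.
Proof.
move=> c10 u0 uv H; have mD : measurable (`[u, v[%classic : set R) by [].
have E (c : R) : (\int[mu]_(s in `[u, v[%classic) (cst c%:E s) = (c * (v - u))%:E)%E.
 rewrite integral_cst // EFinM; congr (_ * _)%E.
 apply: etrans (lebesgue_measure_itv `[u, v[) _.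
 rewrite /= lte_fin; case: ltP => // vu.
 by have -> : v - u = 0 by apply/eqP; rewrite subr_eq0 eq_le uv vu.
have mf : measurable_fun `[u, v[%classic (fun s => (f s)%:E).
 by apply: mf_sub => //; apply: sub.
rewrite -!E; apply/andP; split; apply: ge0_le_integral => //.
- by move=> s /=; rewrite in_itv /= => /H/andP[h1 h2]; rewrite lee_fin.
- by move=> s _; rewrite lee_fin.
- by move=> s /=; rewrite in_itv /= => /H/andP[h1 h2]; rewrite lee_fin.
Qed.

Lemma int_upto0 : A 0 = 0%E.
Proof. by rewrite /int_upto set_itv1 integral_set1. Qed.

Definition Ar (u : R) : R := fine (A u).

Lemma f_ub : exists2 C, 0 < C & forall t, 0 <= t -> f t <= C.
Proof.
have [C HC] := g_ub; exists (expR (gamma * C)); first exact: expR_gt0.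
by move=> t t0; rewrite ler_expR ler_wpM2l ?(ltW gamma_gt0) // HC.
Qed.

Lemma int_uptoE u : 0 <= u -> A u = (Ar u)%:E.
Proof.
move=> u0; rewrite /Ar fineK //; have [C _ HC] := f_ub.
have -> : A u = (\int[mu]_(s in `[0%R, u[%classic) (f s)%:E)%E.
 by rewrite (int_uptoD (lexx 0) u0) int_upto0 add0e.
have := @int_cell 0 C 0 u (lexx _) (lexx _) u0 (fun s (h : 0 <= s < u) => ltac:(rewrite f_ge0 /=; apply: HC; by case/andP: h)).
move=> /andP[h1 h2]; rewrite ge0_fin_numE; first exact: le_lt_trans h2 (ltry _).
by apply: le_trans h1; rewrite mul0r.
Qed.

Lemma Ar_cell (c1 c2 u v : R) : 0 <= c1 -> 0 <= u -> u <= v ->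
 (forall s, u <= s < v -> c1 <= f s <= c2) -> c1 * (v - u) <= Ar v - Ar u <= c2 * (v - u).
Proof.
move=> c10 u0 uv H; have /andP[h1 h2] := int_cell c10 u0 uv H.
have := int_uptoD u0 uv; rewrite !int_uptoE ?(le_trans u0 uv) // => E.
have : (\int[mu]_(s in `[u, v[%classic) (f s)%:E)%E = (Ar v - Ar u)%:E.
 by rewrite EFinB E [X in (X - _)%E]addeC addeK.
by move=> E'; rewrite E' !lee_fin in h1 h2; rewrite h1 h2.
Qed.

Lemma Ar0 : Ar 0 = 0.
Proof. by rewrite /Ar int_upto0. Qed.

Lemma Ar_lt u v : 0 <= u -> u < v -> Ar u < Ar v.
Proof.
move=> u0 uv; have v0 : 0 <= v by exact: le_trans (ltW uv).
have [B HB] := g_bounded v0; have [C _ HC] := f_ub.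
have /andP[h _] := @Ar_cell (expR (gamma * - B)) C u v (expR_ge0 _) u0 (ltW uv) (fun s (h : u <= s < v) =>
 ltac:(move: h => /andP[h1 h2]; rewrite HC ?(le_trans u0 h1) // andbT ler_expR ler_wpM2l ?(ltW gamma_gt0) //;
  have := HB s ltac:(by rewrite (le_trans u0 h1) h2); by rewrite ler_norml => /andP[])).
by rewrite -subr_gt0; apply: lt_le_trans h; rewrite mulr_gt0 ?expR_gt0 // subr_gt0.
Qed.

Lemma Ar_le u v : 0 <= u -> u <= v -> Ar u <= Ar v.
Proof. by move=> u0; rewrite le_eqVlt => /orP[/eqP -> //|/(Ar_lt u0)/ltW]. Qed.

Lemma int_upto_le_I u : 0 <= u -> (A u <= I_infty gamma g)%E.
Proof.
move=> u0; apply: ge0_subset_integral => //.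
- exact: mf_sub.
- by move=> s /=; rewrite !in_itv /= => /andP[-> _].
Qed.

Lemma I_infty_cvg : A n%:R @[n --> \oo] --> I_infty gamma g.
Proof.
have := @ge0_nondecreasing_set_cvg_integral _ (measurableTypeR R) R (fun n : nat => (`[0, n%:R]%classic : set R)) (fun s => (f s)%:E) (@lebesgue_measure R).
rewrite (_ : \bigcup_i _ = `[0, +oo[%classic); last first.
 apply/seteqP; split => x /=; first by move=> [n _ /=]; rewrite !in_itv /= => /andP[-> _].
 rewrite in_itv /= andbT => x0; exists (Num.truncn x).+1 => //=; rewrite in_itv /= x0 /=.
 exact/ltW/truncnS_gt.
apply=> //.
- move=> m n mn; rewrite subsetEset; apply: subset_itv; rewrite bnd_simp //.
 by rewrite ler_nat.
- by move=> n; apply: mf_sub => //; apply: subset_itv; rewrite bnd_simp.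
- by move=> n x _; rewrite lee_fin.
Qed.

Lemma tau_cell a b t : 0 <= a -> a < b -> Ar a <= t < Ar b -> a <= tau gamma g t < b.
Proof.
move=> a0 ab /andP[t1 t2]; have b0 : 0 <= b by exact: le_trans (ltW ab).
have AE u : 0 <= u -> (t%:E < A u)%E = (t < Ar u) by move=> u0; rewrite int_uptoE // lte_fin.
have lba : lbound [set u | 0 <= u /\ (t%:E < A u)%E] a.
 move=> u /= [u0]; rewrite AE // => tu; rewrite leNgt; apply/negP => ua.
 by have := lt_le_trans tu (Ar_le u0 (ltW ua)); rewrite ltNge t1.
apply/andP; split; first by apply: lb_le_inf => //; exists b; split=> //; rewrite AE.
have [C C0 HC] := f_ub.
(* Since [f] is at most [C], going back from [b] by this amount loses at most half of [Ar b - t];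
   the clock has thus passed [t] strictly before [b]. *)
pose u := Num.max a (b - (Ar b - t) / (2 * C)).
have d0 : 0 < (Ar b - t) / (2 * C) by rewrite divr_gt0 ?subr_gt0 ?mulr_gt0.
have ub : u < b by rewrite /u gt_max ab ltrBlDr ltrDl.
have u0 : 0 <= u by rewrite le_max a0.
apply: le_lt_trans ub; apply: ge_inf; first by exists a.
split=> //; rewrite AE //.
have [ub|bu] := ltP u b; last first.
 by have := lt_le_trans t2 (Ar_le b0 bu).
have /andP[_ h] := @Ar_cell 0 C u b (lexx _) u0 (ltW ub) (fun s (h : u <= s < b) =>
 ltac:(move: h => /andP[h1 h2]; by rewrite f_ge0 HC // (le_trans u0 h1))).
have : b - u <= (Ar b - t) / (2 * C) by rewrite lerBlDr -lerBlDl le_max lexx orbT.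
rewrite -(ler_pM2l C0) => h'.
have : C * ((Ar b - t) / (2 * C)) = (Ar b - t) / 2 by field; rewrite gt_eqF.
by move=> E; rewrite E in h'; move: t2 h h'; lra.
Qed.

Lemma lamperti_cell a b t : 0 <= a -> a < b -> Ar a <= t < Ar b ->
 exists2 s, a <= s < b & lamperti gamma g t = expR (g s).
Proof.
move=> a0 ab tab; exists (tau gamma g t); first exact: tau_cell.
rewrite /lamperti ifT //; apply: lt_le_trans (int_upto_le_I (le_trans a0 (ltW ab))).
by rewrite int_uptoE ?(le_trans a0 (ltW ab)) // lte_fin; case/andP: tab.
Qed.

Lemma lamperti_tail a t : 0 <= a -> Ar a <= t ->
 lamperti gamma g t = 0 \/ exists2 s, a <= s & lamperti gamma g t = expR (g s).
Proof.
move=> a0 at_; case: (ltP t%:E (I_infty gamma g)) => [tI|It]; last first.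
 by left; rewrite /lamperti ltNge It.
right; have [N HN] : exists N : nat, (t%:E < A N%:R)%E.
 apply: contrapT => H; have : (I_infty gamma g <= t%:E)%E.
  apply: (@cvge_le _ _ _ _ _ _ _ _ I_infty_cvg); near=> n.
  by rewrite leNgt; apply/negP => lt; apply: H; exists n.
 by rewrite leNgt tI.
have aN : a < N%:R.
 rewrite ltNge; apply/negP => Na; move: HN; rewrite int_uptoE // lte_fin.
 by apply/negP; rewrite -leNgt; apply: le_trans at_; exact: Ar_le.
have [|s /andP[s1 _] ->] := @lamperti_cell a N%:R t a0 aN; last by exists s.
by rewrite at_ /=; move: HN; rewrite int_uptoE // lte_fin.
Unshelve. all: by end_near.
Qed.

Lemma nat_ceil (x : R) : 0 <= x -> exists j : nat, x <= j%:R < x + 1.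
Proof.
move=> x0; have /andP[t1 t2] := truncn_itv x0; rewrite -natr1 in t2.
move: t1; rewrite le_eqVlt => /orP[/eqP E|t1].
 by exists (Num.truncn x); rewrite E lexx ltrDl ltr01.
by exists (Num.truncn x).+1; rewrite -natr1 ltrD2r t1 andbT ltW.
Qed.

(** Counts the breakpoints of the partition in [(j h, (j + 1) h]]. The cells where the oscillation
    may be large are charged through it, at most [r.+1] times in total. *)
Definition nbreak (r : nat) (v : nat -> R) (h : R) (j : nat) : R :=
 \sum_(i < r.+1) (nat_of_bool (j%:R * h < v i <= j.+1%:R * h)%R)%:R.

Lemma sum_nbreak r v h N : 0 < h -> \sum_(j < N) nbreak r v h j <= r.+1%:R.
Proof.
move=> h0; rewrite /nbreak exchange_big /= -[X in _ <= X%:R]card_ord -sumr_const.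
apply: ler_sum => i _.
suff -> : \sum_(j < N) (nat_of_bool (j%:R * h < v i <= j.+1%:R * h)%R)%:R =
  (nat_of_bool (0 < v i <= N%:R * h)%R)%:R :> R.
 by rewrite lern1 leq_b1.
elim: N => [|N IH]; first by rewrite big_ord0 mul0r; case: ltP.
rewrite big_ord_recr /= IH; have Nh : 0 <= N%:R * h by rewrite mulr_ge0 // ltW.
have NN : N%:R * h <= N.+1%:R * h by rewrite ler_wpM2r ?(ltW h0) // ler_nat.
have [v0|v0] := ltP 0 (v i) => /=.
 have [vN|vN] := leP (v i) (N%:R * h) => /=; last by rewrite add0r.
 by rewrite (le_trans vN NN) addr0.
by rewrite add0r ltNge (le_trans v0 Nh).
Qed.

Lemma riemann_cell r v h M C e2 j : 0 < h -> (forall t, 0 <= t -> f t <= C) -> 0 <= e2 ->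
 v 0%N = 0 -> v r = M ->
 (forall i, (i < r)%N -> forall s t, v i <= s < v i.+1 -> v i <= t < v i.+1 -> `|f s - f t| <= e2) ->
 j%:R * h < M -> forall s, j%:R * h <= s <= j.+1%:R * h ->
 `|f s - f (j%:R * h)| <= e2 + C * nbreak r v h j.
Proof.
move=> h0 HC e20 v0 vr vf jM s /andP[s1 s2].
have jh0 : 0 <= j%:R * h by rewrite mulr_ge0 // ltW.
have C0 : 0 <= C by exact: le_trans (f_ge0 _) (HC 0 (lexx _)).
have nb0 : 0 <= nbreak r v h j by apply: sumr_ge0.
have [[i ir /andP[i1 i2]]|] := @find_seg R v r (j%:R * h) ltac:(by rewrite v0); last by rewrite vr leNgt jM.
have [si|is_] := ltP s (v i.+1).
 apply: (le_trans (vf i ir _ _ _ _)); rewrite ?i1 ?i2 ?si ?(le_trans i1 s1) //.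
 by rewrite lerDl mulr_ge0.
apply: (@le_trans _ _ C).
 have f1 := HC s (le_trans jh0 s1); have f2 := HC _ jh0.
 have := f_ge0 s; have := f_ge0 (j%:R * h).
 by rewrite ler_norml => *; apply/andP; split; lra.
apply: (@le_trans _ _ (C * nbreak r v h j)); last by rewrite lerDr.
rewrite ler_peMr // /nbreak (bigD1 (Ordinal (ir : (i.+1 < r.+1)%N))) //= i2 (le_trans is_ s2) lerDl.
exact: sumr_ge0.
Qed.

Hypothesis g0 : g 0 = 0.

(** [M] is a clock time after which $e^g$ stays below [e], and the mesh is refined for fixed [M]. An
    oscillation partition of $[0,M]$ is rounded to the grid: the two clocks differ at matched
    breakpoints by a Riemann sum error, and on matched segments both paths take values of $e^g$ on
    one partition interval. The order of the quantifiers in [M] and [q] is that of an iterated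
    limit. *)
Lemma lamperti_approx (e : R) : 0 < e -> exists M0 : nat, forall M : nat, (M0 <= M)%N -> (0 < M)%N ->
 exists q0 : nat, forall q : nat, (q0 <= q)%N -> (0 < q)%N -> forall s : seq R,
 (forall i, (i < M * q)%N -> nth 0 s i = g (i.+1%:R * q%:R^-1) - g (i%:R * q%:R^-1)) ->
 [/\ J1close e (stp gamma q%:R^-1 (M * q) s) (lamperti gamma g),
   J1close e (lamperti gamma g) (stp gamma q%:R^-1 (M * q) s),
   riem gamma q%:R^-1 (M * q) s <= e, expR (psum s (M * q)) <= e &
   exists m (v c : nat -> R), [/\ v 0%N = 0, forall i, (i < m)%N -> v i < v i.+1,
    forall i, (i < m)%N -> forall t, v i <= t < v i.+1 -> `|lamperti gamma g t - c i| <= e &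
    forall t, v m <= t -> `|lamperti gamma g t - c m| <= e]].
Proof.
move=> e0; have /cvgrNyPle/(_ (ln e)) [M1 [_ HM1]] := g_lim.
exists (Num.truncn (Num.max M1 0)).+1 => M M0M M0; have M1M : M1 < M%:R.
 apply: (@le_lt_trans _ _ (Num.max M1 0)); first by rewrite le_max lexx.
 by apply: lt_le_trans (truncnS_gt _) _; rewrite ler_nat.
have gM t : M%:R <= t -> expR (g t) <= e.
 by move=> Mt; rewrite -[leRHS]lnK // ler_expR; apply: HM1; exact: lt_le_trans Mt.
have [C1 HC1] := g_ub; have [C C0 HC] := f_ub.
have MR0 : 0 < M%:R :> R by rewrite ltr0n.
pose e2 := e / (4 * M%:R); have e20 : 0 < e2 by rewrite divr_gt0 // mulr_gt0.
(* Oscillation of [g] small enough to move $e^g$ by at most [e] and [f] by at most [e2]; over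
   $[0,M]$ the latter adds up to [e / 4]. *)
pose eg := Num.min (e / expR C1) (e2 / (expR (gamma * C1) * gamma)).
have gC0 : 0 < expR (gamma * C1) * gamma by rewrite mulr_gt0 // expR_gt0.
have eg0 : 0 < eg by rewrite lt_min; apply/andP; split; apply: divr_gt0 => //; exact: expR_gt0.
have [r [v [v0 vr vi vg]]] := cells_partition (cells_exist eg0 (ltW MR0)).
have v_ge0 i : (i <= r)%N -> 0 <= v i.
 elim: i => [|i IH] ir; first by rewrite v0.
 by apply: le_trans (IH (ltnW ir)) _; apply/ltW/vi.
have vf i : (i < r)%N -> forall x y, v i <= x < v i.+1 -> v i <= y < v i.+1 -> `|f x - f y| <= e2.
 move=> ir x y hx hy; have x0 : 0 <= x by case/andP: hx => + _; apply: le_trans; exact: v_ge0 (ltnW ir).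
 have y0 : 0 <= y by case/andP: hy => + _; apply: le_trans; exact: v_ge0 (ltnW ir).
 apply: (@le_trans _ _ (expR (gamma * C1) * `|gamma * g x - gamma * g y|)).
  by apply: expR_dist; rewrite ler_wpM2l ?(ltW gamma_gt0) // HC1.
 rewrite -mulrBr normrM (gtr0_norm gamma_gt0) mulrA -ler_pdivlMl //.
 by rewrite mulrC (le_trans (vg i ir x y hx hy)) // /eg ge_min lexx orbT.
have ve i : (i < r)%N -> forall x y, v i <= x < v i.+1 -> v i <= y < v i.+1 -> `|expR (g x) - expR (g y)| <= e.
 move=> ir x y hx hy; have x0 : 0 <= x by case/andP: hx => + _; apply: le_trans; exact: v_ge0 (ltnW ir).
 have y0 : 0 <= y by case/andP: hy => + _; apply: le_trans; exact: v_ge0 (ltnW ir).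
 apply: (@le_trans _ _ (expR C1 * `|g x - g y|)); first by apply: expR_dist; exact: HC1.
 by rewrite -ler_pdivlMl ?expR_gt0 // mulrC (le_trans (vg i ir x y hx hy)) // /eg ge_min lexx.
have [d0 d00 vd] : exists2 d0, 0 < d0 & forall i, (i < r)%N -> v i + d0 <= v i.+1.
 elim: (r) vi => [|k IH] vk; first by exists 1.
 have [|d d_gt0 Hd] := IH; first by move=> i ik; apply: vk; exact: ltnW.
 exists (Num.min d (v k.+1 - v k)); first by rewrite lt_min d_gt0 subr_gt0 vk.
 move=> i; rewrite ltnS leq_eqVlt -lerBrDl => /orP[/eqP ->|ik]; first by rewrite ge_min lexx orbT.
 by rewrite ge_min lerBrDl Hd.
(* The first term makes the mesh smaller than all gaps of the partition, the second makes the cells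
   containing a breakpoint contribute at most [e / 4] in total. *)
pose q1 := d0^-1 + 4 * C * r.+1%:R / e.
have q10 : 0 <= q1.
 apply: addr_ge0; first by rewrite invr_ge0 ltW.
 by apply: divr_ge0; [apply: mulr_ge0 => //; apply: mulr_ge0 => //; exact: ltW|exact: ltW].
exists (Num.truncn q1).+1 => q qq q_gt0 s sg; set h := q%:R^-1 in sg *.
have q1q : q1 <= q%:R by apply/ltW; apply: lt_le_trans (truncnS_gt _) _; rewrite ler_nat.
have qR0 : 0 < q%:R :> R by rewrite ltr0n.
have h0 : 0 < h by rewrite invr_gt0.
have hq : q%:R * h = 1 by rewrite mulfV // gt_eqF.
have hd : h <= d0.
 rewrite -[leRHS]invrK lef_pV2 ?posrE ?invr_gt0 //; apply: le_trans q1q.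
 by rewrite /q1 lerDl; apply: divr_ge0; [apply: mulr_ge0 => //; apply: mulr_ge0 => //; exact: ltW|exact: ltW].
have hC : h * (C * r.+1%:R) <= e / 4.
 rewrite /h ler_pdivrMl // mulrA ler_pdivlMr //.
 have : 4 * C * r.+1%:R / e <= q%:R.
  by apply: le_trans q1q; rewrite /q1 lerDr invr_ge0 ltW.
 by rewrite ler_pdivrMr // => H; rewrite (le_trans _ H) // le_eqVlt; apply/orP; left; apply/eqP; ring.
set N := (M * q)%N in sg *.
have Nh : N%:R * h = M%:R by rewrite /N natrM -mulrA hq mulr1.
have psE l : (l <= N)%N -> psum s l = g (l%:R * h).
 elim: l => [|l IH] lN; first by rewrite /psum big_ord0 mul0r g0.
 by rewrite psumS IH ?(ltnW lN) // sg //; ring.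
have raE l : (l <= N)%N -> rate gamma s l = f (l%:R * h) by move=> lN; rewrite /rate psE.
have e2M : M%:R * e2 = e / 4 by rewrite /e2; field; rewrite gt_eqF.
have osc j : (j < N)%N -> forall x, j%:R * h <= x <= j.+1%:R * h ->
  `|f x - f (j%:R * h)| <= e2 + C * nbreak r v h j.
 move=> jN; apply: (@riemann_cell r v h M%:R C e2 j) => //; first exact: ltW.
 by rewrite -Nh ltr_pM2r // ltr_nat.
have tot l : (l <= N)%N -> \sum_(j < l) h * (e2 + C * nbreak r v h j) <= e / 2.
 move=> lN; rewrite -mulr_sumr big_split /= sumr_const card_ord -mulr_sumr mulrDr.
 have -> : e / 2 = e / 4 + e / 4 by field.
 apply: lerD.
  rewrite -e2M -(mulr_natl e2 l) mulrA (mulrC h) ler_wpM2r ?(ltW e20) // -Nh.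
  by rewrite ler_wpM2r ?(ltW h0) // ler_nat.
 apply: le_trans hC; rewrite ler_wpM2l ?(ltW h0) // ler_wpM2l ?(ltW C0) //.
 exact: sum_nbreak.
have SA l : (l <= N)%N -> `|stime gamma h s l - Ar (l%:R * h)| <= \sum_(j < l) h * (e2 + C * nbreak r v h j).
 elim: l => [|l IH] lN; first by rewrite stime0 mul0r Ar0 subrr normr0 big_ord0.
 rewrite big_ord_recr /= stimeS raE ?(ltnW lN) //.
 set w := e2 + C * nbreak r v h l.
 have lh : l%:R * h <= l.+1%:R * h by rewrite ler_wpM2r ?(ltW h0) // ler_nat.
 have lh0 : 0 <= l%:R * h by rewrite mulr_ge0 // ltW.
 have cell x : l%:R * h <= x < l.+1%:R * h -> Num.max 0 (f (l%:R * h) - w) <= f x <= f (l%:R * h) + w.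
  move=> /andP[x1 x2]; have := osc l lN x ltac:(by rewrite x1 ltW).
  rewrite -/w ler_norml ge_max f_ge0 /= => /andP[z1 z2].
  by move: z1 z2; move: (f x) (f _) (w) => X Y Z *; apply/andP; split; lra.
 have := Ar_cell (_ : 0 <= Num.max 0 (f (l%:R * h) - w)) lh0 lh cell.
 rewrite le_max lexx => /(_ isT).
 have -> : l.+1%:R * h - l%:R * h = h by rewrite -natr1; ring.
 move=> /andP[a1 a2].
 have a3 : (f (l%:R * h) - w) * h <= Ar (l.+1%:R * h) - Ar (l%:R * h).
  by apply: le_trans a1; rewrite ler_wpM2r ?(ltW h0) // le_max lexx orbT.
 rewrite (_ : _ - _ = (stime gamma h s l - Ar (l%:R * h)) +
  (h * f (l%:R * h) - (Ar (l.+1%:R * h) - Ar (l%:R * h)))); last by ring.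
 apply: (le_trans (ler_normD _ _)); apply: lerD; first by apply: IH; exact: ltnW.
 rewrite ler_norml; move: a2 a3; rewrite mulrDl mulrBl !(mulrC _ h).
 by move: (h * f _) (h * w) (Ar _ - Ar _) => X Y Z *; apply/andP; split; lra.
(* Breakpoints are rounded up, so that the grid points of a segment lie to the right of its
   breakpoint, where [g] already has its new values. *)
have /choice[J HJ] : forall i, exists j : nat, (i <= r)%N -> v i * q%:R <= j%:R < v i * q%:R + 1.
 move=> i; have [ir|] := leqP i r; last by exists 0%N.
 by have [j Hj] := nat_ceil (mulr_ge0 (v_ge0 i ir) (ltW qR0)); exists j.
have HJ' i : (i <= r)%N -> v i <= (J i)%:R * h < v i + h.
 move=> /HJ; rewrite -(ler_pM2r h0) -(ltr_pM2r h0) mulrDl -mulrA hq mulr1 mul1r //.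
have Jlt i : (i < r)%N -> (J i < J i.+1)%N.
 move=> ir; rewrite -(ltr_nat R) -(ltr_pM2r h0).
 have /andP[_ j1] := HJ' i (ltnW ir); have /andP[j2 _] := HJ' i.+1 ir.
 by apply: lt_le_trans j1 _; apply: le_trans j2; apply: le_trans (vd i ir); rewrite lerD2l.
have J0 : J 0%N = 0%N.
 have /andP[_] := HJ 0%N (leq0n r); rewrite v0 mul0r add0r -[1]/(1%:R) ltr_nat ltnS leqn0 => /eqP //.
have Jr : J r = N.
 have := HJ r (leqnn r); rewrite vr -natrM natr1 ler_nat ltr_nat ltnS -eqn_leq => /eqP //.
have Jmono i : (i <= r)%N -> (J i <= N)%N.
 move=> ir; rewrite -Jr -(ler_nat R) -(ler_pM2r h0) Jr Nh.
 move: ir; rewrite leq_eqVlt => /orP[/eqP ->|ir]; first by rewrite Jr Nh.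
 have : forall k, (i.+1 <= k)%N -> (k <= r)%N -> (J i <= J k)%N.
  elim=> [//|k IH]; rewrite ltnS leq_eqVlt => /orP[/eqP <- kr|ik kr]; first exact/ltnW/Jlt.
  by apply: leq_trans (IH ik (ltnW kr)) _; exact/ltnW/Jlt.
 by move=> /(_ r ir (leqnn r)); rewrite Jr -Nh ler_pM2r // ler_nat.
pose u i := stime gamma h s (J i); pose V i := Ar (v i).
have uV i : (i <= r)%N -> `|u i - V i| <= e.
 move=> ir; have /andP[j1 j2] := HJ' i ir.
 rewrite (_ : _ - _ = (u i - Ar ((J i)%:R * h)) + (Ar ((J i)%:R * h) - V i)); last by ring.
 apply: (le_trans (ler_normD _ _)).
 have h1 := le_trans (SA _ (Jmono i ir)) (tot _ (Jmono i ir)).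
 have /andP[h2 h3] := @Ar_cell 0 C (v i) ((J i)%:R * h) (lexx _) (v_ge0 i ir) j1
  (fun x (hx : v i <= x < (J i)%:R * h) => ltac:(move: hx => /andP[x1 x2]; by rewrite f_ge0 HC // (le_trans (v_ge0 i ir)))).
 have h4 : C * ((J i)%:R * h - v i) <= e / 4.
  apply: le_trans hC; rewrite mulrA (mulrC h) -mulrA.
  rewrite ler_wpM2l ?(ltW C0) //; apply: (@le_trans _ _ h); first by rewrite lerBlDl ltW.
  by rewrite ler_peMr ?(ltW h0) // ler1n.
 rewrite [X in _ + X]ger0_norm; last by rewrite mul0r in h2.
 have {h2}h3 := le_trans h3 h4; apply: (le_trans (lerD h1 h3)).
 by rewrite -mulrDr ler_piMr ?(ltW e0) //; lra.
have ui i : (i < r)%N -> u i < u i.+1.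
 move=> ir; apply: lt_le_trans (stime_ltS gamma s (J i) h0) _.
 by apply: stime_le => //; exact: Jlt.
have Vi i : (i < r)%N -> V i < V i.+1 by move=> ir; apply: Ar_lt; [exact: v_ge0 (ltnW ir)|exact: vi].
have u0 : u 0%N = 0 by rewrite /u J0 stime0.
have V0 : V 0%N = 0 by rewrite /V v0 Ar0.
have seg i : (i < r)%N -> forall t x, u i <= t < u i.+1 -> V i <= x < V i.+1 ->
  `|stp gamma h N s t - lamperti gamma g x| <= e.
 move=> ir t x /andP[t1 t2] hx.
 have [y hy ->] := lamperti_cell (v_ge0 i (ltnW ir)) (vi i ir) hx.
 have [[k kJ kt]|] := @find_seg R (fun k => stime gamma h s (J i + k)) (J i.+1 - J i) t
   ltac:(by rewrite /= addn0); last first.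
  by rewrite subnKC ?(ltnW (Jlt i ir)) // leNgt t2.
 have jJ : (J i + k < J i.+1)%N by rewrite -ltn_subRL.
 have jN : (J i + k < N)%N by apply: leq_trans jJ (Jmono i.+1 ir).
 rewrite addnS in kt; rewrite (stp_seg h0 jN kt) psE ?(ltnW jN) //; apply: (ve i ir) => //.
 have /andP[j1 _] := HJ' i (ltnW ir); have /andP[_ j2] := HJ' i.+1 ir.
 apply/andP; split; first by apply: le_trans j1 _; rewrite ler_pM2r // ler_nat leq_addr.
 rewrite -(ltrD2r h); apply: le_lt_trans j2.
 by rewrite -[X in _ + X]mul1r -mulrDl natr1 ler_pM2r // ler_nat.
have last t x : u r <= t -> V r <= x -> `|stp gamma h N s t - lamperti gamma g x| <= e.
 rewrite /u Jr => tr xr; rewrite stp_last // sub0r normrN.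
 have [->|[y yM ->]] := lamperti_tail (v_ge0 r (leqnn r)) xr; first by rewrite normr0 ltW.
 by rewrite ger0_norm ?expR_ge0 // gM // -vr.
split.
- exact: (@matched_segments R r u V e).
- apply: (@matched_segments R r V u e) => //.
 + by move=> i ir; rewrite distrC; exact: uV.
 + by move=> i ir t x ht hx; rewrite distrC; exact: (seg i ir).
 + by move=> t x ht hx; rewrite distrC; exact: last.
- apply: (@le_trans _ _ (e / 2)); last by rewrite ler_pdivrMr // ler_peMr ?(ltW e0) // ler1n.
 apply: le_trans (tot N (leqnn N)); rewrite /riem; apply: ler_sum => l _.
 rewrite ler_wpM2l ?(ltW h0) // !raE ?(ltnW (ltn_ord l)) //; apply: osc => //.
 by rewrite lexx andbT ler_wpM2r ?(ltW h0) // ler_nat.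
- by rewrite psE // Nh gM.
exists r, V, (fun i => if (i < r)%N then expR (g (v i)) else 0); split => //.
 move=> i ir t /(lamperti_cell (v_ge0 i (ltnW ir)) (vi i ir))[y hy ->]; rewrite ir.
 by apply: (ve i ir) => //; rewrite lexx vi.
move=> t; rewrite ltnn subr0 => /(lamperti_tail (v_ge0 r (leqnn r)))[->|[y yM ->]].
 by rewrite normr0 ltW.
by rewrite ger0_norm ?expR_ge0 // gM // -vr.
Qed.

Lemma cadlag_lamperti : cadlag (lamperti gamma g).
Proof.
apply: cadlag_segments => e e0; have [M0 H] := lamperti_approx e0.
have [q0 {}H] := H M0.+1 (leqnSn _) isT.
have [|_ _ _ _ //] := H q0.+1 (leqnSn _) isT
 (mkseq (fun i => g (i.+1%:R * q0.+1%:R^-1) - g (i%:R * q0.+1%:R^-1)) (M0.+1 * q0.+1)).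
by move=> i iN; rewrite nth_mkseq.
Qed.

End CadlagPath.

(** * Truncations and exponential tails *)

Section Trunc.
Variable R : realType.
Implicit Types A D x : R.

Definition trunc A D x : R := Num.max (- A) (Num.min x D).

Lemma trunc_bounds A D x : 0 <= A -> 0 <= D -> - A <= trunc A D x <= D.
Proof.
move=> A0 D0; rewrite /trunc le_max lexx ge_max ge_min lexx orbT andbT /=; lra.
Qed.

Lemma trunc_norm A D x : 0 <= A -> 0 <= D -> `|trunc A D x| <= A + D.
Proof.
by move=> A0 D0; have /andP[h1 h2] := trunc_bounds x A0 D0; rewrite ler_norml; apply/andP; split; lra.
Qed.

Lemma bdd_trunc A D : 0 <= A -> 0 <= D -> bdd (trunc A D).
Proof. by move=> A0 D0; exists (A + D) => x; exact: trunc_norm. Qed.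

Lemma trunc_id A D x : - A <= x -> x <= D -> trunc A D x = x.
Proof. by move=> h1 h2; rewrite /trunc min_l // max_r. Qed.

Lemma continuous_trunc A D : continuous (trunc A D).
Proof.
move=> x; have := @continuous_max R R (cst (- A)) (fun y => Num.min y D) x.
apply; first exact: cvg_cst.
by have := @continuous_min R R id (cst D) x; apply; [exact: cvg_id|exact: cvg_cst].
Qed.

(** The integrand of (A3), capped at [D] so that it is bounded; the bounds derived from (A3) are
    uniform in [D]. *)
Definition tailB (beta D x : R) : R := expR (beta * Num.min x D) * (if 1 < x then 1 else 0).

Lemma tailB_ge0 beta D x : 0 <= tailB beta D x.
Proof. by rewrite mulr_ge0 ?expR_ge0 //; case: ifP. Qed.

Lemma bdd_tailB beta D : 0 <= beta -> bdd (tailB beta D).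
Proof.
move=> b0; exists (expR (beta * D)) => x; rewrite ger0_norm ?tailB_ge0 // /tailB.
apply: (@le_trans _ _ (expR (beta * Num.min x D))).
 by rewrite ler_piMr ?expR_ge0 //; case: ifP.
by rewrite ler_expR ler_wpM2l // ge_min lexx orbT.
Qed.

Lemma zeta1_gt1 x : 1 < `|x| -> zeta 1 x = 1.
Proof. by move=> x1; rewrite /zeta clamp_ge1 ?mul1r ?divr1 ?min_l //; lra. Qed.

Lemma sq1_ge1 x : `|x| <= 1 -> sq1 x = x ^+ 2.
Proof. by move=> x1; rewrite /sq1 x1 mulr1. Qed.

Lemma expR_taylor_trunc (t A D x : R) : 0 <= t -> 1 <= A -> 1 <= D ->
 expR (t * trunc A D x) - 1 <= t * trunc A D x +
  t ^+ 2 * ((A + D) ^+ 2 * expR (t * (A + D))) * (sq1 x + zeta 1 x).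
Proof.
move=> t0 A1 D1; set y := trunc A D x.
have A0 : 0 <= A by lra. have D0 : 0 <= D by lra.
have yn : `|y| <= A + D by exact: trunc_norm.
have z0 := @zeta01 R 1 x ltr01; have /andP[s0 s1] := sq1_bounded x.
have T := expR_taylor2 (t * y).
have AD1 : 1 <= A + D by lra.
have T2 : `|t * y| ^+ 2 * expR `|t * y| <= t ^+ 2 * ((A + D) ^+ 2 * expR (t * (A + D))) * (sq1 x + zeta 1 x).
 rewrite normrM (ger0_norm t0) exprMn -[leLHS]mulrA -[leRHS]mulrA ler_wpM2l ?sqr_ge0 //.
 have e1 : expR (t * `|y|) <= expR (t * (A + D)) by rewrite ler_expR ler_wpM2l.
 have y2 : `|y| ^+ 2 <= (A + D) ^+ 2 * (sq1 x + zeta 1 x).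
  have [x1|x1] := leP `|x| 1.
   have yE : y = x.
    by move: x1; rewrite ler_norml => /andP[x2 x3]; apply: trunc_id; lra.
   rewrite sq1_ge1 // yE real_normK ?num_real //.
   have AD2 : 1 <= (A + D) ^+ 2 by rewrite expr_ge1 //; lra.
   have /andP[z1 _] := z0; have x20 := sqr_ge0 x.
   apply: (@le_trans _ _ (1 * x ^+ 2)); first by rewrite mul1r.
   by apply: ler_pM => //; lra.
  rewrite zeta1_gt1 //; apply: (@le_trans _ _ ((A + D) ^+ 2 * 1)).
   by rewrite mulr1 lerXn2r ?nnegrE ?normr_ge0 //; lra.
  by rewrite ler_wpM2l ?sqr_ge0 // lerDr.
 rewrite [leRHS](_ : _ = ((A + D) ^+ 2 * (sq1 x + zeta 1 x)) * expR (t * (A + D))); last by ring.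
 by apply: ler_pM => //; rewrite ?sqr_ge0 ?expR_ge0.
by move: T; rewrite ler_norml => /andP[_ T]; rewrite -lerBlDl; exact: le_trans T T2.
Qed.

(** The factor [t] is kept in front because the bound competes with first-order terms as [t] tends
    to 0; the smallness comes from the exponential in [D]. A quarter of the exponent [beta] absorbs
    $e^{tm}$ and another quarter the linear factor $m-D$. *)
Lemma exp_tail_le (beta t D m : R) : 0 < beta -> 0 <= t -> t <= beta / 4 -> D <= m -> 0 <= D ->
 expR (t * m) - expR (t * D) <= t * (4 / beta * expR (- (beta * D / 2)) * expR (beta * m)).
Proof.
move=> b0 t0 tb Dm D0; have m0 : 0 <= m by exact: le_trans Dm.
have h1 : expR (t * m) - expR (t * D) <= expR (t * m) * (t * (m - D)).
 have := expR_dist (lexx (t * m)) (ler_wpM2l t0 Dm).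
 rewrite -mulrBr [X in _ <= _ * X]ger0_norm ?mulr_ge0 ?subr_ge0 //.
 exact: le_trans (ler_norm _).
apply: (le_trans h1); rewrite mulrCA ler_wpM2l //.
have h2 : m - D <= 4 / beta * expR (beta / 4 * (m - D)).
 have := expR_ge1Dx (beta / 4 * (m - D)) => h.
 rewrite -[leLHS](_ : 4 / beta * (beta / 4 * (m - D)) = _); last by field; rewrite gt_eqF.
 by rewrite ler_wpM2l ?divr_ge0 ?(ltW b0) //; lra.
have h3 : expR (t * m) <= expR (beta / 4 * m) by rewrite ler_expR ler_wpM2r.
apply: (@le_trans _ _ (expR (beta / 4 * m) * (4 / beta * expR (beta / 4 * (m - D))))).
 by apply: ler_pM => //; rewrite ?expR_ge0 ?subr_ge0.
rewrite mulrCA -[leRHS]mulrA ler_wpM2l ?divr_ge0 ?(ltW b0) // -!expRD ler_expR.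
by have := ler_wpM2l (ltW b0) Dm; have := mulr_ge0 (ltW b0) D0; lra.
Qed.

Lemma exp_trunc_le (beta t A D E x : R) : 0 < beta -> 0 <= t <= 1 -> t <= beta / 4 ->
 1 <= A -> 1 <= D -> D <= E ->
 expR (t * Num.min x E) - 1 <= (t * trunc A D x +
  t ^+ 2 * ((A + D) ^+ 2 * expR (A + D)) * (sq1 x + zeta 1 x)) +
  t * (4 / beta * expR (- (beta * D / 2))) * tailB beta E x.
Proof.
move=> b0 t01 tb A1 D1 DE; have /andP[t0 t1] := t01.
have AD : t * (A + D) <= A + D by rewrite ler_piMl //; lra.
have [/andP[z0 _] /andP[s0 _]] := (@zeta01 R 1 x ltr01, sq1_bounded x).
have T : expR (t * trunc A D x) - 1 <= t * trunc A D x +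
  t ^+ 2 * ((A + D) ^+ 2 * expR (A + D)) * (sq1 x + zeta 1 x).
 apply: (le_trans (expR_taylor_trunc x t0 A1 D1)).
 by rewrite lerD2l ler_wpM2r ?addr_ge0 // !ler_wpM2l ?sqr_ge0 // ler_expR.
have q0 : 0 <= t * (4 / beta * expR (- (beta * D / 2))).
 by rewrite mulr_ge0 // mulr_ge0 ?expR_ge0 // divr_ge0 // ltW.
have [xD|xD] := leP x D.
 apply: (@le_trans _ _ (expR (t * trunc A D x) - 1)).
  rewrite lerD2r ler_expR ler_wpM2l // /trunc (min_l xD) min_l ?le_max ?lexx ?orbT //.
  exact: le_trans DE.
 by rewrite (le_trans T) // lerDl mulr_ge0 ?tailB_ge0.
have tD : trunc A D x = D by rewrite /trunc min_r ?(ltW xD) // max_r //; lra.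
have mD : D <= Num.min x E by rewrite le_min (ltW xD).
have H := exp_tail_le b0 t0 tb mD ltac:(by lra).
rewrite (_ : _ - 1 = (expR (t * trunc A D x) - 1) + (expR (t * Num.min x E) - expR (t * D))); last first.
 by rewrite tD; ring.
apply: lerD => //; apply: (le_trans H).
by rewrite /tailB ifT ?mulr1 ?mulrA //; lra.
Qed.

End Trunc.

(** * Moments of the first increment of the chain *)

Section OneCell.
Variables (R : realType) (p : nat -> nat -> R).
Hypotheses (p_ge0 : forall n k, 0 <= p n k) (p_sum1 : sums_to_one p).
Variables (a : nat -> R) (n : nat) (h : R) (eps B cm : R).
Hypotheses (a_gt0 : forall n, 0 < a n) (n_gt0 : (0 < n)%N) (h_gt0 : 0 < h) (B_gt0 : 0 < B)
 (eps_ge : 2 * B <= eps) (cm_gt0 : 0 < cm).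
Local Notation lg := (lg R n).
Local Notation in_range := (in_range n (- B) B).
Local Notation alive := (alive n 1 (- B) B).
Local Notation good := (good n 1 (- B) B).
Local Notation rn s := (run a n h 1 eps (- B) B s).
Local Notation EN := (EN p).
Local Notation jump := (jump p).
Hypothesis c_le : forall x, in_range x -> (a x)^-1 <= cm.

Lemma never_bad s : (sph (rn s) <= 1)%N.
Proof.
elim: s => [//|x [//|y s] IH]; rewrite run_cons // /upd; case: ifP => // al.
have [/(_ al)[_ ph _] _] := run_compare a n h 1 eps (y :: s) (lexx B) eps_ge.
by rewrite /step ph /=; do ! case: ifP.
Qed.

Lemma one_cell s : last 0%N s = n ->
 ((sj (rn s) == 0%N) ==> (sy (rn s) == 0) && (sd (rn s) == [::])) &&
 (good (rn s) ==> (sd (rn s) == [:: lg (sx (rn s))])).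
Proof.
have lg0 : lg n = 0 by rewrite /Submission.lg subrr.
elim: s => [n0|x [|y s] IH ls]; first by move: n_gt0; rewrite -n0.
- by move: ls => /= ->; rewrite lg0 !eqxx /Submission.good.
rewrite (run_cons _ _ _ _ _ _ _ x (s := y :: s)) // /upd; move: (IH ls); move: (rn (y :: s)) => st; case: (boolP (alive st)) => // al.
have /and3P[j1 _ _] := al; have /eqP j0 : sj st == 0%N by case: (sj _) j1.
rewrite j0 eqxx /= => /andP[/andP[/eqP sy0 /eqP sd0] _].
by rewrite /step; do ! case: ifP => _; rewrite /Submission.good /= ?j0 ?sy0 ?sd0 ?subr0 ?eqxx ?implybT.
Qed.

(** Multiplied by $e^{-C\cdot\mathrm{clock}}$ the capped exponential of the position has nonpositive
    drift, and the clock of a single cell is at most [h + cm]. The condition [B <= D] leaves live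
    positions uncapped. *)
Lemma exp_moment (beta C D : R) k : 0 < beta -> 0 <= C -> B <= D ->
 (forall x, in_range x -> forall D, 0 <= D -> a x * jump x (expB beta D) <= C) ->
 EN k (fun s => expR (beta * Num.min (lg (sx (rn s))) D)) [:: n] <= expR (C * (h + cm)).
Proof.
move=> b0 C0 BD H.
have D0 : 0 <= D by apply: le_trans BD; exact: ltW.
pose v st := expR (beta * Num.min (lg (sx st)) D) * expR (- (C * mclock h cm st)).
have wf s := mwf_run eps a_gt0 h_gt0 c_le cm_gt0 s (ltn0Sn 0).
have hc : 0 <= h + cm by rewrite addr_ge0 // ltW.
have m0 s : 0 <= mclock h cm (rn s) := mclock_ge0 eps a_gt0 h_gt0 c_le cm_gt0 s (ltn0Sn 0).
have m1 s : mclock h cm (rn s) <= 1%:R * (h + cm) := mclock_le eps a_gt0 h_gt0 c_le cm_gt0 s (ltn0Sn 0).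
have bE : bdd (fun s => expR (beta * Num.min (lg (sx (rn s))) D)).
 exists (expR (beta * D)) => s; rewrite ger0_norm ?expR_ge0 // ler_expR ler_wpM2l ?(ltW b0) //.
 by rewrite ge_min lexx orbT.
have bv : bdd (fun s => v (rn s)).
 apply: bddM => //; exists 1 => s; rewrite ger0_norm ?expR_ge0 //.
 by rewrite -[leRHS]expR0 ler_expR oppr_le0 mulr_ge0.
have S : EN k (fun s => v (rn s)) [:: n] <= v (mstart R n n).
 apply: (machine_supermartingale p_ge0 p_sum1 a_gt0 n_gt0 h_gt0 c_le cm_gt0) => // st al wst.
 have rg := alive_range al; have /and3P[x0 l1 l2] := rg.
 set L := lg (sx st) in l1 l2 *.
 have LD : L <= D by exact: le_trans BD.
 pose m := mclock h cm st + (a (sx st))^-1.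
 have bx : bdd (fun x : nat => expB beta (D - L) (ln x%:R - ln (sx st)%:R)).
  exact/bdd_jump/bdd_expB/ltW.
 have le1 x : v (step a n h eps st x) <=
   expR (beta * L) * expR (- (C * m)) * (1 + expB beta (D - L) (ln x%:R - ln (sx st)%:R)).
  have sxE : sx (step a n h eps st x) = x by rewrite /step; do ! case: ifP.
  have mc := mclock_step eps c_le x al wst.
  rewrite /v sxE /expB [1 + _]addrC subrK.
  have -> : Num.min (lg x) D = L + Num.min (ln x%:R - ln (sx st)%:R) (D - L).
   by rewrite addr_minr subrKC (_ : L + _ = lg x) // /L /Submission.lg; ring.
  rewrite mulrDr expRD -!mulrA ler_wpM2l ?expR_ge0 // mulrC ler_wpM2r ?expR_ge0 //.
  by rewrite ler_expR lerN2 ler_wpM2l.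
 have bv' : bdd (fun x => v (step a n h eps st x)).
  apply: bddM.
   exists (expR (beta * D)) => s; rewrite ger0_norm ?expR_ge0 // ler_expR ler_wpM2l ?(ltW b0) //.
   by rewrite ge_min lexx orbT.
  exists 1 => s; rewrite ger0_norm ?expR_ge0 // -[leRHS]expR0 ler_expR oppr_le0 mulr_ge0 //.
  have := mclock_step eps c_le s al wst; apply: le_trans.
  by case: wst => [S0 _ _ _ _]; rewrite addr_ge0 ?invr_ge0 ?(ltW (a_gt0 _)) // addr_ge0 // mulr_ge0.
 have b1 : bdd (fun x : nat => 1 + expB beta (D - L) (ln x%:R - ln (sx st)%:R)).
  by apply: bddD => //; exact: bdd_cst.
 apply: (le_trans (av_le p_ge0 p_sum1 (sx st) bv' _ (fun x _ => le1 x))).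
  by apply: bddM => //; exact: bdd_cst.
 rewrite avZ // avD //; last exact: bdd_cst.
 rewrite av_cst // /v -/L (min_l LD) -mulrA ler_wpM2l ?expR_ge0 //.
 have h1 : 1 + av p (sx st) (fun x => expB beta (D - L) (ln x%:R - ln (sx st)%:R)) <= expR (C * (a (sx st))^-1).
  apply: le_trans (expR_ge1Dx _); rewrite lerD2l ler_pdivlMr // mulrC.
  by apply: H => //; rewrite subr_ge0.
 apply: (le_trans (ler_wpM2l (expR_ge0 _) h1)).
 by rewrite -expRD ler_expR /m mulrDr; lra.
have v0 : v (mstart R n n) = 1.
 by rewrite /v /mclock /= mul0r addr0 mulr0 oppr0 expR0 mulr1 /Submission.lg subrr min_l // mulr0 expR0.
rewrite v0 in S.
apply: (@le_trans _ _ (EN k (fun s => expR (C * (h + cm)) * v (rn s)) [:: n])).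
 apply: EN_le => //; first by apply: bddM => //; exact: bdd_cst.
 move=> s; rewrite /v mulrCA ler_peMr ?expR_ge0 // -expRD -[leLHS]expR0 ler_expR.
 by rewrite -mulrBr mulr_ge0 // subr_ge0 (le_trans (m1 s)) // mul1r.
by rewrite ENZ // -[leRHS]mulr1 ler_wpM2l ?expR_ge0.
Qed.

Lemma trunc_shift (A D D' L y : R) : - B <= L -> L <= B -> B + D <= D' ->
 L + trunc (A + B) D y <= trunc A D' (L + y).
Proof.
move=> L1 L2 BD; rewrite /trunc addr_maxr ge_max !le_max; apply/andP; split; first by apply/orP; left; lra.
by apply/orP; right; rewrite addr_minr le_min !ge_min lexx /=; apply/orP; right; lra.
Qed.

(** Around a live position in [[- B, B]], moving by a jump truncated to [[- (A + B), D]] stays below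
    the truncation of the new position to [[- A, D']]; so a lower bound on truncated jumps becomes
    one for the truncated position. *)
Lemma drift_moment (A D D' kappa : R) k : 0 <= kappa -> B <= A -> 0 <= D -> B + D <= D' ->
 (forall x, in_range x -> - kappa <= a x * jump x (trunc (A + B) D)) ->
 - (kappa * (h + cm)) <= EN k (fun s => trunc A D' (lg (sx (rn s)))) [:: n].
Proof.
move=> k0 BA D0 BD H.
have A0 : 0 <= A by apply: le_trans BA; exact: ltW.
have D'0 : 0 <= D' by apply: le_trans BD; rewrite addr_ge0 // ltW.
have AB0 : 0 <= A + B by rewrite addr_ge0 // ltW.
pose v st := (- 1) * trunc A D' (lg (sx st)) + - kappa * mclock h cm st.
have hc : 0 <= h + cm by rewrite addr_ge0 // ltW.
have m0 s : 0 <= mclock h cm (rn s) := mclock_ge0 eps a_gt0 h_gt0 c_le cm_gt0 s (ltn0Sn 0).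
have m1 s : mclock h cm (rn s) <= 1%:R * (h + cm) := mclock_le eps a_gt0 h_gt0 c_le cm_gt0 s (ltn0Sn 0).
have bT : bdd (fun s => trunc A D' (lg (sx (rn s)))).
 by exists (A + D') => s; exact: trunc_norm.
have bm : bdd (fun s => mclock h cm (rn s)).
 by exists (1 * (h + cm)) => s; rewrite ger0_norm.
have bZ T c (f : T -> R) : bdd f -> bdd (fun s => c * f s).
 by move=> bf; apply: bddM => //; exact: bdd_cst.
have bv : bdd (fun s => v (rn s)) by apply: bddD; exact: bZ.
have S : EN k (fun s => v (rn s)) [:: n] <= v (mstart R n n).
 apply: (machine_supermartingale p_ge0 p_sum1 a_gt0 n_gt0 h_gt0 c_le cm_gt0) => // st al wst.
 have rg := alive_range al; have /and3P[x0 l1 l2] := rg.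
 set L := lg (sx st) in l1 l2 *.
 pose m := mclock h cm st + (a (sx st))^-1.
 have LE : trunc A D' L = L by apply: trunc_id; [rewrite (le_trans _ l1) // lerN2|rewrite (le_trans l2) // (le_trans _ BD) // lerDl].
 have bx : bdd (fun x : nat => trunc (A + B) D (ln x%:R - ln (sx st)%:R)).
  exact/bdd_jump/bdd_trunc.
 have le1 x : v (step a n h eps st x) <=
   (- 1) * trunc (A + B) D (ln x%:R - ln (sx st)%:R) + (- L - kappa * m).
  have sxE : sx (step a n h eps st x) = x by rewrite /step; do ! case: ifP.
  have mc := mclock_step eps c_le x al wst.
  have T := trunc_shift A (ln x%:R - ln (sx st)%:R) l1 l2 BD.
  have E : L + (ln x%:R - ln (sx st)%:R) = lg x by rewrite /L /Submission.lg; ring.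
  rewrite E in T; rewrite /v sxE !mulN1r.
  have := ler_wpM2l k0 mc; rewrite -/m mulNr; move: T.
  by move: (trunc _ _ _) (trunc _ _ _) (kappa * _) (kappa * _) => *; lra.
 have bv' : bdd (fun x => v (step a n h eps st x)).
  apply: bddD; first by apply: bZ; exists (A + D') => s; exact: trunc_norm.
  apply: bZ; exists (1 * (h + cm) + (h + cm)) => s.
  have [S0 _ jN _ [Sm _]] := mwf_step eps a_gt0 h_gt0 c_le cm_gt0 s al wst.
  by rewrite ger0_norm /mclock ?addr_ge0 ?mulr_ge0 // lerD // ler_wpM2r // lern1.
 apply: (le_trans (av_le p_ge0 p_sum1 (sx st) bv' _ (fun x _ => le1 x))).
  by apply: bddD; [exact: bZ|exact: bdd_cst].
 rewrite avD ?av_cst //; [|exact: bZ|exact: bdd_cst].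
 rewrite avZ // /v -/L LE !mulN1r mulNr.
 have h1 : - (kappa * (a (sx st))^-1) <= av p (sx st) (fun x => trunc (A + B) D (ln x%:R - ln (sx st)%:R)).
  by rewrite -mulNr ler_pdivrMr // mulrC; exact: H.
 rewrite /m mulrDr; move: h1; move: (av _ _ _) (kappa * _) (kappa * _) => *; lra.
have v0 : v (mstart R n n) = 0.
 by rewrite /v /mclock /= mul0r addr0 mulr0 addr0 /Submission.lg subrr trunc_id ?mulr0 // oppr_le0.
rewrite v0 END ?ENZ // in S; [|exact: bZ|exact: bZ].
have m2 : EN k (fun s => mclock h cm (rn s)) [:: n] <= h + cm.
 rewrite -(EN_cst p_sum1 k (h + cm) [:: n]); apply: EN_le => //; first exact: bdd_cst.
 by move=> s; rewrite -[h + cm]mul1r.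
have := ler_wpM2l k0 m2; move: S; rewrite mulN1r mulNr.
by move: (kappa * _) (kappa * _) (EN _ _ _) => *; lra.
Qed.

End OneCell.

Lemma extends_last k s s' : s != [::] -> extends k s s' -> last 0%N s' = last 0%N s.
Proof.
elim: k s => [|k IH] s s0 /=; first by move=> ->.
by move=> [x x0 /IH ->] //; case: (s) s0.
Qed.

Lemma ub_nth (R : realType) N i : (i < N)%N -> unif_box (fun s : seq R => nth 0 s i) N.
Proof. by move=> iN B e B0 e0; exists e => // s t _ _ _ _; apply. Qed.

Lemma min_dist (R : realType) (x y c : R) : `|Num.min x c - Num.min y c| <= `|x - y|.
Proof.
have h1 := ler_norm (x - y); have h2 := ler_norm (y - x); rewrite distrC in h2.
by case: (leP x c) => hx; case: (leP y c) => hy; rewrite ler_norml; apply/andP; split; lra.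
Qed.

Lemma max_dist (R : realType) (x y c : R) : `|Num.max c x - Num.max c y| <= `|x - y|.
Proof.
have h1 := ler_norm (x - y); have h2 := ler_norm (y - x); rewrite distrC in h2.
by case: (leP c x) => hx; case: (leP c y) => hy; rewrite ler_norml; apply/andP; split; lra.
Qed.

Lemma le_expR (R : realType) (x : R) : x <= expR x.
Proof. by apply: le_trans (expR_ge1Dx x); rewrite lerDr. Qed.

Lemma exp_small (R : realType) (beta mu : R) : 0 < beta -> 0 < mu ->
 exists2 b0 : R, 0 < b0 & forall B, b0 <= B -> expR (- (beta * B)) <= mu.
Proof.
move=> h0 mu0; exists ((beta * mu)^-1) => [|B bB]; first by rewrite invr_gt0 mulr_gt0.
rewrite expRN -[leRHS]invrK lef_pV2 ?posrE ?expR_gt0 ?invr_gt0 //.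
apply: le_trans (le_expR _); apply: le_trans (ler_wpM2l (ltW h0) bB).
by rewrite invfM mulrA divff ?mul1r // gt_eqF.
Qed.

(** * The process restarted at a fixed time *)

Section Shift.
Context {R : realType} {d : measure_display} {T : measurableType d} (Q : probability T R).
Local Notation Ex f := (Rintegral Q setT f).
Implicit Types (f : R -> R) (xi : R -> T -> R).

Lemma cadlag_shift f m c : cadlag f -> 0 <= m -> cadlag (fun t => f (t + m) - c).
Proof.
move=> [fr fl] m0.
have sh (t : R) (P : R -> Prop) : (\forall z \near t + m, P z) -> \forall z \near t, P (z + m).
 move=> H; have : (fun z : R => z + m) z @[z --> t] --> t + m.
  by apply: cvgD; [exact: cvg_id|exact: cvg_cst].
 by move=> /(_ P H).
split=> t t0.
 apply: cvgB; last exact: cvg_cst.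
 move=> A fA; have H : \forall z \near t + m, t + m < z -> A (f z) := fr _ (addr_ge0 t0 m0) A fA.
 change (\forall z \near t, t < z -> A (f (z + m))).
 by apply: filterS (sh _ _ H) => z {}H tz; apply: H; rewrite ltrD2r.
have /cvg_ex[l fll] := fl (t + m) (ltr_wpDr m0 t0).
apply/cvg_ex; exists (l - c); apply: cvgB; last exact: cvg_cst.
move=> A fA; have H : \forall z \near t + m, z < t + m -> A (f z) := fll A fA.
change (\forall z \near t, z < t -> A (f (z + m))).
by apply: filterS (sh _ _ H) => z {}H tz; apply: H; rewrite ltrD2r.
Qed.

Lemma integral_Ex (f : T -> R) : bm f -> (\int[Q]_w (f w)%:E)%E = (Ex f)%:E.
Proof.
by move=> bf; rewrite /Rintegral fineK //; apply: integrable_fin_num => //; exact: bm_integrable.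
Qed.

Definition shift_path (m : R) xi : R -> T -> R := fun t w => xi (t + m) w - xi m w.

Lemma levy_shift (Pi : {measure set R -> \bar R}) (b sigma2 : R) xi m : 0 <= m ->
 levy_process Q b sigma2 Pi xi -> levy_process Q b sigma2 Pi (shift_path m xi).
Proof.
move=> m0 [mx [x0 cx] ind st cf].
have E s t w : shift_path m xi s w - shift_path m xi t w = xi (s + m) w - xi (t + m) w.
 by rewrite /shift_path; ring.
have law t B : 0 <= t -> measurable B ->
  Q [set w | shift_path m xi t w \in B] = Q [set w | xi t w \in B].
 by move=> t0 mB; exact: st.
have mxi t : measurable_fun setT (shift_path m xi t) by apply: measurable_funB.
split=> //.
- split; first by apply: aeW => w; rewrite /shift_path add0r subrr.
 by apply: filterS cx => w cw; have := cadlag_shift (xi m w) cw m0; exact.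
- move=> k t B t0 tS mB.
 have := ind k (fun j => t j + m) B ltac:(by rewrite addr_ge0) ltac:(by move=> j; rewrite lerD2r) mB.
 rewrite (_ : (fun j => [set w | _ \in B j]) =
  (fun j => [set w | shift_path m xi (t j.+1) w - shift_path m xi (t j) w \in B j])); last first.
  by apply/funext => j; apply/seteqP; split=> w /=; rewrite E.
 move=> ->; apply: eq_bigr => j _; congr (Q _).
 by apply/seteqP; split=> w /=; rewrite E.
- move=> s t B s0 t0 mB; rewrite law // -(st (s + m) t B (addr_ge0 s0 m0) t0 mB).
 by congr (Q _); apply/seteqP; split=> w /=; rewrite E addrA.
move=> t lam t0; have [h1 h2] := cf t lam t0.
have eqlaw (F : R -> R) : continuous F -> (forall x, `|F x| <= 1) ->
  (\int[Q]_w (F (shift_path m xi t w))%:E)%E = (\int[Q]_w (F (xi t w))%:E)%E.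
 move=> cF F1; have mF : measurable_fun setT F by exact: continuous_measurable_fun.
 have bY (Y : T -> R) : measurable_fun setT Y -> bm (fun w => F (Y w)).
  by move=> mY; split; [exact: measurableT_comp|exists 1].
 rewrite !integral_Ex; [|exact: bY..].
 (* Equality of laws is known on Borel sets; the product formula with a single factor turns it into
    equality of expectations. *)
 have := @Ex_prod _ _ _ Q 1 (fun=> shift_path m xi t) (xi t) (fun=> F) 1 ltac:(by []) ltac:(by []) ltac:(by []) (mx t).
 have -> : (fun w => \prod_(0 <= i < 1) F (shift_path m xi t w)) = (fun w => F (shift_path m xi t w)).
  by apply/funext => w; rewrite big_nat1.
 rewrite big_nat1 => -> // B mB; rewrite big_ord1 -(law t (B 0%N) t0 (mB 0%N)).
 congr (Q _); apply/seteqP; split=> w /=; first by move=> /(_ 0%N isT).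
 by move=> h [|].
split; [rewrite -h1|rewrite -h2].
 by apply: (eqlaw (fun x => cos (lam * x))) => [|x]; [exact: continuous_cosM|exact: cos_max].
by apply: (eqlaw (fun x => sin (lam * x))) => [|x]; [exact: continuous_sinM|exact: sin_max].
Qed.

Lemma eta_cons xi N h w : eta xi N.+1 h w = nth 0 (eta xi 1 h w) 0 :: eta (shift_path h xi) N h w.
Proof.
apply: (@eq_from_nth _ 0) => [|i]; first by rewrite size_mkseq [RHS]/= size_mkseq.
rewrite size_mkseq => iN; rewrite nth_eta //; case: i iN => [_|i iN] /=; first by [].
rewrite nth_eta // /shift_path.
have e1 : i.+2%:R * h = i.+1%:R * h + h by rewrite -[in LHS]natr1 mulrDl mul1r.
have e2 : i.+1%:R * h = i%:R * h + h by rewrite -[in LHS]natr1 mulrDl mul1r.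
by rewrite e1 e2; ring.
Qed.

End Shift.

(** * Lindley's recursion *)

Section Ladder.
Variable R : realType.
Implicit Types (s : seq R) (x y m A c : R).

(** The maximum of 0 and the partial sums of [s], computed by Lindley's recursion from the end of
    the list. Adding an increment in front gives the law of the maximum over one more step. *)
Fixpoint ladder s : R := if s is x :: s' then Num.max 0 (x + ladder s') else 0.

Lemma ladder_ge0 s : 0 <= ladder s.
Proof. by case: s => //= x s; rewrite le_max lexx. Qed.

Lemma ladder_psum s r : (forall l, (l <= size s)%N -> psum s l <= r) -> ladder s <= r.
Proof.
elim: s r => [|x s IH] r H /=; first by have := H 0%N isT; rewrite /psum big_ord0.
rewrite ge_max; apply/andP; split; first by have := H 0%N isT; rewrite /psum big_ord0.
rewrite -lerBrDl; apply: IH => l ls; rewrite lerBrDl.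
have := H l.+1 ls; rewrite /psum big_ord_recl /=; exact.
Qed.

Lemma ladder_dist N s t e : size s = N -> size t = N -> 0 <= e ->
 (forall i, (i < N)%N -> `|nth 0 s i - nth 0 t i| <= e) -> `|ladder s - ladder t| <= N%:R * e.
Proof.
move=> ss st e0; elim: N s t ss st => [|N IH] [|x s] [|y t] //=.
 by move=> *; rewrite subrr normr0 mul0r.
move=> [ss] [st] H; apply: (le_trans (max_dist _ _ _)).
rewrite (_ : _ - _ = (x - y) + (ladder s - ladder t)); last by ring.
apply: (le_trans (ler_normD _ _)); rewrite -nat1r mulrDl mul1r.
apply: lerD; first exact: (H 0%N).
by apply: IH => // i iN; exact: (H i.+1).
Qed.

Lemma ub_ladder N : unif_box ladder N.
Proof.
move=> B e B0 e0; exists (e / N.+1%:R) => [|s t ss st _ _ H]; first by rewrite divr_gt0.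
have d0 : 0 <= e / N.+1%:R by rewrite divr_ge0 // ltW.
apply: (le_trans (ladder_dist ss st d0 H)).
rewrite mulrCA ler_piMr ?(ltW e0) // ler_pdivrMr ?ltr0n // mul1r ler_nat //.
Qed.

(* The pathwise form of [E (M' + X)^+ - E M' >= E X + E (M' + X)^-] with truncations. *)
Lemma lindley_gain x m A y c : 0 <= m -> 0 <= y -> y + 1 <= A -> y <= A / 2 -> 0 <= c ->
 trunc A (A / 2) x - (c * (A / 2 < m)%R%:R + Num.min (Num.max 0 (x - c)) (A / 2)) +
  (1 - (y < m)%R%:R - (- y - 1 <= x)%R%:R) <=
 Num.min (Num.max 0 (x + m)) A - Num.min m A.
Proof.
move=> m0 y0 yA y2 c0; have A0 : 0 <= A by lra.
set M := Num.min (Num.max 0 (x - c)) (A / 2).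
set P := Num.min (Num.max 0 (x + m)) A; set k := Num.min m A; set t := trunc A (A / 2) x.
have M0 : 0 <= M by rewrite /M le_min le_max lexx /=; lra.
have P0 : 0 <= P by rewrite /P le_min le_max lexx.
have km : k <= m by rewrite /k ge_min lexx.
have kA : k <= A by rewrite /k ge_min lexx orbT.
have xP z : z <= x + m -> z <= A -> z <= P by move=> h1 h2; rewrite /P le_min le_max h1 h2 orbT.
have mx : Num.min x (A / 2) <= x by rewrite ge_min lexx.
have mA2 : Num.min x (A / 2) <= A / 2 by rewrite ge_min lexx orbT.
have tle z : - A <= z -> Num.min x (A / 2) <= z -> t <= z.
 by move=> h1 h2; rewrite /t /trunc ge_max h1 h2.
have tr1 : 0 <= x -> t <= c + M.
 move=> x0; apply: tle; first by lra.
 rewrite -lerBlDl /M le_min le_max; apply/andP; split; last by lra.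
 by apply/orP; right; lra.
have base : m <= A / 2 -> t <= P - k.
 by move=> mA; apply: tle; [lra|rewrite lerBrDr; apply: xP; lra].
have big : x < 0 -> t <= P - k.
 by move=> x0; apply: tle; [lra|rewrite lerBrDr; apply: xP; lra].
have pos : 0 <= x -> 0 <= P - k by move=> x0; rewrite subr_ge0; apply: xP; lra.
have far : m <= y -> x < - y - 1 -> t + 1 <= P - k.
 by move=> my xy; rewrite -lerBrDr; apply: tle; lra.
clearbody M P k t.
case: (leP m (A / 2)) => mA.
 rewrite mulr0 add0r; have b := base mA.
 case: (leP m y) => my; case: (leP (- y - 1) x) => xy /=; rewrite ?subr0 ?subrr ?addr0.
 - lra.
 - by have := far my xy; lra.
 - lra.
 - lra.
have ym : y < m by lra.
rewrite ym /= mulr1 subrr; have [x0|x0] := leP 0 x.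
 by have := tr1 x0; have := pos x0; case: (leP (- y - 1) x) => _ /=; rewrite ?subr0; lra.
by have := big x0; case: (leP (- y - 1) x) => _ /=; rewrite ?subr0; lra.
Qed.

End Ladder.

(** * Drift to minus infinity excludes a nonnegative truncated mean *)

Section Lindley.
Context {R : realType} {d : measure_display} {T : measurableType d} (Q : probability T R).

Lemma dec_small (E : nat -> set T) : (forall n, measurable (E n)) -> (forall n, E n.+1 `<=` E n) ->
 {ae Q, forall w, exists n, ~ E n w} -> forall e : R, 0 < e -> exists n, fine (Q (E n)) <= e.
Proof.
move=> mE dE aeE e e0.
have mI : measurable (\bigcap_n E n) by exact: bigcap_measurableType.
have I0 : Q (\bigcap_n E n) = 0%E.
 apply/measure_negligible => //; apply: negligibleS aeE => w wE /= [n nE].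
 by apply: nE; apply: wE.
have nE : nonincreasing_seq E.
 apply/nonincreasing_seqP => n; exact/subsetPset.
have fin n : (Q (E n) \is a fin_num) by rewrite fin_num_measure.
have Q0 : (Q (E 0%N) < +oo)%E by rewrite ltey_eq fin.
have : (Q \o E) x @[x --> \oo] --> 0%E by rewrite -I0; exact: nonincreasing_cvg_mu.
move=> /fine_cvgP[_] /cvgrPdist_le/(_ _ e0)[n _ /(_ n (leqnn _)) H].
exists n; move: H; rewrite /= sub0r normrN; exact: le_trans (ler_norm _).
Qed.

Variable xi : R -> T -> R.
Hypotheses (mxi : forall t, measurable_fun setT (xi t)) (xi_drift : drifts_to_minus_infty Q xi).

Lemma psum_eta N h w l : (l <= N)%N -> psum (eta xi N h w) l = xi (l%:R * h) w - xi (0%:R * h) w.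
Proof.
elim: l => [|l IH] lN; first by rewrite /psum big_ord0 subrr.
by rewrite psumS IH ?(ltnW lN) // nth_eta //; ring.
Qed.

Lemma measurable_gt (f : T -> R) (c : R) : measurable_fun setT f -> measurable [set w | c < f w].
Proof.
move=> mf; have := @measurable_pre _ _ _ f `]c, +oo[%classic mf (measurable_itv _).
by congr (measurable _); apply/seteqP; split=> w /=; rewrite in_itv /= andbT.
Qed.

Lemma measurable_ge (f : T -> R) (c : R) : measurable_fun setT f -> measurable [set w | c <= f w].
Proof.
move=> mf; have := @measurable_pre _ _ _ f `[c, +oo[%classic mf (measurable_itv _).
by congr (measurable _); apply/seteqP; split=> w /=; rewrite in_itv /= andbT.
Qed.

Let X (j : nat) w := xi j%:R w - xi 0 w.

Let mX j : measurable_fun setT (X j). Proof. by apply: measurable_funB. Qed.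

Lemma drift_nat : {ae Q, forall w, forall c, \forall j \near \oo, X j w < c}.
Proof.
apply: filterS xi_drift => w dw c.
have H : \forall t \near +oo, xi t w < c + xi 0 w.
 by move: dw => /cvgrNy_lt; apply.
have cj : (fun j : nat => j%:R : R) @ \oo --> +oo by exact: cvgr_idn.
have K : \forall j \near \oo, xi j%:R w < c + xi 0 w := cj _ H.
by apply: filterS K => j; rewrite /X ltrBlDr.
Qed.

Lemma sup_small (e : R) : 0 < e -> exists r : nat,
 fine (Q (\bigcup_j [set w | r%:R < X j w])) <= e.
Proof.
move=> e0; apply: (dec_small (E := fun r : nat => \bigcup_j [set w | r%:R < X j w])) => //.
- by move=> r; apply: bigcup_measurable => j _; exact: measurable_gt.
- by move=> r w [j _ /= h]; exists j => //=; apply: lt_trans h; rewrite ltr_nat.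
apply: filterS drift_nat => w dw; have [J _ HJ] := dw 0.
have [r Hr] : exists r : nat, forall j, (j < J)%N -> X j w <= r%:R.
 elim: J {HJ} => [|J [r IH]]; first by exists 0%N.
 have [r' _ /(_ r' (leqnn _)) H'] := near_natge (X J w).
 exists (maxn r r') => j; rewrite ltnS leq_eqVlt => /orP[/eqP ->|jJ].
  by rewrite (le_trans H') // ler_nat leq_maxr.
 by rewrite (le_trans (IH j jJ)) // ler_nat leq_maxl.
exists r => -[j _ /=]; apply/negP; rewrite -leNgt.
have [jJ|Jj] := ltnP j J; first exact: Hr.
by apply: (@le_trans _ _ 0); [exact/ltW/HJ|exact: ler0n].
Qed.

Lemma low_small (c e : R) : 0 < e -> exists2 m : nat, (0 < m)%N &
 fine (Q [set w | c <= X m w]) <= e.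
Proof.
move=> e0.
pose E (r : nat) := \bigcup_(j in [set j | (r <= j)%N]) [set w | c <= X j w].
have mE r : measurable (E r) by apply: bigcup_measurable => j _; exact: measurable_ge.
have [||r Hr] := dec_small (E := E) mE _ _ e0.
- by move=> r w [j /= rj h]; exists j => //=; exact: ltnW.
- apply: filterS drift_nat => w dw; have [J _ HJ] := dw c.
 exists J => -[j /= Jj]; apply/negP; rewrite -ltNge; exact: HJ.
exists r.+1 => //; apply: le_trans Hr; apply: fine_le; rewrite ?fin_num_measure //.
 exact: measurable_ge.
apply: le_measure; rewrite ?inE //; first exact: measurable_ge.
by move=> w /= h; exists r.+1 => //=.
Qed.

End Lindley.

Section LindleyBound.
Context {R : realType} {d : measure_display} {T : measurableType d} (Q : probability T R).
Local Notation Ex f := (Rintegral Q setT f).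
Variable xi : R -> T -> R.
Hypotheses (mxi : forall t, measurable_fun setT (xi t)) (xi_drift : drifts_to_minus_infty Q xi).
Hypothesis law_shift : forall N h (g : seq R -> R) C, 0 < h -> (forall s, `|g s| <= C) ->
 unif_box g N.+1 -> Ex (fun w => g (eta xi N.+1 h w)) = Ex (fun w => g (eta (shift_path h xi) N.+1 h w)).
Variables (beta : R) (Ct : R -> R).
Hypotheses (beta_gt0 : 0 < beta) (Ct_ge0 : forall t, 0 <= Ct t).
Hypothesis exp_bound : forall t c D0, 0 < t -> 0 <= c -> 0 <= D0 ->
 Ex (fun w => Num.min (Num.max 0 (nth 0 (eta xi 1 t w) 0 - c)) D0) <= Ct t * expR (- (beta * c)).
Hypothesis mean_bound : forall t A D0, 0 < t -> 0 <= A -> 0 <= D0 ->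
 - (Ct t * expR (- (beta * D0))) <= Ex (fun w => trunc A D0 (nth 0 (eta xi 1 t w) 0)).

Lemma measurable_ladder N h (zeta : R -> T -> R) : (forall t, measurable_fun setT (zeta t)) ->
 measurable_fun setT (fun w => ladder (eta zeta N h w)).
Proof.
elim: N zeta => [|N IH] zeta mz; first exact: measurable_cst.
rewrite (_ : (fun w => _) = (fun w => Num.max 0 (nth 0 (eta zeta 1 h w) 0 + ladder (eta (shift_path h zeta) N h w)))).
 apply: measurable_maxr; first exact: measurable_cst.
 apply: measurable_funD; first by apply: measurable_funB.
 by apply: IH => t; apply: measurable_funB.
by apply/funext => w; rewrite eta_cons.
Qed.

Lemma ub_comp_lip N (f : R -> R) (g : seq R -> R) : (forall x y, `|f x - f y| <= `|x - y|) ->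
 unif_box g N -> unif_box (fun s => f (g s)) N.
Proof. by move=> fl; apply: (@ub_lip _ _ 1) => // x y; rewrite mul1r. Qed.

(** The maximum over multiples of [m] is below the supremum over all integers, which is finite
    almost surely; hence uniformity in [m] and [n]. A clamp stands between the two indicators
    because equality of laws is available for uniformly continuous functionals. *)
Lemma ladder_tail (e : R) : 0 < e -> exists r : nat, forall (m n : nat), (0 < m)%N ->
 fine (Q [set w | r.+1%:R < ladder (eta (shift_path m%:R xi) n.+1 m%:R w)]) <= e.
Proof.
move=> e0; have [r Hr] := sup_small mxi xi_drift e0; exists r => m n m0.
have m0' : 0 < m%:R :> R by rewrite ltr0n.
set M' := fun w => ladder (eta (shift_path m%:R xi) n.+1 m%:R w).
set M := fun w => ladder (eta xi n.+1 m%:R w).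
have mM' : measurable_fun setT M' by apply: measurable_ladder => t; apply: measurable_funB.
have mM : measurable_fun setT M by apply: measurable_ladder.
have bc (f : T -> R) : measurable_fun setT f -> bm (fun w => clamp (f w - r%:R)).
 move=> mf; split; last by exists 1 => w; have /andP[? ?] := clamp01 (f w - r%:R); rewrite ger0_norm.
 apply: (@measurableT_comp _ _ _ _ _ _ (fun x : R => clamp (x - r%:R))); last exact: mf.
 apply: continuous_measurable_fun; apply: (@continuous_clamp_comp _ (fun x => x - r%:R)) => x.
 by apply: cvgB; [exact: cvg_id|exact: cvg_cst].
have mS : measurable [set w | r.+1%:R < M' w] by exact: measurable_gt.
have mS2 : measurable [set w | r%:R < M w] by exact: measurable_gt.
apply: (@le_trans _ _ (Ex (fun w => clamp (M' w - r%:R)))).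
 rewrite -Ex_indic //; apply: Ex_le; [exact: bm_indic|exact: bc|] => w.
 rewrite indicE; case: (boolP (w \in _)) => [|_]; last by have /andP[] := clamp01 (M' w - r%:R).
 by rewrite inE /= => h; rewrite clamp_ge1 // lerBrDl natr1 ltW.
have <- : Ex (fun w => clamp (M w - r%:R)) = Ex (fun w => clamp (M' w - r%:R)).
 apply: (law_shift (g := fun s => clamp (ladder s - r%:R)) (C := 1)) => //.
  by move=> s; have /andP[? ?] := clamp01 (ladder s - r%:R); rewrite ger0_norm.
 apply: (@ub_comp_lip _ (fun x => clamp (x - r%:R))); last exact: ub_ladder.
 move=> x y; have := clamp_lip (x - r%:R) (y - r%:R).
 by rewrite mul1r (_ : x - r%:R - (y - r%:R) = x - y) //; ring.
apply: le_trans Hr; set E := \bigcup_j _.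
have mE : measurable E.
 by apply: bigcup_measurable => j _; apply: measurable_gt; apply: measurable_funB.
rewrite -Ex_indic //; apply: Ex_le; [exact: bc|exact: bm_indic|] => w.
rewrite indicE; case: (boolP (w \in _)) => [_|nE]; first by have /andP[] := clamp01 (M w - r%:R).
rewrite clamp_le0 // subr_le0; apply: ladder_psum => l; rewrite size_mkseq => ln.
rewrite psum_eta // leNgt; apply: contra nE => h; rewrite inE /E.
by exists (l * m)%N => //=; move: h; rewrite mul0r natrM.
Qed.

(** With a time step [t] so long that the increment is below [- y - 1] with probability at least
    $3/4$, every Lindley step would raise the truncated mean of the maximum by at least $1/4$: the
    truncated mean of the increment is almost nonnegative, and the recursion gains whenever the
    maximum is reset to 0. But this mean never exceeds [A]. *)
Lemma lindley_absurd : False.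
Proof.
have q4 : 0 < 4^-1 :> R by rewrite invr_gt0.
have q16 : 0 < 16^-1 :> R by rewrite invr_gt0.
have [y0 Hy] := ladder_tail q4; set y : R := y0.+1%:R.
have y_ge0 : 0 <= y by exact: ler0n.
have [m m0 Hm] := low_small mxi xi_drift (- y - 1) q4.
pose t : R := m%:R; have t0 : 0 < t by rewrite ltr0n.
have K1 : 0 < Ct t + 1 by rewrite ltr_wpDl.
have [c c_gt0 Hc] := exp_small beta_gt0 (divr_gt0 q16 K1).
have c1 : 0 < c + 1 by rewrite ltr_wpDl // ltW.
have [r1 Hr1] := ladder_tail (divr_gt0 q16 c1).
(* Half of [A] exceeds [y + 1], [c], and a level above which the maximum lies with probability at
   most $1/(16(c+1))$. *)
pose A : R := 2 * (y + 1 + c + r1.+1%:R).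
have r1_ge0 : 0 <= r1.+1%:R :> R by exact: ler0n.
have A2 : A / 2 = y + 1 + c + r1.+1%:R by rewrite /A; field.
have A0 : 0 <= A by rewrite /A mulr_ge0 // !addr_ge0 // ltW.
have A20 : 0 <= A / 2 by rewrite divr_ge0.
have small z : c <= z -> Ct t * expR (- (beta * z)) <= 16^-1.
 move=> /Hc h; apply: (@le_trans _ _ ((Ct t + 1) * expR (- (beta * z)))).
  by rewrite ler_wpM2r ?expR_ge0 // lerDl.
 by rewrite mulrC -ler_pdivlMr.
pose u n := Ex (fun w => Num.min (ladder (eta xi n.+1 t w)) A).
have lip x1 x2 : `|Num.min x1 A - Num.min x2 A| <= `|x1 - x2| by exact: min_dist.
have bmin (f : T -> R) : measurable_fun setT f -> (forall w, 0 <= f w) -> bm (fun w => Num.min (f w) A).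
 move=> mf f0; split; last first.
  by exists A => w; rewrite ger0_norm ?ge_min ?lexx ?orbT // le_min f0.
 by apply: measurable_minr => //; exact: measurable_cst.
have uA n : u n <= A.
 rewrite -[leRHS](Ex_cst Q); apply: Ex_le; [|exact: bm_cst|by move=> w; rewrite ge_min lexx orbT].
 by apply: bmin => [|w]; [exact: measurable_ladder|exact: ladder_ge0].
(* The gain is at least $1-1/4-1/4$, and the three errors (truncated mean, excess over [c], large
   maximum) are at most $1/16$ each. *)
have stepu n : u n + 4^-1 <= u n.+1.
 pose M' w := ladder (eta (shift_path t xi) n.+1 t w).
 pose Z w := nth 0 (eta xi 1 t w) 0.
 have mM' : measurable_fun setT M' by apply: measurable_ladder => s; apply: measurable_funB.
 have mZ : measurable_fun setT Z by apply: measurable_funB.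
 have M'0 w : 0 <= M' w by exact: ladder_ge0.
 have E1 : u n.+1 = Ex (fun w => Num.min (Num.max 0 (Z w + M' w)) A).
  by congr Rintegral; apply/funext => w; rewrite eta_cons.
 have E0 : u n = Ex (fun w => Num.min (M' w) A).
  apply: (law_shift (g := fun s => Num.min (ladder s) A) (C := A)) => //.
   by move=> s; rewrite ger0_norm ?ge_min ?lexx ?orbT // le_min ladder_ge0.
  by apply: (@ub_comp_lip _ (fun x => Num.min x A)) => //; exact: ub_ladder.
 have b1 : bm (fun w => Num.min (Num.max 0 (Z w + M' w)) A).
  apply: bmin => [|w]; last by rewrite le_max lexx.
  by apply: measurable_maxr; [exact: measurable_cst|exact: measurable_funD].
 have b0 : bm (fun w => Num.min (M' w) A) by exact: bmin.
 pose S1 := [set w | y < M' w]; pose S2 := [set w | A / 2 < M' w]; pose S3 := [set w | - y - 1 <= Z w].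
 have mS1 : measurable S1 by exact: measurable_gt.
 have mS2 : measurable S2 by exact: measurable_gt.
 have mS3 : measurable S3 by exact: measurable_ge.
 have bt : bm (fun w => trunc A (A / 2) (Z w)).
  split; last by exists (A + A / 2) => w; exact: trunc_norm.
  apply: (@measurableT_comp _ _ _ _ _ _ (trunc A (A / 2))); last exact: mZ.
  by apply: continuous_measurable_fun; exact: continuous_trunc.
 have be : bm (fun w => Num.min (Num.max 0 (Z w - c)) (A / 2)).
  split.
   apply: measurable_minr; last exact: measurable_cst.
   apply: measurable_maxr; first exact: measurable_cst.
   by apply: measurable_funB => //; exact: measurable_cst.
  exists (A / 2) => w; rewrite ger0_norm ?ge_min ?lexx ?orbT //.
  by rewrite le_min A20 le_max lexx.
 have i1 : bm (\1_S1 : T -> R) by exact: bm_indic.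
 have i2 : bm (\1_S2 : T -> R) by exact: bm_indic.
 have i3 : bm (\1_S3 : T -> R) by exact: bm_indic.
 have b2 : bm (fun w => c * \1_S2 w + Num.min (Num.max 0 (Z w - c)) (A / 2)).
  by apply: bmD => //; exact: bmZ.
 have b3 : bm (fun w => 1 - \1_S1 w - \1_S3 w : R).
  by apply: bmB => //; apply: bmB => //; exact: bm_cst.
 have b4 : bm (fun w => trunc A (A / 2) (Z w) - (c * \1_S2 w + Num.min (Num.max 0 (Z w - c)) (A / 2))).
  exact: bmB.
 have ind (S : set T) (P : bool) w : (S w <-> P) -> (\1_S w : R) = P%:R.
  move=> SP; rewrite indicE; case: P SP => -[h1 h2].
   by rewrite mem_set //; exact: h2.
  by rewrite memNset // => /h1.
 have KEY : Ex (fun w => trunc A (A / 2) (Z w) - (c * \1_S2 w + Num.min (Num.max 0 (Z w - c)) (A / 2)) +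
   (1 - \1_S1 w - \1_S3 w)) <= u n.+1 - u n.
  rewrite E1 E0 -ExB //; apply: Ex_le; [exact: bmD|exact: bmB|] => w.
  rewrite (@ind S1 (y < M' w)%R) // (@ind S2 (A / 2 < M' w)%R) // (@ind S3 (- y - 1 <= Z w)%R) //.
  apply: lindley_gain => //; last exact: ltW.
   by rewrite /A; move: r1_ge0 (ltW c_gt0); lra.
  by rewrite A2; move: r1_ge0 (ltW c_gt0); lra.
 rewrite ExD // ExB // ExD ?ExZ // in KEY; last exact: bmZ.
 rewrite (ExB _ (bmB (bm_cst _) i1) i3) (ExB _ (bm_cst _) i1) Ex_cst !Ex_indic // in KEY.
 have h1 := Hy m n m0.
 have h2 := le_trans (small (A / 2) ltac:(by rewrite A2; lra)) (lexx _).
 have h3 : _ <= Ex (fun w => trunc A (A / 2) (Z w)) := mean_bound t0 A0 A20.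
 have h4 : Ex (fun w => Num.min (Num.max 0 (Z w - c)) (A / 2)) <= 16^-1.
  exact: le_trans (exp_bound t0 (ltW c_gt0) A20) (small c (lexx _)).
 have h5 : fine (Q S3) <= 4^-1.
  apply: le_trans Hm; rewrite le_eqVlt; apply/orP; left; apply/eqP; congr (fine (Q _)).
  by apply/seteqP; split=> w; rewrite /S3 /Z /= mul1r mul0r.
 have h6 : c * fine (Q S2) <= 16^-1.
  have : fine (Q S2) <= 16^-1 / (c + 1).
   apply: le_trans (Hr1 m n m0); apply: fine_le; rewrite ?fin_num_measure //; first exact: measurable_gt.
   apply: le_measure; rewrite ?inE //; first exact: measurable_gt.
   by move=> w /= h; apply: le_lt_trans h; rewrite A2; lra.
  rewrite ler_pdivlMr // => h; apply: le_trans h; rewrite mulrC ler_wpM2l ?lerDl ?fine_ge0 //.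
 have h1' : fine (Q S1) <= 4^-1 by [].
 move: KEY h2 h3 h4 h5 h6 h1'.
 move: (Ex (fun w => trunc _ _ _)) (Ex (fun w => Num.min _ _)) (fine (Q S1)) (fine (Q S3))
  (c * fine (Q S2)) (Ct t * _) (u n) (u n.+1) => *; lra.
have lin n : u 0%N + n%:R / 4 <= u n.
 elim: n => [|n IH]; first by rewrite mul0r addr0.
 by apply: le_trans (stepu n); rewrite -natr1 mulrDl mul1r addrA lerD2r.
have [n _ /(_ n (leqnn _)) Hn] := near_natge (4 * (A + 1 - u 0%N)).
by have := le_trans (lin n) (uA n); move: Hn; move: (u 0%N) (n%:R) => *; lra.
Qed.

End LindleyBound.

(** * Reaching the small states *)

Section NoReturn.
Variables (R : realType) (p : nat -> nat -> R).
Hypotheses (p_ge0 : forall n k, 0 <= p n k) (p_sum1 : sums_to_one p).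
Variable K : nat.
Local Notation EN := (EN p).
Local Notation av := (av p).

(** The avoidance of $\{1,\dots,K\}$ is required at all times from 0 to [t], so the value at a state
    up to [K] is 0. *)
Fixpoint nohit (t : nat) (j : nat) : R :=
 if t is t'.+1 then if (K < j)%N then av j (nohit t') else 0 else (K < j)%N%:R.

Lemma nohit01 t j : 0 <= nohit t j <= 1.
Proof.
elim: t j => [|t IH] j /=; first by rewrite ler0n lern1 leq_b1.
case: ifP => _; last by rewrite lexx ler01.
have bn : bdd (nohit t) by exists 1 => k; have /andP[? ?] := IH k; rewrite ger0_norm.
rewrite av_ge0 //= => [|k _]; last by have /andP[] := IH k.
rewrite -(av_cst p_sum1 j 1); apply: av_le => //; first exact: bdd_cst.
by move=> k _; have /andP[] := IH k.
Qed.

Lemma bdd_nohit t : bdd (nohit t).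
Proof. by exists 1 => k; have /andP[? ?] := nohit01 t k; rewrite ger0_norm. Qed.

Lemma nohit_le t t' j : (t <= t')%N -> nohit t' j <= nohit t j.
Proof.
have S : forall t j, nohit t.+1 j <= nohit t j.
 elim=> [|{}t IH] {}j.
  by rewrite /=; case: ifP => // Kj; have := nohit01 1 j; rewrite /= Kj => /andP[].
 rewrite [leLHS]/= [leRHS]/=; case: ifP => // _.
 by apply: av_le => //; [exact: (bdd_nohit t.+1)|exact: (bdd_nohit t)|move=> k _; exact: IH].
elim: t' => [|t' IH]; first by rewrite leqn0 => /eqP ->.
rewrite leq_eqVlt => /orP[/eqP -> //|tt]; apply: le_trans (S _ _) _; exact: IH.
Qed.

Lemma EN_nohit t k s : EN t (fun s => (all (ltn K) s)%:R) (k :: s) = (all (ltn K) s)%:R * nohit t k.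
Proof.
elim: t k s => [|t IH] k s; first by rewrite /= mulrC -natrM mulnb.
transitivity (av k (fun x => (all (ltn K) (k :: s))%:R * nohit t x)).
 by apply: eq_av => x _; exact: IH.
rewrite (avZ p_ge0 p_sum1); last exact: bdd_nohit.
rewrite /=; case: (K < k)%N => /=; first by [].
by rewrite mul0r mulr0.
Qed.

(** If [nohit t n] were 1 for every [t], each event $X_t\le K$ would be null, and so would their
    countable union. *)
Lemma accessible_nohit d (T : measurableType d) (P : probability T R) n (X : nat -> T -> nat) :
 (0 < n)%N -> markov_chain P p n X -> (0 < P [set w | exists i, (X i w <= K)%N])%E ->
 exists t, nohit t n < 1.
Proof.
move=> n0 mc acc; apply: contrapT => H.
have one t : nohit t n = 1.
 apply/eqP; rewrite eq_le; have /andP[_ ->] := nohit01 t n; rewrite leNgt /=.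
 by apply/negP => lt; apply: H; exists t.
have zero t : P.-negligible [set w | (X t w <= K)%N].
 have mS : measurable [set w | (X t w <= K)%N].
  by have := measurable_X mc t [set x | (x <= K)%N].
 exists [set w | (X t w <= K)%N]; split => //; apply/eqP; rewrite eq_le measure_ge0 andbT.
 pose V (s : seq nat) : R := 1 - (all (ltn K) s)%:R.
 have bV : bdd V by apply: bddB; [exact: bdd_cst|exact: bdd_bool].
 have EV : EN t V [:: n] = 0.
  rewrite /V ENB //; [|exact: bdd_cst|exact: bdd_bool].
  by rewrite EN_cst // EN_nohit mul1r one subrr.
 have := integral_hist_EN p_ge0 p_sum1 n0 mc t bV; rewrite EV -[0%:E]/(0%E) => <-.
 rewrite -[X in P X]setIT -integral_indic //; apply: ge0_le_integral => //.
 - by apply/measurable_EFinP; exact: measurable_indic.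
 - by apply/measurable_EFinP; exact: (measurable_hist_fun mc).
 move=> w _; rewrite lee_fin indicE /V.
 case: (boolP (w \in _)) => [|_]; last by rewrite subr_ge0 lern1 leq_b1.
 rewrite inE /= => Xt; rewrite (_ : all _ _ = false) ?subr0 //.
 by case: t Xt {EV mS} => [|t] /= Xt; rewrite leqNgt in Xt; rewrite (negbTE Xt).
have := negligible_bigcup zero; set S := \bigcup_k _ => nS.
have mS : measurable S.
 by apply: bigcup_measurable => i _; have := measurable_X mc i [set x | (x <= K)%N].
have S0 : P S = 0%E by exact: measure_negligible.
have SE : [set w | exists i, (X i w <= K)%N] = S.
 by apply/seteqP; split=> w /=; [move=> [i Xi]; exists i|move=> [i _ Xi]; exists i].
by move: acc; rewrite SE S0 ltxx.
Qed.

Hypotheses (K_gt0 : (0 < K)%N) (acc : forall j, (0 < j)%N -> exists t, nohit t j < 1).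

Lemma hit_uniform J : exists r, exists2 p0 : R, 0 < p0 & forall j, (K < j)%N -> (j < J)%N ->
 nohit r j <= 1 - p0.
Proof.
elim: J => [|J [r [p0 p00 H]]]; first by exists 0%N, 1.
have [JK|KJ] := leqP J K.
 by exists r, p0 => // j Kj; rewrite ltnS => /(leq_ltn_trans)/(_ (leqnn _)); rewrite ltnS => jJ; have := leq_trans (leq_trans Kj jJ) JK; rewrite ltnn.
have [t tJ] := acc (leq_ltn_trans (leq0n K) KJ).
exists (maxn r t), (Num.min p0 (1 - nohit t J)) => [|j Kj].
 by rewrite lt_min p00 subr_gt0.
rewrite ltnS leq_eqVlt => /orP[/eqP ->|jJ].
 apply: le_trans (nohit_le J (leq_maxr r t)) _.
 by rewrite lerBrDr -lerBrDl ge_min lexx orbT.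
apply: le_trans (nohit_le j (leq_maxl r t)) _; apply: (le_trans (H j Kj jJ)).
by rewrite lerD2l lerN2 ge_min lexx.
Qed.

(** [\sum_(t < r) nohit t j] is the mean of the hitting time capped at [r]; one step lowers it by
    the probability of hitting by time [r]. *)
Lemma sum_nohit r j : (K < j)%N ->
 av j (fun k => \sum_(t < r) nohit t k) = \sum_(t < r) nohit t j - 1 + nohit r j.
Proof.
move=> Kj; elim: r => [|r IH].
 under eq_av do rewrite big_ord0; by rewrite av_cst // big_ord0 /= Kj sub0r addNr.
under eq_av do rewrite big_ord_recr /=.
rewrite (avD p_ge0 p_sum1); [|exists r%:R => k|exact: bdd_nohit]; last first.
 rewrite ger0_norm ?sumr_ge0 // => [|t _]; last by have /andP[] := nohit01 t k.
 rewrite -[r in leRHS]card_ord -sum1_card natr_sum; apply: ler_sum => t _.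
 by have /andP[] := nohit01 t k.
rewrite IH big_ord_recr /=.
have -> : av j (nohit r) = nohit r.+1 j by rewrite /= Kj.
rewrite Kj; ring.
Qed.

End NoReturn.

(** Says that $X^t$ is a supermartingale at states at least [J], with a cap [D] that keeps the
    function bounded. *)
Definition lyapunov (R : realType) (p : nat -> nat -> R) (t : R) (J : nat) := forall j D, (J <= j)%N -> 0 <= D ->
 jump p j (fun x => expR (t * Num.min x D)) <= 1.

Lemma cvg_sum0 (R : realType) (f : nat -> nat -> R) M :
 (forall j, f j n @[n --> \oo] --> (0 : R)) -> \sum_(j < M) f j n @[n --> \oo] --> (0 : R).
Proof.
move=> f0; elim: M => [|M IH].
 by rewrite (_ : (fun n => _) = fun=> 0); [exact: cvg_cst|apply/funext => n; rewrite big_ord0].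
rewrite (_ : (fun n => _) = fun n => \sum_(j < M) f j n + f M n); last first.
 by apply/funext => n; rewrite big_ord_recr.
by rewrite -[X in _ --> X](addr0 (0 : R)); exact: cvgD IH (f0 M).
Qed.

(** * Excursions after the last cell *)

Section Post2.
Variables (R : realType) (p : nat -> nat -> R).
Hypotheses (p_ge0 : forall n k, 0 <= p n k) (p_sum1 : sums_to_one p).
Variables (K J : nat) (th : R).
Hypotheses (K_gt0 : (0 < K)%N) (acc : forall j, (0 < j)%N -> exists t, nohit p K t j < 1)
 (th_gt0 : 0 < th) (lyap : lyapunov p th J).
Local Notation EN := (EN p).
Local Notation av := (av p).
Local Notation nohit := (nohit p K).

(** For [k >= 1] this is $\min(1,(k/L)^{th})$ with $L=e^l$. *)
Definition vfun (l : R) (k : nat) : R := expR (th * Num.min (ln k%:R - l) 0).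

Lemma vfun01 l k : 0 <= vfun l k <= 1.
Proof.
rewrite expR_ge0 /= -expR0 ler_expR; apply: mulr_ge0_le0; first exact: ltW.
by rewrite ge_min lexx orbT.
Qed.

Lemma bdd_vfun l : bdd (vfun l).
Proof. by exists 1 => k; have /andP[? ?] := vfun01 l k; rewrite ger0_norm. Qed.

Lemma vfun_drift l j : (J <= j)%N -> av j (vfun l) <= vfun l j.
Proof.
move=> Jj; have [lj|lj] := leP l (ln j%:R).
 have -> : vfun l j = 1 by rewrite /vfun min_r ?subr_ge0 // mulr0 expR0.
 rewrite -(av_cst p_sum1 j 1); apply: av_le => //; [exact: bdd_vfun|exact: bdd_cst|].
 by move=> k _; have /andP[] := vfun01 l k.
have D0 : 0 <= l - ln j%:R by rewrite subr_ge0 ltW.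
have := lyap Jj D0; rewrite /jump => H.
have vE k : vfun l k = vfun l j * expR (th * Num.min (ln k%:R - ln j%:R) (l - ln j%:R)).
 rewrite /vfun -expRD -mulrDr (min_l (_ : ln j%:R - l <= 0)); last by rewrite subr_le0 ltW.
 by congr (expR (_ * _)); rewrite addr_minr; congr Num.min; ring.
have bE : bdd (fun k : nat => expR (th * Num.min (ln k%:R - ln j%:R) (l - ln j%:R))).
 exists (expR (th * (l - ln j%:R))) => k; rewrite ger0_norm ?expR_ge0 // ler_expR ler_wpM2l ?(ltW th_gt0) //.
 by rewrite ge_min lexx orbT.
under eq_av => k _ do rewrite vE.
by rewrite (avZ p_ge0 p_sum1) // ler_piMr //; have /andP[] := vfun01 l j.
Qed.

Lemma vfun_cvg0 (eta : R) k : 0 < eta -> vfun (ln (eta * m%:R)) k @[m --> \oo] --> (0 : R).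
Proof.
move=> eta0; apply/cvgrPdist_le => e e0.
pose c := ln k%:R - ln e / th.
have := near_natge (expR c / eta); have : \forall m \near \oo, (0 < m)%N by exists 1%N.
apply: filterS2 => m m0; rewrite ler_pdivrMr // mulrC => mc.
have m0' : 0 < eta * m%:R by rewrite mulr_gt0 // ltr0n.
rewrite sub0r normrN ger0_norm ?expR_ge0 // -[leRHS]lnK ?posrE // ler_expR.
apply: (@le_trans _ _ (th * (ln k%:R - ln (eta * m%:R)))).
 by rewrite ler_wpM2l ?(ltW th_gt0) // ge_min lexx.
have : c <= ln (eta * m%:R) by rewrite -[leLHS]expRK ler_ln ?posrE ?expR_gt0.
rewrite /c lerBlDr -lerBlDl => h.
apply: (@le_trans _ _ (th * (ln e / th))); first by rewrite ler_wpM2l // ltW.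
by rewrite mulrCA divff ?mulr1 // gt_eqF.
Qed.

Definition gfun (r j : nat) : R := \sum_(t < r) nohit t j.

Lemma gfun_bounds r j : 0 <= gfun r j <= r%:R.
Proof.
apply/andP; split; first by rewrite sumr_ge0 // => t _; have /andP[] := nohit01 p_ge0 p_sum1 K t j.
rewrite /gfun -[r in leRHS]card_ord -sum1_card natr_sum; apply: ler_sum => t _.
by have /andP[] := nohit01 p_ge0 p_sum1 K t j.
Qed.

Lemma bdd_gfun r : bdd (gfun r).
Proof. by exists r%:R => j; have /andP[? ?] := gfun_bounds r j; rewrite ger0_norm. Qed.

Lemma wfun_super l C r p0 j : 0 < p0 -> 0 <= C ->
 (forall j, (K < j)%N -> (j < J)%N -> nohit r j <= 1 - p0) ->
 (forall j, (j < J)%N -> av j (vfun l) <= C * p0) -> (K < j)%N ->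
 av j (fun k => vfun l k + C * gfun r k) <= vfun l j + C * gfun r j.
Proof.
move=> p00 C0 Hr HC Kj.
have bC : bdd (fun k => C * gfun r k).
 by apply: bddM; [exact: bdd_cst|exact: bdd_gfun].
rewrite (avD p_ge0 p_sum1 _ (bdd_vfun l) bC) (avZ p_ge0 p_sum1 _ _ (bdd_gfun r)).
rewrite (sum_nohit p_ge0 p_sum1 r Kj) -/(gfun r j).
have /andP[v0 _] := vfun01 l j; have /andP[_ n1] := nohit01 p_ge0 p_sum1 K r j.
have [jJ|Jj] := ltnP j J.
 have h1 := HC j jJ; have h2 := ler_wpM2l C0 (Hr j Kj jJ).
 move: h2; rewrite !mulrBr mulr1 mulrDr !mulrBr mulr1.
 move: h1 v0; move: (av j _) (vfun l j) (C * _) (C * _) (C * _) => *; lra.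
have h1 := vfun_drift l Jj; have h2 := ler_wpM2l C0 n1.
move: h2; rewrite mulrDr !mulrBr mulr1.
by move: h1 v0; move: (av j _) (vfun l j) (C * _) (C * _) => *; lra.
Qed.

Section Functional.
Variables (a : nat -> R) (n : nat) (h : R) (N : nat) (eps B eta z : R).
Hypotheses (n_gt0 : (0 < n)%N) (z_eta : z <= eta).
Local Notation post := (post a n h N eps B K eta z).
Local Notation post_of := (post_of n K eta).

Lemma post1_head s : post s = 1%N -> (K < head 0%N s)%N.
Proof.
have po x : post_of x = 1%N -> (K < x)%N by rewrite /Submission.post_of; case: (leqP x K).
case: s => [//|x s]; rewrite post_cons [head _ _]/=.
have [ps0|ps0] := eqVneq (post s) 0%N; first by case: ifP => // _ /po.
have [ps1|ps1] := eqVneq (post s) 1%N; first by move=> /po.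
by move=> h1; rewrite h1 in ps1.
Qed.

(** The potential [F] is worth [b0] before the excursion starts, [w] of the current state during it,
    and 1 once the level [eta * n%:R] has been exceeded; its drift is nonpositive in each of these
    regimes. *)
Lemma post2_le k (w : nat -> R) (b0 : R) : bdd w -> (forall j, 0 <= w j) ->
 (forall j, (K < j)%N -> av j w <= w j) -> (forall j, eta * n%:R < j%:R -> 1 <= w j) ->
 (forall j, (0 < j)%N -> j%:R <= z * n%:R -> w j <= b0) -> 0 <= b0 ->
 EN k (fun s => (post s == 2%N)%:R) [:: n] <= b0.
Proof.
move=> bw w0 wS w1 wz b00.
pose F s : R := (post s == 2%N)%:R + (post s == 1%N)%:R * w (head 0%N s) + (post s == 0%N)%:R * b0.
have bbool (f : seq nat -> bool) : bdd (fun s => (f s)%:R : R) by exact: bdd_bool.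
have bF : bdd F.
 apply: bddD; last by apply: bddM => //; exact: bdd_cst.
 by apply: bddD => //; apply: bddM => //; exact: (@bdd_comp _ _ _ w (head 0%N)).
have F0 : F [:: n] = b0.
 by rewrite /F /= [Submission.alive _ _ _ _ _]/Submission.alive /= andbF /= mul0r !add0r mul1r.
rewrite -F0; apply: (@le_trans _ _ (EN k F [:: n])).
 apply: EN_le => // s; rewrite /F -addrA lerDl addr_ge0 // mulr_ge0 //.
apply: supermartingale_in => //; first by rewrite /hpos /= n_gt0.
move=> s hs.
have po1 x : post_of x = 1%N -> x%:R <= eta * n%:R.
 by rewrite /Submission.post_of; case: ifP => // _; case: ltP.
have po2 x : post_of x = 2%N -> eta * n%:R < x%:R.
 by rewrite /Submission.post_of; case: ifP => // _; case: ltP.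
have pos x : post_of x != 0%N by exact: post_of_neq0.
have bFs : bdd (fun x : nat => F (x :: s)) by exact: (@bdd_comp _ _ _ F (cons^~ s)).
have [ps0|ps0] := eqVneq (post s) 0%N.
 apply: (@le_trans _ _ (av (head 0%N s) (fun=> b0))); last by rewrite av_cst // /F ps0 /= !add0r mul1r mul0r add0r.
 apply: av_le => //; first exact: bdd_cst.
 move=> x x0; rewrite /F post_cons ps0 eqxx; case: ifP => [/andP[_ xz]|_]; last first.
  by rewrite /= mul0r !add0r mul1r.
 rewrite (negbTE (pos x)) mul0r addr0.
 case: (eqVneq (post_of x) 2%N) => [p2|_].
  have := po2 x p2; rewrite ltNge => /negP; case; apply: (le_trans xz).
  by rewrite ler_wpM2r.
 rewrite add0r; case: eqP => _; last by rewrite mul0r.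
 by rewrite mul1r; exact: wz.
have [ps1|ps1] := eqVneq (post s) 1%N.
 apply: (@le_trans _ _ (av (head 0%N s) w)); last first.
  apply: le_trans (wS _ (post1_head ps1)) _.
  by rewrite /F ps1 /= add0r mul1r mul0r addr0.
 apply: av_le => // x x0; rewrite /F post_cons ps1 /= (negbTE (pos x)) mul0r addr0.
 case: (eqVneq (post_of x) 2%N) => [p2|_]; first by rewrite p2 /= mul0r addr0 w1 // po2.
 by rewrite add0r; case: eqP => _; rewrite ?mul1r ?mul0r.
apply: (@le_trans _ _ (av (head 0%N s) (fun=> (post s == 2%N)%:R))); last first.
 by rewrite av_cst // /F (negbTE ps0) (negbTE ps1) !mul0r !addr0.
apply: av_le => //; first exact: bdd_cst.
move=> x x0; have E : post (x :: s) = post s by rewrite post_cons (negbTE ps0) (negbTE ps1).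
by rewrite /F E (negbTE ps0) (negbTE ps1) !mul0r !addr0.
Qed.

End Functional.

(** The threshold on [n] is uniform in the parameters of the machine, which can therefore be chosen
    later: only the starting level [z] of the excursion matters. *)
Lemma post2_small (a : nat -> R) (eta dl zb : R) : 0 < eta -> 0 < dl -> 0 < zb ->
 exists z, [/\ 0 < z, z <= zb, z <= eta & \forall n \near \oo, forall h N eps B k,
  EN k (fun s => (post a n h N eps B K eta z s == 2%N)%:R) [:: n] <= dl].
Proof.
move=> eta0 dl0 zb0; have dl2 : 0 < dl / 2 by rewrite divr_gt0.
(* Solves $(z_1/\eta)^{th}=dl/2$, the value of [vfun] at a start in $z_1n$ relative to the level
   $\eta n$. *)
pose z1 := expR (ln eta + ln (dl / 2) / th).
pose z := Num.min (Num.min zb eta) z1.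
have z0 : 0 < z by rewrite !lt_min zb0 eta0 expR_gt0.
have zz1 : z <= z1 by rewrite /z ge_min lexx orbT.
have ze : z <= eta by rewrite /z !ge_min lexx orbT.
exists z; split => //; first by rewrite /z !ge_min lexx.
have [r [p0 p00 Hr]] := hit_uniform p_ge0 p_sum1 acc J.
(* The constant that [wfun_super] requires; it tends to 0 because only the finitely many rows below
   [J] occur and the level $\eta n$ goes to infinity. *)
pose C n := (\sum_(j < J) av j (vfun (ln (eta * n%:R)))) / p0.
have Cc : C n @[n --> \oo] --> (0 : R).
 rewrite -[X in _ --> X](mul0r p0^-1); apply: cvgMl.
 apply: (@cvg_sum0 R (fun j n => av j (vfun (ln (eta * n%:R))))) => j; apply: (av_cvg0 p_ge0 p_sum1) => [m k|k]; first exact: vfun01.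
 exact: vfun_cvg0.
have r1 : 0 < r%:R + 1 :> R by rewrite ltr_wpDl.
have /cvgrPdist_le/(_ _ (divr_gt0 dl2 r1)) := Cc.
have : \forall n \near \oo, (0 < n)%N by exists 1%N.
apply: filterS2 => n n0 Cn h N eps B k.
have avge0 j : 0 <= av j (vfun (ln (eta * n%:R))).
 by apply: av_ge0 => //; [exact: bdd_vfun|move=> i _; have /andP[] := vfun01 (ln (eta * n%:R)) i].
have C0 : 0 <= C n by rewrite divr_ge0 ?(ltW p00) // sumr_ge0.
have Cr : C n * r%:R <= dl / 2.
 move: Cn; rewrite sub0r normrN ger0_norm // ler_pdivlMr // => h1; apply: le_trans h1.
 by rewrite ler_wpM2l // lerDl.
pose l := ln (eta * n%:R); have n0' : 0 < n%:R :> R by rewrite ltr0n.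
have en : 0 < eta * n%:R by rewrite mulr_gt0.
apply: (post2_le a h N eps B (eta:=eta) (z:=z) n0 ze k (w:=fun j => vfun l j + C n * gfun r j)).
- apply: bddD; first exact: bdd_vfun.
 by apply: bddM; [exact: bdd_cst|exact: bdd_gfun].
- move=> j; have /andP[v0 _] := vfun01 l j; have /andP[g0 _] := gfun_bounds r j.
 by rewrite addr_ge0 // mulr_ge0.
- move=> j Kj; apply: (@wfun_super l (C n) r p0) => // i iJ.
 rewrite /C divfK ?gt_eqF // (bigD1 (Ordinal iJ)) //= lerDl sumr_ge0 // => q _; exact: avge0.
- move=> j jn; have /andP[g0 _] := gfun_bounds r j.
 rewrite /vfun min_r ?mulr0 ?expR0; first by rewrite lerDl mulr_ge0.
 by rewrite subr_ge0 /l ler_ln ?posrE ?(ltW jn) // (lt_trans en).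
- move=> j j0 jz; have /andP[_ g1] := gfun_bounds r j; rewrite [leRHS]splitr; apply: lerD; last first.
  by apply: le_trans Cr; rewrite ler_wpM2l.
 rewrite -[leRHS]lnK ?posrE // /vfun ler_expR.
 apply: (@le_trans _ _ (th * (ln j%:R - l))); first by rewrite ler_wpM2l ?(ltW th_gt0) // ge_min lexx.
 have : ln j%:R <= ln (z1 * n%:R).
  rewrite ler_ln ?posrE ?ltr0n ?mulr_gt0 ?expR_gt0 //; apply: (le_trans jz).
  by rewrite ler_wpM2r // ltW.
 rewrite /l !lnM ?posrE ?expR_gt0 // expRK => h1.
 apply: (@le_trans _ _ (th * (ln (dl / 2) / th))).
  by rewrite ler_wpM2l ?(ltW th_gt0) //; lra.
 by rewrite mulrCA divff ?gt_eqF // mulr1 !lnM ?posrE // invr_gt0.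
exact: ltW.
Qed.

End Post2.

(** * Almost everywhere limits without prior measurability *)

Section AlmostEverywhere.
Context {R : realType} {d : measure_display} {T : measurableType d} (Q : probability T R).

Import HBNNSimple.

(** Neither function is assumed measurable. The integral is a supremum over simple functions below
    the integrand, and setting such a function to 0 on a null set keeps its integral. *)
Lemma le_integral_ae (f g : T -> \bar R) : (forall x, 0 <= f x)%E -> (forall x, 0 <= g x)%E ->
 {ae Q, forall x, (f x <= g x)%E} -> (\int[Q]_x f x <= \int[Q]_x g x)%E.
Proof.
move=> f0 g0 [N [mN N0 sN]]; rewrite !ge0_integralTE //.
apply: ge_ereal_sup => _ [h /= hf <-].
have mC : measurable (~` N) by exact: measurableC.
pose h' : {nnsfun T >-> R} := mul_nnsfun h (indic_nnsfun R mC).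
have h'E x : h' x = h x * \1_(~` N) x by [].
have sE (k : {nnsfun T >-> R}) : sintegral Q k = (\int[Q]_x (k x)%:E)%E.
 by rewrite integral_nnsfun // patch_setT.
have -> : sintegral Q h = sintegral Q h'.
 rewrite !sE; apply: ge0_ae_eq_integral => //.
 - by apply/measurable_EFinP.
 - by apply/measurable_EFinP.
 - by move=> x _; rewrite lee_fin.
 - by move=> x _; rewrite lee_fin.
 exists N; split => // x /= nx; apply: contrapT => Nx; apply: nx => _.
 by have := h'E x => /= ->; rewrite indicE mem_set // mulr1.
apply: ereal_sup_ubound; exists h' => //= x; have := h'E x => /= ->; rewrite indicE.
have [xN|xN] := pselect (N x); first by rewrite memNset ?mulr0 //= => /(_ xN).
rewrite mem_set // mulr1; apply: (le_trans (hf x)).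
by apply: contrapT => nle; apply: xN; exact: sN.
Qed.

Lemma integral_ae_eq (f g : T -> R) : {ae Q, forall x, f x = g x} ->
 (\int[Q]_x (f x)%:E = \int[Q]_x (g x)%:E)%E.
Proof.
move=> fg; rewrite integralE [RHS]integralE; congr (_ - _)%E; apply/eqP; rewrite eq_le;
 apply/andP; split; apply: le_integral_ae => //; apply: filterS fg => x E;
 by rewrite ?funeposE ?funenegE E.
Qed.

Lemma limn_sup_dist (u : nat -> R) (l e C : R) : (forall q, `|u q| <= C) ->
 (exists q0, forall q, (q0 <= q)%N -> `|u q - l| <= e) -> `|limn_sup u - l| <= e.
Proof.
move=> uC [q0 H].
have ubu : has_ubound (range u).
 by exists C => _ [q _ <-]; have := uC q; rewrite ler_norml => /andP[].
have lbu : has_lbound (range u).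
 by exists (- C) => _ [q _ <-]; have := uC q; rewrite ler_norml => /andP[].
have cu : cvgn (sups u) by apply/cvg_ex; eexists; exact: cvg_sups_inf.
have HH q : (q0 <= q)%N -> l - e <= u q <= l + e.
 by move=> /H; rewrite ler_norml => /andP[*]; apply/andP; split; lra.
have b1 : limn_sup u <= l + e.
 apply: limr_le => //; exists q0 => // q /= qq; apply: ge_sup; first by exists (u q), q => /=.
 by move=> _ [m /= qm <-]; have /andP[] := HH m (leq_trans qq qm).
have b2 : l - e <= limn_sup u.
 apply: limr_ge => //; exists q0 => // q /= qq.
 apply: (@le_trans _ _ (u q)); first by have /andP[] := HH q qq.
 apply: ub_le_sup; last by exists q => /=.
 by apply: has_ubound_sdrop.
by rewrite ler_norml; apply/andP; split; move: b1 b2; move: (limn_sup u) => *; lra.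
Qed.

(** Upper limits, in [q] and then in [M], turn the approximations into an everywhere defined
    measurable function, which agrees with [f] wherever the approximation works; nothing is asked of
    [f] itself. *)
Lemma ae_limit_bm (phi : nat -> nat -> T -> R) (f : T -> R) (C : R) :
 (forall M q, measurable_fun setT (phi M q)) -> (forall M q w, `|phi M q w| <= C) ->
 {ae Q, forall w, forall e, 0 < e -> exists M0, forall M, (M0 <= M)%N ->
   exists q0, forall q, (q0 <= q)%N -> `|phi M q w - f w| <= e} ->
 exists V : T -> R, [/\ measurable_fun setT V, forall w, `|V w| <= C & {ae Q, forall w, f w = V w}].
Proof.
move=> mphi phiC H.
pose U M w := limn_sup (fun q => phi M q w).
have UC M w : `|U M w| <= C.
 rewrite -[U M w]subr0; apply: (@limn_sup_dist _ _ _ C) => //.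
 by exists 0%N => q _; rewrite subr0.
have rg (u : nat -> T -> R) : (forall m w, `|u m w| <= C) -> forall w,
  has_ubound (range (u ^~ w)) /\ has_lbound (range (u ^~ w)).
 by move=> uC w; split; [exists C|exists (- C)] => _ [q _ <-]; have := uC q w; rewrite ler_norml => /andP[].
have mU M : measurable_fun setT (U M).
 by apply: measurable_fun_limn_sup => // w _; have [] := rg _ (phiC M) w.
exists (fun w => limn_sup (U ^~ w)); split.
- by apply: measurable_fun_limn_sup => // w _; have [] := rg _ UC w.
- move=> w; rewrite -[limn_sup _]subr0; apply: (@limn_sup_dist _ _ _ C) => //.
 by exists 0%N => q _; rewrite subr0.
apply: filterS H => w Hw; apply/eqP; rewrite -subr_eq0 -normr_le0.
apply/ler_addgt0Pr => e e0; rewrite add0r distrC.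
have [M0 HM] := Hw e e0; apply: (@limn_sup_dist _ _ _ C) => //.
by exists M0 => M MM; apply: (@limn_sup_dist _ _ _ C) => //; exact: HM.
Qed.

(** Continuity from above, twice: for the sets [D m] of points that are bad for infinitely many [q]
    at some [M >= m], and, with [M] fixed, for the points bad at some [q >= j] but only finitely
    often. *)
Lemma ae_iter_small (B : nat -> nat -> set T) : (forall M q, measurable (B M q)) ->
 {ae Q, forall w, exists M0, forall M, (M0 <= M)%N ->
   exists q0, forall q, (q0 <= q)%N -> ~ B M q w} ->
 forall e : R, 0 < e -> exists M q0, forall q, (q0 <= q)%N -> fine (Q (B M q)) <= e.
Proof.
move=> mB H e e0; have e2 : 0 < e / 2 by rewrite divr_gt0.
pose E M j := \bigcup_(q in [set q | (j <= q)%N]) B M q.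
pose A M := \bigcap_j E M j.
pose D m := \bigcup_(M in [set M | (m <= M)%N]) A M.
have mE M j : measurable (E M j) by apply: bigcup_measurable.
have mA M : measurable (A M) by apply: bigcap_measurableType.
have mD m : measurable (D m) by apply: bigcup_measurable.
have finQ (S : set T) : measurable S -> Q S \is a fin_num by move=> mS; rewrite fin_num_measure.
have [m Dm] : exists m, fine (Q (D m)) <= e / 2.
 apply: dec_small => // [n w [M /= nM AM]|]; first by exists M => //=; exact: ltnW.
 apply: filterS H => w [M0 HM]; exists M0 => -[M /= MM AM].
 have [q0 Hq] := HM M MM; have [q /= qq] := AM q0 I; exact: Hq.
have Am : fine (Q (A m)) <= e / 2.
 apply: le_trans Dm; apply: fine_le; [exact: finQ|exact: finQ|].
 by apply: le_measure; rewrite ?inE // => w Aw; exists m => /=.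
have [j Ej] : exists j, fine (Q (E m j `\` A m)) <= e / 2.
 apply: dec_small => // [n|n w [[q /= nq Bq] nA]|].
 - exact: measurableD.
 - by split => //; exists q => //=; exact: ltnW.
 apply: aeW => w; have [Aw|nA] := pselect (A m w); first by exists 0%N => -[].
 by move/existsNP : nA => [j /not_implyP[_ nE]]; exists j => -[].
exists m, j => q jq; rewrite (splitr e).
have : (Q (B m q) <= Q (E m j `\` A m) + Q (A m))%E.
 have mEA : measurable (E m j `\` A m) by exact: measurableD.
 rewrite -measureU //; last by rewrite setDE -setIA setICl setI0.
 apply: le_measure; rewrite ?inE //; first exact: measurableU.
 move=> w Bw; have [Aw|nA] := pselect (A m w); first by right.
 by left; split => //; exists q.
move=> h1; apply: le_trans (fine_le _ _ h1) _; first exact: finQ.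
 by rewrite fin_numD !finQ //; exact: measurableD.
rewrite fineD; [|by apply: finQ; exact: measurableD|exact: finQ].
by rewrite lerD.
Qed.

End AlmostEverywhere.

(** * The rescaled path as a limit of finite histories *)

Section Paths.
Variable R : realType.
Implicit Types (x : nat -> nat) (c : R).

Lemma cadlag_step (u : nat -> R) c : 0 < c -> cadlag (fun t => u (Num.truncn (c * t))).
Proof.
move=> c0; have nearE (F : set_system R) (FF : Filter F) (m : nat) :
  (\forall s \near F, m%:R <= c * s < m.+1%:R) -> u (Num.truncn (c * s)) @[s --> F] --> u m.
 by move=> H; apply: cvg_near_cst; apply: filterS H => s /truncn_def ->.
split=> t t0.
 have ct : 0 <= c * t by rewrite mulr_ge0 // ltW.
 have /andP[m1 m2] := truncn_itv ct; apply: nearE; set m := Num.truncn _ in m1 m2 *.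
 near=> s; apply/andP; split.
  by apply: (le_trans m1); rewrite ler_pM2l //; near: s; exact: nbhs_right_ge.
 rewrite mulrC -ltr_pdivlMr //; near: s; apply: nbhs_right_lt.
 by rewrite ltr_pdivlMr // mulrC.
have ct : 0 < c * t by rewrite mulr_gt0.
have /andP[m1 m2] := truncn_itv (ltW ct); set m := Num.truncn _ in m1 m2 *.
have H (k : nat) : k%:R < c * t -> c * t <= k.+1%:R -> cvg (u (Num.truncn (c * s)) @[s --> t^'-]).
 move=> k1 k2; apply/cvg_ex; exists (u k); apply: nearE; near=> s; apply/andP; split.
  rewrite mulrC -ler_pdivrMr //; near: s; apply: nbhs_left_ge.
  by rewrite ltr_pdivrMr // mulrC.
 by apply: lt_le_trans k2; rewrite ltr_pM2l //; near: s; exact: nbhs_left_lt.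
have [lt|ge] := ltP m%:R (c * t); first by apply: (H m) => //; exact: ltW.
case: (m) ge m1 => [|k] ge m1; first by move: ct; rewrite ltNge ge.
by apply: (H k) => //; apply: lt_le_trans m1; rewrite ltr_nat.
Unshelve. all: by end_near.
Qed.

Lemma stopped_ext x x' K m : (forall l, (l <= m)%N -> x l = x' l) -> stopped x K m = stopped x' K m.
Proof.
move=> xx'.
have H y y' : (forall l, (l <= m)%N -> y l = y' l) -> forall A, hitting_time y K = Some A ->
  (A <= m)%N -> hitting_time y' K = Some A.
 move=> yy' A; rewrite /hitting_time; case: pselect => // h; case: ex_minnP => B /andP[B0 BK] Bm [<-] Bl.
 case: pselect => [h'|[]]; last by exists B; rewrite B0 -yy'.
 congr Some; case: ex_minnP => C /andP[C0 CK] Cm; apply/eqP; rewrite eqn_leq.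
 have CB : (C <= B)%N by apply: Cm; rewrite B0 -yy'.
 by rewrite CB /=; apply: Bm; rewrite C0 yy' // (leq_trans CB).
have x'x l : (l <= m)%N -> x' l = x l by move=> lm; rewrite xx'.
rewrite /stopped; case E : (hitting_time x K) => [A|]; case E' : (hitting_time x' K) => [A'|].
- have [Am|mA] := leqP A m.
  by have := H _ _ xx' _ E Am; rewrite E' => -[->]; rewrite (minn_idPr Am) xx'.
 have [Am'|mA'] := leqP A' m.
  by have := H _ _ x'x _ E' Am'; rewrite E => -[AA]; move: mA; rewrite AA ltnNge Am'.
 by rewrite xx'.
- have [Am|mA] := leqP A m; first by have := H _ _ xx' _ E Am; rewrite E'.
 by rewrite xx' // ?(minn_idPl (ltnW mA)).
- have [Am'|mA'] := leqP A' m; first by have := H _ _ x'x _ E' Am'; rewrite E.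
 by rewrite xx' // ?(minn_idPl (ltnW mA')).
- by rewrite xx'.
Qed.

Lemma J1_cvg_local (x : nat -> R -> R) (y : R -> R) :
 (forall N : nat, \forall m \near \oo, forall t, 0 <= t <= N%:R -> x m t = y t) -> J1_cvg x y.
Proof.
move=> H; have sup0 (A : set R) (f : R -> R) : A 0 -> (forall t, A t -> f t = 0) ->
  ereal_sup [set (`|f t|)%:E | t in A] = 0%E.
 move=> A0 f0; rewrite (_ : [set _ | _ in _] = [set 0%E]) ?ereal_sup1 //.
 apply/seteqP; split=> [_ [t At <-]|_ ->] /=; first by rewrite f0 // normr0.
 by exists 0 => //; rewrite f0 // normr0.
exists (fun _ => id); split.
- by move=> m; exact: J1_time_change_id.
- rewrite (_ : (fun m => _) = fun=> 0%E); first exact: cvg_cst.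
 by apply/funext => m; apply: (sup0 _ (fun t => t - t)) => //= t _; rewrite subrr.
move=> N; apply: cvg_near_cst; apply: filterS (H N) => m Hm.
apply: (sup0 [set t | 0 <= t <= N%:R] (fun t => x m t - y t)); first by rewrite /= lexx /=.
by move=> t /= tN; rewrite Hm // subrr.
Qed.

Variables (p : nat -> nat -> R).
Hypotheses (p_ge0 : forall n k, 0 <= p n k) (p_sum1 : sums_to_one p).
Context {d : measure_display} {T : measurableType d} (P : probability T R).
Variables (n : nat) (X : nat -> T -> nat) (a : nat -> R) (K : nat).
Hypotheses (n_gt0 : (0 < n)%N) (X_mc : markov_chain P p n X) (a_gt0 : 0 < a n).
Variables (F : (R -> R) -> R) (C : R).
Hypotheses (F_le : forall x : R -> R, `|F x| <= C) (F_cont : J1_continuous F).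

Lemma idx_hist k w m : (m <= k)%N -> idx (hist X k w) m = X m w.
Proof.
move=> mk; rewrite /idx nth_rev ?size_hist ?ltnS // subSS -(nth_hist X w mk).
by apply: set_nth_default; rewrite size_hist ltnS leq_subr.
Qed.

Lemma cadlag_cpath s : cadlag (cpath a n K s).
Proof.
exact: (@cadlag_step (fun m => (stopped (fun m => idx s (minn m (size s).-1)) K m)%:R / n%:R)).
Qed.

Definition scaled_path (w : T) (t : R) : R :=
 (stopped (fun k => X k w) K (Num.truncn (a n * t)))%:R / n%:R.

(** Freezing the path after [k] steps leaves any given bounded time interval unchanged once [k] is
    large, and J1 convergence tests bounded intervals only. *)
Lemma cpath_hist_cvg w : F (cpath a n K (hist X k w)) @[k --> \oo] --> F (scaled_path w).
Proof.
apply: F_cont; first by move=> k; exact: cadlag_cpath.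
 exact: (@cadlag_step (fun m => (stopped (fun k => X k w) K m)%:R / n%:R)).
apply: J1_cvg_local => N; exists (Num.truncn (a n * N%:R)) => // k /= Nk t /andP[t0 tN].
rewrite /cpath /scaled_path; congr (_%:R / _); apply: stopped_ext => l lm.
have lk : (l <= k)%N.
 apply: (leq_trans lm); apply: leq_trans Nk; rewrite truncn_ge_nat.
  by rewrite (le_trans _ (ler_wpM2l (ltW a_gt0) tN)) // truncn_le mulr_ge0 // ltW.
 by rewrite mulr_ge0 // ltW.
by rewrite size_hist /= (minn_idPl lk) idx_hist.
Qed.

Lemma bm_scaled_path : bm (fun w => F (scaled_path w)).
Proof.
split; last by exists C.
apply: (@measurable_fun_cvg _ _ _ setT (fun k w => F (cpath a n K (hist X k w)))) => [k|w _].
 exact: (measurable_hist_fun X_mc k (fun s => F (cpath a n K s))).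
exact: cpath_hist_cvg.
Qed.

Lemma EN_cpath_cvg : EN p k (fun s => F (cpath a n K s)) [:: n] @[k --> \oo] -->
 Rintegral P setT (fun w => F (scaled_path w)).
Proof.
rewrite (_ : (fun k => _) = fun k => Rintegral P setT (fun w => F (cpath a n K (hist X k w)))); last first.
 apply/funext => k; rewrite /Rintegral (integral_hist_EN p_ge0 p_sum1 n_gt0 X_mc k (V:=fun s => F (cpath a n K s))) //.
 by exists C.
apply: (@Rintegral_cvg _ _ _ P _ _ (fun=> C)) => //.
- by move=> k; exact: (measurable_hist_fun X_mc k (fun s => F (cpath a n K s))).
- by have [] := bm_scaled_path.
- exact: (bm_integrable P (bm_cst C)).
by apply: aeW => w; exact: cpath_hist_cvg.
Qed.

End Paths.

Lemma measurable_eta (R : realType) d (T : measurableType d) (Q : probability T R)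
  (Pi : {measure set R -> \bar R}) (b sigma2 : R) (xi : R -> T -> R) N h (g : seq R -> R) (C : R) :
 levy_process Q b sigma2 Pi xi -> (forall s, `|g s| <= C) -> unif_box g N.+1 ->
 measurable_fun setT (fun w => g (eta xi N.+1 h w)).
Proof. by move=> xi_levy gC ug; have [cs [_ _ mg _]] := fdd_approx xi_levy h gC ug. Qed.

Lemma Ex_le_except (R : realType) d (T : measurableType d) (Q : probability T R) (f g : T -> R)
  (B : set T) (c D : R) : bm f -> bm g -> measurable B ->
 (forall w, ~ B w -> f w <= g w + c) -> (forall w, B w -> f w <= g w + c + D) ->
 Rintegral Q setT f <= Rintegral Q setT g + c + D * fine (Q B).
Proof.
move=> bf bg mB H1 H2.
have bI : bm (fun w => D * \1_B w : R) by apply: bmZ; exact: bm_indic.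
have bgc : bm (fun w => g w + c) by apply: bmD => //; exact: bm_cst.
have -> : Rintegral Q setT g + c + D * fine (Q B) = Rintegral Q setT (fun w => g w + c + D * \1_B w).
 rewrite (ExD _ bgc bI) (ExD _ bg (bm_cst c)) Ex_cst (ExZ _ _ (bm_indic mB)) Ex_indic //.
apply: Ex_le => //; first exact: bmD.
move=> w; rewrite indicE; have [Bw|nB] := pselect (B w).
 by rewrite mem_set // mulr1; exact: H2.
by rewrite memNset // mulr0 addr0; exact: H1.
Qed.

(** * Approximation of expectations of the limit process *)

Section LimitSide.
Context {R : realType} {d : measure_display} {T : measurableType d} (Q : probability T R).
Variables (gamma : R) (Pi : {measure set R -> \bar R}) (b sigma2 : R) (xi : R -> T -> R).
Hypotheses (gamma_gt0 : 0 < gamma) (xi_levy : levy_process Q b sigma2 Pi xi)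
 (xi_drift : drifts_to_minus_infty Q xi).
Variables (F : (R -> R) -> R) (C : R).
Hypotheses (C_gt0 : 0 < C) (F_le : forall x, `|F x| <= C) (F_cont : J1_continuous F).
Local Notation Ex f := (Rintegral Q setT f).
Local Notation Y w := (lamperti gamma (xi ^~ w)).
Local Notation lipF := (lipF F C).

(** The number of cells used is the successor, equal to [M.+1 * q.+1], so the clock horizon is
    [M.+1]. The successor form matches the approximation lemmas, which are stated for [N.+1]
    increments. *)
Definition ncells (M q : nat) : nat := (q + M * q.+1)%N.
Definition mesh (q : nat) : R := q.+1%:R^-1.
Local Notation est M q w := (eta xi (ncells M q).+1 (mesh q) w).
Local Notation st M q v := (stp gamma (mesh q) (ncells M q).+1 v).
Local Notation rm M q v := (riem gamma (mesh q) (ncells M q).+1 v).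

Lemma mesh_gt0 q : 0 < mesh q. Proof. by rewrite invr_gt0 ltr0n. Qed.

Lemma ae_path : {ae Q, forall w, [/\ cadlag (xi ^~ w), xi t w @[t --> +oo] --> -oo & xi 0 w = 0]}.
Proof.
have [_ [x0 cx] _ _ _] := xi_levy; have xd := xi_drift.
by apply: filterS3 x0 cx xd.
Qed.

Lemma ae_approx : {ae Q, forall w, forall e : R, 0 < e -> exists M0, forall M, (M0 <= M)%N ->
 exists q0, forall q, (q0 <= q)%N ->
 [/\ J1close e (st M q (est M q w)) (Y w), J1close e (Y w) (st M q (est M q w)),
   rm M q (est M q w) <= e & expR (psum (est M q w) (ncells M q).+1) <= e]}.
Proof.
apply: filterS ae_path => w [cw dw w0] e e0.
have [M0 HM] := lamperti_approx gamma_gt0 cw dw w0 e0.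
exists M0 => M MM; have [q0 Hq] := HM M.+1 (leqW MM) isT.
exists q0 => q qq; have [|J1 J2 rl pl _] := Hq q.+1 (leqW qq) isT (est M q w); last by split.
by move=> i iN; rewrite nth_eta.
Qed.

Lemma lipF_dist k e x x' : 0 <= e -> J1close e x x' -> J1close e x' x ->
 `|lipF k x - lipF k x'| <= k%:R * e.
Proof.
move=> e0 c1 c2; have l1 := lipF_lip F_le k e0 c1; have l2 := lipF_lip F_le k e0 c2.
move: l1 l2; move: (lipF k x) (lipF k x') (k%:R * e) => X X' z *.
by rewrite ler_norml; apply/andP; split; lra.
Qed.

Lemma small_mul k (e : R) : 0 < e -> exists2 d', 0 < d' & k%:R * d' <= e.
Proof.
move=> e0; exists (e / k.+1%:R); first by rewrite divr_gt0 // ltr0n.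
by rewrite mulrCA ler_piMr ?(ltW e0) // ler_pdivrMr ?ltr0n // mul1r ler_nat.
Qed.

Lemma lipF_version k : exists V : T -> R,
 [/\ measurable_fun setT V, forall w, `|V w| <= C & {ae Q, forall w, lipF k (Y w) = V w}].
Proof.
apply: (@ae_limit_bm _ _ _ Q (fun M q w => lipF k (st M q (est M q w))) (fun w => lipF k (Y w)) C).
- move=> M q; exact: (measurable_eta (g := fun s => lipF k (st M q s)) (mesh q) xi_levy
  (fun s => lipF_bounded F_le k _) (ub_lipF gamma_gt0 k _ (mesh_gt0 q) F_le)).
- by move=> M q w; exact: lipF_bounded.
apply: filterS ae_approx => w Hw e e0; have [d' d0 kd] := small_mul k e0.
have [M0 HM] := Hw d' d0; exists M0 => M MM; have [q0 Hq] := HM M MM.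
exists q0 => q qq; have [J1 J2 _ _] := Hq q qq.
by apply: le_trans kd; apply: lipF_dist => //; exact: ltW.
Qed.

Lemma F_version : exists V : T -> R,
 [/\ measurable_fun setT V, forall w, `|V w| <= C & {ae Q, forall w, F (Y w) = V w}].
Proof.
have [VV /all_and3[mV bV aeV]] := choice lipF_version.
apply: (@ae_limit_bm _ _ _ Q (fun M _ => VV M) (fun w => F (Y w)) C) => //.
have aeA : {ae Q, forall w, forall k, lipF k (Y w) = VV k w}.
 exact/ae_foralln.
apply: filterS2 ae_path aeA => w [cw dw w0] HV e e0.
have cY : cadlag (Y w) by exact: cadlag_lamperti.
have /cvgrPdist_le/(_ _ e0)[k0 _ Hk] := lipF_cvg F_le F_cont cY.
by exists k0 => k kk; exists 0%N => q _; rewrite -HV distrC; exact: Hk.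
Qed.

(** Off a set of small probability [lipF k] is within [e / 2] of [F] along the limit path; on that
    set the common bound [C] costs at most [e / 2]. *)
Lemma lipF_near (V : T -> R) (e : R) : 0 < e -> measurable_fun setT V -> (forall w, `|V w| <= C) ->
 {ae Q, forall w, F (Y w) = V w} ->
 exists k (W : T -> R), [/\ measurable_fun setT W, forall w, `|W w| <= C,
  {ae Q, forall w, lipF k (Y w) = W w} & Ex V <= Ex W + e].
Proof.
move=> e0 mV bV aeV; have e2 : 0 < e / 2 by rewrite divr_gt0.
have [VV /all_and3[mVV bVV aeVV]] := choice lipF_version.
have c0 : 0 < e / 2 / (2 * C) by rewrite !divr_gt0 // mulr_gt0.
pose B k := [set w | e / 2 < V w - VV k w].
have mB k : measurable (B k) by apply: measurable_gt; exact: measurable_funB.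
have [|k [_ /(_ _ (leqnn _)) Qk]] := @ae_iter_small _ _ _ Q (fun k _ => B k) (fun k _ => mB k) _ _ c0.
 have aeA : {ae Q, forall w, forall k, lipF k (Y w) = VV k w} by exact/ae_foralln.
 apply: filterS3 ae_path aeA aeV => w [cw dw w0] HV FV.
 have cY : cadlag (Y w) by exact: cadlag_lamperti.
 have /cvgrPdist_le/(_ _ e2)[k0 _ Hk] := lipF_cvg F_le F_cont cY.
 exists k0 => k kk; exists 0%N => q _; rewrite /B /= -HV -FV => /lt_geF/negP; apply.
 by apply: le_trans (Hk k kk); exact: ler_norm.
exists k, (VV k); split => //.
have bmV : bm V by split => //; exists C.
have bmW : bm (VV k) by split => //; exists C.
have H1 w : ~ B k w -> V w <= VV k w + e / 2 by move=> /negP; rewrite -leNgt lerBlDl.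
have H2 w : B k w -> V w <= VV k w + e / 2 + 2 * C.
 move=> _; have := bV w; have := bVV k w; rewrite !ler_norml => /andP[? ?] /andP[? ?].
 by move: e2; move: (e / 2) => *; lra.
apply: (le_trans (Ex_le_except Q bmV bmW (mB k) H1 H2)).
rewrite -addrA lerD2l [leRHS]splitr lerD2l mulrC -ler_pdivlMr ?mulr_gt0 //.
Qed.

Lemma cutoff01 h N (e1 e2 : R) s : 0 <= cutoff gamma h N e1 e2 s <= 1.
Proof.
rewrite /cutoff; have /andP[c1 c2] := clamp01 (2 - riem gamma h N s / e1).
have /andP[c3 c4] := clamp01 (2 - expR (psum s N) / e2).
by rewrite mulr_ge0 //= mulr_ile1.
Qed.

Lemma cutoff_eq1 h N (r : R) s : 0 < r -> riem gamma h N s <= r -> expR (psum s N) <= r ->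
 cutoff gamma h N r r s = 1.
Proof.
move=> r0 h1 h2; have H (x : R) : x <= r -> clamp (2 - x / r) = 1.
 move=> xr; have : x / r <= 1 by rewrite ler_pdivrMr // mul1r.
 by move=> ?; apply: clamp_ge1; lra.
by rewrite /cutoff !H // mulr1.
Qed.

Lemma cutoff_neq0 h N (r : R) s : 0 < r -> cutoff gamma h N r r s != 0 ->
 riem gamma h N s <= 2 * r /\ expR (psum s N) <= 2 * r.
Proof.
move=> r0; rewrite /cutoff mulf_eq0 negb_or => /andP[h1 h2].
have H (x : R) : clamp (2 - x / r) != 0 -> x <= 2 * r.
 move=> cx; rewrite leNgt; apply: contra cx => rx; rewrite clamp_le0 //.
 by rewrite subr_le0 ler_pdivlMr // ltW.
by split; apply: H.
Qed.

(** The shift by [C] makes the first factor nonnegative, so that the cutoff can only decrease the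
    product. A lower bound survives the cutoff for this reason, whereas an upper bound would not. *)
Definition lower k M q (r : R) v : R :=
 (lipF k (st M q v) + C) * cutoff gamma (mesh q) (ncells M q).+1 r r v.

Lemma lower01 k M q r v : 0 <= lower k M q r v <= 2 * C.
Proof.
have := lipF_bounded F_le k (st M q v); rewrite ler_norml /lower => /andP[l1 l2].
have /andP[c0 c1] := cutoff01 (mesh q) (ncells M q).+1 r r v.
have lC : 0 <= lipF k (st M q v) + C by rewrite -lerBlDr sub0r.
rewrite mulr_ge0 //=; apply: (@le_trans _ _ (lipF k (st M q v) + C)).
 by rewrite ler_piMr.
by rewrite mulr_natl mulr2n lerD2r.
Qed.

Lemma lower_le k M q r v : `|lower k M q r v| <= 2 * C.
Proof. by have /andP[l0 l1] := lower01 k M q r v; rewrite ger0_norm. Qed.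

Lemma ub_lower k M q r : 0 < r -> unif_box (lower k M q r) (ncells M q).+1.
Proof.
move=> r0; have h0 := mesh_gt0 q.
apply: (@ubM _ _ _ _ (2 * C + 1)); first by rewrite ltr_pwDr // mulr_ge0 // ltW.
- move=> s; have := lipF_bounded F_le k (st M q s); rewrite !ler_norml => /andP[l1 l2].
 by apply/andP; split; move: l1 l2 C_gt0; move: (Submission.lipF _ _ _ _) => *; lra.
- move=> s; have /andP[c0 c1] := cutoff01 (mesh q) (ncells M q).+1 r r s.
 by rewrite ger0_norm // (le_trans c1) // lerDr mulr_ge0 // ltW.
- by apply: ubD; [exact: ub_lipF|exact: ub_cst].
- exact: ub_cutoff.
Qed.

Lemma Ex_lower k (W : T -> R) (r e : R) : measurable_fun setT W -> (forall w, `|W w| <= C) ->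
 {ae Q, forall w, lipF k (Y w) = W w} -> 0 < r -> 0 < e ->
 exists M q0, forall q, (q0 <= q)%N -> Ex W + C <= Ex (fun w => lower k M q r (est M q w)) + e.
Proof.
move=> mW bW aeW r0 e0; have e2 : 0 < e / 2 by rewrite divr_gt0.
have c0 : 0 < e / 2 / (2 * C) by rewrite !divr_gt0 // mulr_gt0.
have ml M q : measurable_fun setT (fun w => lower k M q r (est M q w)).
 by apply: (measurable_eta (mesh q) xi_levy (lower_le k M q r)); exact: ub_lower.
pose B M q := [set w | e / 2 < W w + C - lower k M q r (est M q w)].
have mWC : measurable_fun setT (fun w => W w + C) by exact: measurable_funD.
have mB M q : measurable (B M q) by apply: measurable_gt; exact: measurable_funB.
have [|M [q0 Qk]] := @ae_iter_small _ _ _ Q B mB _ _ c0.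
 have [d1 d10 kd] := small_mul k e2.
 apply: filterS2 ae_approx aeW => w Hw HW.
 have d0 : 0 < Num.min d1 r by rewrite lt_min d10.
 have [M0 HM] := Hw _ d0; exists M0 => M MM; have [q0 Hq] := HM M MM.
 exists q0 => q qq; have [J1 J2 rl pl] := Hq q qq.
 rewrite /B /= -HW /lower cutoff_eq1 ?mulr1 //; [|by rewrite (le_trans rl) // ge_min lexx orbT|
   by rewrite (le_trans pl) // ge_min lexx orbT].
 have := lipF_dist k (ltW d0) J2 J1.
 have : k%:R * Num.min d1 r <= e / 2 by apply: le_trans kd; rewrite ler_wpM2l // ge_min lexx.
 rewrite ler_norml; move: (Submission.lipF _ _ _ _) (Submission.lipF _ _ _ _) (k%:R * _) (e / 2) => x y z u h1 /andP[_ h2].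
 by move=> /lt_geF/negP; apply; lra.
exists M, q0 => q qq.
have bmW : bm (fun w => W w + C) by split => //; apply: bddD; [exists C|exact: bdd_cst].
have bml : bm (fun w => lower k M q r (est M q w)) by split => //; exists (2 * C) => w; exact: lower_le.
have H1 w : ~ B M q w -> W w + C <= lower k M q r (est M q w) + e / 2 by move=> /negP; rewrite -leNgt lerBlDl.
have H2 w : B M q w -> W w + C <= lower k M q r (est M q w) + e / 2 + 2 * C.
 move=> _; have := bW w; have /andP[] := lower01 k M q r (est M q w).
 rewrite !ler_norml; move: (lower _ _ _ _ _) => x ? ? /andP[? ?].
 by move: e2; move: (e / 2) => *; lra.
have := Ex_le_except Q bmW bml (mB M q) H1 H2.
rewrite (ExD Q _ (bm_cst C)) ?Ex_cst; last by split => //; exists C.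
move=> H; apply: (le_trans H).
rewrite -addrA lerD2l [leRHS]splitr lerD2l mulrC -ler_pdivlMr ?mulr_gt0 //.
exact: Qk.
Qed.

End LimitSide.

(** * Pathwise lower bound for the chain *)

Section ChainLower.
Variable R : realType.
Variables (a : nat -> R) (gamma : R) (n : nat) (eps B cm e1 : R) (M q : nat).
Local Notation h := (@mesh R q).
Local Notation N := (ncells M q).+1.
Local Notation rn s := (run a n h N eps (- B) B s).
Hypotheses (a_gt0 : forall n, 0 < a n) (n_gt0 : (0 < n)%N) (gamma_gt0 : 0 < gamma)
 (eps_ge0 : 0 <= eps) (B_ge0 : 0 <= B) (e1_ge0 : 0 <= e1) (e1_le1 : e1 <= 1) (cm_gt0 : 0 < cm)
 (cm_le : cm <= h).

Lemma ncells_mesh : N%:R * h = M.+1%:R :> R.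
Proof. by rewrite (_ : N = (M.+1 * q.+1)%N) // natrM mulfK // pnatr_eq0. Qed.

(** The factors in the hypotheses make the contributions of [riem], of the last cell, of [e1], of
    [eps] and of the overshoots at most $dl/4$, $dl/4$, $dl/8$, $dl/8$ and $dl/8$. *)
Lemma clock_bound v (r dl : R) : 0 <= r -> riem gamma h N v <= 2 * r -> 16 * r <= dl ->
 32 * (M.+1%:R * e1) <= dl -> 64 * (M.+1%:R * (expR (gamma * B) * (gamma * eps))) <= dl ->
 8 * (N%:R * (cm * expR (gamma * B))) <= dl -> 8 * (h * (expR (gamma * B) + 1)) <= dl ->
 clock_err gamma h eps B cm e1 v N + (h + cm) * (expR (gamma * B) + e1) <= dl.
Proof.
move=> r0 rv rd ed epd cd hd; have h0 : 0 < h := mesh_gt0 q.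
rewrite clock_err_riem //; set Cb := expR _ in epd cd hd *.
have Cb0 : 0 <= Cb by exact: expR_ge0.
have h1 : (h + cm) / h * riem gamma h N v <= 4 * r.
 apply: (@le_trans _ _ (2 * riem gamma h N v)).
  apply: ler_wpM2r; last by rewrite ler_pdivrMr //; move: cm_le; move: (mesh _) => *; lra.
  by apply: sumr_ge0 => i _; rewrite mulr_ge0 // ltW.
 by move: rv; move: (riem _ _ _ _) => *; lra.
have h2 : (h + cm) * (Cb + e1) <= 2 * (h * (Cb + 1)).
 rewrite mulrA; apply: ler_pM; [by rewrite addr_ge0 // ltW|by rewrite addr_ge0| |by rewrite lerD2l].
 by move: cm_le; move: (mesh _) => *; lra.
have h3 : N%:R * ((h + cm) * (2 * (e1 + Cb * (gamma * (2 * eps)))) + cm * Cb) <=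
  4 * (M.+1%:R * e1) + 8 * (M.+1%:R * (Cb * (gamma * eps))) + N%:R * (cm * Cb).
 rewrite mulrDr lerD2r.
 have e2 : 0 <= e1 + Cb * (gamma * (2 * eps)).
  by rewrite addr_ge0 // mulr_ge0 // mulr_ge0 ?(ltW gamma_gt0) // mulr_ge0.
 have : (h + cm) * (2 * (e1 + Cb * (gamma * (2 * eps)))) <= 2 * h * (2 * (e1 + Cb * (gamma * (2 * eps)))).
  by apply: ler_wpM2r; [rewrite mulr_ge0|move: cm_le; move: (mesh _) => *; lra].
 move=> /(ler_wpM2l (ler0n R N)) => H; apply: (le_trans H).
 by rewrite -ncells_mesh le_eqVlt; apply/orP; left; apply/eqP; ring.
move: h1 h2 h3 rd ed epd cd hd.
move: ((h + cm) / h * riem gamma h N v) ((h + cm) * (Cb + e1)) (N%:R * (_ + cm * Cb)) (N%:R * (cm * Cb)).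
move: (M.+1%:R * e1) (M.+1%:R * (Cb * (gamma * eps))) (h * (Cb + 1)).
by move=> *; lra.
Qed.

Hypotheses (c_le : forall x, in_range n (- B) B x -> (a x)^-1 <= cm)
 (a_uct : forall x, in_range n (- B) B x -> `|a x / a n - expR (gamma * lg R n x)| <= e1).
Variables (K : nat) (eta z r dl : R).
Hypotheses (K_range : forall x, in_range n (- B) B x -> (K < x)%N) (r_gt0 : 0 < r)
 (r_z : 2 * r <= z).
Hypothesis clock_le : forall v, riem gamma h N v <= 2 * r ->
 clock_err gamma h eps B cm e1 v N + (h + cm) * (expR (gamma * B) + e1) <= dl.
Hypotheses (eps_dl : expR B * (2 * eps) <= dl) (z_dl : z * expR (4 * eps) <= dl)
 (eta_dl : eta <= dl) (K_dl : K%:R <= dl * n%:R).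
Variables (F : (R -> R) -> R) (C : R) (k : nat).
Hypothesis F_le : forall x, `|F x| <= C.
Local Notation post := (post a n h N eps B K eta z).

Lemma post_cases s : [\/ post s = 0%N, post s = 1%N, post s = 2%N | post s = 3%N].
Proof.
have po x : [\/ post_of n K eta x = 0%N, post_of n K eta x = 1%N, post_of n K eta x = 2%N
  | post_of n K eta x = 3%N].
 rewrite /post_of; case: ifP => _; first exact: Or44.
 by case: ifP => _; [exact: Or43|exact: Or42].
elim: s => [|x s IH]; first exact: Or41.
rewrite post_cons; case: ifP => _; first by case: ifP => _ //; exact: Or41.
by case: ifP.
Qed.

(** A nonzero cutoff bounds [riem] and puts the last level below [z], so [post] is not 0. If it is
    2, the subtracted [2 * C] already exceeds the left term; otherwise the chain is close to the
    step path and the Lipschitz property of [lipF] applies. *)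
Lemma chain_lower s : hpos s -> last 0%N s = n ->
 (good n N (- B) B (rn s))%:R * lower gamma F C k M q r (sd (rn s)) -
  k%:R * dl - 2 * C * (post s == 2%N)%:R <= F (cpath a n K s) + C.
Proof.
move=> hs ls; have h0 : 0 < h := mesh_gt0 q.
have dl0 : 0 <= dl by apply: le_trans eps_dl; rewrite mulr_ge0 ?expR_ge0 // mulr_ge0.
have kd : 0 <= k%:R * dl by rewrite mulr_ge0.
have FC : 0 <= F (cpath a n K s) + C.
 by have := F_le (cpath a n K s); rewrite ler_norml => /andP[+ _]; rewrite -lerBlDr sub0r.
have C0 : 0 <= 2 * C by rewrite mulr_ge0 // (le_trans _ (F_le (fun=> 0))).
have p2 : 0 <= 2 * C * (post s == 2%N)%:R by rewrite mulr_ge0.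
have triv : 0 - k%:R * dl - 2 * C * (post s == 2%N)%:R <= F (cpath a n K s) + C.
 by move: kd FC p2; move: (k%:R * dl) (_ * _) (_ + _) => *; lra.
have [gd|] := boolP (good _ _ _ _ _); last by rewrite mul0r.
rewrite mul1r; set v := sd (rn s).
have [c0|c0] := eqVneq (cutoff gamma h N r r v) 0; first by rewrite /lower c0 mulr0.
have [rv pv] := cutoff_neq0 r_gt0 c0.
have pn0 : post s != 0%N.
 apply: (post_good a_gt0 n_gt0 h0 (ltn0Sn _) gamma_gt0 eps_ge0 B_ge0 e1_ge0 cm_gt0 c_le a_uct) => //.
 exact: le_trans r_z.
have [ps2|ps2] := eqVneq (post s) 2%N.
 have /andP[_ lC] := lower01 gamma F_le k M q r v.
 by rewrite mulr1; move: lC kd FC; move: (lower _ _ _ _ _ _ _ _) (k%:R * dl) (F _) => *; lra.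
have ps : (post s == 1%N) || (post s == 3%N).
 by case: (post_cases s) => E; rewrite E in pn0 ps2 *.
have J := chain_close a_gt0 n_gt0 h0 (ltn0Sn _) gamma_gt0 eps_ge0 B_ge0 e1_ge0 cm_gt0 c_le a_uct hs ls ps
 K_range (clock_le rv) eps_dl z_dl eta_dl K_dl.
have l1 := lipF_lip F_le k dl0 J.
have l2 := lipF_le F_le k (cadlag_cpath K (a_gt0 n) s).
have l3 := lipF_bounded F_le k (stp gamma h N v).
have /andP[q0 q1] := cutoff01 gamma h N r r v.
have l4 : lower gamma F C k M q r v <= lipF F C k (stp gamma h N v) + C.
 rewrite /lower ler_piMr //; move: l3; rewrite ler_norml => /andP[+ _].
 by rewrite -lerBlDr sub0r.
rewrite mulr0; move: l1 l2 l4; rewrite -/v.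
move: (lower _ _ _ _ _ _ _ _) (lipF _ _ _ _) (lipF _ _ _ _) (k%:R * dl) (F _) => *; lra.
Qed.

End ChainLower.

Lemma near_mesh (R : realType) (A c : R) : 0 < c -> \forall q \near \oo, A * mesh q <= c.
Proof.
move=> c0; apply: filterS (near_natge (A / c)) => q qA; have q0 : 0 < q.+1%:R :> R by rewrite ltr0n.
rewrite /mesh ler_pdivrMr // mulrC -ler_pdivrMr // (le_trans qA) // ler_nat.
exact: leqnSn.
Qed.

Lemma lower_arith (R : realType) (C u x1 x2 x3 x4 y1 y2 y3 t : R) : y1 - t - y2 <= x4 + C ->
 x2 + C <= x3 + u -> y2 <= u -> y3 <= u -> - (u + y3) <= y1 - x3 -> x1 <= x2 + u -> t <= u ->
 0 < u -> x1 - 8 * u <= x4.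
Proof. by lra. Qed.

(** The cap only lowers the integrand, so one eventual bound for the full integral in (A3) serves
    all [D]. *)
Lemma tail_bound (R : realType) (p : nat -> nat -> R) (a : nat -> R) (beta : R) :
 (forall n k, 0 <= p n k) ->
 (forall n, (0 < n)%N -> (fun N => \sum_(1 <= k < N) p n k) @ \oo --> (1 : R)) ->
 (forall n, 0 < a n) -> 0 < beta ->
 (limn_esup (fun n => (a n)%:E *
   Pistar_int p n (fun x => (expR (beta * x) * (if 1 < x then 1 else 0))%R)) < +oo)%E ->
 exists C3, \forall j \near \oo, forall D, a j * jump p j (tailB beta D) <= C3.
Proof.
move=> p_ge0 p_sum1 a_gt0 b0 /ereal_inf_lt[_ [A Aoo <-] supA].
set f := fun x : R => _ in supA.
exists (fine (ereal_sup [set (a n)%:E * Pistar_int p n f | n in A]%E)).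
have j0 : \forall j \near \oo, (0 < j)%N by exists 1%N.
apply: filterS2 Aoo j0 => j Aj j0 D.
have bt := bdd_tailB D (ltW b0).
have le1 : ((a j * jump p j (tailB beta D))%:E <= (a j)%:E * Pistar_int p j f)%E.
 have E : (jump p j (tailB beta D))%:E = Pistar_int p j (tailB beta D).
  by rewrite /Pistar_int (series1_av p_ge0 p_sum1 j0 (bdd_jump j bt)).
 rewrite EFinM E; apply: lee_wpmul2l; first by rewrite lee_fin ltW.
 apply: lee_nneseries => [i _ _|i _]; rewrite lee_fin; first by rewrite mulr_ge0 ?tailB_ge0.
 rewrite ler_wpM2l // /tailB /f ler_wpM2r //; first by case: ifP.
 by rewrite ler_expR ler_wpM2l ?(ltW b0) // ge_min lexx.
have le2 : ((a j)%:E * Pistar_int p j f <= ereal_sup [set (a n)%:E * Pistar_int p n f | n in A])%E.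
 by apply: ereal_sup_ubound; exists j.
rewrite -lee_fin fineK ?(le_trans le1) // fin_numElt supA andbT.
by apply: lt_le_trans (le_trans le1 le2); rewrite ltNyr.
Qed.

(** * Convergence of the cell increments of the chain *)

Section ChainLimit.
Variables (R : realType) (p : nat -> nat -> R).
Hypotheses (p_ge0 : forall n k, 0 <= p n k) (p_sum1 : sums_to_one p).
Variables (a : nat -> R) (gamma : R) (Pi : {measure set R -> \bar R}) (b sigma2 : R).
Hypotheses (gamma_gt0 : 0 < gamma) (a_rv : reg_var a gamma) (Pi_levy : levy_measure Pi)
 (A1 : step_limit p a Pi).
Local Notation EN := (EN p).
Local Notation jump := (jump p).
Local Notation jump_cvg := (jump_cvg p a).
Hypotheses (A2b : jump_cvg (@id1 R) b)
 (A2v : jump_cvg (@sq1 R) (sigma2 + Rintegral Pi [set x | `|x| <= 1] (fun x => x ^+ 2))).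
Let a_gt0 : forall n, 0 < a n. Proof. by case: a_rv. Qed.

Section FddLimit.
Local Notation trigv := (trigv Pi b sigma2).
Local Notation trig_prod := (trig_prod Pi b sigma2).
Local Notation trig_comb := (trig_comb Pi b sigma2).
Local Notation rn n h N eps B s := (run a n h N eps (- B) B s).
Local Notation rate := (phi_rate Pi b sigma2).
Local Notation trig1 := (trig1 Pi b sigma2).
Local Notation trig := (seq (R * R * R)).

(** What the almost-martingale of the cells asks of a factor, in a form stable under sums: bounds,
    Lipschitz dependence on a slightly negative remaining time, and invariance under one step up to
    [e / a x]. *)
Definition step_ok (h : R) (g : R -> R -> R) : Prop :=
 [/\ forall r, bdd (g r),
   exists2 M, 0 <= M & forall r d, - h <= r <= h -> `|g r d| <= M,
   exists2 K, 0 <= K & forall r d, - h <= r <= 0 -> `|g r d - g 0 d| <= K * - r &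
   forall e, 0 < e -> \forall x \near \oo, forall r, - h <= r <= h -> forall u,
    `|av p x (fun y => g (r - (a x)^-1) (u + (ln y%:R - ln x%:R))) - g r u| <= e / a x].

Lemma step_okD h g1 g2 : step_ok h g1 -> step_ok h g2 -> step_ok h (fun r d => g1 r d + g2 r d).
Proof.
move=> [b1 [M1 M10 m1] [K1 K10 k1] s1] [b2 [M2 M20 m2] [K2 K20 k2] s2]; split.
- by move=> r; exact: bddD.
- exists (M1 + M2) => [|r d rh]; first exact: addr_ge0.
 by apply: (le_trans (ler_normD _ _)); apply: lerD; auto.
- exists (K1 + K2) => [|r d rh]; first exact: addr_ge0.
 rewrite opprD addrACA mulrDl; apply: (le_trans (ler_normD _ _)); apply: lerD; auto.
move=> e e0; have e2 : 0 < e / 2 by lra.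
have n1 := s1 _ e2; have n2 := s2 _ e2.
near=> x => r rh u.
have x1 : forall r, - h <= r <= h -> forall u,
  `|av p x (fun y => g1 (r - (a x)^-1) (u + (ln y%:R - ln x%:R))) - g1 r u| <= e / 2 / a x.
 by near: x.
have x2 : forall r, - h <= r <= h -> forall u,
  `|av p x (fun y => g2 (r - (a x)^-1) (u + (ln y%:R - ln x%:R))) - g2 r u| <= e / 2 / a x.
 by near: x.
rewrite avD //; [|exact: (bdd_comp _ (b1 _))|exact: (bdd_comp _ (b2 _))].
rewrite opprD addrACA; apply: (le_trans (ler_normD _ _)).
by rewrite [X in _ <= X / _](splitr e) mulrDl; apply: lerD; auto.
Unshelve. all: by end_near.
Qed.

(** A step multiplies the mean of $e^{it\cdot}$ by $1+\Phi(t)/a_x+o(1/a_x)$ and reduces the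
    remaining time by $1/a_x$, which divides the weight $e^{r\Phi(t)}$ by $e^{\Phi(t)/a_x}$; the two
    effects cancel to first order. *)
Lemma step_ok_trig1 h q : 0 < h -> step_ok h (fun r => trig1 r q).
Proof.
move=> h0; case: q => [[c t] w]; rewrite /trig1 /=.
set A := RePhi _ _ _; set B := ImPhi _ _ _.
have expM (k r : R) : 0 <= k -> - k <= r <= k -> expR (r * A) <= expR (k * `|A|).
 move=> k0 rk; rewrite ler_expR; apply: (le_trans (ler_norm _)); rewrite normrM ler_wpM2r //.
 by rewrite ler_norml.
split.
- move=> r; exists (`|c| * expR (r * A)) => d; rewrite !normrM ler_wpM2l //.
 by rewrite (gtr0_norm (expR_gt0 _)) ler_piMr ?expR_ge0 // cos_max.
- exists (`|c| * expR (h * `|A|)) => [|r d rh]; first by pos.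
 rewrite !normrM ler_wpM2l // (gtr0_norm (expR_gt0 _)) -[leRHS]mulr1.
 by apply: ler_pM; rewrite ?expR_ge0 ?cos_max // expM // ltW.
- exists (`|c| * (`|A| * expR (h * `|A|) + `|B|)) => [|r d /andP[r1 r2]].
  by pos.
 have nr : `|r| = - r by rewrite ler0_norm.
 rewrite -mulrBr normrM -mulrA ler_wpM2l // !mul0r addr0 expR0 mul1r.
 have -> : expR (r * A) * cos (t * d + w + r * B) - cos (t * d + w) =
  (expR (r * A) - 1) * cos (t * d + w + r * B) + (cos (t * d + w + r * B) - cos (t * d + w)).
  by ring.
 rewrite [leRHS]mulrDl; apply: (le_trans (ler_normD _ _)); apply: lerD.
  rewrite normrM; apply: (@le_trans _ _ (`|expR (r * A) - 1|)).
   by rewrite ler_piMr // cos_max.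
  apply: (le_trans (expR_lip _)); rewrite [X in X * _]normrM nr.
  rewrite [leRHS](_ : _ = - r * `|A| * expR (h * `|A|)); last by ring.
  rewrite ler_wpM2l ?mulr_ge0 ?oppr_ge0 // ler_expR normrM nr ler_wpM2r //; lra.
 have [||s _ E] := @MVT0 R (fun z => cos (t * d + w + z) - cos (t * d + w))
   (fun z => - sin (t * d + w + z)) (r * B) _ _.
 + move=> z; rewrite -[X in is_derive _ _ _ X]subr0; apply: is_deriveB.
  have := @is_derive1_comp R cos (fun z => t * d + w + z) z _ _ (is_derive_cos _)
   (is_deriveD (is_derive_cst (t * d + w) z 1) (is_derive_id z 1)).
  by rewrite add0r mulr1.
 + by rewrite addr0 subrr.
 by rewrite E normrM normrN normrM nr (mulrC `|B|) ler_piMl ?mulr_ge0 ?oppr_ge0 // sin_max.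
(* Bounds the prefactor [c * expR ((r - s) * A)]. After a step of length at most [h] the remaining
   time lies in [[- 2 h, h]], whence the factor 2. *)
move=> e e0; pose E := expR (2 * h * `|A|) * (`|c| + 1).
have E0 : 0 < E by pos.
pose Z := A ^+ 2 * expR `|A| + expR `|A| * B ^+ 2 + `|B| ^+ 3 + `|B| * `|A| * expR `|A|.
have Z0 : 0 <= Z.
 apply: addr_ge0; last exact: mulr_ge0 (mulr_ge0 (normr_ge0 _) (normr_ge0 _)) (expR_ge0 _).
 apply: addr_ge0; last exact: exprn_ge0.
 exact: addr_ge0 (mulr_ge0 (sqr_ge0 _) (expR_ge0 _)) (mulr_ge0 (expR_ge0 _) (sqr_ge0 _)).
pose e1 := e / (4 * E); have e10 : 0 < e1 by pos.
have jC : jump_cvg (fun x => cos (t * x) - 1) A.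
 exact: (jump_cvg_cos p_ge0 p_sum1 a_gt0 Pi_levy A1 A2b A2v).
have jS : jump_cvg (fun x => sin (t * x)) B.
 exact: (jump_cvg_sin p_ge0 p_sum1 a_gt0 Pi_levy A1 A2b A2v).
have /cvgrPdist_le/(_ _ e10) nC := jC.
have /cvgrPdist_le/(_ _ e10) nS := jS.
have n1 := a_cvgy gamma_gt0 a_rv 1; have nh := a_cvgy gamma_gt0 a_rv h^-1.
have nZ := a_cvgy gamma_gt0 a_rv (2 * E * Z / e).
near=> x => r rh u.
have ax : 0 < a x by exact: a_gt0.
set s := (a x)^-1; have s0 : 0 < s by pos.
have s1 : s <= 1 by rewrite invf_le1 //; near: x.
have sh : s <= h by rewrite -[leRHS]invrK lef_pV2 ?posrE ?invr_gt0 //; near: x.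
have conv (l m : R) : `|m - a x * l| <= e1 -> `|l - s * m| <= e1 * s.
 move=> H; rewrite (_ : l - s * m = - (s * (m - a x * l))); last first.
  by rewrite mulrBr mulrA mulVf ?gt_eqF // mul1r opprB.
 by rewrite normrN normrM (gtr0_norm s0) mulrC ler_wpM2r // ltW.
have hX : `|jump x (fun y => cos (t * y) - 1) - s * A| <= e1 * s by apply: conv; near: x.
have hY : `|jump x (fun y => sin (t * y)) - s * B| <= e1 * s by apply: conv; near: x.
have sp : 0 < s <= 1 by rewrite s0.
have T := trig_step_error sp hX hY (t * u + w + (r - s) * B).
set al := t * u + w + (r - s) * B in T.
have bc : bdd (fun y : nat => cos (t * (ln y%:R - ln x%:R)) - 1).
 exact: (@bdd_comp _ _ _ (fun z : R => cos (t * z) - 1) _ (bdd_cosB t)).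
have bs : bdd (fun y : nat => sin (t * (ln y%:R - ln x%:R))).
 exact: (@bdd_comp _ _ _ (fun z : R => sin (t * z)) _ (bdd_sinM t)).
have bk (f : nat -> R) (k : R) : bdd f -> bdd (fun y => k * f y).
 by move=> bf; apply: bddM => //; exact: bdd_cst.
have -> : av p x (fun y => c * (expR ((r - s) * A) *
   cos (t * (u + (ln y%:R - ln x%:R)) + w + (r - s) * B))) =
  c * expR ((r - s) * A) * (cos al * (1 + jump x (fun y => cos (t * y) - 1)) -
   sin al * jump x (fun y => sin (t * y))).
 have -> : 1 + jump x (fun y => cos (t * y) - 1) = av p x (fun y : nat => 1 + (cos (t * (ln y%:R - ln x%:R)) - 1)).
  by rewrite avD ?av_cst //; exact: bdd_cst.
 rewrite /Submission.jump.
 have b1 : bdd (fun y : nat => 1 + (cos (t * (ln y%:R - ln x%:R)) - 1)).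
  by apply: bddD => //; exact: bdd_cst.
 rewrite -avZ // -avZ // -avB //; [|exact: bk..].
 rewrite -avZ //; last by apply: bddB; exact: bk.
 apply: eq_av => y _; rewrite -mulrA; congr (_ * (_ * _)).
 rewrite [1 + _]addrC subrK -cosD; congr cos; rewrite /al; ring.
have -> : expR (r * A) = expR ((r - s) * A) * expR (s * A).
 by rewrite -expRD -mulrDl subrK.
have -> : t * u + w + r * B = al + s * B by rewrite /al; ring.
rewrite [X in `|X|](_ : _ = c * expR ((r - s) * A) * (cos al * (1 + jump x (fun y => cos (t * y) - 1)) -
   sin al * jump x (fun y => sin (t * y)) - expR (s * A) * cos (al + s * B))); last by ring.
rewrite normrM; apply: (@le_trans _ _ (E * ((2 * e1 + s * Z) * s))).
 apply: ler_pM => //; rewrite normrM (gtr0_norm (expR_gt0 _)) mulrC /E.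
 apply: ler_pM => //; rewrite ?expR_ge0 //; last by rewrite lerDl.
 by apply: expM; [rewrite mulr_ge0 // ltW|move: rh s0 sh => /andP[? ?]; lra].
rewrite mulrA ler_pM2r // mulrDr.
have h1 : E * (2 * e1) = e / 2 by rewrite /e1; field; rewrite gt_eqF.
have h2 : E * (s * Z) <= e / 2.
 have : 2 * E * Z / e <= a x by near: x.
 rewrite ler_pdivrMr // => hh.
 rewrite mulrCA ler_pdivrMl // -(ler_pM2l (_ : 0 < 2)) //.
 by rewrite mulrA (_ : 2 * (a x * (e / 2)) = a x * e) //; field.
by rewrite h1 [leRHS](splitr e) lerD2l.
Unshelve. all: by end_near.
Qed.

Lemma step_ok_trigv h l : 0 < h -> step_ok h (trigv l).
Proof.
move=> h0; elim: l => [|q l IH].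
 have z (r d : R) : trigv [::] r d = 0 by rewrite /trigv big_nil.
 split.
 - by move=> r; exists 0 => d; rewrite z normr0.
 - by exists 0 => // r d _; rewrite z normr0.
 - by exists 0 => // r d _; rewrite !z subrr normr0 mul0r.
 move=> e e0; near=> x => r _ u.
 under eq_av do rewrite z.
 by rewrite av_cst // z subrr normr0 divr_ge0 // ltW.
rewrite (_ : trigv (q :: l) = fun r d => trig1 r q d + trigv l r d); last first.
 by apply/funext => r; apply/funext => d; rewrite /trigv big_cons.
by apply: step_okD => //; exact: step_ok_trig1.
Unshelve. all: by end_near.
Qed.

(** The smallest state of the window grows like $ne^{-B}$, so what holds for large states holds
    throughout the window for large [n]. *)
Lemma near_range (Pr : nat -> Prop) (B : R) : (\forall x \near \oo, Pr x) ->
 \forall n \near \oo, forall x, in_range n (- B) B x -> Pr x.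
Proof.
move=> [m0 _ H]; near=> n => x /and3P[x0 xl _]; apply: H => /=.
have n0 : (0 < n)%N by near: n; exists 1%N.
have mn : m0%:R * expR B <= n%:R by near: n; exact: near_natge.
rewrite -(ler_nat R) -(ler_pM2r (expR_gt0 B)); apply: (le_trans mn).
rewrite -[n%:R in leLHS]lnK ?posrE ?ltr0n // -[x%:R in leRHS]lnK ?posrE ?ltr0n //.
by rewrite -expRD ler_expR; move: xl; rewrite /lg; lra.
Unshelve. all: by end_near.
Qed.

Lemma c_range (B c : R) : 0 < c ->
 \forall n \near \oo, forall x, in_range n (- B) B x -> (a x)^-1 <= c.
Proof.
move=> c0; apply: near_range; have := a_cvgy gamma_gt0 a_rv c^-1; apply: filterS => x.
by rewrite -[X in _ <= X -> _]invrK lef_pV2 ?posrE ?invr_gt0.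
Qed.

Lemma trig_unif h N (ls : nat -> trig) : 0 < h ->
 exists M K, [/\ 1 <= M, 0 <= K,
  forall i r d, (i < N)%N -> - h <= r <= h -> `|trigv (ls i) r d| <= M,
  forall i r d, (i < N)%N -> - h <= r <= 0 ->
   `|trigv (ls i) r d - trigv (ls i) 0 d| <= K * - r &
  forall e, 0 < e -> \forall x \near \oo, forall i, (i < N)%N ->
   forall r, - h <= r <= h -> forall u,
   `|av p x (fun y => trigv (ls i) (r - (a x)^-1) (u + (ln y%:R - ln x%:R))) -
    trigv (ls i) r u| <= e / a x].
Proof.
move=> h0; elim: N => [|N [M [K [M1 K0 IM IK IS]]]].
 by exists 1, 0; split => // e e0; near=> x.
have [_ [M' M'0 m'] [K' K'0 k'] s'] :=
 step_ok_trigv (ls N) h0.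
exists (M + M'), (K + K'); split.
- by rewrite (le_trans M1) // lerDl.
- exact: addr_ge0.
- move=> i r d; rewrite ltnS leq_eqVlt => /orP[/eqP ->|iN] rh.
  by apply: (le_trans (m' _ _ rh)); rewrite lerDr (le_trans ler01).
 by apply: (le_trans (IM _ _ _ iN rh)); rewrite lerDl.
- move=> i r d iN rh; have /andP[_ r0] := rh.
 have r1 : 0 <= - r by rewrite oppr_ge0.
 move: iN; rewrite mulrDl ltnS leq_eqVlt => /orP[/eqP ->|iN].
  by apply: (le_trans (k' _ _ rh)); rewrite lerDr mulr_ge0.
 by apply: (le_trans (IK _ _ _ iN rh)); rewrite lerDl mulr_ge0.
move=> e e0; have := IS e e0; have := s' e e0; apply: filterS2 => x s1 s2 i.
rewrite ltnS leq_eqVlt => /orP[/eqP ->|iN]; first exact: s1.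
exact: s2.
Unshelve. all: by end_near.
Qed.

Lemma fdd_trig h N ls : 0 < h -> (0 < N)%N ->
 exists2 M, 0 <= M & forall eps B e, 0 < e -> \forall n \near \oo, forall k,
 `|EN k (fun s => (sj (rn n h N eps B s) == N)%:R * trig_prod N ls (sd (rn n h N eps B s))) [:: n]
   - \prod_(0 <= i < N) trigv (ls i) h 0|
  <= e + M * EN k (fun s => (~~ (sj (rn n h N eps B s) == N))%:R) [:: n].
Proof.
move=> h0 N0; have [M [K [M1 K0 bM bK bS]]] := trig_unif N ls h0.
have M0 : 0 <= M ^+ N by rewrite exprn_ge0 // (le_trans ler01).
exists (M ^+ N) => // eps B e e0.
have N0' : 0 < N%:R :> R by rewrite ltr0n.
pose Q := M ^+ N + 1; have Q0 : 0 < Q by rewrite ltr_wpDl.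
pose c := Num.min h (e / (2 * (Q * (K + 1) * N%:R))).
have K1 : 0 < K + 1 by rewrite ltr_wpDl.
have c0 : 0 < c.
 rewrite /c lt_min h0 /=; apply: divr_gt0 => //.
 by apply: mulr_gt0 => //; apply: mulr_gt0 => //; apply: mulr_gt0.
pose dl := e / (2 * (Q * (N%:R * (h + c)))).
have hc : 0 < h + c by exact: addr_gt0.
have dl0 : 0 < dl.
 by apply: divr_gt0 => //; apply: mulr_gt0 => //; apply: mulr_gt0 => //; apply: mulr_gt0.
have nS := near_range B (bS dl dl0).
have nc := c_range B c0.
near=> n; move=> k.
have n0 : (0 < n)%N by near: n; exists 1%N.
have cm : forall x, in_range n (- B) B x -> (a x)^-1 <= c by near: n.
have ch : c <= h by rewrite /c ge_min lexx.
have Gs : forall x, in_range n (- B) B x -> forall i, (i < N)%N -> forall r, - h <= r <= h ->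
  forall u, `|av p x (fun y => trigv (ls i) (r - (a x)^-1) (u + (ln y%:R - ln x%:R))) -
    trigv (ls i) r u| <= dl / a x.
 by near: n.
have Gl i r d : (i < N)%N -> - c <= r <= 0 -> `|trigv (ls i) r d - trigv (ls i) 0 d| <= K * c.
 move=> iN /andP[r1 r2]; apply: (le_trans (bK _ _ _ iN _)).
  by apply/andP; split=> //; apply: le_trans r1; rewrite lerN2.
 by rewrite ler_wpM2l // lerNl.
have := fdd_bound p_ge0 p_sum1 eps a_gt0 n0 h0 cm ch c0 N0 (ltW dl0) K0 M1 Gs bM Gl k.
move=> /le_trans; apply; rewrite lerD2r.
apply: (@le_trans _ _ (Q * (dl * (N%:R * (h + c)) + (K + 1) * c * N%:R))).
 apply: ler_pM => //.
 - apply: addr_ge0; last by apply: mulr_ge0 => //; apply: mulr_ge0 => //; exact: ltW.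
  by apply: mulr_ge0; [exact: ltW|apply: mulr_ge0 => //; exact: ltW].
 - by rewrite lerDl.
 - by rewrite lerD2l ler_wpM2r // ler_wpM2r ?(ltW c0) // lerDl.
rewrite mulrDr; have -> : Q * (dl * (N%:R * (h + c))) = e / 2.
 by rewrite /dl; field; rewrite !gt_eqF.
rewrite [leRHS](splitr e) lerD2l.
have : c <= e / (2 * (Q * (K + 1) * N%:R)) by rewrite /c ge_min lexx orbT.
rewrite ler_pdivlMr; last by do ![apply: mulr_gt0 => //].
move=> H; rewrite ler_pdivlMr //; apply: le_trans H.
by rewrite le_eqVlt; apply/orP; left; apply/eqP; ring.
Unshelve. all: by end_near.
Qed.

Lemma extends_hist k s s' : hpos s -> extends k s s' -> hpos s' /\ (size s' = k + size s)%N.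
Proof.
elim: k s => [|k IH] s hs /=; first by move=> ->.
move=> [x x0]; move=> /IH[|hs' ->]; first by rewrite /hpos /= x0; case/andP: hs.
by split=> //=; rewrite addSnnS.
Qed.

Lemma hpos_sx n h N eps lo hi s : hpos s -> (0 < sx (run a n h N eps lo hi s))%N.
Proof.
elim: s => [//|x [|y s] IH]; first by rewrite /hpos /= andbT.
rewrite run_cons // /hpos /= => /and3P[x0 y0 ys]; rewrite /upd; case: ifP => _.
 by rewrite /step; do ! case: ifP.
by apply: IH; rewrite /hpos /= y0.
Qed.

Lemma sph_le2 n h N eps lo hi s : (sph (run a n h N eps lo hi s) <= 2)%N.
Proof.
elim: s => [//|x [//|y s] IH]; rewrite run_cons // /upd; case: ifP => // _.
by rewrite /step; do ! case: ifP.
Qed.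

Lemma bdd_good n h N eps lo hi lo' hi' :
 bdd (fun s => (good n N lo' hi' (run a n h N eps lo hi s))%:R : R).
Proof. exact: bdd_bool. Qed.

(** Regular variation bounds the length of each live step from below for fixed [n], so the bounded
    clock allows only finitely many of them. *)
Lemma stop_near (B h : R) (N : nat) eps : 0 < h -> (0 < N)%N ->
 \forall n \near \oo, \forall k \near \oo, forall s, extends k [:: n] s ->
  ~~ alive n N (- B) B (rn n h N eps B s).
Proof.
move=> h0 N0; have u := uct gamma_gt0 a_rv B ltr01.
have nc := c_range B h0.
near=> n.
have n0 : (0 < n)%N by near: n; exists 1%N.
have cm : forall x, in_range n (- B) B x -> (a x)^-1 <= h by near: n.
have un : forall m, (0 < m)%N -> - B <= ln m%:R - ln n%:R <= B ->
 `|a m / a n - expR (gamma * (ln m%:R - ln n%:R))| <= 1 by near: n.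
pose C := a n * (expR (gamma * B) + 1).
have C0 : 0 < C by rewrite mulr_gt0 // addr_gt0 // expR_gt0.
have cmin x : in_range n (- B) B x -> C^-1 <= (a x)^-1.
 move=> /and3P[x0 x1 x2]; rewrite lef_pV2 ?posrE //.
 rewrite -ler_pdivrMl // mulrC.
 have := un x x0; rewrite x1 x2 => /(_ isT); rewrite ler_norml => /andP[_].
 rewrite lerBlDr addrC => /le_trans; apply; rewrite lerD2r ler_expR ler_wpM2l //; exact: ltW.
near=> k => s /extends_hist[]; first by rewrite /hpos /= n0.
move=> hs sz; apply: (stopped_by eps a_gt0 h0 cm h0 N0 (_ : 0 < C^-1) cmin hs).
 by rewrite invr_gt0.
rewrite sz addn1 /= ltr_pdivlMr //; near: k.
have := near_natge (N%:R * (h + h) * C + 1); apply: filterS => k.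
by apply: lt_le_trans; rewrite ltrDl.
Unshelve. all: by end_near.
Qed.

(** A run that has stopped without being good is either in phase 2 or outside the window; in the
    second case [2 * phi B] is at least 1. *)
Lemma good_fail (eps B h : R) (N : nat) : 0 < eps -> 0 < B -> 0 < h -> (0 < N)%N ->
 \forall n \near \oo, \forall k \near \oo,
  EN k (fun s => (~~ good n N (- B) B (rn n h N eps B s))%:R) [:: n] <=
  N%:R * (2 * rate eps * (h + h)) ^+ 2 + 2 * (rate B * (N%:R * (h + h))).
Proof.
move=> e0 B0 h0 N0.
have d1 := near_range B (phi_drift p_ge0 p_sum1 a_gt0 A1 A2b A2v e0).
have d2 := near_range B (phi_drift p_ge0 p_sum1 a_gt0 A1 A2b A2v B0).
have nc := c_range B h0.
have st := stop_near B eps h0 N0.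
near=> n.
have n0 : (0 < n)%N by near: n; exists 1%N.
have cm : forall x, in_range n (- B) B x -> (a x)^-1 <= h by near: n.
have stn : \forall k \near \oo, forall s, extends k [:: n] s ->
  ~~ alive n N (- B) B (rn n h N eps B s) by near: n.
have ph1 : forall x, in_range n (- B) B x -> forall u,
  jump x (fun y => phi eps (u + y)) <= phi eps u + rate eps / a x by near: n.
have ph2 : forall x, in_range n (- B) B x -> forall u,
  jump x (fun y => phi B (u + y)) <= phi B u + rate B / a x by near: n.
near=> k.
have stk : forall s, extends k [:: n] s -> ~~ alive n N (- B) B (rn n h N eps B s).
 by near: k.
have b1 := bad_bound p_ge0 p_sum1 a_gt0 n0 h0 cm h0 e0 (phi_rate_ge0 _ _ _ e0) ph1 k N0.
have b2 := exit_bound p_ge0 p_sum1 eps a_gt0 n0 h0 cm h0 B0 (phi_rate_ge0 _ _ _ B0) ph2 k N0.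
apply: le_trans (lerD b1 (ler_wpM2l (ler0n R 2) b2)).
have bb : bdd (fun s => (sph (rn n h N eps B s) == 2%N)%:R : R) by exact: bdd_bool.
have bp : bdd (fun s => phi B (lg R n (sx (rn n h N eps B s)))).
 by apply: (@bdd_comp _ _ _ (phi B)); exact: bdd_phi.
have bp2 : bdd (fun s => 2 * phi B (lg R n (sx (rn n h N eps B s)))).
 by apply: bddM => //; exact: bdd_cst.
rewrite -ENZ // -END //; apply: EN_le_ext => //.
- exact: bdd_bool.
- exact: bddD.
move=> s ex; have na := stk s ex.
have [|hs sz] := extends_hist _ ex; first by rewrite /hpos /= n0.
have sx0 := hpos_sx n h N eps (- B) B hs.
have [S0 Sh jN jN0 [Sm _]] := mwf_run eps a_gt0 h0 cm h0 s N0.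
have := phi01 (lg R n (sx (rn n h N eps B s))) B0 => /andP[p0 p1].
have p2 : 0 <= 2 * phi B (lg R n (sx (rn n h N eps B s))) by rewrite mulr_ge0.
case: (boolP (good _ _ _ _ _)) => g; first by rewrite addr_ge0.
case: (boolP (sph _ == 2%N)) => ph; first by rewrite lerDl.
rewrite add0r.
have : B <= `|lg R n (sx (rn n h N eps B s))|.
 rewrite leNgt; apply/negP => hB.
 have rg : in_range n (- B) B (sx (rn n h N eps B s)).
  by rewrite /in_range sx0; move: hB; rewrite ltr_norml => /andP[/ltW -> /ltW ->].
 move: na; rewrite /alive rg andbT negb_and -leqNgt => /orP[jN'|].
  by move: g; rewrite /good rg andbT => /negP; apply; rewrite eqn_leq jN jN'.
 move=> ph'; move: ph; have := sph_le2 n h N eps (- B) B s.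
 by rewrite leq_eqVlt (negbTE ph') orbF => /eqP ->.
move=> /(phi_ge_half B0) hp; rewrite (_ : (~~ false)%:R = 1 :> R) //; lra.
Unshelve. all: by end_near.
Qed.

Lemma bdd_trig_prod N ls : bdd (trig_prod N ls).
Proof.
rewrite /Submission.trig_prod; elim: N => [|N IH].
 by exists 1 => v; rewrite big_geq // normr1.
rewrite (_ : (fun v => _) = fun v => \prod_(0 <= i < N) trigv (ls i) 0 (nth 0 v i) *
  trigv (ls N) 0 (nth 0 v N)); last by apply/funext => v; rewrite big_nat_recr.
apply: bddM => //.
apply: (@bdd_comp _ _ _ (trigv (ls N) 0) (fun v : seq R => nth 0 v N)).
by have [] := step_ok_trigv (ls N) ltr01.
Qed.

Lemma bdd_trig_comb N cs : bdd (trig_comb N cs).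
Proof.
rewrite /Submission.trig_comb; elim: cs => [|c cs IH].
 by exists 0 => v; rewrite big_nil normr0.
rewrite (_ : (fun v => _) = fun v => c.1 * trig_prod N c.2 v +
  \sum_(c <- cs) c.1 * trig_prod N c.2 v); last by apply/funext => v; rewrite big_cons.
apply: bddD => //; apply: bddM; first exact: bdd_cst.
exact: bdd_trig_prod.
Qed.

Lemma bdd_fdd N n h eps B (Q : seq R -> R) : bdd Q ->
 bdd (fun s => (sj (rn n h N eps B s) == N)%:R * Q (sd (rn n h N eps B s))).
Proof.
by move=> bQ; apply: bddM; [exact: bdd_bool|exact: bdd_comp].
Qed.

Lemma fdd_comb h N cs : 0 < h -> (0 < N)%N ->
 exists2 M, 0 <= M & forall eps B e, 0 < e -> \forall n \near \oo, forall k,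
 `|EN k (fun s => (sj (rn n h N eps B s) == N)%:R * trig_comb N cs (sd (rn n h N eps B s))) [:: n]
   - \sum_(c <- cs) c.1 * \prod_(0 <= i < N) trigv (c.2 i) h 0|
  <= e + M * EN k (fun s => (~~ (sj (rn n h N eps B s) == N))%:R) [:: n].
Proof.
move=> h0 N0; elim: cs => [|c cs [M M0 IH]].
 exists 0 => // eps B e e0; near=> n; move=> k.
 under eq_EN do rewrite /Submission.trig_comb big_nil mulr0.
 by rewrite EN_cst // big_nil subrr normr0 mul0r addr0 ltW.
have [M1 M10 H1] := fdd_trig c.2 h0 N0.
exists (`|c.1| * M1 + M); first by rewrite addr_ge0 // mulr_ge0.
move=> eps B e e0.
have e1 : 0 < e / (2 * (`|c.1| + 1)) by rewrite divr_gt0 // mulr_gt0 // ltr_wpDl.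
have e2 : 0 < e / 2 by rewrite divr_gt0.
have n1 := H1 eps B _ e1; have n2 := IH eps B _ e2.
near=> n; move=> k.
have q1 : `|EN k (fun s => (sj (rn n h N eps B s) == N)%:R * trig_prod N c.2 (sd (rn n h N eps B s))) [:: n]
   - \prod_(0 <= i < N) trigv (c.2 i) h 0|
  <= e / (2 * (`|c.1| + 1)) + M1 * EN k (fun s => (~~ (sj (rn n h N eps B s) == N))%:R) [:: n].
 by move: k; near: n.
have q2 : `|EN k (fun s => (sj (rn n h N eps B s) == N)%:R * trig_comb N cs (sd (rn n h N eps B s))) [:: n]
   - \sum_(c <- cs) c.1 * \prod_(0 <= i < N) trigv (c.2 i) h 0|
  <= e / 2 + M * EN k (fun s => (~~ (sj (rn n h N eps B s) == N))%:R) [:: n].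
 by move: k {q1}; near: n.
have -> : EN k (fun s => (sj (rn n h N eps B s) == N)%:R * trig_comb N (c :: cs) (sd (rn n h N eps B s))) [:: n]
 = c.1 * EN k (fun s => (sj (rn n h N eps B s) == N)%:R * trig_prod N c.2 (sd (rn n h N eps B s))) [:: n]
 + EN k (fun s => (sj (rn n h N eps B s) == N)%:R * trig_comb N cs (sd (rn n h N eps B s))) [:: n].
 rewrite -ENZ // ?bdd_fdd //; last exact/bdd_fdd/bdd_trig_prod.
 rewrite -END //; last exact/bdd_fdd/bdd_trig_comb.
  by apply: eq_EN => s; rewrite /Submission.trig_comb big_cons mulrDr mulrCA.
 apply: bddM; first exact: bdd_cst.
 exact/bdd_fdd/bdd_trig_prod.
rewrite big_cons opprD addrACA -mulrBr.
apply: (le_trans (ler_normD _ _)); rewrite normrM.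
set F := EN k (fun s => (~~ _)%:R) _ in q1 q2 *.
apply: (le_trans (lerD (ler_wpM2l (normr_ge0 c.1) q1) q2)).
have : `|c.1| * (e / (2 * (`|c.1| + 1))) <= e / 2.
 rewrite mulrCA ler_wpM2l ?(ltW e0) // invfM mulrCA ler_piMr ?invr_ge0 //.
 by rewrite ler_pdivrMr ?mul1r ?lerDl // ltr_wpDl.
set e' := e / (2 * _) => He; rewrite mulrDr; lra.
Unshelve. all: by end_near.
Qed.

(** The constant [M] of [fdd_comb] depends on the trigonometric sum and may be much larger than its
    bound [C]. A second machine with a window [B'] so wide that its failure probability is
    negligible even after multiplication by [M] gives the limit; on good runs of the given machine
    both have the same increments, and elsewhere [C] suffices. *)
Lemma trig_limit h N cs eps B C : 0 < h -> (0 < N)%N -> 0 <= B -> 0 <= C ->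
 (forall v, `|trig_comb N cs v| <= C) -> forall e, 0 < e ->
 \forall n \near \oo, \forall k \near \oo,
 `|EN k (fun s => (good n N (- B) B (rn n h N eps B s))%:R * trig_comb N cs (sd (rn n h N eps B s))) [:: n]
   - \sum_(c <- cs) c.1 * \prod_(0 <= i < N) trigv (c.2 i) h 0|
  <= e + C * EN k (fun s => (~~ good n N (- B) B (rn n h N eps B s))%:R) [:: n].
Proof.
move=> h0 N0 B0 C0 bC e e0; have [M M0 HM] := fdd_comb cs h0 N0.
pose A := N%:R * (2 * (h + h)) ^+ 2; pose D := 2 * (N%:R * (h + h)).
have A0 : 0 <= A by rewrite /A mulr_ge0 // sqr_ge0.
have D0 : 0 <= D by rewrite /D !mulr_ge0 // addr_ge0 // ltW.
have MA0 : 0 < M * (A + D) + 1 by rewrite ltr_wpDl // mulr_ge0 // addr_ge0.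
pose q := Num.min 1 (e / (2 * (M * (A + D) + 1))).
have q0 : 0 < q by rewrite lt_min ltr01 divr_gt0 // mulr_gt0.
have /cvgrPdist_le/(_ _ q0) := phi_rate_cvg0 b sigma2 Pi_levy.
move=> /filterI/(_ (near_natge (2 * B))) nr.
have [r [rq rB]] : exists r : nat, `|0 - rate r.+1%:R| <= q /\ 2 * B <= r%:R.
 by have [r0 _ H] := nr; exists r0; exact: (H r0 (leqnn _)).
pose B' : R := r.+1%:R; have B'0 : 0 < B' by rewrite /B' ltr0n.
have BB : 2 * B <= B' by rewrite (le_trans rB) // ler_nat.
have BB' : B <= B' by apply: le_trans BB; rewrite mulr_natl mulr2n lerDl.
have r0 := phi_rate_ge0 Pi b sigma2 B'0.
have rl : rate B' <= q by move: rq; rewrite sub0r normrN ger0_norm.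
have fl : N%:R * (2 * rate B' * (h + h)) ^+ 2 + 2 * (rate B' * (N%:R * (h + h))) <= q * (A + D).
 rewrite [leRHS]mulrDr; apply: lerD; last first.
  rewrite [leLHS](_ : _ = rate B' * D); last by rewrite /D; ring.
  by rewrite ler_wpM2r.
 rewrite [leLHS](_ : _ = rate B' ^+ 2 * A); last by rewrite /A; ring.
 rewrite ler_wpM2r // expr2; apply: (@le_trans _ _ (1 * rate B')); last by rewrite mul1r.
 by rewrite ler_wpM2r // (le_trans rl) // ge_min lexx.
have e2 : 0 < e / 2 by rewrite divr_gt0.
have n1 := HM B' B' _ e2; have n2 := good_fail B'0 B'0 h0 N0.
near=> n.
have q1 : forall k, `|EN k (fun s => (sj (rn n h N B' B' s) == N)%:R * trig_comb N cs (sd (rn n h N B' B' s))) [:: n]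
   - \sum_(c <- cs) c.1 * \prod_(0 <= i < N) trigv (c.2 i) h 0|
  <= e / 2 + M * EN k (fun s => (~~ (sj (rn n h N B' B' s) == N))%:R) [:: n] by near: n.
have q2 : \forall k \near \oo, EN k (fun s => (~~ good n N (- B') B' (rn n h N B' B' s))%:R) [:: n] <=
  N%:R * (2 * rate B' * (h + h)) ^+ 2 + 2 * (rate B' * (N%:R * (h + h))) by near: n.
near=> k.
have q3 : EN k (fun s => (~~ good n N (- B') B' (rn n h N B' B' s))%:R) [:: n] <=
  N%:R * (2 * rate B' * (h + h)) ^+ 2 + 2 * (rate B' * (N%:R * (h + h))) by near: k.
set E1 := EN k _ _; set L := \sum_(c <- cs) _.
set E2 := EN k (fun s => (sj (rn n h N B' B' s) == N)%:R * trig_comb N cs (sd (rn n h N B' B' s))) [:: n] in q1 *.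
have d1 : `|E2 - L| <= e.
 apply: (le_trans (q1 k)); rewrite [leRHS](splitr e) lerD2l.
 apply: (@le_trans _ _ (M * (q * (A + D)))).
  rewrite ler_wpM2l //; apply: le_trans fl; apply: le_trans q3; apply: EN_le => //.
  - exact: bdd_bool.
  - exact: bdd_bool.
  by move=> s; rewrite ler_nat /good; case: eqP.
 apply: (@le_trans _ _ (q * (M * (A + D) + 1))).
  by rewrite mulrCA ler_wpM2l ?(ltW q0) // lerDl.
 rewrite -ler_pdivlMr // -mulrA -invfM.
 by rewrite ge_min lexx orbT.
have bG : bdd (fun s => (good n N (- B) B (rn n h N eps B s))%:R *
  trig_comb N cs (sd (rn n h N eps B s))).
 by apply: bddM; [exact: bdd_bool|exact/bdd_comp/bdd_trig_comb].
have d2 : `|E1 - E2| <= C * EN k (fun s => (~~ good n N (- B) B (rn n h N eps B s))%:R) [:: n].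
 have H s : `|(good n N (- B) B (rn n h N eps B s))%:R * trig_comb N cs (sd (rn n h N eps B s)) -
   (sj (rn n h N B' B' s) == N)%:R * trig_comb N cs (sd (rn n h N B' B' s))|
   <= C * (~~ good n N (- B) B (rn n h N eps B s))%:R.
  have [_] := run_compare a n h N eps s BB' BB.
  case: (good n N (- B) B _) => /=; last first.
   move=> _; rewrite mul0r sub0r normrN mulr1 normrM ger0_norm //.
   by apply: le_trans (bC (sd (rn n h N B' B' s))); rewrite ler_piMl // lern1 leq_b1.
  by move=> /(_ isT)[[_ _ _ _ ->] /andP[/eqP -> _]]; rewrite eqxx subrr normr0 mulr0.
 have bE2 := bdd_fdd N n h B' B' (bdd_trig_comb N cs).
 have bC' : bdd (fun s => C * (~~ good n N (- B) B (rn n h N eps B s))%:R).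
  by apply: bddM; [exact: bdd_cst|exact: bdd_bool].
 rewrite /E1 /E2 -ENZ //; last exact: bdd_bool.
 rewrite -ENB // ler_norml -ENN //; apply/andP; split; apply: EN_le => //.
 - exact: bddN.
 - exact: bddB.
 - by move=> s; have := H s; rewrite ler_norml => /andP[].
 - exact: bddB.
 - by move=> s; have := H s; rewrite ler_norml => /andP[].
have -> : E1 - L = (E2 - L) + (E1 - E2) by ring.
by apply: (le_trans (ler_normD _ _)); apply: lerD.
Unshelve. all: by end_near.
Qed.

End FddLimit.

Section ChainFdd.
Context {d : measure_display} {T : measurableType d} (Q : probability T R).
Variable xi : R -> T -> R.
Hypothesis xi_levy : levy_process Q b sigma2 Pi xi.
Local Notation rn n h N eps B s := (run a n h N eps (- B) B s).
Local Notation Ex f := (Rintegral Q setT f).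

Lemma chain_fdd h N eps B (g : seq R -> R) (C : R) : 0 < h -> 0 <= B ->
 (forall s, `|g s| <= C) -> unif_box g N.+1 -> forall e, 0 < e ->
 \forall n \near \oo, \forall k \near \oo,
 `|EN k (fun s => (good n N.+1 (- B) B (rn n h N.+1 eps B s))%:R * g (sd (rn n h N.+1 eps B s))) [:: n]
   - Ex (fun w => g (eta xi N.+1 h w))|
  <= e + C * EN k (fun s => (~~ good n N.+1 (- B) B (rn n h N.+1 eps B s))%:R) [:: n].
Proof.
move=> h0 B0 gC ug e e0; have C0 : 0 <= C by apply: le_trans (gC [::]).
have [cs [csC csg mg cscvg]] := fdd_approx xi_levy h gC ug.
have e3 : 0 < e / 3 by rewrite divr_gt0.
have [m [m1 m2 m3]] : exists m : nat, [/\ 2 * B <= m.+1%:R, m.+1%:R^-1 <= e / 3 &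
  `|Ex (fun w => g (eta xi N.+1 h w)) -
   Ex (fun w => trig_comb Pi b sigma2 N.+1 (cs m) (eta xi N.+1 h w))| <= e / 3].
 have /cvgrPdist_le/(_ _ e3) n3 := cscvg.
 have [m _ Hm] := filterI (filterI (near_natge (2 * B)) (near_natge (e / 3)^-1)) n3.
 have [[q1 q2] q3] := Hm m (leqnn m); exists m; split => //.
  by rewrite (le_trans q1) // ler_nat.
 rewrite -[leRHS]invrK lef_pV2 ?posrE ?invr_gt0 ?ltr0n //.
 by rewrite (le_trans q2) // ler_nat.
have TL := trig_limit eps h0 (ltn0Sn N) B0 C0 (csC m) e3.
rewrite -(Ex_trig_comb xi_levy) in TL; last exact: ltW.
apply: filterS TL => n; apply: filterS => k TL.
set E1 := EN k _ _; set E2 := Ex _ in m3 *; set E3 := Ex _ in m3 TL.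
set E4 := EN k _ _ in TL.
have bg : bdd (fun s => (good n N.+1 (- B) B (rn n h N.+1 eps B s))%:R * g (sd (rn n h N.+1 eps B s))).
 by apply: bddM; [exact: bdd_bool|exists C].
have bt : bdd (fun s => (good n N.+1 (- B) B (rn n h N.+1 eps B s))%:R *
  trig_comb Pi b sigma2 N.+1 (cs m) (sd (rn n h N.+1 eps B s))).
 by apply: bddM; [exact: bdd_bool|exists C].
have d1 : `|E1 - E4| <= e / 3.
 rewrite /E1 /E4 -ENB //; apply: EN_norm => // s; rewrite -mulrBr normrM.
 case: (boolP (good _ _ _ _ _)) => /=; last by rewrite normr0 mul0r ltW.
 move=> g1; have [sz sb] := good_increments g1.
 rewrite normr1 mul1r distrC; apply: le_trans m2; apply: csg => // i iN.
 exact: le_trans (sb i iN) m1.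
have -> : E1 - E2 = (E1 - E4) + (E4 - E3) - (E2 - E3) by ring.
apply: (le_trans (ler_normB _ _)).
have := ler_normD (E1 - E4) (E4 - E3); move: d1 TL m3; lra.
Qed.

End ChainFdd.

(** * Exponential moments and the truncated drift of the chain *)

Section Drift.
Local Notation lyapunov := (lyapunov p).
Variables (beta C3 : R).
Hypotheses (beta_gt0 : 0 < beta)
 (A3 : \forall j \near \oo, forall D, a j * jump j (tailB beta D) <= C3).

Lemma jump_cvg_trunc A D : 1 <= A -> 1 <= D -> exists d, jump_cvg (trunc A D) d.
Proof.
move=> A1' D1; have A0 : 0 <= A by lra. have D0 : 0 <= D by lra.
have tC x : `|trunc A D x| <= A + D by exact: trunc_norm.
have t3 x : `|x| <= 1 -> `|trunc A D x - 1 * x - 0 * x ^+ 2| <= (A + D) * `|x| ^+ 3.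
 rewrite ler_norml => /andP[? ?]; rewrite trunc_id; [|lra|lra].
 by rewrite mul1r mul0r subrr subr0 normr0 mulr_ge0 ?exprn_ge0 // addr_ge0.
by eexists; exact: (jump_cvg_taylor p_ge0 p_sum1 a_gt0 Pi_levy A1 A2b A2v (@continuous_trunc R A D) tC t3).
Qed.

Lemma jump_quad : exists2 C, 0 <= C & \forall j \near \oo, a j * jump j (fun x => sq1 x + zeta 1 x) <= C.
Proof.
have bs := @bdd_sq1 R; have bz := @bdd_zeta R 1 ltr01.
have H := jump_cvgD p_ge0 p_sum1 bs bz A2v (zeta_cvg_int p_ge0 p_sum1 A1 ltr01).
set l := _ + Rintegral _ _ _ in H; exists (`|l| + 1); first by rewrite addr_ge0.
have /cvgrPdist_le/(_ 1 ltr01) := H; apply: filterS => j.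
by rewrite ler_norml => /andP[h1 h2]; have := ler_norm l; lra.
Qed.

Lemma C3_ge0 : 0 <= C3.
Proof.
have [j _ /(_ j (leqnn _)) /(_ 0)] := A3; apply: le_trans.
rewrite mulr_ge0 ?(ltW (a_gt0 j)) //; apply: jump_ge0 => //.
 by apply: bdd_tailB; exact: ltW.
exact: tailB_ge0.
Qed.

(** A second-order expansion up to the level 1 reduces to first and second moments, which converge;
    beyond 1 the integrand is at most that of (A3). *)
Lemma exp_drift : exists2 C, 0 <= C & \forall j \near \oo, forall D, 0 <= D ->
 a j * jump j (expB beta D) <= C.
Proof.
have b0 := ltW beta_gt0; have [d cd] := jump_cvg_trunc (lexx 1) (lexx 1).
have [Cq Cq0 nq] := jump_quad.
pose K : R := beta ^+ 2 * ((1 + 1) ^+ 2 * expR (beta * (1 + 1))).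
have K0 : 0 <= K by rewrite !mulr_ge0 ?expR_ge0 ?sqr_ge0.
exists (beta * (`|d| + 1) + K * Cq + C3); first by rewrite !addr_ge0 ?mulr_ge0 ?addr_ge0 // C3_ge0.
have /cvgrPdist_le/(_ 1 ltr01) n1 := cd.
apply: filterS3 n1 nq A3 => j h1 h2 h3 D D0.
have le1 x : expB beta D x <= beta * trunc 1 1 x + K * (sq1 x + zeta 1 x) + tailB beta D x.
 apply: le_trans (lerD (expR_taylor_trunc x b0 (lexx 1) (lexx 1)) (lexx (tailB beta D x))).
 rewrite /expB /tailB; case: ltP => x1; last first.
  rewrite mulr0 addr0 lerD2r ler_expR ler_wpM2l // (@le_trans _ _ x) ?ge_min ?lexx //.
  by rewrite /trunc (min_l x1) le_max lexx orbT.
 by have := expR_gt0 (beta * trunc 1 1 x); rewrite mulr1; move: (expR _) (expR _) => *; lra.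
have bt := @bdd_trunc R 1 1 ler01 ler01; have bT := bdd_tailB D b0.
have bq : bdd (fun x : R => sq1 x + zeta 1 x).
 by apply: bddD; [exact: bdd_sq1|exact: bdd_zeta].
have bZ k (f : R -> R) : bdd f -> bdd (fun x => k * f x).
 by move=> bf; apply: bddM => //; exact: bdd_cst.
have aj := a_gt0 j.
have := ler_wpM2l (ltW aj) (jump_le p_ge0 p_sum1 j (bdd_expB D b0)
 (bddD (bddD (bZ beta _ bt) (bZ K _ bq)) bT) le1).
rewrite (jumpD p_ge0 p_sum1 _ _ bT) ?(jumpD p_ge0 p_sum1 _ (bZ beta _ bt) (bZ K _ bq)); last first.
 by apply: bddD; exact: bZ.
rewrite !(jumpZ p_ge0 p_sum1) // => le2; apply: (le_trans le2).
rewrite !mulrDr !(mulrCA (a j)) -mulrDr; apply: lerD => //; apply: lerD; rewrite ler_wpM2l //.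
by move: h1; rewrite ler_norml => /andP[h1 _]; have := ler_norm d; lra.
Qed.

(** If the limit [d] of the truncated means were below [- c], then for a small enough [t] the
    expansion of $e^{t\min(x,E)}-1$ would have a negative rescaled mean for all large states and all
    caps, so that [t] would satisfy [lyapunov]. *)
Lemma not_lyapunov_drift : (forall t J, 0 < t -> ~ lyapunov t J) ->
 forall A D e, 1 <= A -> 1 <= D -> 0 < e -> \forall j \near \oo,
  - (4 / beta * C3 * expR (- (beta * D / 2)) + e) <= a j * jump j (trunc A D).
Proof.
move=> NL A D e A1' D1 e0.
have A0 : 0 <= A by lra. have D0 : 0 <= D by lra.
have [d cd] := jump_cvg_trunc A1' D1.
have c3 := C3_ge0.
set c := 4 / beta * C3 * expR _.
have dc : - c <= d.
 rewrite leNgt; apply/negP => dc.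
 have [Cq Cq0 nq] := jump_quad.
 pose K := (A + D) ^+ 2 * expR (A + D).
 have K0 : 0 <= K by rewrite mulr_ge0 ?sqr_ge0 ?expR_ge0.
 (* A third of the gap: one share for the convergence of the truncated mean, one for the
    second-order term, and one left over to give a strict sign. *)
 pose e' := (- c - d) / 3; have e'0 : 0 < e' by rewrite divr_gt0 //; lra.
 pose t := Num.min (Num.min 1 (beta / 4)) (e' / (K * Cq + 1)).
 have KC : 0 < K * Cq + 1 by rewrite ltr_wpDl // mulr_ge0.
 have t0 : 0 < t by rewrite /t !lt_min ltr01 /=; apply/andP; split; apply: divr_gt0 => //; lra.
 have t1 : t <= 1 by rewrite !ge_min lexx.
 have tb : t <= beta / 4 by rewrite !ge_min lexx orbT.
 have tK : t * K * Cq <= e'.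
  have : t <= e' / (K * Cq + 1) by rewrite ge_min lexx orbT.
  rewrite ler_pdivlMr // => h; apply: le_trans h.
  by rewrite -mulrA ler_wpM2l ?(ltW t0) // lerDl.
 have /cvgrPdist_le/(_ _ e'0) nd := cd.
 have [J _ HJ] := filterI (filterI nd nq) A3.
 apply: (NL t J t0) => j E Jj E0; rewrite leNgt; apply/negP => gt1.
 have [[h1 h2] h3] := HJ j Jj.
 (* Raising the cap only increases the mean, so it may be assumed at least [D], as the expansion
    requires. *)
 pose E' := Num.max D E.
 have DE : D <= E' by rewrite le_max lexx.
 have be F : bdd (fun x : R => expR (t * Num.min x F)).
  have := bdd_expB F (ltW t0) => bF.
  rewrite (_ : (fun x => _) = fun x => expB t F x + 1); last by apply/funext => x; rewrite /expB subrK.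
  by apply: bddD => //; exact: bdd_cst.
 have gt2 : 1 < jump j (fun x => expR (t * Num.min x E')).
  apply: (lt_le_trans gt1); apply: jump_le => // x.
  rewrite ler_expR ler_wpM2l ?(ltW t0) // le_min !ge_min lexx /=.
  by apply/orP; right; rewrite le_max lexx orbT.
 have bt := bdd_trunc A0 D0.
 have bq : bdd (fun x : R => sq1 x + zeta 1 x).
  by apply: bddD; [exact: bdd_sq1|exact: bdd_zeta].
 have bT := bdd_tailB E' (ltW beta_gt0).
 have bZ k (f : R -> R) : bdd f -> bdd (fun x => k * f x).
  by move=> bf; apply: bddM => //; exact: bdd_cst.
 have le1 : jump j (fun x => expR (t * Num.min x E')) - 1 <=
   (t * jump j (trunc A D) + t ^+ 2 * K * jump j (fun x => sq1 x + zeta 1 x)) +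
   t * (4 / beta * expR (- (beta * D / 2))) * jump j (tailB beta E').
  rewrite -[X in _ - X](jump_cst p_sum1 j 1) -jumpB //; last exact: bdd_cst.
  rewrite -!(jumpZ p_ge0 p_sum1) // -!(jumpD p_ge0 p_sum1); try by [exact: bZ|apply: bddD; exact: bZ].
  apply: jump_le => //.
  - by apply: bddB => //; exact: bdd_cst.
  - by apply: bddD; [apply: bddD|]; exact: bZ.
  by move=> x; apply: exp_trunc_le => //; rewrite (ltW t0).
 have aj := a_gt0 j.
 have : 0 < a j * (jump j (fun x => expR (t * Num.min x E')) - 1) by rewrite mulr_gt0 // subr_gt0.
 apply/negP; rewrite -leNgt; apply: (le_trans (ler_wpM2l (ltW aj) le1)).
 have h3' := h3 E'.
 have q1 : a j * jump j (trunc A D) <= d + e'.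
  by move: h1; rewrite ler_norml => /andP[h1 _]; lra.
 have -> : a j * ((t * jump j (trunc A D) + t ^+ 2 * K * jump j (fun x => sq1 x + zeta 1 x)) +
   t * (4 / beta * expR (- (beta * D / 2))) * jump j (tailB beta E')) =
   t * (a j * jump j (trunc A D) + t * K * (a j * jump j (fun x => sq1 x + zeta 1 x)) +
   4 / beta * expR (- (beta * D / 2)) * (a j * jump j (tailB beta E'))) by ring.
 apply: mulr_ge0_le0; first exact: ltW.
 have q2 : t * K * (a j * jump j (fun x => sq1 x + zeta 1 x)) <= e'.
  by apply: le_trans tK; rewrite ler_wpM2l // mulr_ge0 // ltW.
 have q3 : 4 / beta * expR (- (beta * D / 2)) * (a j * jump j (tailB beta E')) <= c.
  by rewrite /c (mulrAC _ C3) ler_wpM2l // mulr_ge0 ?expR_ge0 // divr_ge0 // ltW.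
 have : d = - c - 3 * e' by rewrite /e'; field.
 move=> dE; apply: (le_trans (lerD (lerD q1 q2) q3)).
 by rewrite dE [leLHS](_ : _ = - e') ?oppr_le0 ?(ltW e'0) //; ring.
have /cvgrPdist_le/(_ _ e0) := cd; apply: filterS => j.
by rewrite ler_norml => /andP[h1 h2]; lra.
Qed.

End Drift.

(** * Moment bounds transferred to the Lévy process *)

Section LevyMoments.
Variables (beta C3 : R).
Hypotheses (beta_gt0 : 0 < beta)
 (A3 : \forall j \near \oo, forall D, a j * jump j (tailB beta D) <= C3).
Context {d : measure_display} {T : measurableType d} (Q : probability T R).
Variable xi : R -> T -> R.
Hypothesis xi_levy : levy_process Q b sigma2 Pi xi.
Local Notation Ex f := (Rintegral Q setT f).
Local Notation rate := (phi_rate Pi b sigma2).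

(** With [eps = 2 * B] both error terms of [good_fail] tend to 0 as [B] grows, for fixed [h] and
    [N]: phases are irrelevant here and the mesh need not be fine. *)
Lemma good_fail_small (h : R) (N : nat) (dl b0 : R) : 0 < h -> (0 < N)%N -> 0 < dl ->
 exists B, [/\ b0 <= B, 0 < B & \forall n \near \oo, \forall k \near \oo,
  EN k (fun s => (~~ good n N (- B) B (run a n h N (2 * B) (- B) B s))%:R) [:: n] <= dl].
Proof.
move=> h0 N0 dl0.
have r1 := phi_rate_cvg0 b sigma2 Pi_levy.
have r2 : rate (2 * r.+1%:R) @[r --> \oo] --> (0 : R).
 rewrite (_ : (fun r : nat => _) = (fun r => rate r.+1%:R) \o (fun r : nat => r.*2.+1)); last first.
  by apply/funext => r /=; rewrite -natrM mul2n doubleS.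
 apply: cvg_comp r1; apply/cvgnyPge => m; exists m => // r /= mr.
 by rewrite leqW // (leq_trans mr) // -addnn leq_addr.
have L : N%:R * (2 * rate (2 * r.+1%:R) * (h + h)) ^+ 2 + 2 * (rate r.+1%:R * (N%:R * (h + h)))
  @[r --> \oo] --> (0 : R).
 rewrite [X in _ --> X](_ : 0 = N%:R * (2 * 0 * (h + h)) ^+ 2 + 2 * (0 * (N%:R * (h + h)))); last by ring.
 apply: cvgD; last by apply: cvgMr; exact: cvgMl.
 apply: cvgMr; rewrite expr2; under eq_fun do rewrite expr2.
 by apply: cvgM; apply: cvgMl; exact: cvgMr.
have /cvgrPdist_le/(_ _ dl0) := L; move=> /filterI/(_ (near_natge b0)) [r _ /(_ r (leqnn _)) [Lr br]].
have B0 : 0 < r.+1%:R :> R by rewrite ltr0n.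
have BB0 : 0 < 2 * r.+1%:R :> R by rewrite mulr_gt0.
exists r.+1%:R; split => //; first by rewrite (le_trans br) // ler_nat.
have gf := good_fail BB0 B0 h0 N0.
apply: filterS gf => n; apply: filterS => k H; apply: (le_trans H).
by move: Lr; rewrite sub0r normrN; apply: le_trans; exact: ler_norm.
Qed.

Lemma levy_fdd_le h N (g : seq R -> R) (C e dl : R) : 0 < h ->
 (forall s, `|g s| <= C) -> unif_box g N.+1 -> 0 < e -> 0 < dl -> forall b0,
 exists B, [/\ b0 <= B, 0 < B & \forall n \near \oo, \forall k \near \oo,
  `|EN k (fun s => (good n N.+1 (- B) B (run a n h N.+1 (2 * B) (- B) B s))%:R *
    g (sd (run a n h N.+1 (2 * B) (- B) B s))) [:: n]
   - Ex (fun w => g (eta xi N.+1 h w))| <= e /\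
  EN k (fun s => (~~ good n N.+1 (- B) B (run a n h N.+1 (2 * B) (- B) B s))%:R) [:: n] <= dl].
Proof.
move=> h0 gC ug e0 dl0 b0; have C0 : 0 <= C by apply: le_trans (gC [::]).
have e2 : 0 < e / 2 by rewrite divr_gt0.
pose dl' := Num.min dl (e / 2 / (C + 1)).
have dl'0 : 0 < dl' by rewrite lt_min dl0 divr_gt0 // ltr_wpDl.
have [B [bB B0 gf]] := good_fail_small b0 h0 (ltn0Sn N) dl'0.
exists B; split => //.
have cf := chain_fdd xi_levy (2 * B) h0 (ltW B0) gC ug e2.
apply: filterS2 gf cf => n; apply: filterS2 => k gf cf.
split; last by rewrite (le_trans gf) // ge_min lexx.
apply: (le_trans cf); rewrite [leRHS]splitr lerD2l.
apply: (@le_trans _ _ (C * dl')); first by rewrite ler_wpM2l.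
apply: (@le_trans _ _ ((C + 1) * dl')); first by rewrite ler_wpM2r ?(ltW dl'0) // lerDl.
have C1 : 0 < C + 1 by rewrite ltr_wpDl.
by rewrite mulrC -ler_pdivlMr // ge_min lexx orbT.
Qed.

Variables (C4 : R).
Hypotheses (C4_ge0 : 0 <= C4)
 (exp_drift4 : \forall j \near \oo, forall D, 0 <= D -> a j * jump j (expB beta D) <= C4).

Let Ct (t : R) : R := beta^-1 * expR (C4 * (t + t)).

Lemma Ct_ge0 t : 0 <= Ct t.
Proof. by rewrite mulr_ge0 ?expR_ge0 // invr_ge0 ltW. Qed.

Lemma excess_le (L c : R) : L - c <= beta^-1 * expR (- (beta * c)) * expR (beta * L).
Proof.
have E : L - c = beta^-1 * (beta * (L - c)) by rewrite mulKf // gt_eqF.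
rewrite -mulrA -expRD [leLHS]E ler_wpM2l ?invr_ge0 ?(ltW beta_gt0) //.
by apply: le_trans (le_expR _) _; rewrite ler_expR; lra.
Qed.

(** Proved for the chain over one cell and transferred in the limit: the excess of a position [L]
    over [c] is at most $\beta^{-1}e^{-\beta c}e^{\beta L}$, and the exponential moment is bounded
    by [exp_moment]. *)
Lemma exp_levy t c D0 : 0 < t -> 0 <= c -> 0 <= D0 ->
 Ex (fun w => Num.min (Num.max 0 (nth 0 (eta xi 1 t w) 0 - c)) D0) <= Ct t * expR (- (beta * c)).
Proof.
move=> t0 c0 D00; apply/ler_addgt0Pr => e e0.
pose f x : R := Num.min (Num.max 0 (x - c)) D0.
pose g (s : seq R) : R := f (nth 0 s 0).
have f0 x : 0 <= f x by rewrite /f le_min le_max lexx.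
have gC s : `|g s| <= D0 by rewrite ger0_norm ?f0 // ge_min lexx orbT.
have fl x y : `|f x - f y| <= 1 * `|x - y|.
 rewrite mul1r; apply: (le_trans (min_dist _ _ _)); apply: (le_trans (max_dist _ _ _)).
 by rewrite (_ : x - c - (y - c) = x - y) //; ring.
have ug : unif_box g 1 by apply: (@ub_lip _ 1 1 f (fun s => nth 0 s 0)) => //; exact: ub_nth.
have [B [_ B0 H]] := levy_fdd_le t0 gC ug e0 ltr01 0.
have nE := near_range B exp_drift4; have nc := c_range B t0.
have n1 : \forall n \near \oo, (0 < n)%N by exists 1%N.
have [n _ /(_ n (leqnn _)) [[[Hn En] cn] n0]] := filterI (filterI (filterI H nE) nc) n1.
have [k _ /(_ k (leqnn _)) [cf _]] := Hn.
move: cf; rewrite ler_norml => /andP[cf _].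
rewrite -[leLHS]/(Ex (fun w => g (eta xi 1 t w))).
rewrite lerBrDr addrC lerBlDr in cf.
apply: (le_trans cf); rewrite lerD2r {cf}.
have M := exp_moment p_ge0 p_sum1 (2 * B) a_gt0 n0 t0 B0 t0 cn k beta_gt0 C4_ge0 (lexx B) En.
have b1 : bdd (fun s => expR (beta * Num.min (lg R n (sx (run a n t 1 (2 * B) (- B) B s))) B)).
 exists (expR (beta * B)) => s; rewrite ger0_norm ?expR_ge0 // ler_expR ler_wpM2l ?(ltW beta_gt0) //.
 by rewrite ge_min lexx orbT.
have q0 : 0 <= beta^-1 * expR (- (beta * c)) by rewrite mulr_ge0 ?expR_ge0 // invr_ge0 ltW.
rewrite /Ct mulrAC; apply: le_trans (ler_wpM2l q0 M).
rewrite -ENZ //; apply: EN_le_ext => //.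
- by apply: bddM; [exact: bdd_good|exists D0].
- by apply: bddM => //; exact: bdd_cst.
move=> s ex; have ls := extends_last (isT : [:: n] != [::]) ex.
have /andP[_ one] := one_cell a t (2 * B) B n0 ls.
case: (boolP (good _ _ _ _ _)) => gd; last by rewrite mul0r mulr_ge0 ?expR_ge0.
rewrite gd in one; rewrite mul1r; move/eqP: one => ->; rewrite /g /=.
have /andP[_ /and3P[_ _ lB]] := gd; rewrite min_l //.
apply: (@le_trans _ _ (Num.max 0 (lg R n (sx (run a n t 1 (2 * B) (- B) B s)) - c))).
 by rewrite /f ge_min lexx.
by rewrite ge_max mulr_ge0 ?expR_ge0 //= excess_le.
Qed.

Variable c1 : R.
Hypothesis drift_lower : forall A D e, 1 <= A -> 1 <= D -> 0 < e -> \forall j \near \oo,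
  - (c1 * expR (- (beta * D / 2)) + e) <= a j * jump j (trunc A D).
Hypothesis c1_ge0 : 0 <= c1.

(** The position of the chain truncated at the scale of the window has almost nonnegative mean.
    Passing to the levels [A] and [D0] loses only the excess over [D0] and the exits above [B], both
    controlled by the exponential moment; raising low values and discarding exits below [- B] can
    only help a lower bound. *)
Lemma drift_levy t A D0 : 0 < t -> 0 <= A -> 0 <= D0 ->
 - (Ct t * expR (- (beta * D0))) <= Ex (fun w => trunc A D0 (nth 0 (eta xi 1 t w) 0)).
Proof.
move=> t0 A0 D00; rewrite lerNl; apply/ler_addgt0Pr => e e0; rewrite lerNl.
pose f x : R := trunc A D0 x; pose g (s : seq R) : R := f (nth 0 s 0).
have gC s : `|g s| <= A + D0 by exact: trunc_norm.
have fl x y : `|f x - f y| <= 1 * `|x - y|.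
 by rewrite mul1r; apply: (le_trans (max_dist _ _ _)); exact: min_dist.
have ug : unif_box g 1 by apply: (@ub_lip _ 1 1 f (fun s => nth 0 s 0)) => //; exact: ub_nth.
have e3 : 0 < e / 3 by rewrite divr_gt0.
pose E4 := expR (C4 * (t + t)).
(* Collects the coefficients of $e^{-\beta B/2}$ in the errors from the drift bound and from exits
   above the window; the final 1 keeps [q] positive. *)
pose q := (t + t) * c1 + 4 / beta * E4 + 1.
have tt : 0 < t + t by exact: addr_gt0.
have q0 : 0 < q.
 by apply: ltr_wpDl => //; apply: addr_ge0; apply: mulr_ge0; rewrite ?expR_ge0 ?(ltW tt) ?divr_ge0 ?(ltW beta_gt0).
have b2 : 0 < beta / 2 by rewrite divr_gt0.
have [b0 b00 Hb0] := exp_small b2 (divr_gt0 e3 q0).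
have [B [bB B0 H]] := levy_fdd_le t0 gC ug e3 ltr01 (Num.max 1 b0).
have B1 : 1 <= B by apply: le_trans bB; rewrite le_max lexx.
have sm : expR (- (beta * B / 2)) <= e / 3 / q.
 have := Hb0 B ltac:(by apply: le_trans bB; rewrite le_max lexx orbT).
 by rewrite (_ : beta / 2 * B = beta * B / 2) //; ring.
pose e1 := e / 3 / (t + t); have e10 : 0 < e1 by rewrite divr_gt0.
pose kappa := c1 * expR (- (beta * B / 2)) + e1.
have k0 : 0 <= kappa by apply: addr_ge0; [apply: mulr_ge0 => //; exact: expR_ge0|exact: ltW].
have BB1 : 1 <= B + B by lra.
have nE := near_range B exp_drift4; have nc := c_range B t0.
have nD := near_range B (drift_lower BB1 B1 e10).
have nS := stop_near B (2 * B) t0 (ltn0Sn 0).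
have n1 : \forall n \near \oo, (0 < n)%N by exists 1%N.
have [n _ /(_ n (leqnn _)) [[[[[Hn En] cn] n0] Dn] Sn]] :=
 filterI (filterI (filterI (filterI (filterI H nE) nc) n1) nD) nS.
have [k _ /(_ k (leqnn _)) [[cf _] Sk]] := filterI Hn Sn.
move: cf; rewrite ler_norml => /andP[_ cf]; rewrite lerBlDr addrC in cf.
rewrite -[leRHS]/(Ex (fun w => g (eta xi 1 t w))).
have M := exp_moment p_ge0 p_sum1 (2 * B) a_gt0 n0 t0 B0 t0 cn k beta_gt0 C4_ge0 _ En.
have {}M := M (B + B) ltac:(by rewrite lerDl ltW).
have DM := drift_moment p_ge0 p_sum1 (2 * B) a_gt0 n0 t0 B0 t0 cn k k0 (lexx B) (ltW B0) (lexx (B + B)) Dn.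
set G := fun s => expR (beta * Num.min (lg R n (sx (run a n t 1 (2 * B) (- B) B s))) (B + B)) in M.
have b1 : bdd G.
 exists (expR (beta * (B + B))) => s; rewrite ger0_norm ?expR_ge0 // ler_expR ler_wpM2l ?(ltW beta_gt0) //.
 by rewrite ge_min lexx orbT.
pose r := beta^-1 * expR (- (beta * D0)) + (B + B) * expR (- (beta * B)).
have BBge : 0 <= B + B by rewrite addr_ge0 // ltW.
have r0 : 0 <= r by rewrite addr_ge0 // mulr_ge0 ?expR_ge0 // invr_ge0 ltW.
have bg : bdd (fun s => (good n 1 (- B) B (run a n t 1 (2 * B) (- B) B s))%:R *
  g (sd (run a n t 1 (2 * B) (- B) B s))).
 by apply: bddM; [exact: bdd_good|exists (A + D0)].
have brG : bdd (fun s => r * G s) by apply: bddM => //; exact: bdd_cst.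
have KEY : EN k (fun s => trunc B (B + B) (lg R n (sx (run a n t 1 (2 * B) (- B) B s)))) [:: n] <=
  EN k (fun s => (good n 1 (- B) B (run a n t 1 (2 * B) (- B) B s))%:R *
    g (sd (run a n t 1 (2 * B) (- B) B s))) [:: n] + r * E4.
 apply: le_trans (lerD (lexx _) (ler_wpM2l r0 M)).
 rewrite -ENZ // -END //; apply: EN_le_ext => //.
 - by exists (B + (B + B)) => s; apply: trunc_norm => //; exact: ltW.
 - exact: bddD.
 move=> s ex; have ls := extends_last (isT : [:: n] != [::]) ex.
 have [|hs _] := extends_hist _ ex; first by rewrite /hpos /= n0.
 have /andP[_ one] := one_cell a t (2 * B) B n0 ls.
 have nal := Sk s ex; have nb := never_bad a n t (lexx (2 * B)) s.
 have [_ _ jN _ _] := mwf_run (2 * B) a_gt0 t0 cn t0 s (ltn0Sn 0).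
 have sx0 := hpos_sx n t 1 (2 * B) (- B) B hs.
 rewrite /G; set st := run _ _ _ _ _ _ _ s in one nal nb jN sx0 *.
 set L := lg R n (sx st) in one *.
 have Gge0 : 0 <= expR (beta * Num.min L (B + B)) by exact: expR_ge0.
 case: (boolP (good _ _ _ _ _)) => gd.
  rewrite gd in one; move/eqP: one => ->; rewrite mul1r /g /=.
  have /andP[_ /and3P[_ lB1 lB2]] := gd; rewrite -/L in lB1 lB2.
  have LBB : L <= B + B by rewrite (le_trans lB2) // lerDl ltW.
  rewrite trunc_id // (min_l LBB).
  apply: (@le_trans _ _ (f L + beta^-1 * expR (- (beta * D0)) * expR (beta * L))); last first.
   by rewrite lerD2l ler_wpM2r ?expR_ge0 // lerDl mulr_ge0 ?expR_ge0.
  have := excess_le L D0; have : 0 <= beta^-1 * expR (- (beta * D0)) * expR (beta * L).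
   by rewrite !mulr_ge0 ?expR_ge0 // invr_ge0 ltW.
  rewrite /f /trunc; set X := _ * expR (beta * L) => X0 LX.
  case: (leP L D0) => LD; last by rewrite max_r ?(le_trans _ D00) ?oppr_le0 //; lra.
  apply: (@le_trans _ _ (Num.max (- A) L + 0)); last by rewrite lerD2l.
  by rewrite addr0 le_max lexx orbT.
 rewrite mul0r add0r.
 have out : ~~ ((- B <= L) && (L <= B)).
  apply: contra nal => LB; rewrite /alive /in_range sx0 -/L LB andbT.
  rewrite (leq_ltn_trans nb) // andbT ltn_neqAle jN andbT.
  by rewrite andbT; apply: contra gd => j1; rewrite /good j1 /in_range sx0.
 have [LB|LB] := leP L B.
  rewrite LB andbT -ltNge in out.
  apply: (@le_trans _ _ 0); last by rewrite mulr_ge0.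
  rewrite /trunc ge_max oppr_le0 (ltW B0) /= ge_min; apply/orP; left.
  by apply: ltW; apply: lt_trans out _; rewrite oppr_lt0.
 apply: (@le_trans _ _ (B + B)).
  by have /andP[] := trunc_bounds L (ltW B0) BBge.
 apply: (@le_trans _ _ ((B + B) * expR (- (beta * B)) * expR (beta * Num.min L (B + B)))).
  rewrite -mulrA ler_peMr // -expRD -[leLHS]expR0 ler_expR addrC -mulrBr.
  by rewrite mulr_ge0 ?(ltW beta_gt0) // subr_ge0 le_min (ltW LB) lerDl ltW.
 by rewrite ler_wpM2r // lerDr mulr_ge0 ?expR_ge0 // invr_ge0 ltW.
have tot := le_trans DM (le_trans KEY (lerD cf (lexx _))).
have Bsm : (B + B) * expR (- (beta * B)) <= 4 / beta * expR (- (beta * B / 2)).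
 have -> : expR (- (beta * B)) = expR (- (beta * B / 2)) * expR (- (beta * B / 2)).
  by rewrite -expRD; congr expR; lra.
 rewrite mulrA ler_wpM2r ?expR_ge0 // expRN ler_pdivrMr ?expR_gt0 //.
 apply: (@le_trans _ _ (4 / beta * (beta * B / 2))).
  by rewrite le_eqVlt; apply/orP; left; apply/eqP; field; rewrite gt_eqF.
 by rewrite ler_wpM2l ?divr_ge0 ?(ltW beta_gt0) // le_expR.
have fin : kappa * (t + t) + (B + B) * expR (- (beta * B)) * E4 <= e / 3 + e / 3.
 apply: (@le_trans _ _ (q * expR (- (beta * B / 2)) + e / 3)); last first.
  by rewrite lerD2r mulrC -ler_pdivlMr.
 rewrite /kappa mulrDl /e1 divfK ?gt_eqF //.
 have := ler_wpM2r (expR_ge0 (C4 * (t + t))) Bsm; rewrite -/E4 /q.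
 have := expR_ge0 (- (beta * B / 2)); move: (expR (- (beta * B / 2))) => X X0 Y.
 apply: (@le_trans _ _ (c1 * X * (t + t) + e / 3 + 4 / beta * X * E4)); first by rewrite lerD2l.
 rewrite [leRHS](_ : _ = c1 * X * (t + t) + e / 3 + 4 / beta * X * E4 + X); last by ring.
 by rewrite lerDl.
have rE : r * E4 = Ct t * expR (- (beta * D0)) + (B + B) * expR (- (beta * B)) * E4.
 by rewrite /r /Ct -/E4; ring.
rewrite rE in tot; move: tot fin.
move: (kappa * (t + t)) (_ * E4) (Ct t * _) (Ex _) => X Y Z W; lra.
Qed.

End LevyMoments.

(** * Uniqueness in law of the increments and existence of a Lyapunov exponent *)

Section LyapunovExists.
Context {d : measure_display} {T : measurableType d} (Q : probability T R).
Local Notation Ex f := (Rintegral Q setT f).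

(** Both processes are limits of the same functionals of the same chain, so their increments agree
    in law. Being stated for an arbitrary pair, the inequality can be reversed by exchanging the
    two. *)
Lemma levy_law_unique (xi xi' : R -> T -> R) N h (g : seq R -> R) C :
 levy_process Q b sigma2 Pi xi -> levy_process Q b sigma2 Pi xi' ->
 0 < h -> (forall s, `|g s| <= C) -> unif_box g N.+1 ->
 Ex (fun w => g (eta xi N.+1 h w)) <= Ex (fun w => g (eta xi' N.+1 h w)).
Proof.
move=> L L' h0 gC ug; apply/ler_addgt0Pr => e e0.
have C0 : 0 <= C by apply: le_trans (gC [::]).
have C1 : 0 < C + 1 by rewrite ltr_wpDl.
have e4 : 0 < e / 4 by rewrite divr_gt0.
have [B [_ B0 gf]] := good_fail_small
  0 h0 (ltn0Sn N) (divr_gt0 e4 C1).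
have c1 := chain_fdd L (2 * B) h0 (ltW B0) gC ug e4.
have c2 := chain_fdd L' (2 * B) h0 (ltW B0) gC ug e4.
have [n _ /(_ n (leqnn _)) [[Hg H1] H2]] := filterI (filterI gf c1) c2.
have [k _ /(_ k (leqnn _)) [[{}Hg {}H1] {}H2]] := filterI (filterI Hg H1) H2.
have small : C * EN k (fun s => (~~ good n N.+1 (- B) B (run a n h N.+1 (2 * B) (- B) B s))%:R) [:: n] <= e / 4.
 apply: (@le_trans _ _ (C * (e / 4 / (C + 1)))); first by rewrite ler_wpM2l.
 by rewrite mulrCA ler_piMr ?(ltW e4) // ler_pdivrMr // mul1r lerDl.
move: H1 H2 small; rewrite !ler_norml => /andP[h1 h2] /andP[h3 h4].
move: (EN k _ _) (C * _) (Ex _) (Ex _) h1 h2 h3 h4 => X Y Z W; lra.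
Qed.

Lemma levy_law_shift (xi : R -> T -> R) N h (g : seq R -> R) C :
 levy_process Q b sigma2 Pi xi ->
 0 < h -> (forall s, `|g s| <= C) -> unif_box g N.+1 ->
 Ex (fun w => g (eta xi N.+1 h w)) = Ex (fun w => g (eta (shift_path h xi) N.+1 h w)).
Proof.
move=> L h0 gC ug; have L' := levy_shift (ltW h0) L.
by apply/eqP; rewrite eq_le (levy_law_unique L L' h0 gC ug) (levy_law_unique L' L h0 gC ug).
Qed.

Variables (beta C3 : R).
Hypotheses (beta_gt0 : 0 < beta)
 (A3 : \forall j \near \oo, forall D, a j * jump j (tailB beta D) <= C3).
Variable xi : R -> T -> R.
Hypotheses (xi_levy : levy_process Q b sigma2 Pi xi) (xi_drift : drifts_to_minus_infty Q xi).

(* Otherwise [e^(t min(log X, D))] would be almost a submartingale for every small [t]; in the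
  limit [xi] would have a nonnegative mean, which Lindley's recursion excludes. *)
Lemma lyapunov_exists : exists t J, 0 < t /\ lyapunov p t J.
Proof.
apply: contrapT => NL0.
have NL : forall t J, 0 < t -> ~ lyapunov p t J by move=> t J t0 L; apply: NL0; exists t, J.
have [C4 C40 ed] := exp_drift beta_gt0 A3.
have DL := not_lyapunov_drift beta_gt0 A3 NL.
have C30 := C3_ge0 beta_gt0 A3.
have c10 : 0 <= 4 / beta * C3 by rewrite mulr_ge0 // divr_ge0 // ltW.
have [mxi _ _ _ _] := xi_levy.
apply: (@lindley_absurd _ _ _ Q xi mxi xi_drift _ beta (fun t => beta^-1 * expR (C4 * (t + t))) beta_gt0).
- by move=> N h g C h0 gC ug; exact: levy_law_shift.
- by move=> t; rewrite mulr_ge0 ?expR_ge0 // invr_ge0 ltW.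
- move=> t c D0 t0 c0 D00.
 exact: (exp_levy beta_gt0 xi_levy C40 ed).
move=> t A D0 t0 A0 D00.
exact: (drift_levy beta_gt0 xi_levy C40 ed DL c10).
Qed.

End LyapunovExists.

(** * The lower limit for a bounded continuous functional *)

Section LowerBound.
Variables (K J : nat) (th : R).
Hypotheses (acc : forall j, (0 < j)%N -> exists t, nohit p K t j < 1) (th_gt0 : 0 < th)
 (lyap : lyapunov p th J).
Context {d : measure_display} {T : measurableType d} (Q : probability T R).
Variable xi : R -> T -> R.
Hypotheses (xi_levy : levy_process Q b sigma2 Pi xi) (xi_drift : drifts_to_minus_infty Q xi).
Variables (F : (R -> R) -> R) (C : R).
Hypotheses (C_gt0 : 0 < C) (F_le : forall x, `|F x| <= C) (F_cont : J1_continuous F).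
Local Notation Ex f := (Rintegral Q setT f).
Local Notation rate := (phi_rate Pi b sigma2).

Lemma small_rate (c : R) : 0 < c -> exists B, 0 < B /\ rate B <= c.
Proof.
move=> c0; have /cvgrPdist_le/(_ _ c0)[r _ /(_ r (leqnn _))] := phi_rate_cvg0 b sigma2 Pi_levy.
rewrite sub0r normrN => H; exists r.+1%:R; split; first by rewrite ltr0n.
exact: le_trans (ler_norm _) H.
Qed.

(** The order of the choices matters: the regularisation [k] and the tolerance [dl], the final level
    [z], the cutoff [r], the horizon [M], the window [B], then [eps], the mesh [q], the one-step
    errors [e1] and [cm], and last [n]. In particular [eps] precedes the mesh, because the
    probability of phase 2 is of order [rate eps ^+ 2] times the mesh. *)
Lemma lower_bound (V : T -> R) (e : R) : 0 < e -> measurable_fun setT V -> (forall w, `|V w| <= C) ->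
 {ae Q, forall w, F (lamperti gamma (xi ^~ w)) = V w} ->
 \forall n \near \oo, \forall k \near \oo, Ex V - e <= EN k (fun s => F (cpath a n K s)) [:: n].
Proof.
move=> e0 mV bV aeV; pose u := e / 8; have u0 : 0 < u by rewrite divr_gt0.
have CC : 0 < 2 * C by rewrite mulr_gt0.
have [k [W [mW bW aeW VW]]] := lipF_near gamma_gt0 xi_levy xi_drift C_gt0 F_le F_cont u0 mV bV aeV.
have [dl dl0 kd] := small_mul k u0.
have c0 : 0 < u / (2 * C) by rewrite divr_gt0.
have zb0 : 0 < dl / 2 by rewrite divr_gt0.
have [z [z0 zb zd p2]] := post2_small p_ge0 p_sum1 acc th_gt0 lyap a dl0 c0 zb0.
pose r := Num.min (dl / 16) (z / 2).
have r0 : 0 < r by rewrite lt_min !divr_gt0.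
have rd : 16 * r <= dl by rewrite mulrC -ler_pdivlMr // ge_min lexx.
have rz : 2 * r <= z by rewrite mulrC -ler_pdivlMr // ge_min lexx orbT.
have [M [q0 HM]] := Ex_lower gamma_gt0 xi_levy xi_drift C_gt0 F_le mW bW aeW r0 u0.
have T0 : 0 < M.+1%:R :> R by rewrite ltr0n.
have c2 : 0 < u / (2 * C) / 2 by rewrite divr_gt0.
have [B [B0 rB]] : exists B, 0 < B /\ rate B <= u / (2 * C) / 2 / (4 * M.+1%:R).
 by apply: small_rate; rewrite divr_gt0 // mulr_gt0.
pose Cb := expR (gamma * B); have Cb0 : 0 < Cb by exact: expR_gt0.
have [eps [eps0 epsB eps4 epsM]] : exists eps, [/\ 0 < eps, expR B * (2 * eps) <= dl,
  expR (4 * eps) <= 2 & 64 * (M.+1%:R * (Cb * (gamma * eps))) <= dl].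
 pose x1 := dl / (2 * expR B); pose x2 := ln 2 / 4 : R; pose x3 := dl / (64 * (M.+1%:R * (Cb * gamma))).
 have x10 : 0 < x1 by rewrite divr_gt0 // mulr_gt0 // expR_gt0.
 have x20 : 0 < x2 by rewrite divr_gt0 // ln_gt0 // ltr1n.
 have x3' : 0 < 64 * (M.+1%:R * (Cb * gamma)) by do ! apply: mulr_gt0 => //.
 have x30 : 0 < x3 by rewrite divr_gt0.
 exists (Num.min (Num.min x1 x2) x3); split.
 - by rewrite !lt_min x10 x20.
 - rewrite (_ : expR B * _ = Num.min (Num.min x1 x2) x3 * (2 * expR B)); last by ring.
  rewrite -ler_pdivlMr ?mulr_gt0 ?expR_gt0 // -/x1.
  by rewrite !ge_min lexx.
 - rewrite -[leRHS]lnK ?posrE // ler_expR mulrC -ler_pdivlMr // -/x2.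
  by rewrite !ge_min lexx orbT.
 rewrite (_ : 64 * _ = Num.min (Num.min x1 x2) x3 * (64 * (M.+1%:R * (Cb * gamma)))); last by ring.
 by rewrite -ler_pdivlMr // -/x3 ge_min lexx orbT.
have [q [qq0 qrate qh]] : exists q, [/\ (q0 <= q)%N,
  16 * M.+1%:R * rate eps ^+ 2 * mesh q <= u / (2 * C) / 2 & 8 * (Cb + 1) * mesh q <= dl].
 have h1 := near_mesh (16 * M.+1%:R * rate eps ^+ 2) c2.
 have h2 := near_mesh (8 * (Cb + 1)) dl0.
 have h3 : \forall q \near \oo, (q0 <= q)%N by exists q0.
 by have [q _ /(_ q (leqnn _)) [[? ?] ?]] := filterI (filterI h1 h2) h3; exists q.
have h0 : 0 < @mesh R q := mesh_gt0 q.
have N0 : 0 < (ncells M q).+1%:R :> R by rewrite ltr0n.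
pose e1 : R := Num.min 1 (dl / (32 * M.+1%:R)).
have e10 : 0 < e1 by rewrite lt_min ltr01 divr_gt0 // mulr_gt0.
have e11 : e1 <= 1 by rewrite ge_min lexx.
have e1d : 32 * (M.+1%:R * e1) <= dl.
 by rewrite mulrA mulrC -ler_pdivlMr ?mulr_gt0 // ge_min lexx orbT.
pose cm : R := Num.min (mesh q) (dl / (8 * ((ncells M q).+1%:R * Cb))).
have cd' : 0 < 8 * ((ncells M q).+1%:R * Cb) by do ! apply: mulr_gt0 => //.
have cm0 : 0 < cm by rewrite lt_min h0 divr_gt0.
have cmh : cm <= mesh q by rewrite ge_min lexx.
have cmd : 8 * ((ncells M q).+1%:R * (cm * Cb)) <= dl.
 rewrite (_ : 8 * _ = cm * (8 * ((ncells M q).+1%:R * Cb))); last by ring.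
 by rewrite -ler_pdivlMr // ge_min lexx orbT.
have clock v : riem gamma (mesh q) (ncells M q).+1 v <= 2 * r ->
  clock_err gamma (mesh q) eps B cm e1 v (ncells M q).+1 + (mesh q + cm) * (expR (gamma * B) + e1) <= dl.
 move=> rv; apply: (clock_bound gamma_gt0 (ltW eps0) (ltW e10) e11 cm0 cmh (ltW r0) rv rd e1d epsM cmd).
 by rewrite mulrCA mulrC.
have zdl : z * expR (4 * eps) <= dl.
 apply: (@le_trans _ _ (dl / 2 * 2)); last by rewrite divfK.
 by apply: ler_pM => //; exact: ltW.
have n1 : \forall n \near \oo, (0 < n)%N by exists 1%N.
have n2 := c_range B cm0.
have n3 := uct gamma_gt0 a_rv B e10.
have n4 : \forall n \near \oo, forall x, in_range n (- B) B x -> (K < x)%N.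
 by apply: near_range; exists K.+1.
have n5 := near_natge (K%:R / dl).
have n7 := good_fail eps0 B0 h0 (ltn0Sn (ncells M q)).
have n8 := chain_fdd xi_levy eps h0 (ltW B0)
 (lower_le gamma F_le k M q r) (ub_lower gamma_gt0 C_gt0 F_le k M q r0) u0.
have fail_small : (ncells M q).+1%:R * (2 * rate eps * (mesh q + mesh q)) ^+ 2 +
  2 * (rate B * ((ncells M q).+1%:R * (mesh q + mesh q))) <= u / (2 * C).
 rewrite (_ : _ + _ = 16 * ((ncells M q).+1%:R * mesh q) * rate eps ^+ 2 * mesh q +
  rate B * (4 * ((ncells M q).+1%:R * mesh q))); last by ring.
 rewrite ncells_mesh [leRHS]splitr; apply: lerD => //.
 by rewrite -ler_pdivlMr // mulr_gt0.
apply: filterS3 (filterI n1 n2) (filterI (filterI n3 n4) (filterI n5 p2)) (filterI n7 n8).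
move=> n [n0 cle] [[auct Kr] [Kn p2n]] [gf cf].
apply: filterS2 gf cf => l gf cf.
have K_dl : K%:R <= dl * n%:R by rewrite mulrC -ler_pdivrMr.
have a_u x : in_range n (- B) B x -> `|a x / a n - expR (gamma * lg R n x)| <= e1.
 by move=> /and3P[x0 x1 x2]; apply: auct => //; apply/andP.
pose g s := (good n (ncells M q).+1 (- B) B (run a n (mesh q) (ncells M q).+1 eps (- B) B s))%:R *
 lower gamma F C k M q r (sd (run a n (mesh q) (ncells M q).+1 eps (- B) B s)).
pose po s : R := (post a n (mesh q) (ncells M q).+1 eps B K dl z s == 2%N)%:R.
have bg : bdd g.
 by apply: bddM; [exact: bdd_bool|exists (2 * C) => s; exact: lower_le].
have bpo : bdd po by exact: bdd_bool.
have bF : bdd (fun s => F (cpath a n K s)) by exists C => s; exact: F_le.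
have b2 : bdd (fun s => 2 * C * po s) by apply: bddM => //; exact: bdd_cst.
have bgk : bdd (fun s => g s - k%:R * dl) by apply: bddB => //; exact: bdd_cst.
have H : EN l (fun s => g s - k%:R * dl - 2 * C * po s) [:: n] <= EN l (fun s => F (cpath a n K s) + C) [:: n].
 apply: EN_le_ext => //; [exact: bddB|by apply: bddD => //; exact: bdd_cst|].
 move=> s ex; have ls := extends_last (isT : [:: n] != [::]) ex.
 have [|hs _] := extends_hist _ ex; first by rewrite /hpos /= n0.
 exact: (chain_lower a_gt0 n0 gamma_gt0 (ltW eps0) (ltW B0) (ltW e10) cm0 cle a_u Kr r0 rz clock epsB zdl
  (lexx dl) K_dl k F_le hs ls).
have bc c T' : bdd (fun _ : T' => c : R) by exact: bdd_cst.
move: H; rewrite (ENB p_ge0 p_sum1 l [:: n] bgk b2) (ENB p_ge0 p_sum1 l [:: n] bg (bc (k%:R * dl) _)).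
rewrite (ENZ p_ge0 p_sum1 l (2 * C) [:: n] bpo) (END p_ge0 p_sum1 l [:: n] bF (bc C _)) !EN_cst // => H.
have h1 := HM q qq0.
have h2 : 2 * C * EN l po [:: n] <= u.
 by rewrite mulrC -ler_pdivlMr //; exact: p2n.
have h3 : 2 * C * EN l (fun s => (~~ good n (ncells M q).+1 (- B) B
  (run a n (mesh q) (ncells M q).+1 eps (- B) B s))%:R) [:: n] <= u.
 by rewrite mulrC -ler_pdivlMr //; exact: le_trans fail_small.
move: cf; rewrite -/g ler_norml => /andP[h4 _].
have eu : e = 8 * u by rewrite /u mulrC divfK.
by rewrite eu; exact: (lower_arith H h1 h2 h3 h4 VW kd u0).
Qed.

End LowerBound.

(** * Convergence in distribution of the rescaled path *)

Section Convergence.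
Variables (K J : nat) (th : R).
Hypotheses (acc : forall j, (0 < j)%N -> exists t, nohit p K t j < 1) (th_gt0 : 0 < th)
 (lyap : lyapunov p th J).
Context {d : measure_display} {T : measurableType d} (P : probability T R).
Variable X : nat -> nat -> T -> nat.
Hypothesis X_mc : forall n, (0 < n)%N -> markov_chain P p n (X n).
Context {d' : measure_display} {T' : measurableType d'} (Q : probability T' R).
Variable xi : R -> T' -> R.
Hypotheses (xi_levy : levy_process Q b sigma2 Pi xi) (xi_drift : drifts_to_minus_infty Q xi).

Lemma expectation_lower (F : (R -> R) -> R) (C : R) (V : T' -> R) (e : R) : 0 < C ->
 (forall x, `|F x| <= C) -> J1_continuous F -> 0 < e ->
 measurable_fun setT V -> (forall w, `|V w| <= C) ->
 {ae Q, forall w, F (lamperti gamma (xi ^~ w)) = V w} ->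
 \forall n \near \oo, Rintegral Q setT V - e <= Rintegral P setT (fun w => F (scaled_path n (X n) a K w)).
Proof.
move=> C0 FC Fc e0 mV bV aeV.
have LB := lower_bound acc th_gt0 lyap xi_levy xi_drift
 C0 FC Fc e0 mV bV aeV.
have n1 : \forall n \near \oo, (0 < n)%N by exists 1%N.
apply: filterS2 LB n1 => n LB n0.
have H : EN k (fun s => F (cpath a n K s)) [:: n] @[k --> \oo] -->
 Rintegral P setT (fun w => F (scaled_path n (X n) a K w)).
 exact: (EN_cpath_cvg p_ge0 p_sum1 n0 (X_mc n0) (a_gt0 n) FC Fc).
by rewrite -(cvg_lim _ H) //; apply: limr_ge => //; apply/cvg_ex; eexists; exact: H.
Qed.

Lemma scaled_path_cvg :
 cvg_dist_D P (fun n => scaled_path n (X n) a K) Q (fun w => lamperti gamma (xi ^~ w)).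
Proof.
move=> F [M FM] Fc; have M0 : 0 <= M by apply: le_trans (FM (fun=> 0)).
have C0 : 0 < M + 1 by rewrite ltr_wpDl.
have FC x : `|F x| <= M + 1 by apply: (le_trans (FM x)); rewrite lerDl.
have [V [mV bV aeV]] := F_version gamma_gt0 xi_levy xi_drift FC Fc.
have bmV : bm V by split => //; exists (M + 1).
have n1 : \forall n \near \oo, (0 < n)%N by exists 1%N.
rewrite (integral_ae_eq aeV) (integral_Ex Q bmV).
pose I n := Rintegral P setT (fun w => F (scaled_path n (X n) a K w)).
have IE : \forall n \near \oo, (I n)%:E = (\int[P]_w (F (scaled_path n (X n) a K w))%:E)%E.
 apply: filterS n1 => n n0.
 by rewrite /I integral_Ex //; exact: (bm_scaled_path K (X_mc n0) (a_gt0 n) FC Fc).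
apply: cvg_trans (near_eq_cvg IE) _; apply: cvg_EFin; first exact: nearW.
apply/cvgrPdist_le => e e0.
have L1 := expectation_lower C0 FC Fc e0 mV bV aeV.
have FC' x : `|-1 * F x| <= M + 1 by rewrite mulN1r normrN.
have Fc' : J1_continuous (fun x => -1 * F x) by move=> x y cx cy xy; apply: cvgMr; exact: Fc.
have mV' : measurable_fun setT (fun w => -1 * V w) by exact: measurable_funM.
have bV' w : `|-1 * V w| <= M + 1 by rewrite mulN1r normrN.
have aeV' : {ae Q, forall w, -1 * F (lamperti gamma (xi ^~ w)) = -1 * V w}.
 by apply: filterS aeV => w ->.
have L2 := expectation_lower C0 FC' Fc' e0 mV' bV' aeV'.
apply: filterS3 L1 L2 n1 => n L1 L2 n0.
have bF := bm_scaled_path K (X_mc n0) (a_gt0 n) FC Fc.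
move: L2; rewrite (ExZ Q _ bmV) (ExZ P _ bF) -/(I n) !mulN1r => L2.
rewrite -/(I n) in L1; change (`|Rintegral Q setT V - I n| <= e).
by move: L1 L2; move: (I n) (Rintegral _ _ _) => *; rewrite ler_norml; apply/andP; split; lra.
Qed.

End Convergence.

End ChainLimit.

Theorem theorem2 (R : realType)
    (p : nat -> nat -> R)
    (d : measure_display) (T : measurableType d) (P : probability T R)
    (X : nat -> nat -> T -> nat)
    (a : nat -> R) (gamma : R)
    (Pi : {measure set R -> \bar R}) (b sigma2 : R)
    (d' : measure_display) (T' : measurableType d') (Q : probability T' R)
    (xi : R -> T' -> R) (K : nat) :
  (forall n k, 0 <= p n k) ->
  (forall n, (0 < n)%N ->
     (fun N => \sum_(1 <= k < N) p n k) @ \oo --> (1 : R)) ->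
  (forall n, (0 < n)%N -> markov_chain P p n (X n)) ->
  0 < gamma -> reg_var a gamma ->
  levy_measure Pi -> 0 <= sigma2 ->
  (* (A1) *)
  (forall f : R -> R, test_fun_A1 f ->
     (fun n => (a n)%:E * exp_step p n f)%E @ \oo -->
       (Rintegral Pi setT (fun x => f (expR x)))%:E) ->
  (* (A2) *)
  (fun n => (a n)%:E *
     Pistar_int p n (fun x => (x * (if `|x| <= 1 then 1 else 0))%R))%E @ \oo --> b%:E ->
  (fun n => (a n)%:E *
     Pistar_int p n (fun x => (x ^+ 2 * (if `|x| <= 1 then 1 else 0))%R))%E @ \oo -->
     (sigma2 + Rintegral Pi [set x | `|x| <= 1] (fun x => x ^+ 2))%:E ->
  (* (A3) *)
  (exists2 beta : R, 0 < beta &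
     (limn_esup (fun n => (a n)%:E *
        Pistar_int p n (fun x => (expR (beta * x) * (if 1 < x then 1 else 0))%R)) < +oo)%E) ->
  (* the Lévy process xi, drifting to -oo *)
  levy_process Q b sigma2 Pi xi ->
  drifts_to_minus_infty Q xi ->
  (* {1,...,K} accessible by X_n for every n >= 1 *)
  (1 <= K)%N ->
  (forall n, (0 < n)%N ->
     (0 < P [set w | exists i, (X n i w <= K)%N])%E) ->
  cvg_dist_D P
    (fun n w t => (stopped (fun k => X n k w) K (Num.truncn (a n * t)))%:R / n%:R)
    Q (fun w => lamperti gamma (xi ^~ w)).

Proof.
move=> p0 p1 mc g0 arv PL _ A1 A2b A2v [beta b0 A3] lev drift _ acc.
have J2b : jump_cvg p a (@id1 R) b by exact: (jump_cvg_Pistar p0 p1 (@bdd_id1 R) A2b).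
have J2v : jump_cvg p a (@sq1 R) (sigma2 + Rintegral Pi [set x | `|x| <= 1] (fun x => x ^+ 2)).
 exact: (jump_cvg_Pistar p0 p1 (@bdd_sq1 R) A2v).
have [C3 J3] := tail_bound p0 p1 (proj1 arv) b0 A3.
have [th [J [th0 ly]]] := lyapunov_exists p0 p1 g0 arv PL A1 J2b J2v b0 J3 lev drift.
have ac j : (0 < j)%N -> exists t, nohit p K t j < 1.
 by move=> j0; exact: (accessible_nohit p0 p1 j0 (mc j j0) (acc j j0)).
exact: (scaled_path_cvg p0 p1 g0 arv PL A1 J2b J2v ac th0 ly mc lev drift).
Qed.
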